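(* Let $T>0$, let $k,d,m$ be positive integers and $\mathcal J=\{1,\dots,m\}$. Let $b:[0,T]\times\mathbb R^k\to\mathbb R^k$ and $\sigma:[0,T]\times\mathbb R^k\to\mathbb R^{k\times d}$ be jointly continuous with $|b(t,x)|+|\sigma(t,x)|\le C(1+|x|)$ and $|b(t,x)-b(t,x')|+|\sigma(t,x)-\sigma(t,x')|\le C|x-x'|$ for some constant $C\ge 0$ and all $t\in[0,T]$, $x,x'\in\mathbb R^k$. Assume that for every $i\in\mathcal J$ the function $f_i:[0,T]\times\mathbb R^{k}\times\mathbb R^m\times\mathbb R^d\to\mathbb R$, $(t,x,y^1,\dots,y^m,z)\mapsto f_i(t,x,y^1,\dots,y^m,z)$, satisfies: (1) $(t,x)\mapsto f_i(t,x,y^1,\dots,y^m,z)$ is continuous uniformly with respect to $(y^1,\dots,y^m,z)$; (2) for some $C\ge0$ and all arguments, $|f_i(t,x,y^1,\dots,y^m,z)-f_i(t,x,\bar y^1,\dots,\bar y^m,\bar z)|\le C(|y^1-\bar y^1|+\dots+|y^m-\bar y^m|+|z-\bar z|)$; (3) $(t,x)\mapsto f_i(t,x,0,\dots,0)$ is Borel measurable and of polynomial growth; (4) for every $l\in\mathcal J\setminus\{i\}$, $y^l\mapsto f_i(t,x,y^1,\dots,y^m,z)$ is non-decreasing when all other arguments are fixed. Assume that for all $i\ne j$ in $\mathcal J$ the function $g_{ij}:[0,T]\times\mathbb R^k\to\mathbb R$ is continuous, non-negative and of polynomial growth, and that for every $(t,x)\in[0,T]\times\mathbb R^k$ and every finite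 sequence $i_1,\dots,i_N\in\mathcal J$ with $N\ge3$, $i_1=i_N$ and $\mathrm{card}\{i_1,\dots,i_N\}=N-1$ one has $g_{i_1i_2}(t,x)+\dots+g_{i_{N-1}i_N}(t,x)>0$. Assume that every $h_i:\mathbb R^k\to\mathbb R$ is continuous, of polynomial growth, and $h_i(x)\ge\max_{j\in\mathcal J\setminus\{i\}}(h_j(x)-g_{ij}(T,x))$ for all $x\in\mathbb R^k$. Then there is a unique viscosity solution $(v_1,\dots,v_m)$, in the class of continuous functions with polynomial growth, of the system: for all $i\in\mathcal J$, $$\min\Big\{v_i(t,x)-\max_{j\in\mathcal J\setminus\{i\}}(v_j(t,x)-g_{ij}(t,x));\ -\partial_tv_i(t,x)-\mathcal Lv_i(t,x)-f_i(t,x,v_1(t,x),\dots,v_m(t,x),\sigma^\top(t,x)D_xv_i(t,x))\Big\}=0,\qquad v_i(T,x)=h_i(x).$$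
   Context: $\mathcal L\varphi(t,x)=\frac12\mathrm{Tr}[(\sigma\sigma^\top)(t,x)D^2_{xx}\varphi(t,x)]+b(t,x)^\top D_x\varphi(t,x)$. A function $\phi$ is of polynomial growth if $|\phi(t,x)|\le C(1+|x|^\gamma)$ (resp. $|\phi(x)|\le C(1+|x|^\gamma)$) for some constants $C,\gamma\ge0$. A maximum over the empty set is read as $-\infty$. Jets. For $u:[0,T]\times\mathbb R^k\to\mathbb R$ lower (resp. upper) semicontinuous, the parabolic subjet $J^-u(t,x)$ (resp. superjet $J^+u(t,x)$) is the set of triples $(p,q,M)\in\mathbb R\times\mathbb R^k\times\mathbb S^k$ ($\mathbb S^k$ = symmetric real $k\times k$ matrices) with $u(t',x')\ge$ (resp. $\le$) $u(t,x)+p(t'-t)+\langle q,x'-x\rangle+\frac12\langle x'-x,M(x'-x)\rangle+o(|t'-t|+|x'-x|^2)$ as $(t',x')\to(t,x)$ in $[0,T]\times\mathbb R^k$. The limiting subjet $\bar J^-u(t,x)$ (resp. limiting superjet $\bar J^+u(t,x)$) is the set of limits $(p,q,M)=\lim_n(p_n,q_n,M_n)$ with $(p_n,q_n,M_n)\in J^-u(t_n,x_n)$ (resp. $J^+u(t_n,x_n)$), $(t_n,x_n)\to(t,x)$ and $u(t_n,x_n)\to u(t,x)$. Viscosity solutions. $(v_i)_{i\in\mathcal J}$ with every $v_i$ lower (resp. upper) semicontinuous on $[0,T]\times\mathbb R^k$ is a viscosity supersolution (resp. subsolution) of the system if for every $i\in\mathcal J$, every $(t,x)\in[0,T)\times\mathbb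 R^k$ and every $(p,q,M)\in\bar J^-v_i(t,x)$ (resp. $\bar J^+v_i(t,x)$), $$\min\Big\{v_i(t,x)-\max_{j\in\mathcal J\setminus\{i\}}(v_j(t,x)-g_{ij}(t,x));\ -p-b(t,x)^\top q-\tfrac12\mathrm{Tr}[(\sigma\sigma^\top)(t,x)M]-f_i(t,x,v_1(t,x),\dots,v_m(t,x),\sigma(t,x)^\top q)\Big\}\ge0\ (\text{resp. }\le0),$$ and $v_i(T,x)\ge h_i(x)$ (resp. $\le h_i(x)$) for all $x\in\mathbb R^k$. A tuple of continuous functions is a viscosity solution if it is both a viscosity supersolution and a viscosity subsolution. *)

(* Defs.v *)
(* MathComp-Analysis *)
From HB Require Import structures.
From mathcomp Require Import all_boot all_order all_algebra.
From mathcomp Require Import all_classical all_reals all_analysis.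

Set Implicit Arguments.
Unset Strict Implicit.
Unset Printing Implicit Defensive.

Import Order.TTheory GRing.Theory Num.Theory.
Import numFieldNormedType.Exports.

Local Open Scope classical_set_scope.
Local Open Scope ring_scope.

(* Functions on [0,T] x R^k are total functions of t : R and x : 'cV[R]_k of
   which only the values at t in [0,T] matter: every hypothesis and conclusion
   below, topological ones included, is relative to the strip [0,T] x R^k. *)
Definition strip (R : realType) (k : nat) (T : R) : set (R * 'cV[R]_k) :=
  [set s | 0 <= s.1 <= T].

(* Euclidean norm on column vectors, Frobenius norm on matrices (the norm
   `|_| that the library puts on matrices is the sup norm). *)
Definition enorm (R : realType) (m n : nat) (A : 'M[R]_(m, n)) : R :=
  Num.sqrt (\sum_(i < m) \sum_(j < n) A i j ^+ 2).

Definition dotv (R : realType) (k : nat) (u v : 'cV[R]_k) : R :=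
  \sum_(i < k) u i ord0 * v i ord0.

Definition strip_continuous (R : realType) (k : nat) (T : R)
    (Y : topologicalType) (u : R -> 'cV[R]_k -> Y) : Prop :=
  {within strip T, continuous (fun s : R * 'cV[R]_k => u s.1 s.2)}.

Definition strip_lsc (R : realType) (k : nat) (T : R)
    (u : R -> 'cV[R]_k -> R) : Prop :=
  lower_semicontinuous
    (fun s : subspace (@strip R k T) => (u s.1 s.2)%:E).

Definition strip_usc (R : realType) (k : nat) (T : R)
    (u : R -> 'cV[R]_k -> R) : Prop :=
  strip_lsc T (fun t x => - u t x).

(* Measurability for the Borel sigma-algebra of R x R^k, i.e. the one generated
   by the open sets, restricted to the strip. *)
Definition strip_borel (R : realType) (k : nat) (T : R)
    (u : R -> 'cV[R]_k -> R) : Prop :=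
  measurable_fun
    (strip T : set (g_sigma_algebraType (@open (R * 'cV[R]_k)%type)))
    (fun s => u s.1 s.2).

Definition poly_growth (R : realType) (k : nat) (u : 'cV[R]_k -> R) : Prop :=
  exists C gamma : R, [/\ 0 <= C, 0 <= gamma &
    forall x, `|u x| <= C * (1 + enorm x `^ gamma)].

Definition strip_poly_growth (R : realType) (k : nat) (T : R)
    (u : R -> 'cV[R]_k -> R) : Prop :=
  exists C gamma : R, [/\ 0 <= C, 0 <= gamma &
    forall (t : R) (x : 'cV[R]_k), 0 <= t <= T ->
      `|u t x| <= C * (1 + enorm x `^ gamma)].

Definition taylor2 (R : realType) (k : nat) (u : R -> 'cV[R]_k -> R)
    (t : R) (x : 'cV[R]_k) (p : R) (q : 'cV[R]_k) (M : 'M[R]_k)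
    (t' : R) (x' : 'cV[R]_k) : R :=
  u t x + p * (t' - t) + dotv q (x' - x)
  + 2^-1 * dotv (x' - x) (M *m (x' - x)).

Definition subjet (R : realType) (k : nat) (T : R) (u : R -> 'cV[R]_k -> R)
    (t : R) (x : 'cV[R]_k) (p : R) (q : 'cV[R]_k) (M : 'M[R]_k) : Prop :=
  M^T = M /\
  forall eps : R, 0 < eps -> \forall s \near within (strip T) (nbhs (t, x)),
    taylor2 u t x p q M s.1 s.2
      - eps * (`|s.1 - t| + enorm (s.2 - x) ^+ 2) <= u s.1 s.2.

Definition superjet (R : realType) (k : nat) (T : R) (u : R -> 'cV[R]_k -> R)
    (t : R) (x : 'cV[R]_k) (p : R) (q : 'cV[R]_k) (M : 'M[R]_k) : Prop :=
  M^T = M /\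
  forall eps : R, 0 < eps -> \forall s \near within (strip T) (nbhs (t, x)),
    u s.1 s.2 <= taylor2 u t x p q M s.1 s.2
      + eps * (`|s.1 - t| + enorm (s.2 - x) ^+ 2).

(* The closure operation taking J = subjet or superjet to its limiting jet. *)
Definition limiting_jet (R : realType) (k : nat) (T : R)
    (J : R -> (R -> 'cV[R]_k -> R) -> R -> 'cV[R]_k ->
         R -> 'cV[R]_k -> 'M[R]_k -> Prop)
    (u : R -> 'cV[R]_k -> R) (t : R) (x : 'cV[R]_k)
    (p : R) (q : 'cV[R]_k) (M : 'M[R]_k) : Prop :=
  exists (t_ : nat -> R) (x_ : nat -> 'cV[R]_k)
         (p_ : nat -> R) (q_ : nat -> 'cV[R]_k) (M_ : nat -> 'M[R]_k),
  [/\ forall n, 0 <= t_ n <= T /\ J T u (t_ n) (x_ n) (p_ n) (q_ n) (M_ n),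
      [/\ t_ n @[n --> \oo] --> t, x_ n @[n --> \oo] --> x
        & u (t_ n) (x_ n) @[n --> \oo] --> u t x]
    & [/\ p_ n @[n --> \oo] --> p, q_ n @[n --> \oo] --> q
        & M_ n @[n --> \oo] --> M]].

Definition generator (R : realType) (k d : nat)
    (b : R -> 'cV[R]_k -> 'cV[R]_k) (sigma : R -> 'cV[R]_k -> 'M[R]_(k, d))
    (t : R) (x : 'cV[R]_k) (q : 'cV[R]_k) (M : 'M[R]_k) : R :=
  2^-1 * \tr (sigma t x *m (sigma t x)^T *m M) + dotv (b t x) q.

(* The maximum of y_j - c_j over j <> i; taken in the extended reals, so that
   it is -oo when i is the only index. *)
Definition max_others (R : realType) (m : nat) (i : 'I_m)
    (y c : 'I_m -> R) : \bar R :=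
  \big[maxe/-oo%E]_(j < m | j != i) (y j - c j)%:E.

(* The left-hand side of the i-th equation, with (p, q, M) in place of the
   derivatives (d_t v_i, D_x v_i, D^2_xx v_i) at (t, x). *)
Definition system_op (R : realType) (k d m : nat)
    (b : R -> 'cV[R]_k -> 'cV[R]_k) (sigma : R -> 'cV[R]_k -> 'M[R]_(k, d))
    (f : 'I_m -> R -> 'cV[R]_k -> 'cV[R]_m -> 'cV[R]_d -> R)
    (g : 'I_m -> 'I_m -> R -> 'cV[R]_k -> R)
    (v : 'I_m -> R -> 'cV[R]_k -> R) (i : 'I_m)
    (t : R) (x : 'cV[R]_k) (p : R) (q : 'cV[R]_k) (M : 'M[R]_k) : \bar R :=
  mine ((v i t x)%:E - max_others i (fun j => v j t x) (fun j => g i j t x))%E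
       (- p - generator b sigma t x q M
        - f i t x (\col_j v j t x) ((sigma t x)^T *m q))%:E.

Definition viscosity_supersolution (R : realType) (k d m : nat) (T : R)
    (b : R -> 'cV[R]_k -> 'cV[R]_k) (sigma : R -> 'cV[R]_k -> 'M[R]_(k, d))
    (f : 'I_m -> R -> 'cV[R]_k -> 'cV[R]_m -> 'cV[R]_d -> R)
    (g : 'I_m -> 'I_m -> R -> 'cV[R]_k -> R) (h : 'I_m -> 'cV[R]_k -> R)
    (v : 'I_m -> R -> 'cV[R]_k -> R) : Prop :=
  [/\ forall i, strip_lsc T (v i),
      forall (i : 'I_m) (t : R) (x : 'cV[R]_k) (p : R) (q : 'cV[R]_k)
        (M : 'M[R]_k), 0 <= t < T ->
        limiting_jet T (@subjet R k) (v i) t x p q M ->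
        (0 <= system_op b sigma f g v i t x p q M)%E
    & forall i x, h i x <= v i T x].

Definition viscosity_subsolution (R : realType) (k d m : nat) (T : R)
    (b : R -> 'cV[R]_k -> 'cV[R]_k) (sigma : R -> 'cV[R]_k -> 'M[R]_(k, d))
    (f : 'I_m -> R -> 'cV[R]_k -> 'cV[R]_m -> 'cV[R]_d -> R)
    (g : 'I_m -> 'I_m -> R -> 'cV[R]_k -> R) (h : 'I_m -> 'cV[R]_k -> R)
    (v : 'I_m -> R -> 'cV[R]_k -> R) : Prop :=
  [/\ forall i, strip_usc T (v i),
      forall (i : 'I_m) (t : R) (x : 'cV[R]_k) (p : R) (q : 'cV[R]_k)
        (M : 'M[R]_k), 0 <= t < T ->
        limiting_jet T (@superjet R k) (v i) t x p q M ->
        (system_op b sigma f g v i t x p q M <= 0)%E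
    & forall i x, v i T x <= h i x].

Definition viscosity_solution (R : realType) (k d m : nat) (T : R)
    (b : R -> 'cV[R]_k -> 'cV[R]_k) (sigma : R -> 'cV[R]_k -> 'M[R]_(k, d))
    (f : 'I_m -> R -> 'cV[R]_k -> 'cV[R]_m -> 'cV[R]_d -> R)
    (g : 'I_m -> 'I_m -> R -> 'cV[R]_k -> R) (h : 'I_m -> 'cV[R]_k -> R)
    (v : 'I_m -> R -> 'cV[R]_k -> R) : Prop :=
  [/\ forall i, strip_continuous T (v i),
      viscosity_supersolution T b sigma f g h v
    & viscosity_subsolution T b sigma f g h v].

(* Continuity in (t,x) uniformly in (y,z): at each point of the strip, one
   neighbourhood serves all (y,z). *)
Definition driver_continuous (R : realType) (k d m : nat) (T : R)
    (f : R -> 'cV[R]_k -> 'cV[R]_m -> 'cV[R]_d -> R) : Prop :=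
  forall (t : R) (x : 'cV[R]_k), 0 <= t <= T -> forall eps : R, 0 < eps ->
    \forall s \near within (strip T) (nbhs (t, x)),
      forall y z, `|f s.1 s.2 y z - f t x y z| < eps.

Definition driver_lipschitz (R : realType) (k d m : nat) (T : R)
    (f : R -> 'cV[R]_k -> 'cV[R]_m -> 'cV[R]_d -> R) : Prop :=
  exists2 C : R, 0 <= C &
    forall (t : R) (x : 'cV[R]_k) (y y' : 'cV[R]_m) (z z' : 'cV[R]_d),
      0 <= t <= T ->
      `|f t x y z - f t x y' z'| <=
        C * (\sum_(l < m) `|y l ord0 - y' l ord0| + enorm (z - z')).

Definition driver_monotone (R : realType) (k d m : nat) (T : R) (i : 'I_m)
    (f : R -> 'cV[R]_k -> 'cV[R]_m -> 'cV[R]_d -> R) : Prop :=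
  forall l : 'I_m, l != i ->
  forall (t : R) (x : 'cV[R]_k) (y y' : 'cV[R]_m) (z : 'cV[R]_d),
    0 <= t <= T ->
    (forall j, j != l -> y j ord0 = y' j ord0) ->
    y l ord0 <= y' l ord0 ->
    f t x y z <= f t x y' z.

(* A loop i_1, ..., i_N is encoded as i :: s with N = (size s).+1; #|i :: s| is
   the number of distinct indices occurring in it. *)
Definition no_free_loop (R : realType) (k m : nat) (T : R)
    (g : 'I_m -> 'I_m -> R -> 'cV[R]_k -> R) : Prop :=
  forall (t : R) (x : 'cV[R]_k), 0 <= t <= T ->
  forall (i : 'I_m) (s : seq 'I_m),
    (3 <= size (i :: s))%N -> last i s = i -> #|i :: s| = size s ->
    0 < \sum_(n < size s) g (nth i (i :: s) n) (nth i (i :: s) n.+1) t x.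

(* Main.v *)
(* The solution is the limit of explicit monotone finite-difference schemes for
   the penalized equations, where the obstacle of component i is replaced by the
   term n \sum_l (y_l - g_il - y_i)^+ of the driver.  A scheme value
   V(j, i, x, xi) carries a second space point xi, ranging over a finite grid, at
   which the coefficients are frozen; a strong coupling term
   lambda (V(x, x) - V(x, xi)) makes the limit independent of xi.  Since the
   coefficients do not depend on x, V(j, i, ., xi) keeps a second-order
   expansion at every point, and this replaces Alexandrov's theorem and the
   theorem on sums: where an upper semicontinuous U touches the lower
   half-relaxed limit from below, one doubles the variables between U and the
   scheme and transfers the expansion of the scheme into a superjet of U.
   Hence every subsolution of polynomial growth lies below the lower limit; the
   loop condition supplies an index whose obstacle is inactive at the maximum.
   Changing signs turns the upper limit into a lower one, so the two limits
   coincide and equal any other solution. *)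

Require Import Defs.
From HB Require Import structures.
From mathcomp Require Import all_boot all_order all_algebra.
From mathcomp Require Import all_classical all_reals all_analysis.
From mathcomp Require Import ring lra.

Import Order.TTheory GRing.Theory Num.Theory.
Import numFieldNormedType.Exports.

Set Implicit Arguments.
Unset Strict Implicit.
Unset Printing Implicit Defensive.

Local Open Scope classical_set_scope.
Local Open Scope ring_scope.

(** Only one of the two functions compared is regular, and only at fixed [n]. An explicit step
    combines translates of the previous value, by shifts depending on [xi] and not on [y], with a
    source sampled at nodes and spread by a smooth partition of unity. Nonnegative weights of total
    mass at most one do not enlarge a cubic Taylor constant; it may be enormous, but it is fixed
    before the time step. The price is the extra variable [xi]: the half-relaxed limits range over
    all of it, and the coupling must beat every growth in [xi].

    At a contact point the other components are known only through lower bounds, which is all that a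
    lower limit provides; this is where the monotonicity of the drivers enters. Statements about
    limits are made for an abstract driver and scheme, so as to serve the penalized scheme and its
    opposite.

    The coefficients are merely continuous in time, so in the doubling the penalty in time is chosen
    after the one in space. The Lipschitz constant of the obstacle penalty grows with [n]; the
    discretization parameters of level [n] feel it, the growth bounds do not. *)

Ltac lraC := repeat match goal with
  | H : ?P |- _ => lazymatch P with
     | is_true (@Order.le _ _ _ _) => fail
     | is_true (@Order.lt _ _ _ _) => fail
     | @eq _ _ _ => fail
     | _ => clear H
     end
  end; lra.

(** * Euclidean norms and limits along an ultrafilter *)

Section euclid.
Variable R : realType.

Definition fdot m n (A B : 'M[R]_(m, n)) : R := \sum_i \sum_j A i j * B i j.

Lemma fdotC m n (A B : 'M[R]_(m, n)) : fdot A B = fdot B A.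
Proof. by apply: eq_bigr => i _; apply: eq_bigr => j _; rewrite mulrC. Qed.

Lemma fdotDl m n (A B C : 'M[R]_(m, n)) : fdot (A + B) C = fdot A C + fdot B C.
Proof.
rewrite -big_split; apply: eq_bigr => i _; rewrite -big_split.
by apply: eq_bigr => j _; rewrite !mxE mulrDl.
Qed.

Lemma fdotZl m n a (A B : 'M[R]_(m, n)) : fdot (a *: A) B = a * fdot A B.
Proof.
rewrite mulr_sumr; apply: eq_bigr => i _; rewrite mulr_sumr.
by apply: eq_bigr => j _; rewrite !mxE mulrA.
Qed.

Lemma fdotNl m n (A B : 'M[R]_(m, n)) : fdot (- A) B = - fdot A B.
Proof. by rewrite -scaleN1r fdotZl mulN1r. Qed.

Lemma enormE m n (A : 'M[R]_(m, n)) : enorm A = Num.sqrt (fdot A A).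
Proof. by congr Num.sqrt; apply: eq_bigr => i _; apply: eq_bigr => j _; rewrite expr2. Qed.

Lemma fdot_ge0 m n (A : 'M[R]_(m, n)) : 0 <= fdot A A.
Proof. by apply: sumr_ge0 => i _; apply: sumr_ge0 => j _; rewrite -expr2 sqr_ge0. Qed.

Lemma enorm_ge0 m n (A : 'M[R]_(m, n)) : 0 <= enorm A.
Proof. exact: sqrtr_ge0. Qed.

Lemma enorm_sqr m n (A : 'M[R]_(m, n)) : enorm A ^+ 2 = fdot A A.
Proof. by rewrite enormE sqr_sqrtr ?fdot_ge0. Qed.

Lemma fdot_eq0 m n (A : 'M[R]_(m, n)) : fdot A A = 0 -> A = 0.
Proof.
move=> /eqP; rewrite psumr_eq0 => [/allP h|i _]; last first.
  by apply: sumr_ge0 => j _; rewrite -expr2 sqr_ge0.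
apply/matrixP => i j; rewrite mxE.
have /= := h i (mem_index_enum _); rewrite psumr_eq0 => [/allP h2|l _]; last first.
  by rewrite -expr2 sqr_ge0.
by have /= := h2 j (mem_index_enum _); rewrite -expr2 sqrf_eq0 => /eqP.
Qed.

Lemma fdot_CS m n (A B : 'M[R]_(m, n)) : `|fdot A B| <= enorm A * enorm B.
Proof.
rewrite -(@ler_pXn2r _ 2) ?nnegrE ?mulr_ge0 ?enorm_ge0 ?normr_ge0//.
rewrite real_normK ?num_real// exprMn !enorm_sqr.
have [B0|B0] := eqVneq (fdot B B) 0.
  rewrite (fdot_eq0 B0) !(fdotC _ 0) -(scale0r 0) !fdotZl; lra.
have Bp : 0 < fdot B B by rewrite lt_def B0 fdot_ge0.
have := fdot_ge0 (fdot B B *: A - fdot A B *: B).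
rewrite !(fdotDl, fdotNl, fdotZl) ![fdot _ (_ - _)]fdotC !(fdotDl, fdotNl, fdotZl).
rewrite (fdotC B A) => h.
have : 0 <= fdot B B * (fdot A A * fdot B B - fdot A B ^+ 2) by nra.
by rewrite pmulr_rge0//; lra.
Qed.

Lemma enormD m n (A B : 'M[R]_(m, n)) : enorm (A + B) <= enorm A + enorm B.
Proof.
rewrite -(@ler_pXn2r _ 2) ?nnegrE ?addr_ge0 ?enorm_ge0//.
rewrite sqrrD !enorm_sqr fdotDl ![fdot _ (_ + _)]fdotC !fdotDl (fdotC B A).
have := fdot_CS A B; rewrite ler_norml => /andP[_]; lra.
Qed.

Lemma enormZ m n a (A : 'M[R]_(m, n)) : enorm (a *: A) = `|a| * enorm A.
Proof.
rewrite !enormE fdotZl fdotC fdotZl mulrA -expr2 sqrtrM ?sqr_ge0//.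
by rewrite sqrtr_sqr.
Qed.

Lemma enormN m n (A : 'M[R]_(m, n)) : enorm (- A) = enorm A.
Proof. by rewrite -scaleN1r enormZ normrN1 mul1r. Qed.

Lemma enormB m n (A B : 'M[R]_(m, n)) : enorm (A - B) = enorm (B - A).
Proof. by rewrite -enormN opprB. Qed.

Lemma enorm0 m n : enorm (0 : 'M[R]_(m, n)) = 0.
Proof. by rewrite -(scale0r 0) enormZ normr0 mul0r. Qed.

Lemma enorm_tri m n (A B C : 'M[R]_(m, n)) :
  enorm (A - C) <= enorm (A - B) + enorm (B - C).
Proof. by have := enormD (A - B) (B - C); rewrite addrA subrK. Qed.

Lemma enorm_le_add m n (A B : 'M[R]_(m, n)) : enorm A <= enorm B + enorm (A - B).
Proof. by have := enormD B (A - B); rewrite addrC subrK. Qed.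

Lemma enorm_eq0 m n (A : 'M[R]_(m, n)) : enorm A = 0 -> A = 0.
Proof.
by move=> h; apply: fdot_eq0; rewrite -enorm_sqr h expr0n.
Qed.

Lemma enorm_coord m n (A : 'M[R]_(m, n)) i j : `|A i j| <= enorm A.
Proof.
rewrite -(@ler_pXn2r _ 2) ?nnegrE ?enorm_ge0// enorm_sqr real_normK ?num_real//.
rewrite /fdot (bigD1 i)//= (bigD1 j)//= -expr2 -addrA lerDl addr_ge0//.
  by apply: sumr_ge0 => l _; rewrite -expr2 sqr_ge0.
by apply: sumr_ge0 => l _; apply: sumr_ge0 => l' _; rewrite -expr2 sqr_ge0.
Qed.

Lemma enorm_le_sum m n (A : 'M[R]_(m, n)) :
  enorm A <= \sum_i \sum_j `|A i j|.
Proof.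
have s0 : 0 <= \sum_i \sum_j `|A i j|.
  by apply: sumr_ge0 => i _; apply: sumr_ge0.
rewrite -(@ler_pXn2r _ 2) ?nnegrE ?enorm_ge0// enorm_sqr expr2 mulr_suml.
apply: ler_sum => i _; rewrite mulr_suml; apply: ler_sum => j _.
apply: (le_trans (ler_norm _)); rewrite normrM ler_wpM2l//.
rewrite (bigD1 i)//= (bigD1 j)//= -addrA lerDl addr_ge0//.
  exact: sumr_ge0.
by apply: sumr_ge0 => l _; apply: sumr_ge0.
Qed.

Lemma enorm_le_coord m n (A : 'M[R]_(m, n)) e :
  (forall i j, `|A i j| <= e) -> enorm A <= (m * n)%:R * e.
Proof.
move=> h; apply: (le_trans (enorm_le_sum _)).
apply: (@le_trans _ _ (\sum_(i < m) \sum_(j < n) e)).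
  by apply: ler_sum => i _; apply: ler_sum.
by rewrite !sumr_const !card_ord -mulrnA mulnC mulr_natl.
Qed.

Lemma dotvE k (u v : 'cV[R]_k) : dotv u v = fdot u v.
Proof. by apply: eq_bigr => i _; rewrite big_ord1. Qed.

Lemma dotvC k (u v : 'cV[R]_k) : dotv u v = dotv v u.
Proof. by rewrite !dotvE fdotC. Qed.
Lemma dotvDl k (u v w : 'cV[R]_k) : dotv (u + v) w = dotv u w + dotv v w.
Proof. by rewrite !dotvE fdotDl. Qed.
Lemma dotvDr k (u v w : 'cV[R]_k) : dotv w (u + v) = dotv w u + dotv w v.
Proof. by rewrite !(dotvC w) dotvDl. Qed.
Lemma dotvNl k (u v : 'cV[R]_k) : dotv (- u) v = - dotv u v.
Proof. by rewrite !dotvE fdotNl. Qed.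
Lemma dotvNr k (u v : 'cV[R]_k) : dotv u (- v) = - dotv u v.
Proof. by rewrite !(dotvC u) dotvNl. Qed.
Lemma dotvZl k a (u v : 'cV[R]_k) : dotv (a *: u) v = a * dotv u v.
Proof. by rewrite !dotvE fdotZl. Qed.
Lemma dotvZr k a (u v : 'cV[R]_k) : dotv u (a *: v) = a * dotv u v.
Proof. by rewrite !(dotvC u) dotvZl. Qed.
Lemma dotv0l k (v : 'cV[R]_k) : dotv 0 v = 0.
Proof. by rewrite -(scale0r 0) dotvZl mul0r. Qed.
Lemma dotv0r k (v : 'cV[R]_k) : dotv v 0 = 0.
Proof. by rewrite dotvC dotv0l. Qed.

Definition dotvE_ := (dotvDl, dotvDr, dotvNl, dotvNr, dotvZl, dotvZr, dotv0l, dotv0r).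

Lemma dotvv k (u : 'cV[R]_k) : dotv u u = enorm u ^+ 2.
Proof. by rewrite enorm_sqr dotvE. Qed.

Lemma dotv_CS k (u v : 'cV[R]_k) : `|dotv u v| <= enorm u * enorm v.
Proof. by rewrite dotvE fdot_CS. Qed.

Lemma dotv_mul k l (A : 'M[R]_(k, l)) u v : dotv u (A *m v) = dotv (A^T *m u) v.
Proof.
transitivity (\sum_i \sum_j u i ord0 * A i j * v j ord0).
  apply: eq_bigr => i _; rewrite mxE mulr_sumr.
  by apply: eq_bigr => j _; rewrite mulrA.
rewrite exchange_big /=; apply: eq_bigr => j _; rewrite mxE mulr_suml.
by apply: eq_bigr => i _; rewrite mxE (mulrC (u _ _)).
Qed.

Lemma enorm_mulv m n (A : 'M[R]_(m, n)) (v : 'cV[R]_n) :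
  enorm (A *m v) <= enorm A * enorm v.
Proof.
rewrite -(@ler_pXn2r _ 2) ?nnegrE ?mulr_ge0 ?enorm_ge0//.
rewrite exprMn enorm_sqr [X in _ <= X * _]enorm_sqr /fdot mulr_suml.
apply: ler_sum => i _; rewrite big_ord1.
have := fdot_CS (row i A)^T v.
move=> h0; have : fdot (row i A)^T v ^+ 2 <= (enorm (row i A)^T * enorm v) ^+ 2.
  rewrite -[X in X <= _]real_normK ?num_real//.
  by rewrite ler_pXn2r ?nnegrE ?mulr_ge0 ?enorm_ge0 ?normr_ge0.
rewrite exprMn (enorm_sqr (row i A)^T).
have -> : fdot (row i A)^T v = (A *m v) i 0.
  by rewrite mxE /fdot; apply: eq_bigr => l _; rewrite big_ord1 !mxE.
suff -> : fdot (row i A)^T (row i A)^T = \sum_j A i j * A i j by rewrite -expr2.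
by rewrite /fdot; apply: eq_bigr => l _; rewrite big_ord1 !mxE.
Qed.

Lemma enorm_trmulv m n (A : 'M[R]_(m, n)) (v : 'cV[R]_m) :
  enorm (A^T *m v) <= enorm A * enorm v.
Proof.
apply: le_trans (enorm_mulv _ _) _; rewrite le_eqVlt; apply/orP; left.
apply/eqP; congr (_ * _); rewrite !enormE; congr Num.sqrt.
by rewrite /fdot exchange_big /=; apply: eq_bigr => i _; apply: eq_bigr => j _; rewrite !mxE.
Qed.

Lemma enorm_sqr_col k d (A : 'M[R]_(k, d)) :
  enorm A ^+ 2 = \sum_j enorm (col j A) ^+ 2.
Proof.
rewrite enorm_sqr /fdot exchange_big /=; apply: eq_bigr => j _.
by rewrite enorm_sqr /fdot; apply: eq_bigr => i _; rewrite big_ord1 !mxE.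
Qed.

Lemma enorm_col k d (A : 'M[R]_(k, d)) j : enorm (col j A) <= enorm A.
Proof.
rewrite -(@ler_pXn2r _ 2) ?nnegrE ?enorm_ge0// (enorm_sqr_col A) (bigD1 j)//=.
by rewrite lerDl sumr_ge0// => i _; rewrite sqr_ge0.
Qed.

Definition qf k (M : 'M[R]_k) (e : 'cV[R]_k) : R := dotv e (M *m e).

Lemma qfD k (M N : 'M[R]_k) e : qf (M + N) e = qf M e + qf N e.
Proof. by rewrite /qf mulmxDl dotvDr. Qed.
Lemma qfZ k a (M : 'M[R]_k) e : qf (a *: M) e = a * qf M e.
Proof. by rewrite /qf -scalemxAl dotvZr. Qed.
Lemma qf1 k (e : 'cV[R]_k) : qf 1%:M e = enorm e ^+ 2.
Proof. by rewrite /qf mul1mx dotvv. Qed.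
Lemma qfZr k (M : 'M[R]_k) a e : qf M (a *: e) = a ^+ 2 * qf M e.
Proof. by rewrite /qf -scalemxAr dotvZl dotvZr mulrA expr2. Qed.
(** Puts the diffusion term in the form used throughout: matrices are compared only as quadratic
    forms, and the scheme takes second differences along the columns of [sigma]. *)
Lemma tr_qf k d (A : 'M[R]_(k, d)) (M : 'M[R]_k) :
  \tr (A *m A^T *m M) = \sum_j qf M (col j A).
Proof.
rewrite -mulmxA mxtrace_mulC -mulmxA; apply: eq_bigr => j _; rewrite mxE.
rewrite /qf /dotv; apply: eq_bigr => i _; rewrite !mxE; congr (_ * _).
by apply: eq_bigr => l _; rewrite !mxE.
Qed.

Lemma generatorE k d b (sigma : R -> 'cV[R]_k -> 'M[R]_(k, d)) t x q M :
  generator b sigma t x q M =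
  2^-1 * (\sum_j qf M (col j (sigma t x))) + dotv (b t x) q.
Proof. by rewrite /generator tr_qf. Qed.

End euclid.

Section ultra.

(* An ultrafilter finer than \oo: bounded sequences converge along it, so no
   subsequence has to be extracted. *)
Definition UU : set_system nat :=
  projT1 (cid (ultraFilterLemma (eventually_filter))).

Global Instance UU_ultra : UltraFilter UU.
Proof. by rewrite /UU; case: cid => ? []. Qed.

Global Instance UU_proper : ProperFilter UU.
Proof. exact: ultra_proper. Qed.

Lemma UU_oo (P : nat -> Prop) : (\forall n \near \oo, P n) -> \forall n \near UU, P n.
Proof. by rewrite /UU; case: cid => U /= [_ h]; apply: h. Qed.

Lemma UU_ge N : \forall n \near UU, (N <= n)%N.
Proof. by apply: UU_oo; exists N. Qed.

Lemma UU_ex (P : nat -> Prop) : (\forall n \near UU, P n) -> exists n, P n.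
Proof. by move=> h; have [n] := filter_ex h; exists n. Qed.

Variable R : realType.

(** Only an upper bound: the sequences concerned are nonnegative, and the one-sided form passes at
    once to smaller sequences. *)
Definition to0 (a : nat -> R) := forall e : R, 0 < e -> \forall n \near UU, a n < e.

Lemma to0_inv : to0 (fun n => n.+1%:R^-1).
Proof.
move=> e e0; apply: UU_oo; exists (Num.truncn e^-1) => // n /= h.
rewrite invf_plt ?posrE//.
apply: lt_le_trans (_ : (Num.truncn e^-1).+1%:R <= _).
  by rewrite truncnS_gt.
by rewrite ler_nat.
Qed.

Lemma to0_ge a l : to0 a -> (\forall n \near UU, l <= a n) -> l <= 0.
Proof.
move=> ha hl; apply/ler_addgt0Pl => e e0; rewrite addr0.
have [n [h1 h2]] := UU_ex (filterI (ha e e0) hl).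
exact: le_trans h2 (ltW h1).
Qed.

Lemma to0_le a b : to0 a -> (\forall n \near UU, b n <= a n) -> to0 b.
Proof.
move=> ha hb e e0; near=> n; apply: (@le_lt_trans _ _ (a n)); near: n => //.
exact: ha.
Unshelve. all: by end_near. Qed.

Lemma to0D a b : to0 a -> to0 b -> to0 (fun n => a n + b n).
Proof.
move=> ha hb e e0; near=> n.
have h1 : a n < e / 2 by near: n; apply: ha; rewrite divr_gt0.
have h2 : b n < e / 2 by near: n; apply: hb; rewrite divr_gt0.
lra.
Unshelve. all: by end_near. Qed.

Lemma to0Z a C : 0 <= C -> to0 a -> to0 (fun n => C * a n).
Proof.
move=> C0 ha e e0; near=> n.
have h : a n < e / (C + 1) by near: n; apply: ha; rewrite divr_gt0// ltr_wpDl.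
have C1 : 0 < C + 1 by rewrite ltr_wpDl.
move: h; rewrite ltr_pdivlMr// => h.
have [an|an] := leP 0 (a n); first by nra.
by apply: (@le_lt_trans _ _ 0); [rewrite mulr_ge0_le0// ltW|exact: e0].
Unshelve. all: by end_near. Qed.

Lemma to0_sum (I : finType) (a : I -> nat -> R) :
  (forall i, to0 (a i)) -> to0 (fun n => \sum_i a i n).
Proof.
move=> h; suff H : forall s : seq I, to0 (fun n => \sum_(i <- s) a i n) by exact: H.
elim=> [|i s IH] e e0.
  by apply: filterE => n; rewrite big_nil.
move: (to0D (h i) IH e0); apply: filterS => n; by rewrite big_cons.
Qed.

Lemma ulim_compact (T : topologicalType) (A : set T) (a : nat -> T) :
  compact A -> (\forall n \near UU, A (a n)) ->
  exists2 p, A p & a n @[n --> UU] --> p.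
Proof.
move=> cA hA; have [p [Ap clp]] := cA (a @ UU) _ hA.
exists p => // B Bp.
have [//|hC] := in_ultra_setVsetC (a @^-1` B) UU_ultra.
have [q [q1 q2]] := clp (~` B) B hC Bp; by [].
Qed.

Lemma ulim_real (a : nat -> R) M : (forall n, `|a n| <= M) ->
  exists l, to0 (fun n => `|a n - l|).
Proof.
move=> h; have [|l _ hl] := @ulim_compact R `[-M, M] a (@segment_compact _ _ _).
  by apply: filterE => n /=; rewrite in_itv/= -ler_norml.
exists l => e e0; apply: (filterS _ (cvg_ball hl e0)) => n.
by rewrite /ball /= distrC.
Qed.

Lemma ulim_mx k m (a : nat -> 'M[R]_(k, m)) M : (forall n, enorm (a n) <= M) ->
  exists l, to0 (fun n => enorm (a n - l)).
Proof.
move=> h.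
have H (p : 'I_k * 'I_m) : exists l, to0 (fun n => `|a n p.1 p.2 - l|).
  by apply: (@ulim_real _ M) => n; apply: le_trans (enorm_coord _ _ _) (h n).
have [l hl] := choice H.
exists (\matrix_(i, j) l (i, j)).
apply: (to0_le (to0_sum (fun i => to0_sum (fun j => hl (i, j))))).
apply: filterE => n; apply: le_trans (enorm_le_sum _) _.
by apply: ler_sum => i _; apply: ler_sum => j _; rewrite !mxE.
Qed.

(** An extreme value theorem. For any sequence in [P], [key] gives a point of [P] whose value is
    asymptotically not exceeded; it serves twice, for the finiteness of the supremum and for its
    attainment. *)
Lemma usc_max k (P : R -> 'cV[R]_k -> Prop) (F : R -> 'cV[R]_k -> R) M t0 x0 :
  P t0 x0 ->
  (forall t x, P t x -> `|t| <= M /\ enorm x <= M) ->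
  (forall (t_ : nat -> R) (x_ : nat -> 'cV[R]_k) t x,
    (forall n, P (t_ n) (x_ n)) -> to0 (fun n => `|t_ n - t|) ->
    to0 (fun n => enorm (x_ n - x)) -> P t x) ->
  (forall t x, P t x -> forall e : R, 0 < e -> exists2 r : R, 0 < r &
     forall (t' : R) (x' : 'cV[R]_k), P t' x' -> `|t' - t| < r -> enorm (x' - x) < r ->
       F t' x' < F t x + e) ->
  exists t x, P t x /\ forall (t' : R) (x' : 'cV[R]_k), P t' x' -> F t' x' <= F t x.
Proof.
move=> P0 bP cP uF.
have key (t_ : nat -> R) x_ : (forall n, P (t_ n) (x_ n)) ->
  exists t x, P t x /\ forall e : R, 0 < e -> \forall n \near UU, F (t_ n) (x_ n) < F t x + e.
  move=> Pn.
  have [t ht] := ulim_real (fun n => (bP _ _ (Pn n)).1).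
  have [x hx] := ulim_mx (fun n => (bP _ _ (Pn n)).2).
  have Ptx := cP _ _ _ _ Pn ht hx.
  exists t, x; split=> // e e0; have [r r0 hr] := uF _ _ Ptx e e0.
  by apply: filterS2 (ht r r0) (hx r r0) => n; apply: hr.
pose S := [set F s.1 s.2 | s in [set s : R * 'cV[R]_k | P s.1 s.2]].
have S0 : S !=set0 by exists (F t0 x0), (t0, x0).
have Sub : has_ubound S.
  apply: contrapT => nub.
  have /choice [s hs] (n : nat) : exists s : R * 'cV[R]_k, P s.1 s.2 /\ n%:R < F s.1 s.2.
    apply: contrapT => h; apply: nub; exists n%:R => _ [s Ps <-].
    by rewrite leNgt; apply/negP => hlt; apply: h; exists s.
  have [t [x [_ h]]] := key (fst \o s) (snd \o s) (fun n => (hs n).1).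
  pose N := (Num.truncn (F t x + 1)).+1.
  have [n [hn1 hn2]] := UU_ex (filterI (h 1 ltr01) (UU_ge N)).
  have := lt_trans (hs n).2 hn1; apply/negP; rewrite -leNgt.
  apply: le_trans (ltW (truncnS_gt _)) _; by rewrite ler_nat.
have hS : has_sup S by split.
have /choice [s hs] (n : nat) : exists s : R * 'cV[R]_k, P s.1 s.2 /\ sup S - n.+1%:R^-1 < F s.1 s.2.
  have [_ [s Ps <-] h] := sup_adherent (ltac:(by rewrite invr_gt0 ltr0n) : 0 < n.+1%:R^-1 :> R) hS.
  by exists s.
have [t [x [Ptx h]]] := key (fst \o s) (snd \o s) (fun n => (hs n).1).
exists t, x; split=> // t' x' P'.
have h1 : F t' x' <= sup S by apply: ub_le_sup => //; exists (t', x').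
apply: (le_trans h1).
suff H : forall e : R, 0 < e -> sup S <= e + F t x by apply/ler_addgt0Pl.
move=> e e0; have e20 : 0 < e / 2 by rewrite divr_gt0.
have [n [hn1 hn2]] := UU_ex (filterI (h _ e20) (to0_inv e20)).
have h3 := (hs n).2; rewrite /= in hn1 hn2 h3.
by move: (n.+1%:R^-1) (F (s n).1 (s n).2) (sup S) hn1 hn2 h3 => *; lra.
Qed.

End ultra.

(** * Topology of the strip in epsilon form *)

Section strip.
Variables (R : realType) (k : nat) (T : R).

Lemma nbhs_enorm (x : 'cV[R]_k) (Q : set 'cV[R]_k) :
  nbhs x Q <-> exists2 r : R, 0 < r & forall y, enorm (y - x) < r -> Q y.
Proof.
split.
  move=> /nbhs_ballP [e /= e0 h]; exists e => // y hy; apply: h; split=> // i j.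
  have := enorm_coord (y - x) i j; rewrite !mxE => h.
  by rewrite /ball /= distrC; apply: le_lt_trans h hy.
move=> [r r0 h]; apply/nbhs_ballP.
exists (r / (k%:R + 1)) => /=; first by rewrite divr_gt0// ltr_wpDl.
move=> y hy; apply: h.
have k1 : 0 < k%:R + 1 :> R by rewrite ltr_wpDl.
apply: (@le_lt_trans _ _ ((k * 1)%:R * (r / (k%:R + 1)))).
  apply: enorm_le_coord => i j; have := hy.2 i j; rewrite /ball /= distrC !mxE.
  exact: ltW.
rewrite muln1 mulrA ltr_pdivrMr// mulrC ltr_pM2l//; lra.
Qed.

Lemma near_strip t (x : 'cV[R]_k) (Q : R * 'cV[R]_k -> Prop) :
  (\forall s \near within (strip T) (nbhs (t, x)), Q s) <->
  exists2 r : R, 0 < r & forall (t' : R) (x' : 'cV[R]_k), 0 <= t' <= T -> `|t' - t| < r ->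
     enorm (x' - x) < r -> Q (t', x').
Proof.
split.
  move=> [[A B] /= [hA hB] h].
  have [e1 /= e10 h1] := (nbhs_ballP _ _).1 hA.
  have [e2 e20 h2] := (nbhs_enorm _ _).1 hB.
  exists (Num.min e1 e2); first by rewrite lt_min e10.
  move=> t' x' ht' ht hx; apply: (h (t', x')) => //; split=> /=.
    by apply: h1; rewrite /ball /= distrC; move: ht; rewrite lt_min => /andP[].
  by apply: h2; move: hx; rewrite lt_min => /andP[].
move=> [r r0 h]; exists ([set t' | `|t' - t| < r], [set x' | enorm (x' - x) < r]) => /=.
  split=> /=; last by apply/nbhs_enorm; exists r.
  by apply/nbhs_ballP; exists r => //= y; rewrite /ball /= distrC.
by move=> [t' x'] /= [ht hx] hs; apply: h.
Qed.

Lemma strip_lscP (u : R -> 'cV[R]_k -> R) : strip_lsc T u <->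
  forall (t : R) (x : 'cV[R]_k), 0 <= t <= T -> forall e : R, 0 < e -> exists2 r : R, 0 < r &
    forall (t' : R) (x' : 'cV[R]_k), 0 <= t' <= T -> `|t' - t| < r -> enorm (x' - x) < r ->
      u t x - e < u t' x'.
Proof.
split.
  move=> h t x ht e e0.
  have [|V hV hlt] := h (t, x) (u t x - e); first by rewrite lte_fin gtrBl.
  move: hV; rewrite [X in X V](_ : _ = nbhs_subspace (t, x))//.
rewrite -nbhs_subspace_in//= => /near_strip [r r0 hr].
  by exists r => // t' x' ht' h1 h2; rewrite -lte_fin; apply: (hlt (t', x')); apply: hr.
move=> h [t x] a hlt; have [ht|ht] := boolP (0 <= t <= T); last first.
  exists [set (t, x)]; last by move=> y ->.
  rewrite [X in X _](_ : _ = nbhs_subspace (t, x))//.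
  by rewrite -nbhs_subspace_out// => ht2; case/negP: ht.
have [|r r0 hr] := h t x ht (u t x - a); first by rewrite subr_gt0 -lte_fin.
exists [set s : R * 'cV[R]_k | a < u s.1 s.2] => //.
rewrite [X in X _](_ : _ = nbhs_subspace (t, x))//.
rewrite -nbhs_subspace_in//=; apply/near_strip; exists r => // t' x' ht' h1 h2 /=.
by have := hr _ _ ht' h1 h2; lra.
Qed.

Lemma strip_uscP (u : R -> 'cV[R]_k -> R) : strip_usc T u <->
  forall (t : R) (x : 'cV[R]_k), 0 <= t <= T -> forall e : R, 0 < e -> exists2 r : R, 0 < r &
    forall (t' : R) (x' : 'cV[R]_k), 0 <= t' <= T -> `|t' - t| < r -> enorm (x' - x) < r ->
      u t' x' < u t x + e.
Proof.
rewrite /strip_usc strip_lscP.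
by split=> h t x ht e e0; have [r r0 hr] := h t x ht e e0; exists r => // t' x' a b c;
  have := hr t' x' a b c; lra.
Qed.

Lemma strip_contmx m n (u : R -> 'cV[R]_k -> 'M[R]_(m, n)) : strip_continuous T u ->
  forall (t : R) (x : 'cV[R]_k), 0 <= t <= T -> forall e : R, 0 < e -> exists2 r : R, 0 < r &
    forall (t' : R) (x' : 'cV[R]_k), 0 <= t' <= T -> `|t' - t| < r -> enorm (x' - x) < r ->
      enorm (u t' x' - u t x) < e.
Proof.
move=> h t x ht e e0.
have mn0 : 0 < (m * n)%:R + 1 :> R by rewrite ltr_wpDl.
have e'0 : 0 < e / ((m * n)%:R + 1) by rewrite divr_gt0.
have := h (t, x) (ball (u t x) (e / ((m * n)%:R + 1))) (nbhsx_ballx _ _ e'0).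
rewrite nbhs_simpl /=.
rewrite -[X in X _ -> _]nbhs_subspace_in//= => /near_strip [r r0 hr].
exists r => // t' x' a b c.
apply: (@le_lt_trans _ _ ((m * n)%:R * (e / ((m * n)%:R + 1)))).
  apply: enorm_le_coord => i j; have := (hr _ _ a b c).2 i j; rewrite /ball /= distrC !mxE.
  exact: ltW.
by rewrite mulrA ltr_pdivrMr// mulrC ltr_pM2l//; lra.
Qed.

Lemma strip_contP (u : R -> 'cV[R]_k -> R) : strip_continuous T u <->
  forall (t : R) (x : 'cV[R]_k), 0 <= t <= T -> forall e : R, 0 < e -> exists2 r : R, 0 < r &
    forall (t' : R) (x' : 'cV[R]_k), 0 <= t' <= T -> `|t' - t| < r -> enorm (x' - x) < r ->
      `|u t' x' - u t x| < e.
Proof.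
split=> h.
  move=> t x ht e e0.
  have := h (t, x) (ball (u t x) e) (nbhsx_ballx _ _ e0).
  rewrite nbhs_simpl /=.
rewrite -[X in X _ -> _]nbhs_subspace_in//= => /near_strip [r r0 hr].
  by exists r => // t' x' a b c; have := hr _ _ a b c; rewrite /ball /= distrC.
move=> [t x] B; rewrite nbhs_simpl/= => /nbhs_ballP [e /= e0 hB].
have [ht|ht] := boolP (0 <= t <= T); last first.
  rewrite [X in X _](_ : _ = nbhs_subspace (t, x))//.
  rewrite -nbhs_subspace_out; last by move=> ht2; case/negP: ht.
  by move=> y ->; apply: hB; exact: ballxx.
have [r r0 hr] := h t x ht e e0.
rewrite [X in X _](_ : _ = nbhs_subspace (t, x))//.
rewrite -nbhs_subspace_in//=; apply/near_strip; exists r => // t' x' a b c.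
by apply: hB; rewrite /ball /= distrC; apply: hr.
Qed.

Lemma cont_enorm (u : 'cV[R]_k -> R) : continuous u ->
  forall x (e : R), 0 < e -> exists2 r : R, 0 < r & forall y, enorm (y - x) < r -> `|u y - u x| < e.
Proof.
move=> h x e e0.
have := h x (ball (u x) e) (nbhsx_ballx _ _ e0).
move=> /nbhs_enorm [r r0 hr]; exists r => // y hy.
by have := hr y hy; rewrite /ball /= distrC.
Qed.

End strip.

(** * Schemes and half-relaxed limits *)

Section halflimit.
Variables (R : realType) (T : R) (k d m : nat).
Hypothesis T_gt0 : 0 < T.

(** A smooth weight standing for polynomial growth; the integer exponent lets its Taylor expansion
    be obtained by induction. *)
Definition psi (P : nat) (x : 'cV[R]_k) : R := (1 + enorm x ^+ 2) ^+ P.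

Lemma mul_small (C e : R) : 0 <= C -> 0 < e -> C * (e / (C + 1)) <= e.
Proof.
move=> C0 e0; have C1 : 0 < C + 1 by lra.
by rewrite mulrA ler_pdivrMr//; nra.
Qed.

Lemma psi_ge1 P x : 1 <= psi P x.
Proof. by apply: exprn_ege1; rewrite lerDl sqr_ge0. Qed.

Lemma psi_gt0 P x : 0 < psi P x.
Proof. exact: lt_le_trans ltr01 (psi_ge1 P x). Qed.

(* Locked, for lra to treat it as an atom. *)
Definition nn (n : nat) : R := locked (n.+1%:R).

Lemma nnE n : nn n = n.+1%:R.
Proof. by rewrite /nn -lock. Qed.

Lemma nn_ge1 n : 1 <= nn n. Proof. by rewrite nnE ler1n. Qed.
Lemma nn_gt0 n : 0 < nn n. Proof. by rewrite nnE ltr0Sn. Qed.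

Lemma nn_large (K : R) : exists n0, forall n, (n0 <= n)%N -> K <= nn n.
Proof.
exists (Num.truncn K) => n h; apply: le_trans (ltW (truncnS_gt _)) _.
by rewrite nnE ler_nat ltnS.
Qed.

(* val_ n j i y xi approximates component i at the time T - j T / nsteps n and
   the point y, the coefficients being frozen at the grid point xi. *)
Record schemes := Schemes {
  nsteps : nat -> nat;
  grid : nat -> seq 'cV[R]_k;
  val_ : nat -> nat -> 'I_m -> 'cV[R]_k -> 'cV[R]_k -> R;
  gC : R;
  bC : R;
  bP : nat;
  nsteps_gt : forall n, (n < nsteps n)%N;
  grid_n0 : forall n, exists xi, xi \in grid n;
  gC_ge0 : 0 <= gC;
  grid_le : forall n xi, xi \in grid n -> enorm xi <= gC * nn n;
  val_bnd : forall n j i y xi, (j <= nsteps n)%N -> xi \in grid n ->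
    `|val_ n j i y xi| <= bC * psi bP y;
  val_cont : forall n j i xi, (j <= nsteps n)%N -> xi \in grid n ->
    forall x (e : R), 0 < e -> exists2 r : R, 0 < r &
      forall y, enorm (y - x) < r -> `|val_ n j i y xi - val_ n j i x xi| < e
}.

Variable A : schemes.

Definition tau n : R := T / (nsteps A n)%:R.
Definition time n j : R := T - j%:R * tau n.
(** At the minimum studied in [touch], everything but the coupling is bounded by a multiple of
    [nn n ^+ (2 * bP A + 3)], see [far_bound]. Since [lam n * beta n] has two powers more,
    [nn n * enorm (y - xi)] stays bounded there. *)
Definition lam n : R := nn n ^+ (2 * bP A + 8).
(** Small enough that [beta n] times the squared radius of the grid tends to 0: the penalty on
    [y - xi] then costs nothing in the limit, wherever the grid point [xi] lies. *)
Definition beta n : R := (nn n ^+ 3)^-1.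

Lemma nsteps_gt0 n : 0 < (nsteps A n)%:R :> R.
Proof. by rewrite ltr0n (leq_ltn_trans _ (nsteps_gt A n)). Qed.

Lemma tau_gt0 n : 0 < tau n.
Proof. by rewrite divr_gt0 ?nsteps_gt0. Qed.

Lemma tau_le n : tau n <= T / nn n.
Proof.
rewrite /tau ler_wpM2l ?(ltW T_gt0)// lef_pV2 ?posrE ?nn_gt0 ?nsteps_gt0//.
by rewrite nnE ler_nat nsteps_gt.
Qed.

Lemma time_in n j : (j <= nsteps A n)%N -> 0 <= time n j <= T.
Proof.
move=> h; rewrite /time lerBlDr lerDl mulr_ge0 ?ler0n ?(ltW (tau_gt0 n))// andbT.
by rewrite subr_ge0 mulrCA ger_pMr// ler_pdivrMr ?nsteps_gt0// mul1r ler_nat.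
Qed.

Lemma timeS n j : time n j = time n j.+1 + tau n.
Proof. by rewrite /time -natr1 mulrDl mul1r; ring. Qed.

Lemma time0 n : time n 0 = T. Proof. by rewrite /time mul0r subr0. Qed.

Lemma time_lt n j : time n j.+1 < T.
Proof. by rewrite /time gtrBl mulr_gt0 ?ltr0Sn ?tau_gt0. Qed.

Lemma time_ex n t : 0 <= t <= T -> exists2 j, (j <= nsteps A n)%N & `|time n j - t| <= tau n.
Proof.
move=> /andP[t0 tT].
pose j := Num.truncn ((T - t) / tau n).
have q0 : 0 <= (T - t) / tau n by rewrite divr_ge0 ?subr_ge0// ltW ?tau_gt0.
have /andP[h2 h3] := truncn_itv q0.
rewrite -/j in h2 h3.
have tp := tau_gt0 n.
move: h2 h3; rewrite ler_pdivlMr// ltr_pdivrMr// => h2 h3.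
exists j.
  rewrite -(ler_nat R) -(ler_pM2r tp); apply: le_trans h2 _.
  by rewrite /tau mulrCA divff ?gt_eqF ?nsteps_gt0// mulr1; lra.
rewrite /time ler_norml; apply/andP; split; first by lra.
by move: h3; rewrite -natr1 mulrDl; lra.
Qed.

(* The lower half-relaxed limit; the infimum is also over the frozen points xi,
   however far from x. *)
Definition lowset i t x : set R := [set a | exists2 r : R, 0 < r & exists n0,
  forall n j y xi, (n0 <= n)%N -> (j <= nsteps A n)%N -> xi \in grid A n ->
   `|time n j - t| < r -> enorm (y - x) < r -> a <= val_ A n j i y xi].

Definition lowlim (i : 'I_m) t x : R := sup (lowset i t x).

Lemma bC_ge0 : (0 < m)%N -> 0 <= bC A.
Proof.
move=> m0; have [xi hxi] := grid_n0 A 0.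
have := le_trans (normr_ge0 _) (@val_bnd A 0 0 (Ordinal m0) 0 xi isT hxi).
by rewrite pmulr_lge0 ?psi_gt0.
Qed.

Lemma psi_le P x y r : enorm (x - y) <= r -> 0 <= r ->
  psi P x <= (1 + (enorm y + r) ^+ 2) ^+ P.
Proof.
move=> h r0; apply: lerXn2r; rewrite ?nnegrE ?addr_ge0 ?sqr_ge0//.
rewrite lerD2l; apply: lerXn2r; rewrite ?nnegrE ?addr_ge0 ?enorm_ge0//.
by have := enorm_le_add x y; lra.
Qed.

Lemma lowset_n0 i t x : lowset i t x !=set0.
Proof.
have m0 : (0 < m)%N := leq_ltn_trans (leq0n i) (ltn_ord i).
exists (- (bC A * (1 + (enorm x + 1) ^+ 2) ^+ bP A)); exists 1 => //; exists 0%N.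
move=> n j y xi _ hj hxi _ hy.
have := @val_bnd A n j i y xi hj hxi; rewrite ler_norml => /andP[h _].
apply: le_trans h; rewrite lerN2 ler_wpM2l ?bC_ge0//.
by apply: psi_le => //; apply: ltW.
Qed.

Lemma lowset_ub i t x a (e : R) : 0 <= t <= T -> 0 < e -> lowset i t x a ->
  forall n0, exists n j y xi, [/\ (n0 <= n)%N, (j <= nsteps A n)%N & xi \in grid A n] /\
    [/\ `|time n j - t| < e, enorm (y - x) < e & a <= val_ A n j i y xi].
Proof.
move=> ht e0 [r r0 [n1 h]] n0.
have re : 0 < Num.min r e by rewrite lt_min r0.
have [n2 hn2] := nn_large (T / Num.min r e + 1).
pose n := maxn n0 (maxn n1 n2).
have [j hj hjt] := time_ex n ht; have [xi hxi] := grid_n0 A n.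
have hmin : `|time n j - t| < Num.min r e.
  apply: (le_lt_trans hjt); apply: (le_lt_trans (tau_le n)).
  rewrite ltr_pdivrMr ?nn_gt0// mulrC -ltr_pdivrMr//.
  have := hn2 n (leq_trans (leq_maxr _ _) (leq_maxr _ _)); lra.
exists n, j, x, xi; move: hmin; rewrite lt_min => /andP[h1 h2].
rewrite subrr enorm0; do 2 split => //; first exact: leq_maxl.
apply: h => //; first by rewrite (leq_trans (leq_maxl _ _) (leq_maxr _ _)).
by rewrite subrr enorm0.
Qed.

Lemma lowset_has_sup i t x : 0 <= t <= T -> has_sup (lowset i t x).
Proof.
move=> ht; split; first exact: lowset_n0.
have m0 : (0 < m)%N := leq_ltn_trans (leq0n i) (ltn_ord i).
exists (bC A * (1 + (enorm x + 1) ^+ 2) ^+ bP A) => a ha.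
have [n [j [y [xi [[_ hj hxi] [_ hy h]]]]]] := lowset_ub ht ltr01 ha 0.
have := @val_bnd A n j i y xi hj hxi; rewrite ler_norml => /andP[_ h2].
apply: (le_trans h); apply: (le_trans h2); rewrite ler_wpM2l ?bC_ge0//.
by apply: psi_le => //; apply: ltW.
Qed.

Lemma lowlim_near i t x (e : R) : 0 <= t <= T -> 0 < e ->
  lowset i t x (lowlim i t x - e).
Proof.
move=> ht e0; have [a [r r0 [n0 h]] ha] := sup_adherent e0 (lowset_has_sup i x ht).
by exists r => //; exists n0 => n j y xi h1 h2 h3 h4 h5; apply: le_trans (ltW ha) (h _ _ _ _ h1 h2 h3 h4 h5).
Qed.

Lemma lowlim_recover i t x (e : R) n0 : 0 <= t <= T -> 0 < e ->
  exists n j y xi, [/\ (n0 <= n)%N, (j <= nsteps A n)%N & xi \in grid A n] /\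
    [/\ `|time n j - t| < e, enorm (y - x) < e & val_ A n j i y xi < lowlim i t x + e].
Proof.
move=> ht e0; apply: contrapT => hn.
have : lowset i t x (lowlim i t x + e).
  exists e => //; exists n0 => n j y xi h1 h2 h3 h4 h5; rewrite leNgt; apply/negP => h6.
  by apply: hn; exists n, j, y, xi.
move/(ub_le_sup (lowset_has_sup i x ht).2); rewrite -/(lowlim i t x); lra.
Qed.

Lemma lowlim_lsc i : strip_lsc T (lowlim i).
Proof.
apply/strip_lscP => t x ht e e0.
have e20 : 0 < e / 2 by rewrite divr_gt0.
have [r r0 [n0 h]] := lowlim_near i x ht e20.
exists (r / 2); first by rewrite divr_gt0.
move=> t' x' ht' h1 h2; apply: (@lt_le_trans _ _ (lowlim i t x - e / 2)); first by lra.
apply: (ub_le_sup (lowset_has_sup i x' ht').2).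
exists (r / 2); first by rewrite divr_gt0.
exists n0 => n j y xi g1 g2 g3 g4 g5; apply: h => //.
  have := ler_distD t' (time n j) t; lra.
by have := enorm_tri y x' x; lra.
Qed.

Lemma psi_cont P x (e : R) : 0 < e -> exists2 r : R, 0 < r &
  forall y, enorm (y - x) < r -> psi P y < psi P x + e.
Proof.
move=> e0.
have h : (fun r : R => (1 + (enorm x + r) ^+ 2) ^+ P) r @[r --> 0] --> (1 + (enorm x + 0) ^+ 2) ^+ P.
  apply: (@continuous_cvg _ _ _ _ _ _ (fun r : R => r ^+ P)); first exact: exprn_continuous.
  apply: cvgD; first exact: cvg_cst.
  apply: (@continuous_cvg _ _ _ _ _ _ (fun r : R => r ^+ 2)); first exact: exprn_continuous.
  by apply: cvgD; [exact: cvg_cst|exact: cvg_id].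
have [r /= r0 hr] := (nbhs_ballP _ _).1 (cvg_ball h e0).
exists (r / 2); first by rewrite divr_gt0.
move=> y hy; have := hr (r / 2); rewrite /ball /= sub0r normrN ger0_norm; last by lra.
have r2 : r / 2 < r by lra.
move=> /(_ r2); rewrite addr0 -/(psi P x) => h2.
apply: (@le_lt_trans _ _ ((1 + (enorm x + r / 2) ^+ 2) ^+ P)).
  by apply: psi_le; lra.
by have := ler_norm ((1 + (enorm x + r / 2) ^+ 2) ^+ P - psi P x); rewrite distrC in h2; lra.
Qed.

Lemma lowlim_bnd i t x : 0 <= t <= T -> `|lowlim i t x| <= bC A * psi (bP A) x.
Proof.
move=> ht; have m0 : (0 < m)%N := leq_ltn_trans (leq0n i) (ltn_ord i).
have b0 := bC_ge0 m0.
have H (e : R) : 0 < e -> `|lowlim i t x| <= bC A * psi (bP A) x + e.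
  move=> e0; have bp : 0 < bC A + 1 by lra.
  have e'0 : 0 < e / 2 / (bC A + 1) by rewrite !divr_gt0.
  have [r r0 hr] := psi_cont (bP A) x e'0.
  have e20 : 0 < e / 2 by rewrite divr_gt0.
  have bnd y : enorm (y - x) < r -> bC A * psi (bP A) y <= bC A * psi (bP A) x + e / 2.
    move=> /hr /ltW h.
    apply: le_trans (ler_wpM2l b0 h) _; rewrite mulrDr lerD2l.
    exact: mul_small.
  have re : 0 < Num.min r (e / 2) by rewrite lt_min r0.
  have [n [j [y [xi [[_ hj hxi] [_ hy h]]]]]] := lowlim_recover i x 0 ht re.
  have [n' [j' [y' [xi' [[_ hj' hxi'] [_ hy' h']]]]]] := lowset_ub ht re (lowlim_near i x ht e20) 0.
  rewrite !lt_min in hy hy' h; case/andP: hy => hy _; case/andP: hy' => hy' _.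
  have [hm1 hm2] : Num.min r (e/2) <= e / 2 /\ True by split=> //; rewrite ge_min lexx orbT.
  have := val_bnd i y hj hxi; have := val_bnd i y' hj' hxi'; rewrite !ler_norml.
  have := bnd y hy; have := bnd y' hy'.
  move=> g1 g2 /andP[_ g3] /andP[g4 _]; apply/andP; split; lra.
suff G : forall e : R, 0 < e -> `|lowlim i t x| <= e + bC A * psi (bP A) x by apply/ler_addgt0Pl.
by move=> e /H; lra.
Qed.

End halflimit.

Lemma seq_argmin (R : realType) (I : eqType) (s : seq I) (f : I -> R) i0 :
  i0 \in s -> exists2 i, i \in s & forall j, j \in s -> f i <= f j.
Proof.
elim: s i0 => // a [|b s] IH i0 _.
  by exists a => [|j]; rewrite ?mem_head// inE => /eqP ->.
have [i hi h] := IH b (mem_head _ _).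
have [hai|hia] := leP (f a) (f i).
  exists a; first exact: mem_head.
  by move=> j; rewrite inE => /orP[/eqP -> //|/h]; apply: le_trans.
exists i; first by rewrite inE hi orbT.
by move=> j; rewrite inE => /orP[/eqP ->|/h //]; apply: ltW.
Qed.

(** * Test functions touching the lower limit *)

Section touch.
Variables (R : realType) (T : R) (k d m : nat).
Hypothesis T_gt0 : 0 < T.
Variable b : R -> 'cV[R]_k -> 'cV[R]_k.
Variable sigma : R -> 'cV[R]_k -> 'M[R]_(k, d).
Variable Cg : R.
Hypothesis Cg_ge0 : 0 <= Cg.
Hypothesis bs_growth : forall t x, 0 <= t <= T ->
  enorm (b t x) + enorm (sigma t x) <= Cg * (1 + enorm x).
Variable A : schemes R k m.
Local Notation time := (time T A).
Local Notation tau := (tau T A).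
Local Notation v_ := (lowlim T A).

Definition driver := nat -> 'I_m -> R -> 'cV[R]_k -> 'cV[R]_m -> 'cV[R]_d -> R.

(* The supersolution property of the scheme at (y0, xi0): if q is a subgradient
   there up to a quadratic error, then it is the gradient, with Hessian Y, and
   the equation holds up to 1/n.  The number a measures by how much the diagonal
   exceeds the value at xi0; its large factor lam keeps xi0 close to y0. *)
Definition lower_scheme (F : driver) : Prop :=
  forall n j i y0 xi0, (j < nsteps A n)%N -> xi0 \in grid A n -> enorm y0 <= nn R n ->
  forall q (B : R) (c : 'I_m -> R) (a : R), enorm q <= nn R n -> 0 <= B <= nn R n -> 0 <= a ->
  (forall y, enorm (y - y0) <= (nn R n)^-1 ->
     val_ A n j.+1 i y0 xi0 + dotv q (y - y0) - B * enorm (y - y0) ^+ 2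
       <= val_ A n j.+1 i y xi0) ->
  (forall y, y \in grid A n -> enorm (y - y0) <= (nn R n)^-1 ->
     val_ A n j.+1 i y0 xi0 + a - B * enorm (y - y0) <= val_ A n j.+1 i y y) ->
  (forall l, l != i -> forall y, enorm (y - y0) <= (nn R n)^-1 ->
     c l <= val_ A n j.+1 l y xi0) ->
  c i = val_ A n j.+1 i y0 xi0 ->
  exists Y C, [/\ Y^T = Y,
    forall e, enorm e <= 1 -> val_ A n j.+1 i (y0 + e) xi0 <=
      val_ A n j.+1 i y0 xi0 + dotv q e + 2^-1 * qf Y e + C * enorm e ^+ 3 &
    lam A n * a + F n i (time n j.+1) xi0 (\col_l c l) ((sigma (time n j.+1) xi0)^T *m q)
       - (nn R n)^-1 <=
    (val_ A n j.+1 i y0 xi0 - val_ A n j i y0 xi0) / tau n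
     - 2^-1 * (\sum_l qf Y (col l (sigma (time n j.+1) xi0))) - dotv (b (time n j.+1) xi0) q].

(** The displaced point [x'] makes room for terminal values that are averages of [h] over nodes near
    [x]. *)
Definition lower_terminal (h : 'I_m -> 'cV[R]_k -> R) : Prop :=
  forall n i x xi, enorm x <= nn R n -> xi \in grid A n ->
  exists2 x', enorm (x' - x) <= (nn R n)^-1 & h i x' <= val_ A n 0 i x xi.

Variable i : 'I_m.
Variables (that : R) (xhat : 'cV[R]_k) (r kap B : R).
Variables (phi pf : R -> 'cV[R]_k -> R) (qv : R -> 'cV[R]_k -> 'cV[R]_k).
Hypothesis that_in : 0 <= that <= T.
Hypothesis r_gt0 : 0 < r.
Hypothesis kap_gt0 : 0 < kap.
Hypothesis B_ge0 : 0 <= B.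

Definition boxQ s y := [/\ 0 <= s <= T, `|s - that| <= r & enorm (y - xhat) <= r].

(** Semiconvexity, with [pf] and [qv] a selection of subgradients. No second derivative of the test
    function is assumed: this is exactly what a sup-convolution offers. *)
Hypothesis phi_sc : forall s y, boxQ s y -> [/\ `|pf s y| <= B, enorm (qv s y) <= B &
  forall s' y', boxQ s' y' ->
    phi s y + pf s y * (s' - s) + dotv (qv s y) (y' - y)
      - B * ((s' - s) ^+ 2 + enorm (y' - y) ^+ 2) <= phi s' y'].
Hypothesis phi_min : forall s y, boxQ s y ->
  v_ i that xhat - phi that xhat + kap * ((s - that) ^+ 2 + enorm (y - xhat) ^+ 2)
    <= v_ i s y - phi s y.

Tactic Notation "lra_on" hyp_list(hs) :=
  revert hs; clear -T_gt0 Cg_ge0 bs_growth that_in r_gt0 kap_gt0 B_ge0 phi_sc phi_min; lra.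
Tactic Notation "nra_on" hyp_list(hs) :=
  revert hs; clear -T_gt0 Cg_ge0 bs_growth that_in r_gt0 kap_gt0 B_ge0 phi_sc phi_min; nra.

Lemma boxQ0 : boxQ that xhat.
Proof. by split=> //; rewrite subrr ?normr0 ?enorm0 ltW. Qed.

Definition phiK := B * (1 + 2 * r).

Lemma phiK_ge0 : 0 <= phiK.
Proof. by rewrite /phiK; apply: mulr_ge0 => //; have := r_gt0; lra. Qed.

Lemma phi_lip s y s' y' : boxQ s y -> boxQ s' y' ->
  phi s y - phi s' y' <= phiK * (`|s' - s| + enorm (y' - y)).
Proof.
move=> Q1 Q2; have [p1 q1 /(_ _ _ Q2)] := phi_sc Q1.
have [_ a1 b1] := Q1; have [_ a2 b2] := Q2.
have t1 : `|s' - s| <= 2 * r by have := ler_distD that s' s; rewrite (distrC that); lra.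
have t2 : enorm (y' - y) <= 2 * r by have := enorm_tri y' xhat y; rewrite (enormB xhat); lra.
have : `|pf s y * (s' - s)| <= B * `|s' - s| by rewrite normrM ler_wpM2r.
have : `|dotv (qv s y) (y' - y)| <= B * enorm (y' - y).
  by apply: le_trans (dotv_CS _ _) _; rewrite ler_wpM2r ?enorm_ge0.
rewrite !ler_norml => /andP[h1 _] /andP[h2 _].
rewrite -(real_normK (num_real (s' - s))).
have := normr_ge0 (s' - s); have := enorm_ge0 (y' - y).
move: (enorm (y' - y)) (`|s' - s|) t1 t2 h1 h2 => E S t1 t2 h1 h2 E0 S0 h3.
have : S ^+ 2 <= 2 * r * S by rewrite expr2; apply: ler_wpM2r.
have : E ^+ 2 <= 2 * r * E by rewrite expr2; apply: ler_wpM2r.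
rewrite /phiK => e1 e2; have : B * (S ^+ 2 + E ^+ 2) <= B * (2 * r * (S + E)) by apply: ler_wpM2l => //; lra.
by lra.
Qed.

Definition Jn n j y xi : R :=
  val_ A n j i y xi - phi (time n j) y + beta R n / 2 * enorm (y - xi) ^+ 2.

Lemma beta_gt0 n : 0 < beta R n.
Proof. by rewrite invr_gt0 exprn_gt0// nn_gt0. Qed.

Lemma beta_le1 n : beta R n <= (nn R n)^-1.
Proof.
rewrite /beta -exprVn -[leRHS]expr1; apply: ler_wiXn2l => //; first by rewrite invr_ge0 ltW ?nn_gt0.
by rewrite invf_le1 ?nn_gt0 ?nn_ge1.
Qed.

Lemma beta_nn n : beta R n * nn R n <= (nn R n)^-1.
Proof.
rewrite /beta exprSr invfM -mulrA mulVf ?gt_eqF ?nn_gt0// mulr1.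
rewrite lef_pV2 ?posrE ?exprn_gt0 ?nn_gt0// expr2.
by rewrite ler_peMr ?nn_ge1// ltW ?nn_gt0.
Qed.

Lemma Jn_min n j0 y0 xi0 : (j0 <= nsteps A n)%N -> xi0 \in grid A n ->
  boxQ (time n j0) y0 ->
  exists j y xi, [/\ (j <= nsteps A n)%N, xi \in grid A n, boxQ (time n j) y &
    forall j' y' xi', (j' <= nsteps A n)%N -> xi' \in grid A n -> boxQ (time n j') y' ->
    Jn n j y xi <= Jn n j' y' xi'].
Proof.
move=> hj0 hxi0 Q0.
pose ok (p : nat * 'cV[R]_k) := [&& (p.1 <= nsteps A n)%N, p.2 \in grid A n & `|time n p.1 - that| <= r].
have H (p : nat * 'cV[R]_k) : exists y, ok p -> boxQ (time n p.1) y /\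
   forall y', boxQ (time n p.1) y' -> Jn n p.1 y p.2 <= Jn n p.1 y' p.2.
  have [/and3P[h1 h2 h3]|nok] := boolP (ok p); last by exists 0.
  (* The time variable of [usc_max] is a dummy pinned at 0: here time ranges over finitely many
     levels, treated afterwards by [seq_argmin]. *)
  pose P (t : R) (x : 'cV[R]_k) := t = 0 /\ enorm (x - xhat) <= r.
  have [||||t [x [[_ hx] hmax]]] := @usc_max R k P (fun _ x => - Jn n p.1 x p.2) (enorm xhat + r) 0 xhat.
  - by split=> //; rewrite subrr enorm0 ltW.
  - move=> t x [-> hx]; rewrite normr0 addr_ge0 ?enorm_ge0 ?(ltW r_gt0)//; split=> //.
    by have := enorm_le_add x xhat; lra.
  - move=> t_ x_ t x hP ht hx; split.
      apply/eqP; rewrite -normr_eq0 eq_le normr_ge0 andbT.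
      by apply: (to0_ge ht); apply: filterE => l; have [-> _] := hP l; rewrite sub0r normrN.
    rewrite -subr_le0; apply: (to0_ge hx); apply: filterE => l; have [_ h] := hP l.
    by have := enorm_tri x (x_ l) xhat; rewrite (enormB x (x_ l)); lra.
  - move=> t x [_ hx] e e0.
    have e40 : 0 < e / 4 by lra.
    have [r1 r10 hr1] := val_cont i h1 h2 x e40.
    have K0 := phiK_ge0.
    have K10 : 0 < phiK + 1 by lra.
    have b0 := beta_gt0 n.
    pose L := beta R n / 2 * (2 * (enorm xhat + r) + 2 * enorm p.2).
    have L0 : 0 <= L.
      rewrite /L; have := enorm_ge0 xhat; have := enorm_ge0 p.2; have := r_gt0; move=> u v w.
      by apply: mulr_ge0; lra.
    have L10 : 0 < L + 1 by lra.
    exists (Num.min r1 (Num.min (e / 4 / (phiK + 1)) (e / 4 / (L + 1)))).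
      by rewrite !lt_min r10 !divr_gt0.
    move=> t' x' [_ hx'] _; rewrite !lt_min => /andP[g1 /andP[g2 g3]].
    have q1 := hr1 x' g1.
    have Q1 : boxQ (time n p.1) x by split=> //; exact: time_in.
    have Q2 : boxQ (time n p.1) x' by split=> //; exact: time_in.
    have q2 := phi_lip Q2 Q1; rewrite subrr normr0 add0r enormB in q2.
    have q3 : phiK * enorm (x' - x) <= e / 4.
      by apply: le_trans (mul_small K0 e40); apply: ler_wpM2l => //; apply: ltW.
    have q4 : L * enorm (x' - x) <= e / 4.
      by apply: le_trans (mul_small L0 e40); apply: ler_wpM2l => //; apply: ltW.
    have q5 : enorm (x - p.2) ^+ 2 - enorm (x' - p.2) ^+ 2 <= (2 * (enorm xhat + r) + 2 * enorm p.2) * enorm (x' - x).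
      have := enorm_tri x x' p.2; rewrite (enormB x x').
      have : enorm (x - p.2) <= enorm xhat + r + enorm p.2.
        have := enorm_tri x 0 p.2; rewrite sub0r subr0 enormN => u1.
        by have := enorm_le_add x xhat; lra_on u1 hx.
      have : enorm (x' - p.2) <= enorm xhat + r + enorm p.2.
        have := enorm_tri x' 0 p.2; rewrite sub0r subr0 enormN => u1.
        by have := enorm_le_add x' xhat; lra_on u1 hx'.
      have := enorm_ge0 (x - p.2); have := enorm_ge0 (x' - p.2); have := enorm_ge0 (x' - x).
      move: (enorm (x - p.2)) (enorm (x' - p.2)) (enorm (x' - x)) (enorm xhat) (enorm p.2) => u v w e1 e2 w0 v0 u0 hv hu tr.
      have [uv|uv] := leP u v; first by nra_on uv u0 v0 w0 hv hu.
      rewrite subr_sqr; nra_on uv u0 v0 w0 hv hu tr.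
    have : beta R n / 2 * (enorm (x - p.2) ^+ 2 - enorm (x' - p.2) ^+ 2) <= L * enorm (x' - x).
      by rewrite /L -(mulrA (beta R n / 2)); apply: ler_wpM2l => //; lra_on b0.
    move: q1; rewrite /Jn ltr_norml => /andP[q1 _]; lra_on q1 q2 q3 q4 e0.
  exists x => _; split; first by split=> //; exact: time_in.
  move=> y' [_ _ hy']; have := hmax 0 y' (conj erefl hy'); lra.
have [Y hY] := choice H.
pose s := [seq p <- [seq (j, xi) | j <- iota 0 (nsteps A n).+1, xi <- grid A n] | ok p].
have hs p : (p \in s) = ok p.
  rewrite mem_filter; apply/andP/idP => [[] //|hp]; split=> //.
  case/and3P: hp => h1 h2 h3; rewrite [p]surjective_pairing.
  by apply: allpairs_f => //; rewrite mem_iota add0n ltnS.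
have ok0 : (j0, xi0) \in s by rewrite hs /ok /= hj0 hxi0; case: Q0 => _ ->.
have [[j xi] hp hmin] := seq_argmin (fun p => Jn n p.1 (Y p) p.2) ok0.
rewrite hs in hp; have [h1 h2] := hY _ hp.
case/and3P: (hp) => /= g1 g2 g3.
exists j, (Y (j, xi)), xi; split => // j' y' xi' h3 h4 h5.
have hp' : ok (j', xi') by rewrite /ok /= h3 h4; case: h5 => _ ->.
have := hmin (j', xi'); rewrite hs => /(_ hp') /= h6.
by apply: le_trans h6 _; apply: (hY _ hp').2.
Qed.

(** Comparing minimizers of [Jn] with recovery points of the lower limit bounds their values from
    above, up to [er]; at any limit along [UU] the definition of the lower limit bounds them from
    below. The two bounds together with the strict minimum [phi_min] leave only the contact point as
    a limit. *)
Lemma touch_seq (e0 : R) n0 : 0 < e0 ->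
  exists n j y xi, [/\ (n0 <= n)%N, (j <= nsteps A n)%N, xi \in grid A n &
    boxQ (time n j) y] /\
   [/\ `|time n j - that| < e0, enorm (y - xhat) < e0,
    `|val_ A n j i y xi - v_ i that xhat| < e0 &
    forall j' y' xi', (j' <= nsteps A n)%N -> xi' \in grid A n -> boxQ (time n j') y' ->
    Jn n j y xi <= Jn n j' y' xi'].
Proof.
move=> e00.
pose el (l : nat) : R := Num.min r l.+1%:R^-1.
have el0 l : 0 < el l by rewrite lt_min r_gt0 invr_gt0 ltr0Sn.
have H (l : nat) : exists w : nat * nat * ('cV[R]_k * 'cV[R]_k) * (nat * ('cV[R]_k * 'cV[R]_k)),
  let: (n, j', (y', xi'), (j, (y, xi))) := w in
  [/\ [/\ (maxn n0 l <= n)%N, (j' <= nsteps A n)%N & xi' \in grid A n],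
   [/\ `|time n j' - that| < el l, enorm (y' - xhat) < el l & val_ A n j' i y' xi' < v_ i that xhat + el l],
   [/\ (j <= nsteps A n)%N, xi \in grid A n & boxQ (time n j) y] &
   forall j' y' xi', (j' <= nsteps A n)%N -> xi' \in grid A n -> boxQ (time n j') y' ->
    Jn n j y xi <= Jn n j' y' xi'].
  have [n [j' [y' [xi' [[h1 h2 h3] [h4 h5 h6]]]]]] := lowlim_recover T_gt0 A i xhat (maxn n0 l) that_in (el0 l).
  have Q : boxQ (time n j') y'.
    split; first exact: time_in.
      by apply: ltW; apply: lt_le_trans h4 _; rewrite ge_min lexx.
    by apply: ltW; apply: lt_le_trans h5 _; rewrite ge_min lexx.
  have [j [y [xi [g1 g2 g3 g4]]]] := Jn_min h2 h3 Q.
  by exists (n, j', (y', xi'), (j, (y, xi))).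
have [w hw] := choice H.
pose s_ l := time (w l).1.1.1 (w l).2.1.
pose y_ l := (w l).2.2.1.
pose V_ l := val_ A (w l).1.1.1 (w l).2.1 i (y_ l) (w l).2.2.2.
have hQ l : boxQ (s_ l) (y_ l).
  by move: (hw l); rewrite /s_ /y_; case: (w l) => [[[n j'] [y' xi']] [j [y xi]]] /= [_ _ []].
have [sb hsb] : exists sb, to0 (fun l => `|s_ l - sb|).
  apply: (@ulim_real _ _ T) => l; have [/andP[a0 a1] _ _] := hQ l.
  by rewrite ger0_norm.
have [yb hyb] : exists yb, to0 (fun l => enorm (y_ l - yb)).
  apply: (@ulim_mx _ _ _ _ (enorm xhat + r)) => l; have [_ _ a0] := hQ l.
  by have := enorm_le_add (y_ l) xhat; lra.
have Qb : boxQ sb yb.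
  have bs l : 0 <= s_ l <= T by have [] := hQ l.
  split.
  - apply/andP; split; rewrite -subr_le0; apply: (to0_ge hsb); apply: filterE => l; have /andP[b1 b2] := bs l.
      by have := ler_norm (s_ l - sb); lra.
    by have := ler_norm (sb - s_ l); rewrite distrC; lra.
  - rewrite -subr_le0; apply: (to0_ge hsb); apply: filterE => l; have [_ b1 _] := hQ l.
    by have := ler_distD (s_ l) sb that; rewrite (distrC sb (s_ l)); lra.
  - rewrite -subr_le0; apply: (to0_ge hyb); apply: filterE => l; have [_ _ b1] := hQ l.
    by have := enorm_tri yb (y_ l) xhat; rewrite (enormB yb (y_ l)); lra.
pose er l := phiK * (`|s_ l - sb| + enorm (y_ l - yb)) +
   (2 * phiK + 1 + (enorm xhat + 1 + gC A) ^+ 2) * l.+1%:R^-1.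
have K0 := phiK_ge0.
have her : to0 er.
  apply: to0D; first by apply: to0Z => //; apply: to0D.
  apply: to0Z; last exact: to0_inv.
  by rewrite addr_ge0 ?sqr_ge0//; lra.
have key l : V_ l <= v_ i that xhat - phi that xhat + phi sb yb + er l.
  move: (hw l) (hQ l); rewrite /V_ /er /s_ /y_; case: (w l) => [[[n j'] [y' xi']] [j [y xi]]] /=.
  move=> [[h1 h2 h3] [h4 h5 h6] [h7 h8 h9] /(_ j' y' xi' h2 h3) h10] _.
  have ele : el l <= l.+1%:R^-1 by rewrite ge_min lexx orbT.
  have elr : el l <= r by rewrite ge_min lexx.
  have Q' : boxQ (time n j') y' by split; [exact: time_in|lra_on h4 elr|lra_on h5 elr].
  have := h10 Q'; rewrite /Jn.
  have := phi_lip h9 Qb; have := phi_lip boxQ0 Q'.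
  rewrite (distrC sb) (enormB yb) => p1 p2.
  have p3 : phiK * (`|time n j' - that| + enorm (y' - xhat)) <= phiK * (2 * l.+1%:R^-1).
    apply: ler_wpM2l => //; apply: le_trans (lerD (ltW h4) (ltW h5)) _.
    by rewrite mulr_natl mulr2n lerD.
  have : beta R n / 2 * enorm (y' - xi') ^+ 2 <= (enorm xhat + 1 + gC A) ^+ 2 * l.+1%:R^-1.
    have d1 : enorm (y' - xi') <= (enorm xhat + 1 + gC A) * nn R n.
      have := enorm_tri y' 0 xi'; rewrite subr0 sub0r enormN.
      have := grid_le h3; have := enorm_le_add y' xhat.
      have : l.+1%:R^-1 <= 1 :> R by rewrite invf_le1 ?ltr0Sn// ler1n.
      move/(le_trans ele) => /(lt_le_trans h5) g1 g2 g3 g4.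
      have g5 : (enorm xhat + 1) * 1 <= (enorm xhat + 1) * nn R n.
        by apply: ler_wpM2l; [rewrite addr_ge0 ?enorm_ge0|exact: nn_ge1].
      rewrite mulrDl; lra_on g1 g2 g3 g4 g5.
    have n1 := nn_gt0 R n.
    have d2 : enorm (y' - xi') ^+ 2 <= ((enorm xhat + 1 + gC A) * nn R n) ^+ 2.
      apply: lerXn2r => //; rewrite ?nnegrE ?enorm_ge0//; exact: le_trans (enorm_ge0 _) d1.
    apply: (@le_trans _ _ (beta R n * ((enorm xhat + 1 + gC A) * nn R n) ^+ 2)).
      have := beta_gt0 n; have := sqr_ge0 (enorm (y' - xi')); nra_on d2.
    rewrite exprMn mulrCA; apply: ler_wpM2l; first exact: sqr_ge0.
    rewrite /beta exprS invfM -mulrA mulVf ?mulr1 ?expf_neq0 ?gt_eqF//.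
    rewrite lef_pV2 ?posrE// ?ltr0Sn// nnE ler_nat ltnS.
    exact: leq_trans (leq_maxr _ _) h1.
  have : 0 <= beta R n / 2 * enorm (y - xi) ^+ 2.
    by rewrite mulr_ge0 ?sqr_ge0// divr_ge0// ltW ?beta_gt0.
  move: (l.+1%:R^-1) (el l) ele p3 h6 => I E ele p3 h6 q1 q2 q3.
  rewrite mulrDl mulrDl mul1r; move: q1 q2 q3.
  move: ((enorm xhat + 1 + gC A) ^+ 2 * I) => X.
  move: (beta R n / 2 * _) (beta R n / 2 * _) => X1 X2.
  have -> : 2 * phiK * I = phiK * (2 * I) by ring.
  lra_on ele p1 p2 p3 h6.
have Vlow (e : R) : 0 < e -> \forall l \near UU, v_ i sb yb - e <= V_ l.
  move=> ep; have [rr rr0 [n1 hn1]] := lowlim_near T_gt0 A i yb (let: And3 a _ _ := Qb in a) ep.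
  near=> l.
  have a1 : `|s_ l - sb| < rr by near: l; exact: hsb.
  have a2 : enorm (y_ l - yb) < rr by near: l; exact: hyb.
  have a3 : (n1 <= l)%N by near: l; exact: UU_ge.
  move: (hw l) a1 a2; rewrite /V_ /s_ /y_; case: (w l) => [[[n j'] [y' xi']] [j [y xi]]] /=.
  move=> [[h1 _ _] _ [h7 h8 _] _] a1 a2; apply: hn1 => //.
  by apply: leq_trans a3 (leq_trans (leq_maxr _ _) h1).
have zb : sb = that /\ yb = xhat.
  have hm := phi_min Qb.
  have h0 : kap * ((sb - that) ^+ 2 + enorm (yb - xhat) ^+ 2) <= 0.
    suff G : forall e : R, 0 < e -> kap * ((sb - that) ^+ 2 + enorm (yb - xhat) ^+ 2) <= e + 0 by apply/ler_addgt0Pl.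
    move=> e ep; have e20 : 0 < e / 2 by lra.
    have [l [a1 a2]] := UU_ex (filterI (Vlow _ e20) (her _ e20)).
    have := key l; lra.
  have h1 : (sb - that) ^+ 2 + enorm (yb - xhat) ^+ 2 <= 0 by rewrite pmulr_rle0 in h0.
  have h2 := sqr_ge0 (sb - that); have h3 := sqr_ge0 (enorm (yb - xhat)).
  have /eqP : (sb - that) ^+ 2 = 0 by lra.
  rewrite sqrf_eq0 subr_eq0 => /eqP ->.
  have /eqP : enorm (yb - xhat) ^+ 2 = 0 by lra.
  rewrite sqrf_eq0 => /eqP/enorm_eq0/eqP; rewrite subr_eq0 => /eqP ->.
  by [].
case: zb => ? ?; subst sb yb.
have e02 : 0 < e0 / 2 by rewrite divr_gt0.
have [l [a1 [a2 [a3 a4]]]] := UU_ex (filterI (Vlow _ e02) (filterI (her _ e00) (filterI (hsb _ e00) (hyb _ e00)))).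
have := key l.
move: (hw l) a1 a2 a3 a4; rewrite /V_ /s_ /y_; case: (w l) => [[[n j'] [y' xi']] [j [y xi]]] /=.
move=> [[h1 _ _] _ [h7 h8 h9] h10] a1 a2 a3 a4 a5.
exists n, j, y, xi; do 2 split=> //; first exact: leq_trans (leq_maxl _ _) h1.
rewrite ltr_norml; apply/andP; split; lra_on a1 a2 a3 a4 a5.
Unshelve. all: by end_near. Qed.

Lemma enorm_sqrD p (u v : 'cV[R]_p) :
  enorm (u + v) ^+ 2 = enorm u ^+ 2 + 2 * dotv u v + enorm v ^+ 2.
Proof. by rewrite -!dotvv !dotvE_ (dotvC v u); ring. Qed.

(** Insert [t *: e], divide by [t ^+ 2] and let [t] tend to 0: the cubic term disappears and
    homogeneity removes the restriction on [e]. *)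
Lemma qf_lower (Y : 'M[R]_k) (K C rr : R) : 0 < rr ->
  (forall e, enorm e <= rr -> - K * enorm e ^+ 2 <= 2^-1 * qf Y e + C * enorm e ^+ 3) ->
  forall e, - (2 * K) * enorm e ^+ 2 <= qf Y e.
Proof.
move=> rr0 h e.
suff G : forall ep : R, 0 < ep -> - (2 * K) * enorm e ^+ 2 <= ep + qf Y e by apply/ler_addgt0Pl.
move=> ep ep0.
have en0 := enorm_ge0 e.
pose t := Num.min (rr / (enorm e + 1)) (ep / (2 * `|C| * enorm e ^+ 3 + 1)).
have c0 : 0 <= 2 * `|C| * enorm e ^+ 3 by rewrite !mulr_ge0// exprn_ge0.
have t0 : 0 < t by rewrite lt_min !divr_gt0//; lra.
have t1 : t * enorm e <= rr.
  apply: (@le_trans _ _ (rr / (enorm e + 1) * enorm e)).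
    by apply: ler_wpM2r => //; rewrite ge_min lexx.
  by rewrite mulrC; apply: mul_small.
have t2 : t * (2 * `|C| * enorm e ^+ 3) <= ep.
  apply: (@le_trans _ _ (ep / (2 * `|C| * enorm e ^+ 3 + 1) * (2 * `|C| * enorm e ^+ 3))).
    by apply: ler_wpM2r => //; rewrite ge_min lexx orbT.
  by rewrite mulrC; apply: mul_small.
have := h (t *: e); rewrite enormZ (gtr0_norm t0) => /(_ t1).
rewrite qfZr !exprMn => h1.
have h2 : 0 <= t ^+ 2 * (2 * K * enorm e ^+ 2 + qf Y e + t * (2 * C * enorm e ^+ 3)).
  by move: h1; move: (enorm e) (qf Y e) => E Q h1; rewrite exprS in h1; lra.
rewrite pmulr_rge0 ?exprn_gt0// in h2.
have h3 : t * (2 * C * enorm e ^+ 3) <= t * (2 * `|C| * enorm e ^+ 3).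
  apply: ler_wpM2l; first exact: ltW.
  by rewrite ler_wpM2r ?exprn_ge0// ler_wpM2l ?ler_norm.
lra.
Qed.

(** Three comparisons at a minimum of [Jn]. Moving [y] alone makes [q] a subgradient of the scheme
    up to the quadratic error [2 * B + 1]; moving to a diagonal pair [(y', y')] shows that the
    diagonal is higher by the penalty [beta / 2 * |y - xi|^2]; moving to the previous level [j]
    bounds the difference quotient in time through the semiconvexity of [phi]. *)
Lemma touch_step F n j y xi c : lower_scheme F -> (j < nsteps A n)%N ->
  xi \in grid A n -> boxQ (time n j.+1) y -> boxQ (time n j) y ->
  enorm (y - xhat) + (nn R n)^-1 <= r -> enorm y <= nn R n ->
  enorm (qv (time n j.+1) y - beta R n *: (y - xi)) <= nn R n ->
  2 * B + 1 <= nn R n ->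
  (forall j' y' xi', (j' <= nsteps A n)%N -> xi' \in grid A n -> boxQ (time n j') y' ->
    Jn n j.+1 y xi <= Jn n j' y' xi') ->
  (forall l, l != i -> forall y', enorm (y' - y) <= (nn R n)^-1 ->
     c l <= val_ A n j.+1 l y' xi) ->
  c i = val_ A n j.+1 i y xi ->
  let s := time n j.+1 in let q := qv s y - beta R n *: (y - xi) in
  exists Y C, [/\ Y^T = Y,
   forall e, enorm e <= (nn R n)^-1 -> phi s (y + e) <= phi s y + dotv (qv s y) e +
      2^-1 * qf (Y + beta R n *: 1%:M) e + C * enorm e ^+ 3,
   forall e, - (2 * (2 * B + 1)) * enorm e ^+ 2 <= qf Y e &
   lam A n * (beta R n / 2 * enorm (y - xi) ^+ 2) +
     F n i s xi (\col_l c l) ((sigma s xi)^T *m q) - (nn R n)^-1 <=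
   - pf s y + B * tau n - 2^-1 * (\sum_l qf Y (col l (sigma s xi))) - dotv (b s xi) q].
Proof.
move=> sF hj hxi Q1 Q0 hint hy hq hB hmin hc ci s q.
have n0 := nn_gt0 R n; have n1 := nn_ge1 R n.
have ni0 : 0 < (nn R n)^-1 by rewrite invr_gt0.
have ni1 : (nn R n)^-1 <= 1 by rewrite invf_le1.
have b0 := beta_gt0 n; have b1 : beta R n <= 1 := le_trans (beta_le1 n) ni1.
have Qy y' : enorm (y' - y) <= (nn R n)^-1 -> boxQ s y'.
  by case: Q1 => g1 g2 g3 h; split=> //; have := enorm_tri y' y xhat; lra.
have [hp hq0 hsc] := phi_sc Q1.
have sq y' : enorm (y' - xi) ^+ 2 = enorm (y - xi) ^+ 2 + 2 * dotv (y - xi) (y' - y) + enorm (y' - y) ^+ 2.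
  by rewrite -enorm_sqrD; congr (enorm _ ^+ 2); rewrite [RHS]addrC addrA subrK.
have dq e : dotv q e = dotv (qv s y) e - beta R n * dotv (y - xi) e.
  by rewrite /q !dotvE_.
have low1 y' : enorm (y' - y) <= (nn R n)^-1 ->
     val_ A n j.+1 i y xi + dotv q (y' - y) - (2 * B + 1) * enorm (y' - y) ^+ 2
       <= val_ A n j.+1 i y' xi.
  move=> h; have := hmin j.+1 y' xi hj hxi (Qy _ h).
  have := hsc s y' (Qy _ h); rewrite subrr mulr0 expr0n /= addr0 add0r.
  rewrite /Jn -/s (sq y') dq.
  have := sqr_ge0 (enorm (y' - y)).
  move: (enorm (y' - y) ^+ 2) (dotv (y - xi) (y' - y)) => E D E0 h1 h2.
  have h3 : beta R n / 2 * E <= (1 + B) * E by apply: ler_wpM2r => //; have := B_ge0; lra.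
  lra.
have [||y' hy' h|Y [C [Ys hY hI]]] := sF n j i y xi hj hxi hy q (2 * B + 1) c (beta R n / 2 * enorm (y - xi) ^+ 2) hq _ _ low1 _ hc ci.
- by rewrite hB andbT; have := B_ge0; lra.
- by rewrite mulr_ge0 ?sqr_ge0//; lra.
- have := hmin j.+1 y' y' hj hy' (Qy _ h).
  rewrite /Jn -/s subrr enorm0 expr0n /= mulr0 addr0.
  have := hsc s y' (Qy _ h); rewrite subrr mulr0 expr0n /= addr0 add0r.
  have : `|dotv (qv s y) (y' - y)| <= B * enorm (y' - y).
    by apply: le_trans (dotv_CS _ _) _; rewrite ler_wpM2r ?enorm_ge0.
  rewrite ler_norml => /andP[h1 _].
  have E0 := enorm_ge0 (y' - y).
  have h2 : B * enorm (y' - y) ^+ 2 <= B * enorm (y' - y).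
    by apply: ler_wpM2l => //; rewrite expr2; apply: ler_piMl => //; lra.
  lra.
exists Y, C; split=> //.
- move=> e he; have he1 : enorm e <= 1 by lra.
  have h1 := hY e he1.
  have yee : y + e - y = e by rewrite addrAC subrr add0r.
  have h2 : enorm (y + e - y) <= (nn R n)^-1 by rewrite yee.
  have := hmin j.+1 (y + e) xi hj hxi (Qy _ h2).
  rewrite /Jn -/s (sq (y + e)) yee qfD qfZ qf1; rewrite dq in h1; lra_on h1.
- apply: (@qf_lower _ _ C _ ni0) => e he.
  have he1 : enorm e <= 1 by lra.
  have yee : y + e - y = e by rewrite addrAC subrr add0r.
  have := low1 (y + e); rewrite yee => /(_ he); have := hY e he1; lra_on he1.
apply: (le_trans hI).
have tp := tau_gt0 T_gt0 A n.
rewrite !lerD2r ler_pdivrMr//.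
have := hmin j y xi (ltnW hj) hxi Q0.
have := hsc _ _ Q0; rewrite subrr dotv0r enorm0 expr0n /= addr0.
rewrite /Jn -/s (timeS T A n j) -/s.
have -> : s + tau n - s = tau n by ring.
lra.
Qed.

Lemma fin_lb (I : finType) (f : I -> R) : (forall j, 0 < f j) ->
  exists2 e : R, 0 < e & forall j, e <= f j.
Proof.
move=> f0; suff H (s : seq I) : exists2 e : R, 0 < e & forall j, j \in s -> e <= f j.
  by have [e e0 he] := H (enum I); exists e => // j; apply: he; rewrite mem_enum.
elim: s => [|j s [e e0 he]]; first by exists 1.
exists (Num.min e (f j)); first by rewrite lt_min e0 f0.
move=> l; rewrite inE ge_min => /orP[/eqP ->|/he ->//]; by rewrite lexx orbT.
Qed.

Lemma nn_large_all (Ks : seq R) : exists n0, forall n, (n0 <= n)%N ->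
  all (fun K => K <= nn R n) Ks.
Proof.
elim: Ks => [|K Ks [n0 h]]; first by exists 0%N.
have [n1 h1] := nn_large K; exists (maxn n0 n1) => n /=.
by rewrite geq_max => /andP[/h -> /h1 ->].
Qed.

Lemma nn_div n (K e : R) : 0 < e -> K / e <= nn R n -> K * (nn R n)^-1 <= e.
Proof.
move=> e0; rewrite ler_pdivrMr// => h.
by rewrite ler_pdivrMr ?nn_gt0// mulrC.
Qed.

Lemma psi_pow P (x : 'cV[R]_k) : psi P x <= (1 + enorm x) ^+ (2 * P).
Proof.
rewrite /psi exprM; apply: lerXn2r; rewrite ?nnegrE ?sqr_ge0//.
  by rewrite addr_ge0 ?sqr_ge0.
by have := enorm_ge0 x; nra.
Qed.

(** Keeps the minimizers of [Jn] off level 0, where no scheme inequality is available: either that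
    level is far in time, or its values lie near [h], hence away from the strictly smaller lower
    limit. *)
Lemma terminal_sep h : lower_terminal h ->
  (forall e : R, 0 < e -> exists2 e1 : R, 0 < e1 &
     forall y, enorm (y - xhat) < e1 -> `|h i y - h i xhat| < e) ->
  (that < T \/ v_ i that xhat < h i xhat) ->
  exists2 e3 : R, 0 < e3 & exists K, forall n y xi, K <= nn R n ->
    enorm y <= nn R n -> xi \in grid A n ->
    `|T - that| < e3 -> enorm (y - xhat) < e3 ->
    `|val_ A n 0 i y xi - v_ i that xhat| < e3 -> False.
Proof.
move=> tmn hc [tT|hlt].
  exists (T - that); first by rewrite subr_gt0.
  by exists 0 => n y xi _ _ _; rewrite ger0_norm ?ltxx// subr_ge0 ltW.
pose dl := (h i xhat - v_ i that xhat) / 2.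
have d0 : 0 < dl by rewrite /dl; lra.
have [rh rh0 hrh] := hc _ d0.
have r2 : 0 < rh / 2 by rewrite divr_gt0.
exists (Num.min dl (rh / 2)); first by rewrite lt_min d0.
exists (1 / (rh / 2)) => n y xi hn hy hxi _; rewrite !lt_min => /andP[_ h1] /andP[h2 _].
have [x' hx' hle] := tmn n i y xi hy hxi.
have := nn_div r2 hn; rewrite mul1r => h3.
have : `|h i x' - h i xhat| < dl.
  by apply: hrh; have := enorm_tri x' y xhat; lra.
move: h2; rewrite !ltr_norml => /andP[_ h4] /andP[h5 _]; rewrite /dl in h4 h5 *; lra.
Qed.

(** To be read with [N = nn n], [X = 1 + |xi|], [S = |sigma|] and [Q = |q|], the coefficients being
    taken at [xi]. As long as [xi] is not known to be close to [y], it can be as far away as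
    [gC A * N], and the other terms of the scheme inequality can have this size. *)
Lemma far_bound (P : nat) (C5 Cc : R) : 0 <= C5 -> 0 <= Cc -> exists2 C7 : R, 0 <= C7 &
  forall (N : R) (X S Q p t s2 bq : R), 1 <= N ->
    0 <= X -> X <= (1 + gC A) * N -> 0 <= S -> S <= Cg * X -> 0 <= Q -> Q <= B + 1 ->
    p <= B -> t <= T -> 0 <= t -> s2 <= (2 * B + 1) * S ^+ 2 -> bq <= Cg * X * Q ->
    p + B * t + s2 + bq + 1 + C5 * N * (1 + Cc + X ^+ (2 * P) + S * Q) <= C7 * N ^+ (2 * P + 3).
Proof.
move=> C50 Cc0; have B0 := B_ge0; have D0 := gC_ge0 A; have G0 := Cg_ge0; have T0 := ltW T_gt0.
pose D := 1 + gC A; have D1 : 0 <= D by rewrite /D; lra.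
exists (B + B * T + (2 * B + 1) * (Cg * D) ^+ 2 + Cg * D * (B + 1) + 1 +
  C5 * (1 + Cc + D ^+ (2 * P) + Cg * D * (B + 1))).
  have z1 : 0 <= Cg * D * (B + 1) by rewrite !mulr_ge0//; lra.
  have z2 : 0 <= D ^+ (2 * P) by exact: exprn_ge0.
  have z3 : 0 <= (2 * B + 1) * (Cg * D) ^+ 2 by rewrite mulr_ge0 ?sqr_ge0//; lra.
  have z4 : 0 <= C5 * (1 + Cc + D ^+ (2 * P) + Cg * D * (B + 1)) by apply: mulr_ge0 => //; lra.
  have z5 := mulr_ge0 B0 T0; lra.
move=> N X S Q p t s2 bq N1 X0 XN S0 SX Q0 QB pB tT t0 hs hb; rewrite -/D in XN.
have N0 : 0 <= N by lra.
have E1 (l : nat) : 1 <= N ^+ l by exact: exprn_ege1.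
have e1 : N <= N ^+ (2 * P + 2) by rewrite -[leLHS]expr1; apply: ler_weXn2l => //; rewrite addn2.
have e2 : N ^+ 2 <= N ^+ (2 * P + 3) by apply: ler_weXn2l => //; rewrite addn3.
have e3 : N ^+ (2 * P) <= N ^+ (2 * P + 2) by apply: ler_weXn2l => //; rewrite leq_addr.
have e4 : N * N ^+ (2 * P + 2) = N ^+ (2 * P + 3) by rewrite -exprS -addnS.
have e5 : N <= N ^+ (2 * P + 3) by rewrite -[leLHS]expr1; apply: ler_weXn2l => //; rewrite addn3.
have SN : S <= Cg * D * N by apply: le_trans SX _; rewrite -mulrA; apply: ler_wpM2l.
have h1 : p <= B * N ^+ (2 * P + 3).
  by apply: le_trans pB _; apply: ler_peMr.
have h2 : B * t <= B * T * N ^+ (2 * P + 3).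
  by apply: (@le_trans _ _ (B * T)); [apply: ler_wpM2l|apply: ler_peMr => //; apply: mulr_ge0].
have h3 : s2 <= (2 * B + 1) * (Cg * D) ^+ 2 * N ^+ (2 * P + 3).
  apply: le_trans hs _; rewrite -mulrA; apply: ler_wpM2l; first by lra.
  apply: (@le_trans _ _ ((Cg * D * N) ^+ 2)).
    by apply: lerXn2r => //; rewrite nnegrE ?mulr_ge0.
  by rewrite exprMn; apply: ler_wpM2l => //; exact: sqr_ge0.
have h45 (Z : R) : N <= Z -> Cg * X * Q <= Cg * D * (B + 1) * Z.
  move=> hZ; apply: (@le_trans _ _ (Cg * (D * N) * (B + 1))).
    by apply: ler_pM => //; [exact: mulr_ge0|apply: ler_wpM2l].
  rewrite [leLHS](_ : _ = Cg * D * (B + 1) * N); last by ring.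
  by apply: ler_wpM2l => //; rewrite !mulr_ge0//; lra.
have h4 := le_trans hb (h45 _ e5).
have h5 : S * Q <= Cg * D * (B + 1) * N ^+ (2 * P + 2).
  apply: le_trans (h45 _ e1); apply: ler_wpM2r => //.
have h6 : X ^+ (2 * P) <= D ^+ (2 * P) * N ^+ (2 * P + 2).
  apply: (@le_trans _ _ ((D * N) ^+ (2 * P))).
    by apply: lerXn2r => //; rewrite nnegrE ?mulr_ge0.
  by rewrite exprMn; apply: ler_wpM2l => //; exact: exprn_ge0.
have h7 : 1 + Cc <= (1 + Cc) * N ^+ (2 * P + 2) by apply: ler_peMr => //; lra_on Cc0.
have h8 : C5 * N * (1 + Cc + X ^+ (2 * P) + S * Q) <=
   C5 * N * ((1 + Cc + D ^+ (2 * P) + Cg * D * (B + 1)) * N ^+ (2 * P + 2)).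
  by apply: ler_wpM2l; [exact: mulr_ge0|rewrite !mulrDl; rewrite mulrDl in h7; lra_on h5 h6 h7].
have h9 : C5 * N * ((1 + Cc + D ^+ (2 * P) + Cg * D * (B + 1)) * N ^+ (2 * P + 2)) =
  C5 * (1 + Cc + D ^+ (2 * P) + Cg * D * (B + 1)) * N ^+ (2 * P + 3) by rewrite -e4; ring.
have h10 := E1 (2 * P + 3)%N.
rewrite h9 in h8; rewrite !(mulrDl _ _ (N ^+ (2 * P + 3))) mul1r; lra_on h1 h2 h3 h4 h8 h10.
Qed.

(* Minimize V(y, xi) - phi + beta |y - xi|^2 / 2 over y and xi jointly: at the
   minimum a = beta |y - xi|^2 / 2 in lower_scheme, which forces xi - y to 0. *)
Lemma touch F h G CG C5 (eta dl : R) : lower_scheme F -> lower_terminal h ->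
  (forall e : R, 0 < e -> exists2 e1 : R, 0 < e1 &
     forall y, enorm (y - xhat) < e1 -> `|h i y - h i xhat| < e) ->
  (that < T \/ v_ i that xhat < h i xhat) ->
  0 <= CG -> (forall z z', `|G z - G z'| <= CG * enorm (z - z')) ->
  0 < eta -> 0 < dl ->
  (exists2 rr : R, 0 < rr & exists n1, forall n t xi (c : 'I_m -> R),
     (n1 <= n)%N -> 0 <= t <= T -> `|t - that| < rr -> enorm (xi - xhat) < rr ->
     `|c i - v_ i that xhat| < rr -> (forall l, l != i -> c l = v_ l that xhat - rr) ->
     forall z, G z - eta / 4 <= F n i t xi (\col_l c l) z) ->
  0 <= C5 -> (forall n t xi (c : 'I_m -> R) z, 0 <= t <= T ->
     - (C5 * nn R n * (1 + \sum_l `|c l| + psi (bP A) xi + enorm z))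
      <= F n i t xi (\col_l c l) z) ->
  exists s y xi Y C r',
   [/\ [/\ 0 <= s < T, `|s - that| < dl, enorm (y - xhat) < dl & enorm (xi - xhat) < dl],
    Y^T = Y, 0 < r',
    forall e, enorm e <= r' -> phi s (y + e) <= phi s y + dotv (qv s y) e
       + 2^-1 * qf Y e + C * enorm e ^+ 3 &
    - eta <= - pf s y - 2^-1 * (\sum_l qf Y (col l (sigma s xi))) - dotv (b s xi) (qv s y)
        - G ((sigma s xi)^T *m qv s y)].
Proof.
move=> sF tmn hcont hsep CG0 Glip eta0 dl0 [rr rr0 [n1 hloc]] C50 Fgr.
have B0 := B_ge0; have D0 := gC_ge0 A; have G0 := Cg_ge0; have T0 := ltW T_gt0.
have x0 := enorm_ge0 xhat.
pose w l := v_ l that xhat.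
have eta4 : 0 < eta / 4 by rewrite divr_gt0.
have Hl l : exists p : R * nat, 0 < p.1 /\ forall n j y xi, (p.2 <= n)%N -> (j <= nsteps A n)%N ->
   xi \in grid A n -> `|time n j - that| < p.1 -> enorm (y - xhat) < p.1 ->
   w l - rr <= val_ A n j l y xi.
  by have [r1 r10 [n2 h2]] := lowlim_near T_gt0 A l xhat that_in rr0; exists (r1, n2).
have [pl hpl] := choice Hl.
have [r2 r20 hr2] := fin_lb (fun l => (hpl l).1).
pose n2 := (\max_l (pl l).2)%N.
have [e3 e30 [K3 hK3]] := terminal_sep tmn hcont hsep.
pose Cc := \sum_l (`|w l| + rr + 1).
have Cc0 : 0 <= Cc by apply: sumr_ge0 => l _; have := normr_ge0 (w l); lraC.
have [C7 C70 hC7] := far_bound (bP A) C50 Cc0.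
have [e0 [e00 [e0a [e0b [e0c [e0d [e0e e0f]]]]]]] : exists e0 : R, 0 < e0 /\ e0 <= dl / 2 /\
    e0 <= rr / 2 /\ e0 <= r / 2 /\ e0 <= r2 / 2 /\ e0 <= e3 /\ e0 <= 1/2.
  exists (Num.min (Num.min (dl / 2) (rr / 2)) (Num.min (Num.min (r / 2) (r2 / 2)) (Num.min e3 (1/2)))).
  split; first by rewrite !lt_min e30 !divr_gt0.
  by rewrite !ge_min !lexx !orbT /=.
pose Cs := Cg * (2 + enorm xhat).
pose Kq := enorm xhat + 1 + gC A.
pose C8 := B * T + 1 + Cs ^+ 2 + Cs * Kq + CG * (Cs * Kq).
have Cs0 : 0 <= Cs by apply: mulr_ge0 => //; lraC.
have Kq0 : 0 <= Kq by rewrite /Kq; lraC.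
have CK0 : 0 <= Cs * Kq by apply: mulr_ge0.
have C80 : 0 <= C8.
  by have := mulr_ge0 B0 T0; have := mulr_ge0 CG0 CK0; have := sqr_ge0 Cs; rewrite /C8; lraC.
have [n3 hn3] := nn_large_all [:: (2 * C7 + 1) / e0; 1 / (r / 2); 1 / (r2 / 2); T / (r / 2);
  2 * B + 1; enorm xhat + 1; Kq; C8 / (eta / 4); K3].
have C8E : C8 = B * T + 1 + Cs ^+ 2 + Cs * Kq + CG * (Cs * Kq) by [].
have KqE : Kq = enorm xhat + 1 + gC A by [].
have CsE : Cs = Cg * (2 + enorm xhat) by [].
have CcE : Cc = \sum_l (`|w l| + rr + 1) by [].
clearbody C8 Kq Cs Cc.
have [n [j [y [xi [[hn hj hxi hQ] [hs hy hv hmin]]]]]] := touch_seq (maxn (maxn n1 n2) n3) e00.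
have /= /andP[k1 /andP[k2 /andP[k3 /andP[k4 /andP[k5 /andP[k6 /andP[k7 /andP[k8 /andP[k9 _]]]]]]]]] :=
  hn3 n (leq_trans (leq_maxr _ _) hn).
have hn1 : (n1 <= n)%N by exact: leq_trans (leq_trans (leq_maxl _ _) (leq_maxl _ _)) hn.
have hn2 : (n2 <= n)%N by exact: leq_trans (leq_trans (leq_maxr _ _) (leq_maxl _ _)) hn.
have N1 := nn_ge1 R n; have N0 := nn_gt0 R n.
have r20' : 0 < r / 2 by rewrite divr_gt0.
have k1' := nn_div e00 k1; have k2' := nn_div r20' k2; have k4' := nn_div r20' k4.
have k3' := nn_div (divr_gt0 r20 (ltr0n _ 2)) k3; have k8' := nn_div eta4 k8.
rewrite mul1r in k2' k3'.
clear k1 k2 k3 k4 k8.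
have tau1 : tau n <= T * (nn R n)^-1 := tau_le T_gt0 A n.
have tp := tau_gt0 T_gt0 A n.
have hyN : enorm y <= nn R n.
  by have := enorm_le_add y xhat; lra_on k6 hy e0f.
have jp : (0 < j)%N.
  rewrite lt0n; apply/eqP => j0; move: hs hv; rewrite j0 (time0 T A n) => hs hv.
  by apply: (hK3 n y xi) => //; lra_on hs hy hv e0e.
case: j jp hj hQ hs hv hmin => // j _ hj hQ hs hv hmin.
have ts := timeS T A n j.
have Q0 : boxQ (time n j) y.
  have [g1 g2 g3] := hQ; split=> //; first exact: (time_in T_gt0 (ltnW hj)).
  by have := ler_normD (time n j.+1 - that) (tau n); rewrite ts addrAC (ger0_norm (ltW tp)); lra_on hs e0c tau1 k4'.
set s := time n j.+1 in ts hQ hs hmin.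
have hint : enorm (y - xhat) + (nn R n)^-1 <= r by lra_on hy e0c k2'.
have [hp hqv _] := phi_sc hQ.
have hxiN := grid_le hxi.
have hbyxi : beta R n * enorm (y - xi) <= Kq * (nn R n)^-1.
  have h1 : enorm (y - xi) <= Kq * nn R n.
    have := enorm_tri y 0 xi; rewrite subr0 sub0r enormN; have := enorm_le_add y xhat.
    have : (enorm xhat + 1) * 1 <= (enorm xhat + 1) * nn R n by apply: ler_wpM2l => //; lra_on x0.
    rewrite KqE mulrDl; lra_on hxiN hy e0f.
  apply: (@le_trans _ _ (beta R n * (Kq * nn R n))).
    by apply: ler_wpM2l => //; exact: ltW (beta_gt0 n).
  by rewrite mulrCA; apply: ler_wpM2l => //; exact: beta_nn.
have hq' : enorm (beta R n *: (y - xi)) <= Kq * (nn R n)^-1.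
  by rewrite enormZ gtr0_norm ?beta_gt0.
have hK1 : Kq * (nn R n)^-1 <= 1 by rewrite ler_pdivrMr// mul1r.
have hqB : enorm (qv s y - beta R n *: (y - xi)) <= B + 1.
  by have := enormD (qv s y) (- (beta R n *: (y - xi))); rewrite enormN; lra_on hqv hq' hK1.
have hqN : enorm (qv s y - beta R n *: (y - xi)) <= nn R n by lra_on hqB k5 B0.
(* For [l != i] only the lower bound provided by the half-relaxed limit is recorded; [lower_scheme]
   asks for nothing more. *)
pose c l := if l == i then val_ A n j.+1 i y xi else w l - rr.
have ci : c i = val_ A n j.+1 i y xi by rewrite /c eqxx.
have cl l : l != i -> c l = w l - rr by rewrite /c => /negbTE ->.
have hc l : l != i -> forall y', enorm (y' - y) <= (nn R n)^-1 -> c l <= val_ A n j.+1 l y' xi.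
  move=> li y' hy'; rewrite cl//.
  have hr2l := hr2 l.
  have hnl : ((pl l).2 <= n)%N by apply: leq_trans hn2; exact: leq_bigmax.
  apply: (hpl l).2 => //; rewrite -/s; first by lra_on hs e0d hr2l r20.
  by have := enorm_tri y' y xhat; lra_on hy' hy e0d hr2l k3'.
have [Y [C [Ys hY hYl hI]]] := touch_step sF hj hxi hQ Q0 hint hyN hqN k5 hmin hc ci.
rewrite -/s in hY hI.
set q := qv s y - beta R n *: (y - xi) in hqB hI.
have sin : 0 <= s <= T := time_in T_gt0 hj.
have bsx := bs_growth xi sin.
have X1 : 1 + enorm xi <= (1 + gC A) * nn R n by lra_on hxiN N1.
have b0 := enorm_ge0 (b s xi); have s0 := enorm_ge0 (sigma s xi).
have xi0 := enorm_ge0 xi.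
have hYs : - (2^-1 * (\sum_l qf Y (col l (sigma s xi)))) <= (2 * B + 1) * enorm (sigma s xi) ^+ 2.
  rewrite enorm_sqr_col -mulrN ler_pdivrMl// mulrA -sumrN mulr_sumr.
  by apply: ler_sum => l _; have := hYl (col l (sigma s xi)); lra_on.
have hbq : `|dotv (b s xi) q| <= Cg * (1 + enorm xi) * enorm q.
  by apply: le_trans (dotv_CS _ _) _; apply: ler_wpM2r; rewrite ?enorm_ge0//; lra_on bsx s0.
have hci1 : `|c i - w i| < e0 by rewrite ci.
have hsumc : \sum_l `|c l| <= Cc.
  rewrite CcE; apply: ler_sum => l _; have [->|li] := eqVneq l i.
    by have := ler_distD (w i) (c i) 0; rewrite !subr0; lra_on hci1 e0f rr0.
  rewrite cl//; have := ler_normB (w l) rr; rewrite (gtr0_norm rr0); lra_on rr0.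
have hz : enorm ((sigma s xi)^T *m q) <= enorm (sigma s xi) * enorm q := enorm_trmulv _ _.
have ni0 : 0 < (nn R n)^-1 by rewrite invr_gt0.
have ni1 : (nn R n)^-1 <= 1 by rewrite invf_le1.
(* The crude growth bound [Fgr] of the driver is used first, to bring [xi] close to [y]; only then
   does the local bound [hloc] apply. *)
have dyxi : enorm (y - xi) <= (2 * C7 + 1) * (nn R n)^-1.
  have hF := Fgr n s xi c ((sigma s xi)^T *m q) sin.
  have tT : tau n <= T.
    by apply: le_trans tau1 _; apply: ler_piMr.
  have := hC7 (nn R n) (1 + enorm xi) (enorm (sigma s xi)) (enorm q) `|pf s y| (tau n)
     (- (2^-1 * (\sum_l qf Y (col l (sigma s xi))))) `|dotv (b s xi) q| N1 _ X1 s0 _ (enorm_ge0 q) hqB hp tT (ltW tp) hYs hbq.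
  move=> /(_ _ _)h7.
  have {}h7 := h7 (ltac:(lra_on xi0)) (ltac:(lra_on bsx b0)).
  have hps := psi_pow (bP A) xi.
  have C5N : 0 <= C5 * nn R n by apply: mulr_ge0 => //; exact: ltW.
  have h8 : C5 * nn R n * (1 + \sum_l `|c l| + psi (bP A) xi + enorm ((sigma s xi)^T *m q)) <=
    C5 * nn R n * (1 + Cc + (1 + enorm xi) ^+ (2 * bP A) + enorm (sigma s xi) * enorm q).
    by apply: ler_wpM2l => //; lra_on hsumc hps hz.
  have h9 : lam A n * (beta R n / 2 * enorm (y - xi) ^+ 2) <= C7 * nn R n ^+ (2 * bP A + 3).
    have := ler_norm (- pf s y); rewrite normrN.
    have := ler_norm (- dotv (b s xi) q); rewrite normrN.
    move: hI hF h8 h7; move: (C5 * nn R n * _) (C5 * nn R n * _) => z1 z2; lra_on ni1.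
  have h10 : lam A n * (beta R n / 2 * enorm (y - xi) ^+ 2) =
     nn R n ^+ (2 * bP A + 3) * (2^-1 * (nn R n * enorm (y - xi)) ^+ 2).
    rewrite /lam /beta (_ : (2 * bP A + 8 = 2 * bP A + 3 + (2 + 3))%N); last by rewrite -addnA.
    rewrite !exprD exprMn; field; exact: lt0r_neq0.
  have h11 : 2^-1 * (nn R n * enorm (y - xi)) ^+ 2 <= C7.
    by rewrite -(ler_pM2l (exprn_gt0 (2 * bP A + 3) N0)) -h10 (mulrC _ C7); exact: h9.
  rewrite ler_pdivlMr// mulrC.
  move: (nn R n * _) h11 => z h11; nra_on h11 C70.
have hxid : enorm (xi - xhat) < 2 * e0.
  by have := enorm_tri xi y xhat; rewrite (enormB xi y); lra_on dyxi k1' hy.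
have hF : G ((sigma s xi)^T *m q) - eta / 4 <= F n i s xi (\col_l c l) ((sigma s xi)^T *m q).
  by apply: hloc => //; rewrite -/w; lra_on hs hxid hci1 e0b e00.
have xi2 : 1 + enorm xi <= 2 + enorm xhat by have := enorm_le_add xi xhat; lra_on hxid e0f.
have hCs : enorm (b s xi) + enorm (sigma s xi) <= Cs.
  by rewrite CsE; apply: le_trans bsx _; apply: ler_wpM2l.
have hGq : G ((sigma s xi)^T *m qv s y) - CG * (Cs * Kq) * (nn R n)^-1 <= G ((sigma s xi)^T *m q).
  have := Glip ((sigma s xi)^T *m qv s y) ((sigma s xi)^T *m q).
  rewrite -mulmxBr (_ : qv s y - q = beta R n *: (y - xi)); last by rewrite /q opprB addrC subrK.
  have h1 : enorm ((sigma s xi)^T *m (beta R n *: (y - xi))) <= Cs * (Kq * (nn R n)^-1).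
    by apply: le_trans (enorm_trmulv _ _) _; apply: ler_pM => //; [exact: enorm_ge0|lra_on hCs b0].
  have h2 := ler_wpM2l CG0 h1.
  rewrite ler_norml => /andP[_ h3]; rewrite -mulrA -(mulrA Cs); lra_on h2 h3.
have hbq2 : dotv (b s xi) (qv s y) - Cs * Kq * (nn R n)^-1 <= dotv (b s xi) q.
  rewrite /q dotvDr dotvNr lerD2l lerN2 -mulrA.
  apply: le_trans (ler_norm _) _; apply: le_trans (dotv_CS _ _) _.
  by apply: ler_pM; rewrite ?enorm_ge0//; lra_on hCs s0.
have b1 := beta_le1 n; have bp := beta_gt0 n.
have hsum : \sum_l qf (Y + beta R n *: 1%:M) (col l (sigma s xi)) =
   \sum_l qf Y (col l (sigma s xi)) + beta R n * enorm (sigma s xi) ^+ 2.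
  rewrite enorm_sqr_col mulr_sumr -big_split /=.
  by apply: eq_bigr => l _; rewrite qfD qfZ qf1.
have hss : 2^-1 * (beta R n * enorm (sigma s xi) ^+ 2) <= Cs ^+ 2 * (nn R n)^-1.
  have h1 : enorm (sigma s xi) ^+ 2 <= Cs ^+ 2 by apply: lerXn2r; rewrite ?nnegrE//; lra_on hCs b0.
  have h2 := ler_pM (ltW bp) (sqr_ge0 _) b1 h1.
  have := mulr_ge0 (ltW bp) (sqr_ge0 (enorm (sigma s xi))).
  rewrite (mulrC (Cs ^+ 2)); lra_on h2.
exists s, y, xi, (Y + beta R n *: 1%:M), C, (nn R n)^-1; split => //.
- split; [|lra_on hs e0a dl0|lra_on hy e0a dl0|lra_on hxid e0a]; case/andP: sin => -> _ /=.
  exact: time_lt.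
- by rewrite linearD /= linearZ /= trmx1 Ys.
have lam0 : 0 <= lam A n * (beta R n / 2 * enorm (y - xi) ^+ 2).
  apply: mulr_ge0; first by apply: exprn_ge0; exact: ltW.
  by apply: mulr_ge0; [apply: divr_ge0 => //; exact: ltW|exact: sqr_ge0].
rewrite hsum mulrDr.
have hBt : B * tau n <= B * T * (nn R n)^-1 by rewrite -mulrA; apply: ler_wpM2l.
move: k8'; rewrite C8E !(mulrDl _ _ (nn R n)^-1) mul1r => k8'.
lra_on hI hF hGq hbq2 hss lam0 hBt k8' eta0.
Qed.

End touch.

(** * Doubling of variables *)

Section coupling.
Variables (R : realType) (k : nat).

(* The matrix part of the theorem on sums, for a quadratic function: the
   infimum over g of (g, Y g) + al |e - g|^2 is a quadratic form in e. *)
Lemma quad_coupling (Y : 'M[R]_k) (al e1 : R) : Y^T = Y -> 0 < e1 ->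
  (forall e, - (al - e1) * enorm e ^+ 2 <= qf Y e) ->
  exists (A X : 'M[R]_k), [/\ X^T = X,
    forall e, qf X e = qf Y (A *m e) + al * enorm (e - A *m e) ^+ 2 &
    forall e g, qf X e <= qf Y g + al * enorm (e - g) ^+ 2].
Proof.
move=> Ys e10 hY.
pose W := Y + al%:M.
have Ws : W^T = W by rewrite /W linearD /= Ys tr_scalar_mx.
have qW v : e1 * enorm v ^+ 2 <= qf W v.
  by rewrite /W -scalemx1 qfD qfZ qf1; have := hY v; lra.
have Wu : W \in unitmx.
  rewrite -row_free_unit -kermx_eq0; apply/eqP/row_matrixP => i; rewrite row0.
  set v := row i _.
  have vW : v *m W = 0 by apply/sub_kermxP; exact: row_sub.
  have Wv : W *m v^T = 0 by rewrite -[W]Ws -trmx_mul vW trmx0.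
  have := qW v^T; rewrite /qf Wv dotv0r => h.
  have : enorm v^T ^+ 2 <= 0 by rewrite -(pmulr_rle0 _ e10).
  have := sqr_ge0 (enorm v^T) => h1 h2.
  have /eqP : enorm v^T ^+ 2 = 0 by lra.
  by rewrite sqrf_eq0 => /eqP/enorm_eq0 /(congr1 trmx); rewrite trmxK trmx0.
(* [A *m e] is the minimizer [g], the solution of [(Y + al) g = al e]; the coercivity of [W] makes
   it unique. *)
pose A := al *: invmx W.
have WA e : W *m (A *m e) = al *: e.
  by rewrite mulmxA /A -scalemxAr mulmxV// -scalemxAl mul1mx.
clearbody A.
pose X := A^T *m Y *m A + al *: ((1%:M - A)^T *m (1%:M - A)).
have qX e : qf X e = qf Y (A *m e) + al * enorm (e - A *m e) ^+ 2.
  rewrite /X qfD qfZ; congr (_ + _ * _).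
    by rewrite /qf -!mulmxA dotv_mul trmxK.
  by rewrite /qf -mulmxA dotv_mul trmxK dotvv mulmxBl mul1mx.
exists A, X; split=> //.
  have trD (M N : 'M[R]_k) : (M + N)^T = M^T + N^T by apply/matrixP => a c; rewrite !mxE.
  have trZ (M : 'M[R]_k) : (al *: M)^T = al *: M^T by apply/matrixP => a c; rewrite !mxE.
  by rewrite /X trD trZ !trmx_mul !trmxK Ys mulmxA.
move=> e g; rewrite qX.
pose u := g - A *m e.
have gE : g = A *m e + u by rewrite /u addrC subrK.
clearbody u.
rewrite gE.
have qD : qf Y (A *m e + u) = qf Y (A *m e) + 2 * dotv u (Y *m (A *m e)) + qf Y u.
  rewrite /qf mulmxDr !dotvE_ (dotv_mul Y (A *m e) u) Ys (dotvC (Y *m (A *m e)) u).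
  ring.
have -> : e - (A *m e + u) = (e - A *m e) + (- u) by rewrite opprD addrA.
have nD : enorm ((e - A *m e) + (- u)) ^+ 2 = enorm (e - A *m e) ^+ 2
    - 2 * dotv u (e - A *m e) + enorm u ^+ 2.
  by rewrite -!dotvv !dotvE_ !(dotvC _ u) (dotvC e (A *m e)); ring.
rewrite qD nD.
have h1 : dotv u (W *m (A *m e)) = al * dotv u e by rewrite WA dotvZr.
rewrite /W mulmxDl mul_scalar_mx !dotvE_ in h1.
have h2 : 0 <= qf Y u + al * enorm u ^+ 2.
  have := qW u; rewrite /W -scalemx1 qfD qfZ qf1; apply: le_trans.
  by rewrite mulr_ge0 ?sqr_ge0// ltW.
rewrite !dotvE_; lra.
Qed.

End coupling.

Section doubling.
Variables (R : realType) (T : R) (k : nat).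
Variables (that : R) (xhat : 'cV[R]_k) (r0 : R).
Hypothesis that_in : 0 <= that <= T.
Hypothesis r0_gt0 : 0 < r0.

Local Notation Q := (boxQ T that xhat r0).

Lemma boxQ_bnd t x : Q t x -> `|t| <= `|that| + `|T| + enorm xhat + r0 /\
  enorm x <= `|that| + `|T| + enorm xhat + r0.
Proof.
move=> [_ h1 h2]; have := enorm_le_add x xhat; have := ler_distD that t 0; rewrite !subr0.
have := normr_ge0 that; have := normr_ge0 T; have := enorm_ge0 xhat; split; lra.
Qed.

Lemma boxQ_closed (t_ : nat -> R) (x_ : nat -> 'cV[R]_k) t x :
  (forall n, Q (t_ n) (x_ n)) -> to0 (fun n => `|t_ n - t|) ->
  to0 (fun n => enorm (x_ n - x)) -> Q t x.
Proof.
move=> hQ ht hx; split.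
- apply/andP; split; rewrite -subr_le0; apply: (to0_ge ht); apply: filterE => l; have [/andP[b1 b2] _ _] := hQ l.
    by have := ler_norm (t_ l - t); lra.
  by have := ler_norm (t - t_ l); rewrite distrC; lra.
- rewrite -subr_le0; apply: (to0_ge ht); apply: filterE => l; have [_ b1 _] := hQ l.
  by have := ler_distD (t_ l) t that; rewrite (distrC t (t_ l)); lra.
- rewrite -subr_le0; apply: (to0_ge hx); apply: filterE => l; have [_ _ b1] := hQ l.
  by have := enorm_tri x (x_ l) xhat; rewrite (enormB x (x_ l)); lra.
Qed.

Variables (U v : R -> 'cV[R]_k -> R).
Hypothesis U_usc : strip_usc T U.
Hypothesis v_lsc : strip_lsc T v.

Lemma usc_seq (W : R -> 'cV[R]_k -> R) (t_ : nat -> R) (x_ : nat -> 'cV[R]_k) t x :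
  strip_usc T W ->
  (forall n, Q (t_ n) (x_ n)) -> Q t x -> to0 (fun n => `|t_ n - t|) ->
  to0 (fun n => enorm (x_ n - x)) ->
  forall e : R, 0 < e -> \forall n \near UU, W (t_ n) (x_ n) < W t x + e.
Proof.
move=> /strip_uscP hW hQ [ht _ _] h1 h2 e e0; have [r r1 hr] := hW t x ht e e0.
by apply: filterS2 (h1 r r1) (h2 r r1) => n; apply: hr; have [] := hQ n.
Qed.

Lemma lsc_seq (W : R -> 'cV[R]_k -> R) (t_ : nat -> R) (x_ : nat -> 'cV[R]_k) t x :
  strip_lsc T W ->
  (forall n, Q (t_ n) (x_ n)) -> Q t x -> to0 (fun n => `|t_ n - t|) ->
  to0 (fun n => enorm (x_ n - x)) ->
  forall e : R, 0 < e -> \forall n \near UU, W t x - e < W (t_ n) (x_ n).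
Proof.
move=> /strip_lscP hW hQ [ht _ _] h1 h2 e e0; have [r r1 hr] := hW t x ht e e0.
by apply: filterS2 (h1 r r1) (h2 r r1) => n; apply: hr; have [] := hQ n.
Qed.

Variables (m0 eta0 : R).
Hypothesis eta0_gt0 : 0 < eta0.
Hypothesis Uv_max : forall t x, Q t x ->
  U t x - v t x + eta0 * ((t - that) ^+ 2 + enorm (x - xhat) ^+ 2) <= m0.
Hypothesis Uv_eq : U that xhat - v that xhat = m0.

(** The two penalty parameters are free above [nn R a], because [rho] will be chosen after [al].
    Otherwise bad near-maximizers would exist for every [a0]; along [UU] their two points would
    converge to a common limit, and the strictness in [Uv_max] identifies it. *)
Lemma dbl_conv (e : R) : 0 < e -> exists a0, forall a, (a0 <= a)%N ->
  forall al rho t x s1 y1, nn R a <= al -> nn R a <= rho -> Q t x -> Q s1 y1 ->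
  al / 2 * enorm (x - y1) ^+ 2 + rho / 2 * (t - s1) ^+ 2 <= U t x - v s1 y1 - m0 + (nn R a)^-1 ->
  [/\ `|t - that| < e, enorm (x - xhat) < e, `|s1 - that| < e & enorm (y1 - xhat) < e] /\
  [/\ al / 2 * enorm (x - y1) ^+ 2 + rho / 2 * (t - s1) ^+ 2 < e,
      `|U t x - U that xhat| < e & `|v s1 y1 - v that xhat| < e].
Proof.
move=> e0; apply: contrapT => hn.
have H (a0 : nat) : exists w : nat * (R * R) * ((R * 'cV[R]_k) * (R * 'cV[R]_k)),
  let: (a, (al, rho), ((t, x), (s1, y1))) := w in
  [/\ [/\ (a0 <= a)%N, nn R a <= al & nn R a <= rho], Q t x, Q s1 y1,
   al / 2 * enorm (x - y1) ^+ 2 + rho / 2 * (t - s1) ^+ 2 <= U t x - v s1 y1 - m0 + (nn R a)^-1 &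
   ~ ([/\ `|t - that| < e, enorm (x - xhat) < e, `|s1 - that| < e & enorm (y1 - xhat) < e] /\
  [/\ al / 2 * enorm (x - y1) ^+ 2 + rho / 2 * (t - s1) ^+ 2 < e,
      `|U t x - U that xhat| < e & `|v s1 y1 - v that xhat| < e])].
  apply: contrapT => hn2; apply: hn; exists a0 => a ha al rho t x s1 y1 h1 h2 h3 h4 h5.
  apply: contrapT => hn3; apply: hn2; exists (a, (al, rho), ((t, x), (s1, y1))).
  by split.
have [w hw] := choice H.
pose a_ l := (w l).1.1; pose al l := (w l).1.2.1; pose rho l := (w l).1.2.2.
pose t_ l := (w l).2.1.1; pose x_ l := (w l).2.1.2.
pose s_ l := (w l).2.2.1; pose y_ l := (w l).2.2.2.
have {H hn}hw l : [/\ [/\ (l <= a_ l)%N, nn R (a_ l) <= al l & nn R (a_ l) <= rho l], Q (t_ l) (x_ l), Q (s_ l) (y_ l),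
   al l / 2 * enorm (x_ l - y_ l) ^+ 2 + rho l / 2 * (t_ l - s_ l) ^+ 2 <= U (t_ l) (x_ l) - v (s_ l) (y_ l) - m0 + (nn R (a_ l))^-1 &
   ~ ([/\ `|t_ l - that| < e, enorm (x_ l - xhat) < e, `|s_ l - that| < e & enorm (y_ l - xhat) < e] /\
  [/\ al l / 2 * enorm (x_ l - y_ l) ^+ 2 + rho l / 2 * (t_ l - s_ l) ^+ 2 < e,
      `|U (t_ l) (x_ l) - U that xhat| < e & `|v (s_ l) (y_ l) - v that xhat| < e])].
  by move: (hw l); rewrite /a_ /al /rho /t_ /x_ /s_ /y_; case: (w l) => [[a [? ?]] [[? ?] [? ?]]].
clearbody a_ al rho t_ x_ s_ y_; clear w.
have hQ l : Q (t_ l) (x_ l) by have [] := hw l.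
have hQ1 l : Q (s_ l) (y_ l) by have [] := hw l.
have [tb htb] := ulim_real (fun l => (boxQ_bnd (hQ l)).1).
have [xb hxb] := ulim_mx (fun l => (boxQ_bnd (hQ l)).2).
have [sb hsb] := ulim_real (fun l => (boxQ_bnd (hQ1 l)).1).
have [yb hyb] := ulim_mx (fun l => (boxQ_bnd (hQ1 l)).2).
have Qb := boxQ_closed hQ htb hxb.
have Qb1 := boxQ_closed hQ1 hsb hyb.
pose D l := al l / 2 * enorm (x_ l - y_ l) ^+ 2 + rho l / 2 * (t_ l - s_ l) ^+ 2.
have nl l : nn R l <= nn R (a_ l) by rewrite !nnE ler_nat ltnS; have [[]] := hw l.
have ni : to0 (fun l => (nn R (a_ l))^-1).
  apply: (to0_le (@to0_inv R)); apply: filterE => l.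
  by rewrite lef_pV2 ?posrE ?ltr0Sn ?nn_gt0// -nnE.
have keyd (e1 : R) : 0 < e1 -> \forall l \near UU, D l < U tb xb - v sb yb - m0 + e1.
  move=> e10; have e13 : 0 < e1 / 3 by rewrite divr_gt0.
  near=> l.
  have := hw l => -[_ _ _ h _].
  have h1 : U (t_ l) (x_ l) < U tb xb + e1 / 3 by near: l; apply: usc_seq.
  have h2 : v sb yb - e1 / 3 < v (s_ l) (y_ l) by near: l; apply: lsc_seq.
  have h3 : (nn R (a_ l))^-1 < e1 / 3 by near: l; apply: ni.
  rewrite /D; lra.
have D0 l : nn R l * (enorm (x_ l - y_ l) ^+ 2 + (t_ l - s_ l) ^+ 2) <= 2 * D l.
  have [[_ h1 h2] _ _ _ _] := hw l; have h3 := nl l; rewrite /D.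
  have := sqr_ge0 (enorm (x_ l - y_ l)); have := sqr_ge0 (t_ l - s_ l).
  move: (enorm _ ^+ 2) ((t_ l - s_ l) ^+ 2) => X Z Z0 X0.
  have := ler_wpM2r X0 (le_trans h3 h1); have := ler_wpM2r Z0 (le_trans h3 h2); lra.
have dxy : to0 (fun l => enorm (x_ l - y_ l) ^+ 2 + (t_ l - s_ l) ^+ 2).
  pose M := `|U tb xb - v sb yb - m0| + 1.
  apply: (@to0_le _ (fun l => 2 * M * l.+1%:R^-1)).
    by apply: to0Z; [rewrite mulr_ge0// addr_ge0|exact: to0_inv].
  apply: filterS (keyd 1 ltr01) => l h; rewrite -(nnE R l) ler_pdivlMr ?nn_gt0// mulrC.
  by apply: le_trans (D0 l) _; rewrite /M; have := ler_norm (U tb xb - v sb yb - m0); lra.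
have sqr0 (z : nat -> R) : to0 (fun l => z l ^+ 2) -> to0 z.
  move=> h ep ep0; have e2 : 0 < ep ^+ 2 by rewrite exprn_gt0.
  apply: filterS (h _ e2) => l hl; rewrite ltNge; apply/negP => hge.
  by move: hl; apply/negP; rewrite -leNgt; apply: lerXn2r; rewrite ?nnegrE//; lra.
have dx : to0 (fun l => enorm (x_ l - y_ l)).
  by apply: sqr0; apply: (to0_le dxy); apply: filterE => l; rewrite lerDl sqr_ge0.
have dt : to0 (fun l => `|t_ l - s_ l|).
  apply: sqr0; apply: (to0_le dxy); apply: filterE => l.
  by rewrite real_normK ?num_real// lerDr sqr_ge0.
have eqx : yb = xb.
  apply/eqP; rewrite -subr_eq0; apply/eqP/enorm_eq0/eqP; rewrite eq_le enorm_ge0 andbT.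
  apply: (to0_ge (to0D hyb (to0D dx hxb))); apply: filterE => l /=.
  have := enorm_tri yb (y_ l) xb; have := enorm_tri (y_ l) (x_ l) xb.
  rewrite (enormB yb (y_ l)) (enormB (y_ l) (x_ l)); lra.
have eqt : sb = tb.
  apply/eqP; rewrite -subr_eq0 -normr_eq0 eq_le normr_ge0 andbT.
  apply: (to0_ge (to0D hsb (to0D dt htb))); apply: filterE => l /=.
  have := ler_distD (s_ l) sb tb; have := ler_distD (t_ l) (s_ l) tb.
  rewrite (distrC sb (s_ l)) (distrC (s_ l) (t_ l)); lra.
subst yb sb.
have Dge l : 0 <= D l.
  apply: le_trans (_ : 0 <= 2^-1 * (nn R l * (enorm (x_ l - y_ l) ^+ 2 + (t_ l - s_ l) ^+ 2))) _.
    by rewrite !mulr_ge0 ?addr_ge0 ?sqr_ge0// ltW ?nn_gt0.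
  by have := D0 l; lra.
have hz : eta0 * ((tb - that) ^+ 2 + enorm (xb - xhat) ^+ 2) <= 0.
  suff G : forall ep : R, 0 < ep -> eta0 * ((tb - that) ^+ 2 + enorm (xb - xhat) ^+ 2) <= ep + 0 by apply/ler_addgt0Pl.
  move=> ep ep0; have [l hl] := UU_ex (keyd ep ep0).
  by have := Uv_max Qb; have := Dge l; lra.
have h1 : (tb - that) ^+ 2 + enorm (xb - xhat) ^+ 2 <= 0 by rewrite pmulr_rle0 in hz.
have h2 := sqr_ge0 (tb - that); have h3 := sqr_ge0 (enorm (xb - xhat)).
have /eqP : (tb - that) ^+ 2 = 0 by lra.
rewrite sqrf_eq0 subr_eq0 => /eqP ?.
have /eqP : enorm (xb - xhat) ^+ 2 = 0 by lra.
rewrite sqrf_eq0 => /eqP/enorm_eq0/eqP; rewrite subr_eq0 => /eqP ?.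
subst tb xb.
have e2 : 0 < e / 4 by rewrite divr_gt0.
have [l [[[[[[[b1 b2] b3] b4] b5] b6] b7] b8]] : exists l, ((((((`|t_ l - that| < e /\ enorm (x_ l - xhat) < e) /\ `|s_ l - that| < e) /\
   enorm (y_ l - xhat) < e) /\ D l < U that xhat - v that xhat - m0 + e / 4) /\
   U (t_ l) (x_ l) < U that xhat + e / 4) /\ v that xhat - e / 4 < v (s_ l) (y_ l)) /\ (nn R (a_ l))^-1 < e / 4.
  apply: UU_ex; apply: filterI (ni _ e2).
  apply: filterI; last by apply: lsc_seq.
  apply: filterI; last by apply: usc_seq.
  apply: filterI; last by apply: keyd.
  by do 3 (apply: filterI; last by [apply: hyb|apply: hsb|apply: hxb]); apply: htb.
have [_ _ _ hE] := hw l; apply.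
have := Dge l; rewrite Uv_eq subrr add0r in b5 *; rewrite -/(D l) in hE * => Dl.
split; first by split.
split; first by lra.
- by have := Uv_eq; rewrite ltr_norml => ?; apply/andP; split; lra.
- by have := Uv_eq; rewrite ltr_norml => ?; apply/andP; split; lra.
Unshelve. all: by end_near. Qed.

End doubling.

(** * Moduli of continuity and the error of the doubling *)

Section timemod.
Variables (R : realType) (T : R) (k : nat).

Lemma time_mod m n (w : R -> 'cV[R]_k -> 'M[R]_(m, n)) (M e : R) :
  strip_continuous T w -> 0 < e -> exists2 r : R, 0 < r & forall t s x,
  0 <= t <= T -> 0 <= s <= T -> enorm x <= M -> `|t - s| < r -> enorm (w t x - w s x) < e.
Proof.
move=> hw e0; apply: contrapT => hn.
have H (l : nat) : exists p : R * R * 'cV[R]_k, [/\ [/\ 0 <= p.1.1 <= T, 0 <= p.1.2 <= T & enorm p.2 <= M],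
    `|p.1.1 - p.1.2| < l.+1%:R^-1 & e <= enorm (w p.1.1 p.2 - w p.1.2 p.2)].
  apply: contrapT => hn2; apply: hn; exists l.+1%:R^-1; first by rewrite invr_gt0 ltr0Sn.
  move=> t s x h1 h2 h3 h4; rewrite ltNge; apply/negP => h5; apply: hn2.
  by exists (t, s, x).
have [p hp] := choice H.
have b1 l : `|(p l).1.1| <= T by have [[/andP[a c] _ _] _ _] := hp l; rewrite ger0_norm.
have b2 l : enorm (p l).2 <= M by have [[_ _ a] _ _] := hp l.
have [tb htb] := ulim_real b1; have [xb hxb] := ulim_mx b2.
have hsb : to0 (fun l => `|(p l).1.2 - tb|).
  apply: (to0_le (to0D htb (@to0_inv R))); apply: filterE => l /=.
  have [_ h _] := hp l; have := ler_distD (p l).1.1 (p l).1.2 tb.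
  rewrite (distrC (p l).1.2 (p l).1.1); move: (l.+1%:R^-1) h => z; lra.
have tin : 0 <= tb <= T.
  apply/andP; split; rewrite -subr_le0; apply: (to0_ge htb); apply: filterE => l; have [[/andP[c1 c2] _ _] _ _] := hp l.
    by have := ler_norm ((p l).1.1 - tb); lra.
  by have := ler_norm (tb - (p l).1.1); rewrite distrC; lra.
have e2 : 0 < e / 2 by rewrite divr_gt0.
have [r r0 hr] := strip_contmx hw xb tin e2.
have [l [[h1 h2] h3]] := UU_ex (filterI (filterI (htb r r0) (hsb r r0)) (hxb r r0)).
have [[c1 c2 _] _ h4] := hp l.
have := hr _ _ c1 h1 h3; have := hr _ _ c2 h2 h3.
have := enorm_tri (w (p l).1.1 (p l).2) (w tb xb) (w (p l).1.2 (p l).2).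
rewrite (enormB (w tb xb)); lra.
Qed.

Lemma sqd_cont that (xhat : 'cV[R]_k) t x (e : R) : 0 < e -> exists2 r : R, 0 < r &
  forall t' x', `|t' - t| < r -> enorm (x' - x) < r ->
   (t - that) ^+ 2 + enorm (x - xhat) ^+ 2 < (t' - that) ^+ 2 + enorm (x' - xhat) ^+ 2 + e.
Proof.
move=> e0; pose L := 2 * `|t - that| + 2 * enorm (x - xhat).
have L0 : 0 <= L by rewrite /L; have := enorm_ge0 (x - xhat); have := normr_ge0 (t - that); lra.
exists (e / (L + 1)); first by rewrite divr_gt0//; lra.
move=> t' x' h1 h2.
have key (u v w : R) : 0 <= u -> u <= v + w -> 0 <= v -> 0 <= w -> u ^+ 2 - v ^+ 2 <= 2 * u * w.
  by have [uv|uv] := leP u v => *; [nra|rewrite subr_sqr; nra].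
have k1 := key `|t - that| `|t' - that| `|t' - t| (normr_ge0 _) _ (normr_ge0 _) (normr_ge0 _).
have k2 := key (enorm (x - xhat)) (enorm (x' - xhat)) (enorm (x' - x)) (enorm_ge0 _) _ (enorm_ge0 _) (enorm_ge0 _).
have {}k1 := k1 _; have {}k2 := k2 _.
have {k1}h3 : (t - that) ^+ 2 - (t' - that) ^+ 2 <= 2 * `|t - that| * `|t' - t|.
  rewrite -(real_normK (num_real (t - that))) -(real_normK (num_real (t' - that))).
  by apply: k1; have := ler_distD t' t that; rewrite (distrC t t'); lra.
have {k2}h4 : enorm (x - xhat) ^+ 2 - enorm (x' - xhat) ^+ 2 <= 2 * enorm (x - xhat) * enorm (x' - x).
  by apply: k2; have := enorm_tri x x' xhat; rewrite (enormB x x'); lra.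
have L1 : 0 < L + 1 by lra.
have h5 : (L + 1) * (e / (L + 1)) = e by rewrite mulrCA divff ?mulr1// gt_eqF.
have p0 := normr_ge0 (t - that); have p1 := enorm_ge0 (x - xhat).
have : 2 * `|t - that| * `|t' - t| <= 2 * `|t - that| * (e / (L + 1)) by apply: ler_wpM2l; lra.
have : 2 * enorm (x - xhat) * enorm (x' - x) <= 2 * enorm (x - xhat) * (e / (L + 1)) by apply: ler_wpM2l; lra.
have h6 : 0 < e / (L + 1) by rewrite divr_gt0.
move: (e / (L + 1)) h5 h6 => z; rewrite /L; lra.
Qed.

(** [N] is the penalty in space, [d] the distance of the doubled points, [D] the increment of the
    coefficients and [Q] the size of the gradient. After expansion each term either contains
    [N * d ^+ 2], which is small at the maximum, or carries a factor [N^-1]. *)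
Lemma err_bound (CL CG eta : R) : 0 <= CL -> 0 <= CG -> 0 < eta -> exists2 ep : R, 0 < ep &
  exists K : R, forall N d D Q : R, K <= N -> 1 <= N -> 0 <= d -> d <= 1 -> N * d ^+ 2 <= 2 * ep ->
   0 <= D -> D <= CL * d + (CL + 1) * (N^-1) ^+ 2 -> 0 <= Q -> Q <= N * d + 3 * N^-1 ->
   N / 2 * D ^+ 2 + (1 + CG) * (D * Q) <= eta.
Proof.
move=> CL0 CG0 e0.
pose C1 := 2 * CL ^+ 2 + (1 + CG) * 2 * CL.
pose C2 := (CL + 1) ^+ 2 + (1 + CG) * ((CL + 1) + 3 * CL + 3 * (CL + 1)).
have C10 : 0 <= C1 by rewrite /C1 addr_ge0 ?mulr_ge0 ?sqr_ge0//; lra.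
have C20 : 0 <= C2 by rewrite /C2 addr_ge0 ?mulr_ge0 ?sqr_ge0//; lra.
have e2 : 0 < eta / 2 by rewrite divr_gt0.
exists (eta / 2 / (C1 + 1)); first by rewrite divr_gt0//; lra.
exists (C2 / (eta / 2)) => N d D Q hK N1 d0 d1 hd D0 hD Q0 hQ.
have N0 : 0 < N by lra.
have h1 := mul_small C10 e2.
have h2 : C2 * N^-1 <= eta / 2 by rewrite ler_pdivrMr// mulrC -ler_pdivrMr.
set ep := eta / 2 / (C1 + 1) in hd h1.
have NV : N * N^-1 = 1 by rewrite divff// gt_eqF.
have I0 : 0 < N^-1 by rewrite invr_gt0.
have I1 : N^-1 <= 1 by rewrite invf_le1.
move: (N^-1) NV I0 I1 h2 hD hQ => I NV I0 I1 h2 hD hQ.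
have a1 : D ^+ 2 <= 2 * (CL ^+ 2 * d ^+ 2 + (CL + 1) ^+ 2 * (I ^+ 2) ^+ 2).
  apply: (@le_trans _ _ ((CL * d + (CL + 1) * I ^+ 2) ^+ 2)).
    apply: lerXn2r => //; rewrite nnegrE//; exact: le_trans D0 hD.
  rewrite -!exprMn; have := sqr_ge0 (CL * d - (CL + 1) * I ^+ 2); rewrite sqrrB sqrrD; lra.
have NI2 : N * (I ^+ 2) ^+ 2 <= I.
  have -> : N * (I ^+ 2) ^+ 2 = N * I * (I * (I * I)) by ring.
  by rewrite NV mul1r ler_piMr//; [exact: ltW|apply: mulr_ile1 => //; exact: ltW].
have a2 : N / 2 * D ^+ 2 <= CL ^+ 2 * (2 * ep) + (CL + 1) ^+ 2 * I.
  apply: (@le_trans _ _ (N / 2 * (2 * (CL ^+ 2 * d ^+ 2 + (CL + 1) ^+ 2 * (I ^+ 2) ^+ 2)))).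
    by apply: ler_wpM2l => //; lra.
  have := ler_wpM2l (sqr_ge0 CL) hd; have := ler_wpM2l (sqr_ge0 (CL + 1)) NI2; lra.
have a3 : D * Q <= CL * (2 * ep) + ((CL + 1) + 3 * CL + 3 * (CL + 1)) * I.
  apply: (@le_trans _ _ ((CL * d + (CL + 1) * I ^+ 2) * (N * d + 3 * I))); first exact: ler_pM.
  have -> : (CL * d + (CL + 1) * I ^+ 2) * (N * d + 3 * I) =
    CL * (N * d ^+ 2) + (CL + 1) * (N * I) * (I * d) + 3 * CL * (d * I) + 3 * (CL + 1) * (I * (I * I)) by ring.
  rewrite NV mulr1.
  have b1 := ler_wpM2l CL0 hd.
  have b2 : I * d <= I by rewrite ler_piMr// ltW.
  have b3 : I * (I * I) <= I by rewrite ler_piMr//; [exact: ltW|apply: mulr_ile1 => //; exact: ltW].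
  have c1 : 0 <= CL + 1 by lra.
  have c3 : 0 <= 3 * CL by lra.
  have c4 : 0 <= 3 * (CL + 1) by lra.
  have := ler_wpM2l c1 b2; have := ler_wpM2l c3 b2; have := ler_wpM2l c4 b3; rewrite (mulrC d I); lra.
have c2 : 0 <= 1 + CG by lra.
have := ler_wpM2l c2 a3; rewrite /C1 /C2 in h1 h2 *; lra.
Qed.

End timemod.

(** * Sup-convolutions and the transfer of jets *)

Section supconv.
Variables (R : realType) (T : R) (k : nat).
Variables (that : R) (xhat : 'cV[R]_k) (r0 : R).
Hypothesis that_in : 0 <= that <= T.
Hypothesis r0_gt0 : 0 < r0.
Local Notation Q := (boxQ T that xhat r0).
Variables (U v : R -> 'cV[R]_k -> R).
Hypothesis U_usc : strip_usc T U.
Hypothesis v_lsc : strip_lsc T v.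
Variables (al rho : R).
Hypothesis al_ge0 : 0 <= al.
Hypothesis rho_ge0 : 0 <= rho.

Definition pen (t : R) (x : 'cV[R]_k) s (y : 'cV[R]_k) : R :=
  al / 2 * enorm (x - y) ^+ 2 + rho / 2 * (t - s) ^+ 2.

Lemma pen_expand t x s y s' y' : pen t x s' y' = pen t x s y
   - al * dotv (x - y) (y' - y) - rho * (t - s) * (s' - s)
   + al / 2 * enorm (y' - y) ^+ 2 + rho / 2 * (s' - s) ^+ 2.
Proof.
rewrite /pen (_ : x - y' = (x - y) + - (y' - y)); last by rewrite opprB addrA subrK.
by rewrite -!dotvv !dotvE_ (dotvC y x) (dotvC y' x) (dotvC y y'); field.
Qed.

Definition penK : R := al * (2 * r0) + rho * (2 * r0) + (al / 2 + rho / 2) * (2 * r0).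

Lemma boxQ_diam t x s y : Q t x -> Q s y -> `|t - s| <= 2 * r0 /\ enorm (x - y) <= 2 * r0.
Proof.
move=> [_ a1 a2] [_ b1 b2]; split.
  by have := ler_distD that t s; rewrite (distrC that s); lra.
by have := enorm_tri x xhat y; rewrite (enormB xhat y); lra.
Qed.

Lemma pen_lip t x s y s' y' : Q t x -> Q s y -> Q s' y' ->
  pen t x s' y' - pen t x s y <= penK * (`|s' - s| + enorm (y' - y)).
Proof.
move=> q1 q2 q3; rewrite (pen_expand t x s y).
have [d1 d2] := boxQ_diam q1 q2; have [d3 d4] := boxQ_diam q3 q2.
have h1 : - (al * dotv (x - y) (y' - y)) <= al * (2 * r0) * enorm (y' - y).
  rewrite -mulrN -mulrA; apply: ler_wpM2l => //.
  apply: le_trans (ler_norm _) _; rewrite normrN; apply: le_trans (dotv_CS _ _) _.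
  by apply: ler_wpM2r => //; exact: enorm_ge0.
have h2 : - (rho * (t - s) * (s' - s)) <= rho * (2 * r0) * `|s' - s|.
  rewrite -mulrA -mulrN -mulrA; apply: ler_wpM2l => //.
  by apply: le_trans (ler_norm _) _; rewrite normrN normrM; apply: ler_wpM2r.
have h3 : al / 2 * enorm (y' - y) ^+ 2 <= al / 2 * (2 * r0) * enorm (y' - y).
  have a20 : 0 <= al / 2 by rewrite divr_ge0.
  by rewrite expr2 -(mulrA (al / 2)); apply: ler_wpM2l => //; apply: ler_wpM2r => //; exact: enorm_ge0.
have h4 : rho / 2 * (s' - s) ^+ 2 <= rho / 2 * (2 * r0) * `|s' - s|.
  have p20 : 0 <= rho / 2 by rewrite divr_ge0.
  rewrite -(real_normK (num_real (s' - s))).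
  by rewrite expr2 -(mulrA (rho / 2)); apply: ler_wpM2l => //; apply: ler_wpM2r.
have e0 := enorm_ge0 (y' - y); have s0 := normr_ge0 (s' - s).
have r00 := r0_gt0; have a0 := al_ge0; have p0 := rho_ge0.
have z1 : 0 <= (al * (2 * r0) + al / 2 * (2 * r0)) * `|s' - s|.
  by apply: mulr_ge0 => //; rewrite -mulrDl mulr_ge0//; lra.
have z2 : 0 <= (rho * (2 * r0) + rho / 2 * (2 * r0)) * enorm (y' - y).
  by apply: mulr_ge0 => //; rewrite -mulrDl mulr_ge0//; lra.
rewrite /penK; lra.
Qed.

Lemma penK_ge0 : 0 <= penK.
Proof.
have r00 := r0_gt0; have a0 := al_ge0; have p0 := rho_ge0.
by rewrite /penK !addr_ge0// !mulr_ge0//; lra.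
Qed.

Lemma pen_sym t x s y : pen t x s y = pen s y t x.
Proof. by rewrite /pen enormB -(sqrrN (t - s)) opprB. Qed.

(** [phi] is the sup-convolution of [U], and it touches [v] from below at [(s1, y1)]. The maximizers
    [tm], [xm] are selected as functions since they yield the subgradients of [phi] and the points
    at which [U] will receive its jets. *)
Lemma supconv_ex : exists (tm : R -> 'cV[R]_k -> R) (xm : R -> 'cV[R]_k -> 'cV[R]_k) s1 y1,
  let phi s y := U (tm s y) (xm s y) - pen (tm s y) (xm s y) s y in
  [/\ forall s y, Q (tm s y) (xm s y),
      forall s y t x, Q s y -> Q t x -> U t x - pen t x s y <= phi s y,
      Q s1 y1,
      forall s y, Q s y -> v s1 y1 - phi s1 y1 <= v s y - phi s y &
      forall s y s' y', Q s y -> Q s' y' -> phi s y - phi s' y' <= penK * (`|s' - s| + enorm (y' - y))].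
Proof.
have Qz : Q that xhat by split=> //; rewrite subrr ?normr0 ?enorm0 ltW.
have Lz (e : R) : 0 < e -> exists2 r : R, 0 < r & forall z w : R, z < r -> w < r -> penK * (z + w) < e.
  move=> e0; have K0 := penK_ge0; have e2 : 0 < e / 2 by lra.
  exists (e / 2 / (penK + 1) / 2); first by rewrite !divr_gt0//; lra.
  move=> z w hz hw; apply: (@le_lt_trans _ _ (penK * (e / 2 / (penK + 1)))).
    by apply: ler_wpM2l => //; lra.
  by have := mul_small K0 e2; lra.
have H (p : R * 'cV[R]_k) : exists q : R * 'cV[R]_k, Q q.1 q.2 /\ (Q p.1 p.2 ->
   forall t x, Q t x -> U t x - pen t x p.1 p.2 <= U q.1 q.2 - pen q.1 q.2 p.1 p.2).
  have [Qp|nQ] := pselect (Q p.1 p.2); last by exists (that, xhat).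
  have [|||t [x [hq hm]]] := @usc_max R k Q (fun t x => U t x - pen t x p.1 p.2)
     (`|that| + `|T| + enorm xhat + r0) that xhat Qz; last by exists (t, x).
  - exact: boxQ_bnd.
  - exact: boxQ_closed.
  - move=> t x q1 e e0; have e2 : 0 < e / 2 by lra.
    have [ht _ _] := q1.
    have [r r1 hr] := (strip_uscP T U).1 U_usc t x ht _ e2.
    have [r2 r20 hr2] := Lz _ e2.
    exists (Num.min r r2); first by rewrite lt_min r1.
    move=> t' x' q2; rewrite !lt_min => /andP[g1 g2] /andP[g3 g4].
    have [ht' _ _] := q2.
    have := hr _ _ ht' g1 g3; have := hr2 _ _ g2 g4.
    have := pen_lip Qp q2 q1; rewrite -!(pen_sym _ _ p.1 p.2) (distrC t t') (enormB x x'); lra.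
have [qm hqm] := choice H.
pose tm s y := (qm (s, y)).1; pose xm s y := (qm (s, y)).2.
pose phi s y := U (tm s y) (xm s y) - pen (tm s y) (xm s y) s y.
have h1 s y : Q (tm s y) (xm s y) by have [] := hqm (s, y).
have h2 s y t x : Q s y -> Q t x -> U t x - pen t x s y <= phi s y.
  by move=> q1; have [_ h] := hqm (s, y); exact: h.
have h3 s y s' y' : Q s y -> Q s' y' -> phi s y - phi s' y' <= penK * (`|s' - s| + enorm (y' - y)).
  move=> q1 q2; have := h2 s' y' _ _ q2 (h1 s y); have := pen_lip (h1 s y) q1 q2; rewrite /phi; lra.
have [|||s1 [y1 [hq hm]]] := @usc_max R k Q (fun s y => phi s y - v s y)
     (`|that| + `|T| + enorm xhat + r0) that xhat Qz.
- exact: boxQ_bnd.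
- exact: boxQ_closed.
- move=> t x q1 e e0; have e2 : 0 < e / 2 by lra.
  have [ht _ _] := q1.
  have [r r1 hr] := (strip_lscP T v).1 v_lsc t x ht _ e2.
  have [r2 r20 hr2] := Lz _ e2.
  exists (Num.min r r2); first by rewrite lt_min r1.
  move=> t' x' q2; rewrite !lt_min => /andP[g1 g2] /andP[g3 g4].
  have [ht' _ _] := q2.
  have := hr _ _ ht' g1 g3; have := hr2 _ _ g2 g4.
  have := h3 _ _ _ _ q2 q1; rewrite (distrC t t') (enormB x x'); lra.
exists tm, xm, s1, y1; split=> // s y q1; have := hm s y q1; rewrite -/(phi _ _) -/(phi _ _); lra.
Qed.

End supconv.

Lemma dotvBZ (R : realType) k a1 (u : 'cV[R]_k) a2 w z :
  dotv (a1 *: u - a2 *: w) z = a1 * dotv u z - a2 * dotv w z.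
Proof. by rewrite dotvDl dotvNl !dotvZl. Qed.

Lemma sum_qf_shift (R : realType) k d (M : 'M[R]_k) c (S : 'M[R]_(k, d)) :
  \sum_l qf (M + c *: 1%:M) (col l S) = \sum_l qf M (col l S) + c * enorm S ^+ 2.
Proof.
rewrite enorm_sqr_col mulr_sumr -big_split /=.
by apply: eq_bigr => l _; rewrite qfD qfZ qf1.
Qed.

Tactic Notation "lra_on" hyp_list(hs) := revert hs; clear; intros; lra.
Tactic Notation "nra_on" hyp_list(hs) := revert hs; clear; intros; nra.

Section jets.
Variables (R : realType) (T : R) (k : nat).

(** When [x] moves by [e], let [y] move by the optimal [A *m e] of [quad_coupling]: the expansion of
    [Phi] at [y] then becomes one of [U] at [x]. The final inequality between [X] and [Y] is the
    matrix inequality of the theorem on sums. *)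
Lemma jet_transfer (U : R -> 'cV[R]_k -> R) (Phi : 'cV[R]_k -> R) that xhat t x s y
    (N rho et0 e1 C r1 r2 : R) (Y : 'M[R]_k) :
  0 < r1 -> 0 < r2 -> 0 < e1 -> Y^T = Y -> 0 <= rho -> 0 <= et0 ->
  (forall e, - (N - e1) * enorm e ^+ 2 <= qf Y e) ->
  (forall t' x' y', 0 <= t' <= T -> `|t' - t| < r1 -> enorm (x' - x) < r1 -> enorm (y' - y) < r1 ->
     U t' x' <= U t x + (Phi y' - Phi y) + N / 2 * (enorm (x' - y') ^+ 2 - enorm (x - y) ^+ 2)
      + rho / 2 * ((t' - s) ^+ 2 - (t - s) ^+ 2)
      + et0 * ((t' - that) ^+ 2 - (t - that) ^+ 2 + enorm (x' - xhat) ^+ 2 - enorm (x - xhat) ^+ 2)) ->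
  (forall e, enorm e <= r2 -> Phi (y + e) <= Phi y + N * dotv (x - y) e + 2^-1 * qf Y e + C * enorm e ^+ 3) ->
  exists X : 'M[R]_k,
    superjet T U t x (rho * (t - s) + 2 * et0 * (t - that))
      (N *: (x - y) + (2 * et0) *: (x - xhat)) (X + (2 * et0) *: 1%:M) /\
    forall e g, qf X e <= qf Y g + N * enorm (e - g) ^+ 2.
Proof.
move=> r10 r20 e10 Ys rho0 et00 hY hU hPhi.
have [A [X [Xs hX hXe]]] := quad_coupling Ys e10 hY.
exists X; split=> //; split.
  by apply/matrixP => a c; move/matrixP: Xs => /(_ a c); rewrite !mxE (eq_sym a) => ->.
move=> eps eps0; apply/near_strip.
have A0 := enorm_ge0 A.
pose K1 := `|C| * enorm A ^+ 3.
have K10 : 0 <= K1 by rewrite mulr_ge0// exprn_ge0.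
pose K2 := rho / 2 + et0.
have K20 : 0 <= K2 by rewrite /K2; lra.
pose rA := Num.min r1 r2 / 2 / (enorm A + 1).
have mr : 0 < Num.min r1 r2 / 2 by rewrite divr_gt0// lt_min r10.
exists (Num.min (Num.min r1 rA) (Num.min (eps / (K1 + 1)) (eps / (K2 + 1)))).
  by rewrite !lt_min r10 !divr_gt0//; lra.
move=> t' x' ht' /=; rewrite !lt_min => /andP[/andP[g1 g2] /andP[g3 g4]] /andP[/andP[g5 g6] /andP[g7 g8]].
pose e := x' - x.
have xe : x' = x + e by rewrite /e addrC subrK.
rewrite -/e in g5 g6 g7 g8.
have eE : x' - x = e by [].
clearbody e.
have eA : enorm (A *m e) <= Num.min r1 r2 / 2.
  apply: le_trans (enorm_mulv _ _) _.
  apply: (@le_trans _ _ (enorm A * rA)); first by apply: ler_wpM2l => //; exact: ltW.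
  exact: mul_small.
have m1 : Num.min r1 r2 <= r1 by rewrite ge_min lexx.
have m2 : Num.min r1 r2 <= r2 by rewrite ge_min lexx orbT.
have yA : y + A *m e - y = A *m e by rewrite addrAC subrr add0r.
have hA1 : enorm (y + A *m e - y) < r1 by rewrite yA; lra.
have hA2 : enorm (A *m e) <= r2 by lra.
have g5' : enorm (x' - x) < r1 by rewrite eE.
have b1 := hU t' x' (y + A *m e) ht' g1 g5' hA1.
have b2 := hPhi _ hA2.
have E1 : enorm (x' - (y + A *m e)) ^+ 2 = enorm (x - y) ^+ 2 + 2 * (dotv (x - y) e - dotv (x - y) (A *m e)) + enorm (e - A *m e) ^+ 2.
  have -> : x' - (y + A *m e) = (x - y) + (e - A *m e) by rewrite xe opprD addrACA.
  by rewrite (enorm_sqrD (x - y)) dotvDr dotvNr.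
have E2 : enorm (x' - xhat) ^+ 2 = enorm (x - xhat) ^+ 2 + 2 * dotv (x - xhat) e + enorm e ^+ 2.
  have -> : x' - xhat = (x - xhat) + e by rewrite xe addrAC.
  by rewrite enorm_sqrD.
have e3 : C * enorm (A *m e) ^+ 3 <= eps * enorm e ^+ 2.
  apply: (@le_trans _ _ (`|C| * (enorm A * enorm e) ^+ 3)).
    apply: (@le_trans _ _ (`|C| * enorm (A *m e) ^+ 3)).
      by apply: ler_wpM2r (ler_norm _); rewrite exprn_ge0 ?enorm_ge0.
    by apply: ler_wpM2l => //; apply: lerXn2r; rewrite ?nnegrE ?mulr_ge0 ?enorm_ge0 ?enorm_mulv.
  rewrite exprMn mulrA -/K1 [enorm e ^+ 3]exprSr (mulrC (enorm e ^+ 2)) mulrA.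
  apply: ler_wpM2r; first exact: sqr_ge0.
  apply: le_trans (ler_wpM2l K10 (ltW g7)) _; exact: mul_small.
have t3 : K2 * (t' - t) ^+ 2 <= eps * `|t' - t|.
  rewrite -(real_normK (num_real (t' - t))) expr2 mulrA; apply: ler_wpM2r => //.
  apply: le_trans (ler_wpM2l K20 (ltW g4)) _; exact: mul_small.
have XE := hX e.
rewrite /taylor2 -/(qf _ _) eE qfD qfZ qf1 !dotvE_ XE.
rewrite E1 E2 in b1.
have T1 : (t' - s) ^+ 2 - (t - s) ^+ 2 = 2 * (t - s) * (t' - t) + (t' - t) ^+ 2 by ring.
have T2 : (t' - that) ^+ 2 - (t - that) ^+ 2 = 2 * (t - that) * (t' - t) + (t' - t) ^+ 2 by ring.
rewrite T1 in b1.
rewrite /K2 in t3; rewrite !(dotvDl, dotvNl) in b1 b2 *.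
apply: (le_trans b1); rewrite T2.
move: (enorm (e - A *m e) ^+ 2) (enorm (x - xhat) ^+ 2) (enorm (x - y) ^+ 2) (enorm e ^+ 2) (C * _) e3 b2 => *.
move: ((t' - t) ^+ 2) t3 => *; lra.
Qed.

End jets.

(** Stands for the theorem on sums. Instead of a jet of the lower limit, the equation of the scheme
    is used at a point where the sup-convolution of [U] touches it; the jet obtained there is
    carried over to [U], and the difference of the coefficients at the two points is estimated by
    [err_bound]. *)
Lemma superjet_at_max (R : realType) (T : R) (k d m : nat) (b : R -> 'cV[R]_k -> 'cV[R]_k)
    (sigma : R -> 'cV[R]_k -> 'M[R]_(k, d)) (Cg CL : R) (A : schemes R k m)
    (F : driver R k d m) h (i : 'I_m) U that xhat r0 G CG C5 :
  0 < T -> 0 <= Cg -> 0 <= CL ->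
  (forall (t : R) x, 0 <= t <= T -> enorm (b t x) + enorm (sigma t x) <= Cg * (1 + enorm x)) ->
  (forall (t : R) x x', 0 <= t <= T ->
    enorm (b t x - b t x') + enorm (sigma t x - sigma t x') <= CL * enorm (x - x')) ->
  strip_continuous T b -> strip_continuous T sigma ->
  strip_usc T U -> 0 <= that < T -> 0 < r0 ->
  (forall t x, boxQ T that xhat r0 t x ->
     U t x - lowlim T A i t x <= U that xhat - lowlim T A i that xhat) ->
  lower_scheme T b sigma A F -> lower_terminal A h ->
  (forall x (e : R), 0 < e -> exists2 e1 : R, 0 < e1 &
     forall y, enorm (y - x) < e1 -> `|h i y - h i x| < e) ->
  0 <= CG -> (forall z z', `|G z - G z'| <= CG * enorm (z - z')) ->
  (forall eta : R, 0 < eta -> exists2 rr : R, 0 < rr & exists n1, forall n t xi (c : 'I_m -> R),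
     (n1 <= n)%N -> 0 <= t <= T -> `|t - that| < rr -> enorm (xi - xhat) < rr ->
     `|c i - lowlim T A i that xhat| < rr ->
     (forall l, l != i -> lowlim T A l that xhat - rr <= c l) ->
     forall z, G z - eta <= F n i t xi (\col_l c l) z) ->
  0 <= C5 -> (forall n t xi (c : 'I_m -> R) z, 0 <= t <= T ->
     - (C5 * nn R n * (1 + \sum_l `|c l| + psi (bP A) xi + enorm z))
      <= F n i t xi (\col_l c l) z) ->
  forall eta : R, 0 < eta -> exists t x p q X,
    [/\ 0 <= t < T, `|t - that| < eta, enorm (x - xhat) < eta, `|U t x - U that xhat| < eta &
      superjet T U t x p q X] /\
    - eta <= - p - generator b sigma t x q X - G ((sigma t x)^T *m q).
Proof.
move=> T_gt0 Cg_ge0 CL_ge0 bs_growth bs_lip b_cont sigma_cont Uusc /andP[t0 tT] r00 hmax sF tmn hcont CG0 Glip Hloc C50 Fgr eta eta0.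
have that_in : 0 <= that <= T by rewrite t0 ltW.
have vl l : strip_lsc T (lowlim T A l) by exact: (lowlim_lsc T_gt0).
have x0 := enorm_ge0 xhat.
have [Cs Cs0 hCs] : exists2 Cs : R, 0 <= Cs & forall (t : R) x, 0 <= t <= T -> enorm (x - xhat) <= 1 ->
    enorm (b t x) + enorm (sigma t x) <= Cs.
  exists (Cg * (2 + enorm xhat)); first by apply: mulr_ge0 => //; lra.
  move=> t x ht hx; apply: le_trans (bs_growth t x ht) _; apply: ler_wpM2l => //.
  by have := enorm_le_add x xhat; lra.
have [et0 [et00 et01 etC]] : exists et0 : R, [/\ 0 < et0, et0 <= 1 & et0 * Cs ^+ 2 <= eta / 16].
  have c2 := sqr_ge0 Cs; have c1 : 0 < Cs ^+ 2 + 1 by lra.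
  have e16 : 0 < eta / 16 by rewrite divr_gt0.
  exists (Num.min 1 (eta / 16 / (Cs ^+ 2 + 1))); split.
  - by rewrite lt_min ltr01 divr_gt0.
  - by rewrite ge_min lexx.
  - rewrite mulrC; apply: (@le_trans _ _ (Cs ^+ 2 * (eta / 16 / (Cs ^+ 2 + 1)))).
      by apply: ler_wpM2l => //; rewrite ge_min lexx orbT.
    exact: mul_small.
(* Makes the maximum strict; [et0] is small enough for its contribution to the diffusion term,
   bounded by [et0 * Cs ^+ 2], to be negligible. *)
pose Ut t x := U t x - et0 * ((t - that) ^+ 2 + enorm (x - xhat) ^+ 2).
have Utusc : strip_usc T Ut.
  apply/strip_uscP => t x ht e e0; have e2 : 0 < e / 2 by lra.
  have [r1 r10 hr1] := (strip_uscP T U).1 Uusc t x ht _ e2.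
  have [r2 r20 hr2] := sqd_cont that xhat t x e2.
  exists (Num.min r1 r2); first by rewrite lt_min r10.
  move=> t' x' ht'; rewrite !lt_min => /andP[g1 g2] /andP[g3 g4].
  have g6 := hr1 _ _ ht' g1 g3; have := hr2 _ _ g2 g4; rewrite /Ut.
  move: (_ + enorm (x' - xhat) ^+ 2) (_ + enorm (x - xhat) ^+ 2) => X' X g5.
  have : et0 * (X - X') <= et0 * (e / 2) by apply: ler_wpM2l; [exact: ltW|lra_on g5].
  have : et0 * (e / 2) <= e / 2 by apply: ler_piMl; [exact: ltW|].
  lra_on g6.
pose v := lowlim T A i.
pose m0 := U that xhat - v that xhat.
have UtE : Ut that xhat = U that xhat.
  by rewrite /Ut !subrr enorm0 expr0n /= addr0 mulr0 subr0.
have Um t x : boxQ T that xhat r0 t x -> Ut t x - v t x + et0 * ((t - that) ^+ 2 + enorm (x - xhat) ^+ 2) <= m0.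
  by move=> /hmax; rewrite /Ut /m0 -/v; lra.
have Ue : Ut that xhat - v that xhat = m0 by rewrite UtE.
have eta8 : 0 < eta / 8 by rewrite divr_gt0.
have eta84 : 0 < eta / 8 / 4 by rewrite divr_gt0.
have [ep1 ep10 [K1 hK1]] := err_bound CL_ge0 CG0 eta8.
have [rr rr0 [n1 hloc]] := Hloc _ eta84.
have rr2 : 0 < rr / 2 by rewrite divr_gt0.
have Hl l : exists2 r : R, 0 < r & forall t' x', 0 <= t' <= T -> `|t' - that| < r -> enorm (x' - xhat) < r ->
    lowlim T A l that xhat - rr / 2 < lowlim T A l t' x'.
  exact: ((strip_lscP T _).1 (vl l)).
have [rl rl0 hrl] : exists2 r : 'I_m -> R, forall l, 0 < r l & forall l t' x', 0 <= t' <= T ->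
   `|t' - that| < r l -> enorm (x' - xhat) < r l -> lowlim T A l that xhat - rr / 2 < lowlim T A l t' x'.
  have /choice [f hf] l : exists r : R, 0 < r /\ forall t' x', 0 <= t' <= T -> `|t' - that| < r -> enorm (x' - xhat) < r ->
    lowlim T A l that xhat - rr / 2 < lowlim T A l t' x' by have [r a1 a2] := Hl l; exists r.
  by exists f => l; [exact: (hf l).1|exact: (hf l).2].
have [rm rm0 hrm] := fin_lb rl0.
pose C9 := 2 + 2 * (1 + CG) * Cs.
have C90 : 0 <= C9 by rewrite /C9 addr_ge0// !mulr_ge0//; lra_on CG0.
have C9E : C9 = 2 + 2 * (1 + CG) * Cs by [].
clearbody C9.
have [ep [ep0 [pa pb pc] [pd pe pf0] [pg pk]]] : exists ep : R, [/\ 0 < ep,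
   [/\ ep <= ep1, ep <= rr / 2 & ep <= rm], [/\ ep <= r0 / 4, ep <= 1 / 4 & ep <= eta / 4] &
   C9 * ep <= eta / 8 /\ ep <= T - that].
  exists (Num.min (Num.min (Num.min ep1 (rr / 2)) (Num.min rm (r0 / 4)))
     (Num.min (Num.min (1 / 4) (eta / 4)) (Num.min (eta / 8 / (C9 + 1)) (T - that)))).
  split; first by rewrite !lt_min ep10 rr2 rm0 !divr_gt0// ?subr_gt0//; lra_on C90.
  - by rewrite !ge_min !lexx !orbT.
  - by rewrite !ge_min !lexx !orbT.
  - split; last by rewrite !ge_min !lexx !orbT.
    apply: (@le_trans _ _ (C9 * (eta / 8 / (C9 + 1)))); last exact: mul_small.
    by apply: ler_wpM2l => //; rewrite !ge_min !lexx !orbT.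
have [a0 ha0] := dbl_conv Utusc (vl i) et00 Um Ue ep0.
pose C10 := 2 + 2 * Cs ^+ 2 + 2 * (1 + CG) * Cs.
have C10E : C10 = 2 + 2 * Cs ^+ 2 + 2 * (1 + CG) * Cs by [].
clearbody C10.
have [n3 hn3] := nn_large_all [:: K1; C10 / (eta / 8)].
pose a := maxn a0 n3.
have /= /andP[k1 /andP[k2 _]] := hn3 a (leq_maxr _ _).
have {}ha0 := ha0 a (leq_maxl _ _).
have N1 := nn_ge1 R a; have N0 := nn_gt0 R a.
have {}k2 := nn_div eta8 k2.
move: (nn R a) ha0 k1 k2 N1 N0 => N ha0 k1 k2 N1 N0.
have I0 : 0 < N^-1 by rewrite invr_gt0.
have I1 : N^-1 <= 1 by rewrite invf_le1.
have NI : N * N^-1 = 1 by rewrite divff// gt_eqF.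
have I20 : 0 < (N^-1) ^+ 2 by rewrite exprn_gt0.
have I2I : (N^-1) ^+ 2 <= N^-1 by rewrite expr2 ler_piMl// ltW.
have [rw1 rw10 hrw1] := @time_mod R T k _ _ b (enorm xhat + 1) _ b_cont I20.
have [rw2 rw20 hrw2] := @time_mod R T k _ _ sigma (enorm xhat + 1) _ sigma_cont I20.
pose rw := Num.min rw1 rw2.
have rw0 : 0 < rw by rewrite lt_min rw10.
(* The time modulus [rw] corresponds to the accuracy [N^-2] and depends on [N]. Since the whole
   penalty stays below 1, this [rho] forces the times to within [rw / 2]. *)
pose rho := N + 8 / rw ^+ 2.
have w20 : 0 < rw ^+ 2 by rewrite exprn_gt0.
have rho8 : 8 / rw ^+ 2 <= rho by rewrite lerDr ltW.
have rhoN : N <= rho by rewrite lerDl divr_ge0// ltW.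
have rho0 : 0 <= rho by apply: le_trans rhoN; exact: ltW.
clearbody rho.
have [tm [xm [s1 [y1 [h1 h2 h3 h4 h5]]]]] := supconv_ex xhat that_in r00 Utusc (vl i) (ltW N0) rho0.
set phi := (fun s y => Ut (tm s y) (xm s y) - pen N rho (tm s y) (xm s y) s y) in h2 h4 h5.
have Qz : boxQ T that xhat r0 that xhat by split=> //; rewrite subrr ?normr0 ?enorm0 ltW.
have K0 := penK_ge0 r00 (ltW N0) rho0.
set K := penK r0 N rho in h5 K0.
have vphi : v s1 y1 - phi s1 y1 <= - m0.
  apply: le_trans (h4 _ _ Qz) _.
  have := h2 _ _ _ _ Qz Qz; rewrite {1}/pen !subrr enorm0 expr0n /= !mulr0 addr0 subr0.
  rewrite /m0 UtE -/v; clear; lra.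
have conv t x : boxQ T that xhat r0 t x -> pen N rho t x s1 y1 <= Ut t x - v s1 y1 - m0 + N^-1 ->
   [/\ `|t - that| < ep, enorm (x - xhat) < ep, `|s1 - that| < ep & enorm (y1 - xhat) < ep] /\
   [/\ pen N rho t x s1 y1 < ep, `|Ut t x - U that xhat| < ep & `|v s1 y1 - v that xhat| < ep].
  by move=> q1 q2; have := ha0 N rho t x s1 y1 (lexx _) rhoN q1 h3 q2; rewrite UtE.
have [[_ _ cs1 cy1] [_ _ cv1]] := conv _ _ (h1 s1 y1) (ltac:(by move: vphi I0; rewrite /phi; clear; lra)).
have s1in : 0 <= s1 <= T by case: h3.
pose e1 := N^-1.
(* Subtracting [e1] times the squared distance makes the contact at [(s1, y1)] strict, as [touch]
   requires. *)
pose phi' s y := phi s y - e1 * ((s - s1) ^+ 2 + enorm (y - y1) ^+ 2).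
pose pf s y := rho * (tm s y - s) - 2 * e1 * (s - s1).
pose qv s y := N *: (xm s y - y) - (2 * e1) *: (y - y1).
pose dl := Num.min (Num.min ep (rw / 2)) (Num.min ((N^-1) ^+ 2) (N^-1 / 4 / (K + 1))).
have dl0 : 0 < dl by rewrite !lt_min ep0 !divr_gt0//; lra_on K0.
have [dla dlb dlc] : [/\ dl <= ep, dl <= rw / 2 & dl <= (N^-1) ^+ 2] by rewrite !ge_min !lexx !orbT.
have dld : K * dl <= N^-1 / 4.
  apply: (@le_trans _ _ (K * (N^-1 / 4 / (K + 1)))).
    by apply: ler_wpM2l => //; rewrite !ge_min !lexx !orbT.
  by apply: mul_small => //; lra_on I0.
clearbody dl.
have r02 : 0 < r0 / 2 by rewrite divr_gt0.
have Qsub s y : boxQ T s1 y1 (r0 / 2) s y -> boxQ T that xhat r0 s y.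
  move=> [q1 q2 q3]; split=> //.
    by have := ler_distD s1 s that; lra_on q2 cs1 pd r00.
  by have := enorm_tri y y1 xhat; lra_on q3 cy1 pd r00.
pose B := (N + rho + 2) * (2 * r0 + 1).
have B0 : 0 <= B by rewrite mulr_ge0//; lra_on N0 rho0 r00.
have phi_sc s y : boxQ T s1 y1 (r0 / 2) s y -> [/\ `|pf s y| <= B, enorm (qv s y) <= B &
  forall s' y', boxQ T s1 y1 (r0 / 2) s' y' ->
    phi' s y + pf s y * (s' - s) + dotv (qv s y) (y' - y)
      - B * ((s' - s) ^+ 2 + enorm (y' - y) ^+ 2) <= phi' s' y'].
  move=> Q1; have [_ q1 q2] := Q1; have q3 := h1 s y.
  have [d1 d2] := boxQ_diam q3 (Qsub _ _ Q1).
  have e10 : 0 <= e1 := ltW I0.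
  have e11 : e1 <= 1 by [].
  split.
  - apply: le_trans (ler_normB _ _) _; rewrite normrM (ger0_norm rho0) -mulrA normrM (@ger0_norm _ 2)// normrM (ger0_norm e10).
    have := ler_pM rho0 (normr_ge0 _) (lexx rho) d1.
    have := ler_pM e10 (normr_ge0 (s - s1)) e11 q1.
    have := mulr_ge0 rho0 (ltW r00); have := mulr_ge0 (ltW N0) (ltW r00); rewrite /B; lra_on N0 r00 rho0.
  - apply: le_trans (enormD _ _) _; rewrite enormN !enormZ (gtr0_norm N0) ger0_norm; last by rewrite mulr_ge0.
    have := ler_pM (ltW N0) (enorm_ge0 _) (lexx N) d2.
    have := ler_pM e10 (enorm_ge0 (y - y1)) e11 q2.
    have := mulr_ge0 rho0 (ltW r00); have := mulr_ge0 (ltW N0) (ltW r00); rewrite /B -mulrA; lra_on N0 r00 rho0.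
  - move=> s' y' Q2; have := h2 s' y' _ _ (Qsub _ _ Q2) q3.
    rewrite (pen_expand N rho (tm s y) (xm s y) s y).
    have E1 : (s' - s1) ^+ 2 = (s - s1) ^+ 2 + 2 * (s - s1) * (s' - s) + (s' - s) ^+ 2 by ring.
    have E2 : enorm (y' - y1) ^+ 2 = enorm (y - y1) ^+ 2 + 2 * dotv (y - y1) (y' - y) + enorm (y' - y) ^+ 2.
      by rewrite -enorm_sqrD; congr (enorm _ ^+ 2); rewrite [RHS]addrC addrA subrK.
    have E3 : dotv (qv s y) (y' - y) = N * dotv (xm s y - y) (y' - y) - 2 * e1 * dotv (y - y1) (y' - y).
      exact: dotvBZ.
    rewrite -/(phi s' y') /phi' E1 E2 E3 /pf.
    have S0 := sqr_ge0 (s' - s); have Y0 := sqr_ge0 (enorm (y' - y)).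
    rewrite {2}/phi.
    have B1 : N / 2 + e1 <= B.
      by have := mulr_ge0 rho0 (ltW r00); have := mulr_ge0 (ltW N0) (ltW r00); rewrite /B; lra_on N0 r00 rho0 e11.
    have B2 : rho / 2 + e1 <= B.
      by have := mulr_ge0 rho0 (ltW r00); have := mulr_ge0 (ltW N0) (ltW r00); rewrite /B; lra_on N0 r00 rho0 e11.
    have := ler_wpM2r Y0 B1; have := ler_wpM2r S0 B2.
    move: ((s' - s) ^+ 2) (enorm (y' - y) ^+ 2) ((s - s1) ^+ 2) (enorm (y - y1) ^+ 2) (dotv _ _) (dotv _ _).
    clear; move=> *; lra.
have phi_min s y : boxQ T s1 y1 (r0 / 2) s y ->
  lowlim T A i s1 y1 - phi' s1 y1 + e1 * ((s - s1) ^+ 2 + enorm (y - y1) ^+ 2)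
    <= lowlim T A i s y - phi' s y.
  move=> Q1; have E0 : phi' s1 y1 = phi s1 y1 by rewrite /phi' !subrr enorm0 expr0n /= addr0 mulr0 subr0.
  have E1 : phi' s y = phi s y - e1 * ((s - s1) ^+ 2 + enorm (y - y1) ^+ 2) by [].
  have : lowlim T A i s1 y1 - phi s1 y1 <= lowlim T A i s y - phi s y := h4 _ _ (Qsub _ _ Q1).
  by rewrite E0 E1; clear; move: (phi s1 y1) (phi s y) => *; lra.
have s1T : s1 < T \/ lowlim T A i s1 y1 < h i y1.
  by left; have := ler_norm (s1 - that); lra_on cs1 pk.
have hl1 : exists2 rr : R, 0 < rr & exists n1, forall n t xi (c : 'I_m -> R),
     (n1 <= n)%N -> 0 <= t <= T -> `|t - s1| < rr -> enorm (xi - y1) < rr ->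
     `|c i - lowlim T A i s1 y1| < rr -> (forall l, l != i -> c l = lowlim T A l s1 y1 - rr) ->
     forall z, G z - (eta / 8) / 4 <= F n i t xi (\col_l c l) z.
  exists (rr / 2) => //; exists n1 => n t xi c hn ht g1 g2 g3 g4; apply: hloc => //.
  - by have := ler_distD s1 t that; lra_on g1 cs1 pb.
  - by have := enorm_tri xi y1 xhat; lra_on g2 cy1 pb.
  - by have := ler_distD (lowlim T A i s1 y1) (c i) (lowlim T A i that xhat); rewrite /v in cv1; lra_on g3 cv1 pb.
  - move=> l li; rewrite g4//.
    have := hrl l s1 y1 s1in (ltac:(have := hrm l; lra_on cs1 pc)) (ltac:(have := hrm l; lra_on cy1 pc)); clear; lra.
have := touch T_gt0 Cg_ge0 bs_growth s1in r02 I0 B0 phi_sc phi_min sF tmn (hcont y1) s1T CG0 Glip eta8 dl0 hl1 C50 Fgr.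
move=> [s [y [xi [Y [C [r' [[shT cs cy cxi] Ys r'0 hY hI]]]]]]].
have sin : 0 <= s <= T by move: shT => /andP[-> /ltW ->].
have Qs1 : boxQ T s1 y1 (r0 / 2) s y by split=> //; [lra_on cs dla pd r00|lra_on cy dla pd r00].
have Qs := Qsub _ _ Qs1.
have Qt := h1 s y.
have pl := pen_lip r00 (ltW N0) rho0 Qt Qs h3; rewrite -/K in pl.
have pl2 := h5 _ _ _ _ h3 Qs.
rewrite (distrC s1 s) (enormB y1 y) in pl.
have Kd : K * (`|s - s1| + enorm (y - y1)) <= N^-1 / 2.
  by have : K * (`|s - s1| + enorm (y - y1)) <= K * (2 * dl) by [apply: ler_wpM2l => //; lra_on cs cy]; lra_on dld.
have phE : phi s y = Ut (tm s y) (xm s y) - pen N rho (tm s y) (xm s y) s y by [].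
move: h1 Qt pl phE => _.
(* [touch] returns a contact point [(s, y)] near [(s1, y1)] and not that point itself. As [phi] and
   [pen] are Lipschitz with constant [K], the maximizer attached to [(s, y)] is still almost optimal
   against [(s1, y1)], so [conv] applies to it. *)
have conv2 : boxQ T that xhat r0 (tm s y) (xm s y) ->
   pen N rho (tm s y) (xm s y) s1 y1 - pen N rho (tm s y) (xm s y) s y <= K * (`|s - s1| + enorm (y - y1)) ->
   phi s y = Ut (tm s y) (xm s y) - pen N rho (tm s y) (xm s y) s y ->
   pen N rho (tm s y) (xm s y) s1 y1 <= Ut (tm s y) (xm s y) - v s1 y1 - m0 + N^-1.
  have pl3 : phi s1 y1 - phi s y <= K * (`|s - s1| + enorm (y - y1)) := pl2.
  move=> _ z1 z2; move: z1 z2 Kd pl3 vphi; clear.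
  move: (phi s1 y1) (phi s y) (Ut _ _) (v s1 y1) (pen _ _ _ _ s1 y1) (pen _ _ _ _ s y) => *; lra.
move=> Qt pl phE; have [[ct cx _ _] [cp cU _]] := conv _ _ Qt (conv2 Qt pl phE).
clear conv2 conv pl pl2 Kd.
have qvE : qv s y = N *: (xm s y - y) - (2 * e1) *: (y - y1) by [].
have pfE : pf s y = rho * (tm s y - s) - 2 * e1 * (s - s1) by [].
have h2' t' x' y' := h2 s y' t' x'.
have pexp y' := pen_expand N rho (tm s y) (xm s y) s y s y'.
move: (tm s y) (xm s y) Qt phE ct cx cp cU qvE pfE pexp => t x Qt phE ct cx cp cU qvE pfE pexp.
have tin : 0 <= t <= T by case: Qt.
(* Two [e1] undo the Hessian of the correction in [phi']. Since [phi] lies above a paraboloid of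
   Hessian [- N] touching it at [y], the result is at least [- N]; the third [e1] gives the strict
   bound needed by [jet_transfer]. *)
pose Y2 := Y + (3 * e1) *: 1%:M.
have Y2s : Y2^T = Y2.
  by apply/matrixP => p q; move/matrixP: Ys => /(_ p q); rewrite !mxE (eq_sym p) => ->.
have e10 : 0 < e1 by [].
have yQ e : enorm e <= r0 / 4 -> boxQ T that xhat r0 s (y + e).
  move=> he; split=> //; first by case: Qs.
  have yE : y + e - y = e by rewrite addrC addKr.
  have := enorm_tri (y + e) y xhat; rewrite yE.
  have := enorm_tri y y1 xhat; lra_on he cy cy1 dla pd r00.
have hPhi0 e : enorm e <= r' -> phi s (y + e) <= phi s y + N * dotv (x - y) e + 2^-1 * qf (Y + (2 * e1) *: 1%:M) e + C * enorm e ^+ 3.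
  move=> /hY; rewrite /phi' qvE qfD qfZ qf1 dotvBZ.
  have -> : enorm (y + e - y1) ^+ 2 = enorm (y - y1) ^+ 2 + 2 * dotv (y - y1) e + enorm e ^+ 2.
    by rewrite (addrAC y) (enorm_sqrD (y - y1)).
  by clear; move: (phi _ _) (phi _ _) => *; lra.
have hPhi e : enorm e <= r' -> phi s (y + e) <= phi s y + N * dotv (x - y) e + 2^-1 * qf Y2 e + C * enorm e ^+ 3.
  move=> /hPhi0; rewrite /Y2 !qfD !qfZ qf1.
  by have := mulr_ge0 (ltW e10) (sqr_ge0 (enorm e)); clear; move: (phi _ _) (phi _ _) => *; lra.
have hY2 e : - (N - e1) * enorm e ^+ 2 <= qf Y2 e.
  have r1p : 0 < Num.min r' (r0 / 4) by rewrite lt_min r'0 divr_gt0.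
  have := @qf_lower R k (Y + (2 * e1) *: 1%:M) (N / 2) C _ r1p _ e.
  rewrite /Y2 !qfD !qfZ !qf1 => H0.
  have : - (2 * (N / 2)) * enorm e ^+ 2 <= qf Y e + 2 * e1 * enorm e ^+ 2; last by clear; lra.
  apply: H0 => e'; rewrite le_min => /andP[g1 g2].
  have yE : y + e' - y = e' by rewrite addrC addKr.
  have : Ut t x - pen N rho t x s (y + e') <= phi s (y + e') := h2' _ _ _ (yQ _ g2) Qt.
  have := hPhi0 _ g1; rewrite pexp phE yE subrr expr0n /= !mulr0 !addr0 subr0 qfD qfZ qf1.
  by clear; move: (phi _ _) (Ut _ _) (pen _ _ _ _ _ _) => *; lra.
have hU t' x' y' : 0 <= t' <= T -> `|t' - t| < r0 / 4 -> enorm (x' - x) < r0 / 4 -> enorm (y' - y) < r0 / 4 ->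
     U t' x' <= U t x + (phi s y' - phi s y) + N / 2 * (enorm (x' - y') ^+ 2 - enorm (x - y) ^+ 2)
      + rho / 2 * ((t' - s) ^+ 2 - (t - s) ^+ 2)
      + et0 * ((t' - that) ^+ 2 - (t - that) ^+ 2 + enorm (x' - xhat) ^+ 2 - enorm (x - xhat) ^+ 2).
  move=> g1 g2 g3 g4.
  have Q1 : boxQ T that xhat r0 t' x'.
    split=> //; first by have := ler_distD t t' that; lra_on g2 ct pd r00.
    by have := enorm_tri x' x xhat; lra_on g3 cx pd r00.
  have Q2 : boxQ T that xhat r0 s y'.
    by have := yQ (y' - y) (ltW g4); rewrite addrC subrK.
  have : Ut t' x' - pen N rho t' x' s y' <= phi s y' := h2' _ _ _ Q2 Q1.
  by rewrite phE /pen /Ut; clear; move: (phi _ _) => *; lra.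
have r04 : 0 < r0 / 4 by rewrite divr_gt0.
have [X [hsup hXe]] := jet_transfer r04 r'0 e10 Y2s rho0 (ltW et00) hY2 hU hPhi.
have ep1' : ep <= 1 by lra_on pe.
exists t, x, (rho * (t - s) + 2 * et0 * (t - that)), (N *: (x - y) + (2 * et0) *: (x - xhat)), (X + (2 * et0) *: 1%:M).
split.
  split=> //.
  - by case/andP: tin => -> _ /=; have := ler_norm (t - that); lra_on ct pk.
  - by lra_on ct pf0 ep0.
  - by lra_on cx pf0 ep0.
  - have q1 : (t - that) ^+ 2 <= ep.
      rewrite -(real_normK (num_real (t - that))); have := normr_ge0 (t - that); move: (`|t - that|) ct => z; nra_on ep1'.
    have q2 : enorm (x - xhat) ^+ 2 <= ep.
      have := enorm_ge0 (x - xhat); move: (enorm (x - xhat)) cx => z; nra_on ep1'.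
    have q3 : 0 <= et0 * ((t - that) ^+ 2 + enorm (x - xhat) ^+ 2) by rewrite mulr_ge0 ?addr_ge0 ?sqr_ge0// ltW.
    have q4 : et0 * ((t - that) ^+ 2 + enorm (x - xhat) ^+ 2) <= 2 * ep.
      apply: (@le_trans _ _ (1 * (2 * ep))); last by rewrite mul1r.
      by apply: ler_pM => //; [exact: ltW|rewrite addr_ge0 ?sqr_ge0|lra_on q1 q2].
    move: cU; rewrite /Ut !ltr_norml => /andP[u1 u2]; apply/andP; split; lra_on u1 u2 q3 q4 pf0 ep0.
pose dd := enorm (x - y1).
have dd0 : 0 <= dd := enorm_ge0 _.
have Nd : N * dd ^+ 2 <= 2 * ep1.
  move: cp; rewrite /pen -/dd; have : 0 <= rho / 2 * (t - s1) ^+ 2 by rewrite mulr_ge0 ?sqr_ge0// divr_ge0.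
  lra_on pa.
have ts1 : `|t - s1| < rw / 2.
  have h1 : 4 / rw ^+ 2 * (t - s1) ^+ 2 < 1.
    move: cp; rewrite /pen -/dd; have : 0 <= N / 2 * dd ^+ 2 by rewrite mulr_ge0 ?sqr_ge0// divr_ge0// ltW.
    have : 4 / rw ^+ 2 * (t - s1) ^+ 2 <= rho / 2 * (t - s1) ^+ 2.
      apply: ler_wpM2r; first exact: sqr_ge0.
      by move: rho8; rewrite -[8](_ : 4 * 2 = 8)//; [clear; lra|ring].
    lra_on pe.
  rewrite -[4](_ : 2 ^+ 2 = 4) in h1; last by ring.
  rewrite -expr_div_n -exprMn in h1.
  rewrite ltr_pdivlMr// mulrC.
  have h6 : `|2 / rw * (t - s1)| < 1.
    rewrite ltNge; apply/negP => hge; move: h1; apply/negP; rewrite -leNgt.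
    by rewrite -(real_normK (num_real (2 / rw * (t - s1)))) exprn_ege1.
  move: h6; rewrite normrM ger0_norm; last by rewrite divr_ge0// ltW.
  by rewrite mulrAC ltr_pdivrMr// mul1r.
have ts : `|t - s| < rw.
  by have := ler_distD s1 t s; rewrite (distrC s1 s); lra_on ts1 cs dlb.
have dd1 : dd <= 1.
  by have := enorm_tri x xhat y1; rewrite (enormB xhat y1) -/dd; lra_on cx cy1 pe.
have xy : enorm (x - y) <= dd + dl by have := enorm_tri x y1 y; rewrite (enormB y1 y) -/dd; lra_on cy.
have xxi : enorm (x - xi) <= dd + (N^-1) ^+ 2 by have := enorm_tri x y1 xi; rewrite (enormB y1 xi) -/dd; lra_on cxi dlc.
have xix : enorm (xi - xhat) <= 1 by have := enorm_tri xi y1 xhat; lra_on cxi cy1 dla pe.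
have xiM : enorm xi <= enorm xhat + 1 by have := enorm_le_add xi xhat; lra_on xix.
have xx1 : enorm (x - xhat) <= 1 by lra_on cx ep1'.
have hc1 := hCs t x tin xx1; have hc2 := hCs s xi sin xix.
have [rw1' rw2'] : rw <= rw1 /\ rw <= rw2 by rewrite /rw !ge_min !lexx !orbT.
have tb := hrw1 t s xi tin sin xiM (lt_le_trans ts rw1').
have tsg := hrw2 t s xi tin sin xiM (lt_le_trans ts rw2').
have lp := bs_lip t x xi tin.
pose D := CL * dd + (CL + 1) * (N^-1) ^+ 2.
have lpx : CL * enorm (x - xi) <= CL * dd + CL * (N^-1) ^+ 2 by rewrite -mulrDr; apply: ler_wpM2l.
have bD : enorm (b t x - b s xi) <= D.
  have := enorm_tri (b t x) (b t xi) (b s xi); have := enorm_ge0 (sigma t x - sigma t xi).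
  rewrite /D; lra_on tb lp lpx.
have sD : enorm (sigma t x - sigma s xi) <= D.
  have := enorm_tri (sigma t x) (sigma t xi) (sigma s xi); have := enorm_ge0 (b t x - b t xi).
  rewrite /D; lra_on tsg lp lpx.
have D0 : 0 <= D := le_trans (enorm_ge0 _) bD.
have qvN : enorm (qv s y) <= N * dd + 3 * N^-1.
  rewrite qvE; apply: le_trans (enormD _ _) _; rewrite enormN !enormZ (gtr0_norm N0) ger0_norm; last by rewrite mulr_ge0// ltW.
  have z1 : N * enorm (x - y) <= N * dd + N^-1.
    apply: (@le_trans _ _ (N * (dd + (N^-1) ^+ 2))); first by apply: ler_wpM2l; [exact: ltW|lra_on xy dlc].
    by rewrite mulrDr expr2 mulrA NI mul1r.
  have z2 : e1 * enorm (y - y1) <= N^-1 * 1.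
    apply: ler_pM => //; [exact: ltW|exact: enorm_ge0|lra_on cy dla ep1'].
  rewrite -mulrA; lra_on z1 z2.
have hb := hK1 N dd D (enorm (qv s y)) k1 N1 dd0 dd1 Nd D0 (lexx _) (enorm_ge0 _) qvN.
have sD2 : N / 2 * enorm (sigma t x - sigma s xi) ^+ 2 <= N / 2 * D ^+ 2.
  apply: ler_wpM2l; first by rewrite divr_ge0// ltW.
  by apply: lerXn2r; rewrite ?nnegrE// enorm_ge0.
set q := N *: (x - y) + (2 * et0) *: (x - xhat).
pose dq := (2 * et0) *: (x - xhat) + (2 * e1) *: (y - y1).
have qE : q = qv s y + dq.
  by rewrite qvE /q /dq addrACA addNr addr0.
have dqN : enorm dq <= 2 * ep + 2 * N^-1.
  apply: le_trans (enormD _ _) _; rewrite !enormZ !ger0_norm; try by rewrite mulr_ge0// ltW.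
  have z1 : et0 * enorm (x - xhat) <= 1 * ep by apply: ler_pM; [exact: ltW|exact: enorm_ge0| |exact: ltW].
  have z2 : e1 * enorm (y - y1) <= N^-1 * 1.
    apply: ler_pM => //; [exact: ltW|exact: enorm_ge0|lra_on cy dla ep1'].
  rewrite -!mulrA; lra_on z1 z2.
have S1 : \sum_l qf X (col l (sigma t x)) <= \sum_l qf Y2 (col l (sigma s xi)) + N * enorm (sigma t x - sigma s xi) ^+ 2.
  rewrite (enorm_sqr_col (sigma t x - sigma s xi)) mulr_sumr -big_split /=; apply: ler_sum => l _.
  have -> : col l (sigma t x - sigma s xi) = col l (sigma t x) - col l (sigma s xi).
    by apply/matrixP => p r; rewrite !mxE.
  exact: hXe.
rewrite /Y2 sum_qf_shift in S1.
rewrite generatorE sum_qf_shift.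
have b0 := enorm_ge0 (b t x); have s0 := enorm_ge0 (sigma t x).
have b0' := enorm_ge0 (b s xi); have s0' := enorm_ge0 (sigma s xi).
have ss1 : et0 * enorm (sigma t x) ^+ 2 <= eta / 16.
  apply: le_trans etC; apply: ler_wpM2l; first exact: ltW.
  by apply: lerXn2r; rewrite ?nnegrE//; lra_on hc1 b0.
have ss2 : e1 * enorm (sigma s xi) ^+ 2 <= Cs ^+ 2 * N^-1.
  rewrite mulrC; apply: ler_wpM2r; first exact: ltW.
  by apply: lerXn2r; rewrite ?nnegrE//; lra_on hc2 b0'.
have dq0 := enorm_ge0 dq; have qv0 := enorm_ge0 (qv s y).
have G1 : G ((sigma t x)^T *m q) - G ((sigma s xi)^T *m qv s y) <= CG * (Cs * (2 * ep + 2 * N^-1) + D * enorm (qv s y)).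
  apply: le_trans (ler_norm _) _; apply: le_trans (Glip _ _) _; apply: ler_wpM2l => //.
  have -> : (sigma t x)^T *m q - (sigma s xi)^T *m qv s y = (sigma t x)^T *m dq + (sigma t x - sigma s xi)^T *m qv s y.
    rewrite qE mulmxDr (_ : (sigma t x - sigma s xi)^T = (sigma t x)^T - (sigma s xi)^T); last first.
      by apply/matrixP => p r; rewrite !mxE.
    by rewrite mulmxBl addrA (addrC (_ *m dq)).
  apply: le_trans (enormD _ _) _; apply: lerD; apply: le_trans (enorm_trmulv _ _) _.
    by apply: ler_pM => //; lra_on hc1 b0.
  by apply: ler_pM => //; exact: enorm_ge0.
have B1 : dotv (b t x) q - dotv (b s xi) (qv s y) <= Cs * (2 * ep + 2 * N^-1) + D * enorm (qv s y).
  have -> : dotv (b t x) q - dotv (b s xi) (qv s y) = dotv (b t x) dq + dotv (b t x - b s xi) (qv s y).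
    by rewrite qE dotvDr dotvDl dotvNl; ring.
  apply: lerD; apply: le_trans (ler_norm _) _; apply: le_trans (dotv_CS _ _) _.
    by apply: ler_pM => //; lra_on hc1 s0.
  by apply: ler_pM => //; exact: enorm_ge0.
have P1 : rho * (t - s) + 2 * et0 * (t - that) - pf s y <= 2 * ep + 2 * N^-1.
  rewrite pfE.
  have z1 : et0 * (t - that) <= ep.
    apply: le_trans (ler_norm _) _; rewrite normrM (gtr0_norm et00) -[leRHS]mul1r.
    by apply: ler_pM; [exact: ltW|exact: normr_ge0| |exact: ltW].
  have z2 : e1 * (s - s1) <= N^-1.
    apply: le_trans (ler_norm _) _; rewrite normrM (gtr0_norm e10) -[leRHS]mulr1.
    by apply: ler_pM => //; [exact: ltW|lra_on cs dla ep1'].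
  lra_on z1 z2.
rewrite C10E mulrDl mulrDl in k2; rewrite C9E in pg.
have := mulr_ge0 (sqr_ge0 Cs) (ltW I0).
move: hI hb sD2 S1 ss1 ss2 G1 B1 P1 k2 pg I0 ep0 eta0.
rewrite -/e1.
move: (\sum_l qf X _) (\sum_l qf Y _) (enorm (sigma t x - sigma s xi) ^+ 2) (enorm (sigma t x) ^+ 2) (enorm (sigma s xi) ^+ 2).
move: (G _) (G _) (dotv _ _) (dotv _ _) (rho * (t - s) + 2 * et0 * (t - that)) (pf s y) (D ^+ 2) (D * _).
move: (Cs ^+ 2) => Cs2 v1 v2 v3 v4 v5 v6 v7 v8 v9 v10 v11 v12 v13.
clear.
move: (e1) => e2 *; lra.
Qed.

Lemma dotvBr_Z (R : realType) k (u : 'cV[R]_k) a w z :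
  dotv (u - a *: w) z = dotv u z - a * dotv w z.
Proof. by rewrite dotvDl dotvNl dotvZl. Qed.

(** * Viscosity inequalities for the lower limit *)

Section operator.
Variables (R : realType) (T : R) (k d : nat).
Variable b : R -> 'cV[R]_k -> 'cV[R]_k.
Variable sigma : R -> 'cV[R]_k -> 'M[R]_(k, d).

(** The equation without its obstacle; [G] is the driver as a function of [z] alone, with time,
    space and the components frozen. *)
Definition op (G : 'cV[R]_d -> R) t x p q M : R :=
  - p - generator b sigma t x q M - G ((sigma t x)^T *m q).

Lemma qf_diff (M : 'M[R]_k) (e g : 'cV[R]_k) :
  `|qf M e - qf M g| <= enorm M * (enorm e + enorm g) * enorm (e - g).
Proof.
have -> : qf M e - qf M g = dotv (e - g) (M *m e) + dotv g (M *m (e - g)).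
  by rewrite /qf mulmxBr dotvDl dotvNl dotvDr dotvNr; ring.
have h1 := dotv_CS (e - g) (M *m e); have h2 := dotv_CS g (M *m (e - g)).
have h3 := ler_wpM2l (enorm_ge0 (e - g)) (enorm_mulv M e).
have h4 := ler_wpM2l (enorm_ge0 g) (enorm_mulv M (e - g)).
apply: le_trans (ler_normD _ _) _; lra.
Qed.

Lemma qf_le (M : 'M[R]_k) (e : 'cV[R]_k) : `|qf M e| <= enorm M * enorm e ^+ 2.
Proof.
have := qf_diff M e 0; rewrite subr0 enorm0 addr0 /qf mulmx0.
have -> : dotv (0 : 'cV[R]_k) 0 = 0 by rewrite /dotv big1// => i _; rewrite !mxE mul0r.
by rewrite subr0 -mulrA expr2.
Qed.

Lemma op_cont (G : 'cV[R]_d -> R) (CG t0 : R) x0 (p : R) q M (w : R) :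
  strip_continuous T b -> strip_continuous T sigma ->
  0 <= CG -> (forall z z', `|G z - G z'| <= CG * enorm (z - z')) ->
  0 <= t0 <= T -> 0 < w ->
  exists2 dl : R, 0 < dl & forall (t : R) x (p' : R) q' M', 0 <= t <= T ->
    `|t - t0| < dl -> enorm (x - x0) < dl -> `|p' - p| <= dl -> enorm (q' - q) <= dl ->
    (forall e, `|qf M' e - qf M e| <= dl * enorm e ^+ 2) ->
    `|op G t x p' q' M' - op G t0 x0 p q M| <= w.
Proof.
move=> bc sc CG0 Gl ht w0.
pose S0 := enorm (sigma t0 x0); pose B0 := enorm (b t0 x0); pose Q := enorm q; pose Nm := enorm M.
have [s0 b0 q0 n0] : [/\ 0 <= S0, 0 <= B0, 0 <= Q & 0 <= Nm] by split; exact: enorm_ge0.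
pose C := 1 + 2^-1 * (S0 + 1) ^+ 2 + d%:R * (Nm * (2 * S0 + 1)) + (1 + CG) * (Q + 1 + B0 + S0).
have s2 := sqr_ge0 (S0 + 1).
have d0 : 0 <= d%:R * (Nm * (2 * S0 + 1)) :> R by rewrite !mulr_ge0//; lra_on s0.
have g0 : 0 <= (1 + CG) * (Q + 1 + B0 + S0) by rewrite mulr_ge0//; lra_on CG0 s0 b0 q0.
have C0 : 0 <= C by rewrite /C; lra_on s2 d0 g0.
pose e := Num.min 1 (w / (C + 1)).
have e0 : 0 < e by rewrite lt_min ltr01 divr_gt0//; lra_on C0.
have e1 : e <= 1 by rewrite ge_min lexx.
have eC : C * e <= w.
  apply: le_trans (mul_small C0 w0); apply: ler_wpM2l => //.
  by rewrite ge_min lexx orbT.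
clearbody e.
have [r1 r10 hb] := strip_contmx bc x0 ht e0.
have [r2 r20 hs] := strip_contmx sc x0 ht e0.
exists (Num.min (Num.min r1 r2) e); first by rewrite !lt_min r10 r20.
move=> t x p' q' M' tin; rewrite !lt_min !le_min => /andP[/andP[a1 a2] a3] /andP[/andP[c1 c2] c3].
move=> /andP[_ hp] /andP[_ hq] hM.
have hM' g : `|qf M' g - qf M g| <= e * enorm g ^+ 2.
  apply: le_trans (hM g) _; apply: ler_wpM2r; first exact: sqr_ge0.
  by rewrite ge_min lexx orbT.
have {hb} hb := hb t x tin a1 c1; have {hs} hs := hs t x tin a2 c2.
have sS : enorm (sigma t x) <= S0 + 1.
  by have := enorm_le_add (sigma t x) (sigma t0 x0); rewrite -/S0; lra_on hs e1.
have bB : enorm (b t x) <= B0 + 1.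
  by have := enorm_le_add (b t x) (b t0 x0); rewrite -/B0; lra_on hb e1.
have qQ : enorm q' <= Q + 1.
  by have := enorm_le_add q' q; rewrite -/Q; lra_on hq e1.
have K1 : `|dotv (b t x) q' - dotv (b t0 x0) q| <= e * (Q + 1) + B0 * e.
  have -> : dotv (b t x) q' - dotv (b t0 x0) q = dotv (b t x - b t0 x0) q' + dotv (b t0 x0) (q' - q).
    by rewrite dotvDl dotvNl dotvDr dotvNr; ring.
  apply: le_trans (ler_normD _ _) _; apply: lerD; apply: le_trans (dotv_CS _ _) _; apply: ler_pM;
    rewrite ?enorm_ge0//; exact: ltW.
have K2 : `|G ((sigma t x)^T *m q') - G ((sigma t0 x0)^T *m q)| <= CG * (e * (Q + 1) + S0 * e).
  apply: le_trans (Gl _ _) _; apply: ler_wpM2l => //.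
  have -> : (sigma t x)^T *m q' - (sigma t0 x0)^T *m q = (sigma t x - sigma t0 x0)^T *m q' + (sigma t0 x0)^T *m (q' - q).
    have -> : (sigma t x - sigma t0 x0)^T = (sigma t x)^T - (sigma t0 x0)^T.
      by apply/matrixP => i j; rewrite !mxE.
    by rewrite mulmxBl mulmxBr addrA subrK.
  apply: le_trans (enormD _ _) _; apply: lerD; apply: le_trans (enorm_trmulv _ _) _; apply: ler_pM;
    rewrite ?enorm_ge0//; exact: ltW.
have K3 : `|\sum_l qf M' (col l (sigma t x)) - \sum_l qf M (col l (sigma t x))| <= e * (S0 + 1) ^+ 2.
  rewrite -sumrB; apply: le_trans (ler_norm_sum _ _ _) _.
  apply: (@le_trans _ _ (e * enorm (sigma t x) ^+ 2)).
    by rewrite enorm_sqr_col mulr_sumr; apply: ler_sum => l _; exact: hM'.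
  by apply: ler_wpM2l; [exact: ltW|apply: lerXn2r; rewrite ?nnegrE ?enorm_ge0//; lra_on s0].
have K4 : `|\sum_l qf M (col l (sigma t x)) - \sum_l qf M (col l (sigma t0 x0))| <= d%:R * (Nm * (2 * S0 + 1)) * e.
  rewrite -sumrB; apply: le_trans (ler_norm_sum _ _ _) _.
  apply: (@le_trans _ _ (\sum_(l < d) Nm * (2 * S0 + 1) * e)); last first.
    by rewrite sumr_const card_ord -[X in X <= _]mulr_natl !mulrA.
  apply: ler_sum => l _; apply: le_trans (qf_diff _ _ _) _.
  have -> : col l (sigma t x) - col l (sigma t0 x0) = col l (sigma t x - sigma t0 x0).
    by apply/matrixP => i j; rewrite !mxE.
  have h1 := enorm_col (sigma t x) l; have h2 := enorm_col (sigma t0 x0) l.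
  apply: ler_pM; rewrite ?enorm_ge0 ?mulr_ge0 ?addr_ge0 ?enorm_ge0//.
    apply: ler_wpM2l => //; rewrite -/S0 in h2; lra_on h1 h2 sS.
  apply: le_trans (enorm_col _ _) _; exact: ltW.
rewrite /op !generatorE.
have := mulr_ge0 d0 (ltW e0); have := mulr_ge0 s0 (ltW e0); have := mulr_ge0 CG0 (mulr_ge0 b0 (ltW e0)).
move: K1 K2 K3 K4 hp eC; rewrite /C !ler_norml.
move: (\sum_l _) (\sum_l _) (\sum_l _) (dotv _ _) (dotv _ _) (G _) (G _) => v1 v2 v3 v4 v5 v6 v7.
move: (d%:R * _) ((S0 + 1) ^+ 2) => v8 v9.
clear; move=> /andP[? ?] /andP[? ?] /andP[? ?] /andP[? ?] /andP[? ?] ? ? ? ?.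
apply/andP; split; lra.
Qed.

End operator.

Definition coefs (R : realType) (T : R) (k d : nat) (b : R -> 'cV[R]_k -> 'cV[R]_k)
    (sigma : R -> 'cV[R]_k -> 'M[R]_(k, d)) (Cg CL : R) : Prop :=
  [/\ 0 <= Cg /\ 0 <= CL,
    forall (t : R) x, 0 <= t <= T -> enorm (b t x) + enorm (sigma t x) <= Cg * (1 + enorm x),
    forall (t : R) x x', 0 <= t <= T ->
      enorm (b t x - b t x') + enorm (sigma t x - sigma t x') <= CL * enorm (x - x'),
    strip_continuous T b & strip_continuous T sigma].

Definition approximates (R : realType) (T : R) (k d m : nat) (b : R -> 'cV[R]_k -> 'cV[R]_k)
    (sigma : R -> 'cV[R]_k -> 'M[R]_(k, d)) (A : schemes R k m) (F : driver R k d m)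
    (h : 'I_m -> 'cV[R]_k -> R) (C5 : R) : Prop :=
  [/\ lower_scheme T b sigma A F, lower_terminal A h,
    forall i x (e : R), 0 < e -> exists2 e1 : R, 0 < e1 &
      forall y, enorm (y - x) < e1 -> `|h i y - h i x| < e,
    0 <= C5 & forall n i t xi (c : 'I_m -> R) z, 0 <= t <= T ->
     - (C5 * nn R n * (1 + \sum_l `|c l| + psi (bP A) xi + enorm z))
      <= F n i t xi (\col_l c l) z].

(* Asymptotically F dominates G at (t, x), along values close to those of the
   half-relaxed limit; only a lower bound is asked of the other components. *)
Definition dominates (R : realType) (T : R) (k d m : nat) (A : schemes R k m) (F : driver R k d m)
    (i : 'I_m) (t : R) (x : 'cV[R]_k) (G : 'cV[R]_d -> R) : Prop :=
  forall eta : R, 0 < eta -> exists2 rr : R, 0 < rr & exists n1, forall n s xi (c : 'I_m -> R),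
     (n1 <= n)%N -> 0 <= s <= T -> `|s - t| < rr -> enorm (xi - x) < rr ->
     `|c i - lowlim T A i t x| < rr ->
     (forall l, l != i -> lowlim T A l t x - rr <= c l) ->
     forall z, G z - eta <= F n i s xi (\col_l c l) z.
Section quadratic.
Variables (R : realType) (k : nat).

(** A second-order polynomial made concave in time, so that a large [K] localizes in time the
    minimum of a function minus it. *)
Definition quad (p : R) (q : 'cV[R]_k) (M : 'M[R]_k) (K : R) (t0 : R) (x0 : 'cV[R]_k) s y : R :=
  p * (s - t0) + dotv q (y - x0) + 2^-1 * qf M (y - x0) - K * (s - t0) ^+ 2.

Lemma quad_expand p q M K t0 x0 s y s' y' : M^T = M ->
  quad p q M K t0 x0 s' y' = quad p q M K t0 x0 s y + (p - 2 * K * (s - t0)) * (s' - s)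
    + dotv (q + M *m (y - x0)) (y' - y) + 2^-1 * qf M (y' - y) - K * (s' - s) ^+ 2.
Proof.
move=> Ms; rewrite /quad.
have -> : y' - x0 = (y - x0) + (y' - y) by rewrite [RHS]addrC addrA subrK.
move: (y - x0) (y' - y) => u v.
have -> : qf M (u + v) = qf M u + 2 * dotv (M *m u) v + qf M v.
  rewrite /qf mulmxDr !(dotvDl, dotvDr) (dotvC v (M *m u)).
  have -> : dotv u (M *m v) = dotv (M *m u) v; last by ring.
  by rewrite dotv_mul Ms.
by rewrite !(dotvDl, dotvDr); field.
Qed.

End quadratic.

(** [touch] is applied to the quadratic lowered by [kp] times the squared distance, which makes the
    minimum strict. The expansion it returns bounds an explicit quadratic from above, hence
    [M - 2 kp <= Y] as quadratic forms ([hYM]), and ellipticity replaces [Y]; then [op_cont] absorbs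
    [kp] and the displacement of the point. *)
Lemma quad_touch (R : realType) (T : R) (k d m : nat) (b : R -> 'cV[R]_k -> 'cV[R]_k)
    (sigma : R -> 'cV[R]_k -> 'M[R]_(k, d)) (Cg CL : R) (A : schemes R k m)
    (F : driver R k d m) h C5 (i : 'I_m) G CG (t0 t1 : R) x0 x1 r p q M K :
  0 < T -> coefs T b sigma Cg CL -> approximates T b sigma A F h C5 ->
  0 <= CG -> (forall z z', `|G z - G z'| <= CG * enorm (z - z')) ->
  0 <= t1 <= T -> 0 < r -> M^T = M -> 0 <= K ->
  (forall s y, boxQ T t1 x1 r s y ->
    lowlim T A i t1 x1 - quad p q M K t0 x0 t1 x1 <= lowlim T A i s y - quad p q M K t0 x0 s y) ->
  (t1 < T \/ lowlim T A i t1 x1 < h i x1) ->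
  dominates T A F i t1 x1 G ->
  0 <= op b sigma G t1 x1 (p - 2 * K * (t1 - t0)) (q + M *m (x1 - x0)) M.
Proof.
move=> T0 [[Cg0 CL0] hg hl bc sc] [sF tF hc C50 Fgr] CG0 Gl t1in r0 Ms K0 hmin hT dom.
pose p1 := p - 2 * K * (t1 - t0); pose q1 := q + M *m (x1 - x0).
suff H : forall eta : R, 0 < eta -> 0 <= eta + op b sigma G t1 x1 p1 q1 M by apply/ler_addgt0Pl.
move=> eta eta0; have eta2 : 0 < eta / 2 by rewrite divr_gt0.
have [w w0 hw] := op_cont x1 p1 q1 M bc sc CG0 Gl t1in eta2.
pose kp := Num.min 1 (w / 4).
have kp0 : 0 < kp by rewrite lt_min ltr01 divr_gt0.
have [kp1 kpw] : kp <= 1 /\ kp <= w / 4 by rewrite /kp !ge_min !lexx !orbT.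
clearbody kp.
have Nm0 := enorm_ge0 M.
pose phi s y := quad p q M K t0 x0 s y - kp * ((s - t1) ^+ 2 + enorm (y - x1) ^+ 2).
pose pf s (y : 'cV[R]_k) := (p - 2 * K * (s - t0)) - 2 * kp * (s - t1).
pose qv (s : R) y := (q + M *m (y - x0)) - (2 * kp) *: (y - x1).
pose B := `|p| + 2 * K * (r + `|t1 - t0|) + 2 * r + enorm q + enorm M * (r + enorm (x1 - x0)) + K + enorm M + 1.
have pos1 : 0 <= K * (r + `|t1 - t0|) by rewrite mulr_ge0// addr_ge0// ltW.
have pos2 : 0 <= enorm M * (r + enorm (x1 - x0)) by rewrite mulr_ge0// addr_ge0 ?enorm_ge0// ltW.
have q0 := enorm_ge0 q; have p0 := normr_ge0 p.
have B0 : 0 <= B by rewrite /B; lra_on pos1 pos2 q0 p0 r0 K0 Nm0.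
have phi_sc s y : boxQ T t1 x1 r s y -> [/\ `|pf s y| <= B, enorm (qv s y) <= B &
  forall s' y', boxQ T t1 x1 r s' y' ->
    phi s y + pf s y * (s' - s) + dotv (qv s y) (y' - y)
      - B * ((s' - s) ^+ 2 + enorm (y' - y) ^+ 2) <= phi s' y'].
  move=> [_ g1 g2].
  have g3 : `|kp * (s - t1)| <= r.
    by rewrite normrM gtr0_norm// -[r]mul1r; apply: ler_pM => //; exact: ltW.
  have g4 : kp * enorm (y - x1) <= r.
    by rewrite -[r]mul1r; apply: ler_pM => //; [exact: ltW|exact: enorm_ge0].
  have g5 : K * `|s - t0| <= K * (r + `|t1 - t0|).
    apply: ler_wpM2l => //; have := ler_distD t1 s t0; lra_on g1.
  have g6 : enorm M * enorm (y - x0) <= enorm M * (r + enorm (x1 - x0)).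
    apply: ler_wpM2l => //; have := enorm_tri y x1 x0; lra_on g2.
  split.
  - have : `|pf s y| <= `|p| + 2 * (K * `|s - t0|) + 2 * `|kp * (s - t1)|.
      apply: le_trans (ler_normB _ _) _; apply: lerD.
        apply: le_trans (ler_normB _ _) _; rewrite !normrM (ger0_norm K0) (@ger0_norm _ 2)//.
        by rewrite mulrA.
      by rewrite -mulrA normrM (@ger0_norm _ 2).
    by rewrite /B; lra_on g3 g5 pos2 q0 K0 Nm0.
  - have : enorm (qv s y) <= enorm q + enorm M * enorm (y - x0) + 2 * (kp * enorm (y - x1)).
      apply: le_trans (enormD _ _) _; rewrite enormN enormZ ger0_norm; last by rewrite mulr_ge0// ltW.
      rewrite mulrA lerD2r; apply: le_trans (enormD _ _) _; rewrite lerD2l; exact: enorm_mulv.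
    by rewrite /B; lra_on g4 g6 pos1 p0 K0 Nm0.
  - move=> s' y' _; rewrite /phi (quad_expand p q K t0 x0 s y s' y' Ms).
    have E1 : (s' - t1) ^+ 2 = (s - t1) ^+ 2 + 2 * (s - t1) * (s' - s) + (s' - s) ^+ 2 by ring.
    have E2 : enorm (y' - x1) ^+ 2 = enorm (y - x1) ^+ 2 + 2 * dotv (y - x1) (y' - y) + enorm (y' - y) ^+ 2.
      by rewrite -enorm_sqrD; congr (enorm _ ^+ 2); rewrite [RHS]addrC addrA subrK.
    have E3 : dotv (qv s y) (y' - y) = dotv (q + M *m (y - x0)) (y' - y) - 2 * kp * dotv (y - x1) (y' - y).
      exact: dotvBr_Z.
    have := qf_le M (y' - y); rewrite E1 E2 E3 ler_norml => /andP[h1 _].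
    have S0 := sqr_ge0 (s' - s); have Y0 := sqr_ge0 (enorm (y' - y)).
    have B1 : K + kp <= B by rewrite /B; lra_on pos1 pos2 q0 p0 r0 K0 Nm0 kp1.
    have B2 : 2^-1 * enorm M + kp <= B by rewrite /B; lra_on pos1 pos2 q0 p0 r0 K0 Nm0 kp1.
    have := ler_wpM2r Y0 B2; have := ler_wpM2r S0 B1.
    move: ((s' - s) ^+ 2) (enorm (y' - y) ^+ 2) ((s - t1) ^+ 2) (enorm (y - x1) ^+ 2) h1 {E1 E2 E3 S0 Y0}.
    rewrite /pf; clear; move: (dotv _ _) (dotv _ _) (qf _ _) (quad _ _ _ _ _ _ _ _) => *; lra.
have phi_min s y : boxQ T t1 x1 r s y ->
  lowlim T A i t1 x1 - phi t1 x1 + kp * ((s - t1) ^+ 2 + enorm (y - x1) ^+ 2) <= lowlim T A i s y - phi s y.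
  move=> Q1; have := hmin _ _ Q1.
  have E0 : phi t1 x1 = quad p q M K t0 x0 t1 x1.
    by rewrite /phi !subrr enorm0 expr0n /= addr0 mulr0 subr0.
  have E1 : phi s y = quad p q M K t0 x0 s y - kp * ((s - t1) ^+ 2 + enorm (y - x1) ^+ 2) by [].
  by rewrite E0 E1; clear; move: (quad _ _ _ _ _ _ _ _) (quad _ _ _ _ _ _ _ _) => *; lra.
have w4 : 0 < w / 4 by rewrite divr_gt0.
pose dl := Num.min (w / 4) (w / 4 / (2 * K + enorm M + 1)).
have dl0 : 0 < dl by rewrite lt_min w4 divr_gt0//; lra_on K0 Nm0.
have [dl1 dl2] : dl <= w / 4 /\ (2 * K + enorm M) * dl <= w / 4.
  split; first by rewrite ge_min lexx.
  apply: (@le_trans _ _ ((2 * K + enorm M) * (w / 4 / (2 * K + enorm M + 1)))).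
    by apply: ler_wpM2l; [lra_on K0 Nm0|rewrite ge_min lexx orbT].
  by apply: mul_small => //; lra_on K0 Nm0.
clearbody dl.
have hloc : exists2 rr : R, 0 < rr & exists n1, forall n s xi (c : 'I_m -> R),
     (n1 <= n)%N -> 0 <= s <= T -> `|s - t1| < rr -> enorm (xi - x1) < rr ->
     `|c i - lowlim T A i t1 x1| < rr -> (forall l, l != i -> c l = lowlim T A l t1 x1 - rr) ->
     forall z, G z - (eta / 2) / 4 <= F n i s xi (\col_l c l) z.
  have e8 : 0 < eta / 2 / 4 by rewrite divr_gt0.
  have [rr rr0 [n1 hn1]] := dom _ e8.
  exists rr => //; exists n1 => n s xi c g1 g2 g3 g4 g5 g6; apply: hn1 => //.
  by move=> l li; rewrite g6.
have := touch T0 Cg0 hg t1in r0 kp0 B0 phi_sc phi_min sF tF (hc i x1) hT CG0 Gl eta2 dl0 hloc C50 (fun n => Fgr n i).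
move=> [s [y [xi [Y [C [r' [[shT cs cy cxi] Ys r'0 hY hI]]]]]]].
have sin : 0 <= s <= T by move: shT => /andP[-> /ltW ->].
have hYM e : qf (M - (2 * kp) *: 1%:M) e <= qf Y e.
  have := @qf_lower R k (Y - (M - (2 * kp) *: 1%:M)) 0 C _ r'0 _ e.
  have qB (P Q : 'M[R]_k) g : qf (P - Q) g = qf P g - qf Q g.
    by rewrite -[- Q]scaleN1r qfD qfZ mulN1r.
  rewrite !mulr0 oppr0 mul0r qB subr_ge0 => H; apply: H => g hg'.
  have := hY g hg'; rewrite /phi (quad_expand p q K t0 x0 s y s (y + g) Ms) subrr mulr0 expr0n /= mulr0 addr0 subr0.
  have -> : y + g - y = g by rewrite addrC addKr.
  have -> : enorm (y + g - x1) ^+ 2 = enorm (y - x1) ^+ 2 + 2 * dotv (y - x1) g + enorm g ^+ 2.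
    by rewrite (addrAC y) (enorm_sqrD (y - x1)).
  have -> : dotv (qv s y) g = dotv (q + M *m (y - x0)) g - 2 * kp * dotv (y - x1) g.
    exact: dotvBr_Z.
  rewrite mul0r !qB qfZ qf1; clear; lra.
pose M' := M - (2 * kp) *: 1%:M.
have hop : - (eta / 2) <= op b sigma G s xi (pf s y) (qv s y) M'.
  rewrite /op generatorE; apply: le_trans hI _.
  have : \sum_l qf M' (col l (sigma s xi)) <= \sum_l qf Y (col l (sigma s xi)) by apply: ler_sum.
  clear; lra.
have := hw s xi (pf s y) (qv s y) M' sin.
have -> : `|s - t1| < w by lra_on cs dl1 w0.
have -> : enorm (xi - x1) < w by lra_on cxi dl1 w0.
have y0 := enorm_ge0 (y - x1); have s0 := normr_ge0 (s - t1).
have g1 : K * `|s - t1| <= K * dl by apply: ler_wpM2l => //; exact: ltW.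
have g2 : kp * `|s - t1| <= 1 * dl by apply: ler_pM => //; [exact: ltW|exact: ltW].
have g3 : enorm M * enorm (y - x1) <= enorm M * dl by apply: ler_wpM2l => //; exact: ltW.
have g4 : kp * enorm (y - x1) <= 1 * dl by apply: ler_pM => //; [exact: ltW|exact: ltW].
have pos3 : 0 <= K * dl by rewrite mulr_ge0// ltW.
have pos4 : 0 <= enorm M * dl by rewrite mulr_ge0// ltW.
have -> : `|pf s y - p1| <= w.
  have -> : pf s y - p1 = - (2 * K * (s - t1)) - 2 * kp * (s - t1) by rewrite /pf /p1; ring.
  apply: le_trans (ler_normB _ _) _; rewrite normrN !normrM (ger0_norm K0) (gtr0_norm kp0) (@ger0_norm _ 2)//.
  by rewrite -!mulrA; lra_on g1 g2 dl1 dl2 pos4 w0.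
have -> : enorm (qv s y - q1) <= w.
  have -> : qv s y - q1 = M *m (y - x1) - (2 * kp) *: (y - x1).
    have e0 : M *m (y - x1) = M *m (y - x0) - M *m (x1 - x0) by rewrite -mulmxBr opprB addrA subrK.
    by rewrite e0 /qv /q1 addrAC [q + _]addrC addrKA.
  apply: le_trans (enormD _ _) _; rewrite enormN enormZ ger0_norm; last by rewrite mulr_ge0// ltW.
  have := enorm_mulv M (y - x1); rewrite -mulrA; lra_on g3 g4 dl1 dl2 pos3 w0.
move=> /(_ isT isT isT isT); rewrite ler_norml => H.
have /H /andP[_ ] : forall e, `|qf M' e - qf M e| <= w * enorm e ^+ 2.
  move=> e; have -> : qf M' e - qf M e = - (2 * kp * enorm e ^+ 2).
    by rewrite /M' -scaleNr qfD qfZ qf1; ring.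
  rewrite normrN ger0_norm; last by apply: mulr_ge0; [apply: mulr_ge0 => //; exact: ltW|exact: sqr_ge0].
  by apply: ler_wpM2r; [exact: sqr_ge0|lra_on kpw w0].
rewrite -/p1 -/q1; lra_on hop.
Qed.

Section boxmin.
Variables (R : realType) (T : R) (k : nat).

Lemma quad0 p (q : 'cV[R]_k) M K t0 x0 : quad p q M K t0 x0 t0 x0 = 0.
Proof.
have h : qf M (x0 - x0) = 0.
  have := qf_le M (x0 - x0); rewrite {2}subrr enorm0 expr0n /= mulr0.
  by rewrite normr_le0 => /eqP.
rewrite /quad h !subrr expr0n /= !mulr0 /dotv big1 ?addr0 ?subr0// => i _.
by rewrite !mxE mulr0.
Qed.

Lemma quad_le (p : R) (q : 'cV[R]_k) M K t0 x0 s y r : 0 <= K -> r <= 1 ->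
  `|s - t0| <= r -> enorm (y - x0) <= r ->
  quad p q M K t0 x0 s y <= (`|p| + enorm q + enorm M) * r.
Proof.
move=> K0 r1 hs hy; rewrite /quad.
have y0 := enorm_ge0 (y - x0); have M0 := enorm_ge0 M; have q0 := enorm_ge0 q.
have a1 : p * (s - t0) <= `|p| * r.
  by apply: le_trans (ler_norm _) _; rewrite normrM; apply: ler_wpM2l.
have a2 : dotv q (y - x0) <= enorm q * r.
  by apply: le_trans (ler_norm _) _; apply: le_trans (dotv_CS _ _) _; apply: ler_wpM2l.
have a3 : qf M (y - x0) <= enorm M * r.
  apply: le_trans (ler_norm _) _; apply: le_trans (qf_le _ _) _; apply: ler_wpM2l => //.
  rewrite expr2; apply: le_trans (_ : enorm (y - x0) * 1 <= _); last by rewrite mulr1.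
  by apply: ler_wpM2l => //; lra_on hy r1.
have a4 : 0 <= K * (s - t0) ^+ 2 by rewrite mulr_ge0// sqr_ge0.
have a5 : 0 <= enorm M * r by apply: mulr_ge0 => //; lra_on hy y0.
lra_on a1 a2 a3 a4 a5.
Qed.

Lemma quad_cont p (q : 'cV[R]_k) M K t0 x0 s y (e : R) : M^T = M -> 0 < e ->
  exists2 r : R, 0 < r & forall s' y', `|s' - s| < r -> enorm (y' - y) < r ->
    quad p q M K t0 x0 s' y' < quad p q M K t0 x0 s y + e.
Proof.
move=> Ms e0.
pose p1 := `|p - 2 * K * (s - t0)|; pose q1 := enorm (q + M *m (y - x0)).
pose C := p1 + q1 + enorm M + `|K|.
have C0 : 0 <= C by rewrite /C /p1 /q1 !addr_ge0 ?enorm_ge0.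
pose r := Num.min 1 (e / 2 / (C + 1)).
have e2 : 0 < e / 2 by rewrite divr_gt0.
have r0 : 0 < r by rewrite lt_min ltr01 divr_gt0//; lra_on C0.
have r1 : r <= 1 by rewrite ge_min lexx.
have rC : C * r <= e / 2.
  apply: le_trans (mul_small C0 e2); apply: ler_wpM2l => //.
  by rewrite ge_min lexx orbT.
clearbody r; exists r => // s' y' hs hy.
rewrite (quad_expand p q K t0 x0 s y s' y' Ms).
have y0 := enorm_ge0 (y' - y); have M0 := enorm_ge0 M.
have sq : (s' - s) ^+ 2 <= r.
  rewrite -(real_normK (num_real (s' - s))); have := normr_ge0 (s' - s).
  by move: (`|s' - s|) hs => z; nra_on r1.
have yq : enorm (y' - y) ^+ 2 <= r by move: (enorm (y' - y)) y0 hy => z; nra_on r1.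
have a1 : (p - 2 * K * (s - t0)) * (s' - s) <= p1 * r.
  by apply: le_trans (ler_norm _) _; rewrite normrM; apply: ler_wpM2l => //; exact: ltW.
have a2 : dotv (q + M *m (y - x0)) (y' - y) <= q1 * r.
  apply: le_trans (ler_norm _) _; apply: le_trans (dotv_CS _ _) _.
  by apply: ler_wpM2l; [exact: enorm_ge0|exact: ltW].
have a3 : qf M (y' - y) <= enorm M * r.
  by apply: le_trans (ler_norm _) _; apply: le_trans (qf_le _ _) _; apply: ler_wpM2l.
have a4 : - (K * (s' - s) ^+ 2) <= `|K| * r.
  apply: le_trans (ler_norm _) _; rewrite normrN normrM; apply: ler_wpM2l => //.
  by rewrite ger0_norm ?sqr_ge0.
have a5 : 0 <= enorm M * r by apply: mulr_ge0 => //; exact: ltW.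
move: rC; rewrite /C; lra_on a1 a2 a3 a4 a5 e0.
Qed.

Lemma boxQ_center (t0 : R) (x0 : 'cV[R]_k) r : 0 <= t0 <= T -> 0 < r -> boxQ T t0 x0 r t0 x0.
Proof. by move=> h r0; split=> //; rewrite subrr ?normr0 ?enorm0 ltW. Qed.

Lemma box_min (v : R -> 'cV[R]_k -> R) t0 x0 r p q M K : strip_lsc T v ->
  0 <= t0 <= T -> 0 < r -> M^T = M ->
  exists t1 x1, boxQ T t0 x0 r t1 x1 /\ forall s y, boxQ T t0 x0 r s y ->
    v t1 x1 - quad p q M K t0 x0 t1 x1 <= v s y - quad p q M K t0 x0 s y.
Proof.
move=> vl ht r0 Ms.
pose F t x := quad p q M K t0 x0 t x - v t x.
have [||||t1 [x1 [h1 h2]]] := @usc_max R k (boxQ T t0 x0 r) F (`|t0| + `|T| + enorm x0 + r) t0 x0.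
- exact: boxQ_center.
- by move=> t x; apply: boxQ_bnd.
- by move=> t_ x_ t x; apply: boxQ_closed.
- move=> t x [tin _ _] e e0; have e2 : 0 < e / 2 by rewrite divr_gt0.
  have [r1 r10 hr1] := quad_cont p q K t0 x0 t x Ms e2.
  have [r2 r20 hr2] := (strip_lscP T v).1 vl t x tin _ e2.
  exists (Num.min r1 r2); first by rewrite lt_min r10.
  move=> t' x' [t'in _ _]; rewrite !lt_min => /andP[g1 g2] /andP[g3 g4].
  have := hr1 _ _ g1 g3; have := hr2 _ _ t'in g2 g4; rewrite /F; clear; lra.
exists t1, x1; split=> // s y Q; have := h2 _ _ Q; rewrite /F; clear; lra.
Qed.

Lemma boxQ_sub (t0 : R) (x0 : 'cV[R]_k) r t1 x1 : `|t1 - t0| < r -> enorm (x1 - x0) < r ->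
  exists2 r1 : R, 0 < r1 & forall s y, boxQ T t1 x1 r1 s y -> boxQ T t0 x0 r s y.
Proof.
move=> h1 h2; exists (Num.min (r - `|t1 - t0|) (r - enorm (x1 - x0))).
  by rewrite lt_min !subr_gt0 h1.
move=> s y [g1]; rewrite !le_min => /andP[g2 g3] /andP[g4 g5]; split=> //.
  by have := ler_distD t1 s t0; lra_on g2.
by have := enorm_tri y x1 x0; lra_on g5.
Qed.

Lemma lsc_all m (v : 'I_m -> R -> 'cV[R]_k -> R) (t0 : R) x0 (e : R) :
  (forall l, strip_lsc T (v l)) -> 0 <= t0 <= T -> 0 < e ->
  exists2 r : R, 0 < r & forall l t x, 0 <= t <= T -> `|t - t0| < r -> enorm (x - x0) < r ->
    v l t0 x0 - e < v l t x.
Proof.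
move=> vl ht e0.
have /choice [f hf] l : exists r : R, 0 < r /\ forall t x, 0 <= t <= T -> `|t - t0| < r ->
    enorm (x - x0) < r -> v l t0 x0 - e < v l t x.
  by have [r a1 a2] := (strip_lscP T _).1 (vl l) t0 x0 ht e e0; exists r.
have [rm rm0 hrm] := fin_lb (fun l => (hf l).1).
exists rm => // l t x h1 h2 h3; apply: (hf l).2 => //; exact: lt_le_trans (hrm l).
Qed.

End boxmin.

Lemma lowlim_lsc_ (R : realType) (T : R) (k m : nat) (A : schemes R k m) i :
  0 < T -> strip_lsc T (lowlim T A i).
Proof. by move=> T0; exact: (lowlim_lsc T0). Qed.
Arguments lowlim_lsc_ {R T k m} A i _.

Section consequences.
Variables (R : realType) (T : R) (k d m : nat).

(** Lower semicontinuity takes care of the lower bounds on all components at the new point.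
    Component [i] is to be approached from both sides, whence the extra upper bound on its value
    there. *)
Lemma dominates_near (A : schemes R k m) (F : driver R k d m) i (t0 : R) x0 G (eta : R) :
  0 < T -> 0 <= t0 <= T -> dominates T A F i t0 x0 G -> 0 < eta ->
  exists2 dl : R, 0 < dl & forall (t1 : R) x1, 0 <= t1 <= T -> `|t1 - t0| < dl ->
    enorm (x1 - x0) < dl -> lowlim T A i t1 x1 < lowlim T A i t0 x0 + dl ->
    dominates T A F i t1 x1 (fun z => G z - eta).
Proof.
move=> T0 t0in dom eta0.
have [rr rr0 [n1 hn1]] := dom _ eta0.
have rr2 : 0 < rr / 2 by rewrite divr_gt0.
have [r r0 hr] := lsc_all x0 (fun l => lowlim_lsc_ A l T0) t0in rr2.
exists (Num.min (rr / 2) r); first by rewrite lt_min rr2.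
move=> t1 x1 t1in; rewrite !lt_min => /andP[a1 a2] /andP[b1 b2] hv.
have hv2 : lowlim T A i t1 x1 < lowlim T A i t0 x0 + rr / 2.
  apply: lt_le_trans hv _; rewrite lerD2l ge_min lexx//.
move=> e e0; exists (rr / 2) => //; exists n1 => n s xi c g1 g2 g3 g4 g5 g6 z.
apply: (@le_trans _ _ (G z - eta)); first by lra_on e0.
apply: hn1 => //.
- by have := ler_distD t1 s t0; lra_on g3 a1.
- by have := enorm_tri xi x1 x0; lra_on g4 b1.
- have := hr i t1 x1 t1in a2 b2; move: g5; rewrite !ltr_norml => /andP[g7 g8] g9.
  by apply/andP; split; lra_on g7 g8 g9 hv2.
- by move=> l li; have := g6 l li; have := hr l t1 x1 t1in a2 b2; lra_on rr0.
Qed.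

End consequences.

(** A subjet allows an error of order [|t - t0|], which no quadratic in time dominates, so the
    minimum of the lower limit minus the quadratic moves to some [(t1, x1)]. Still, [key] gives
    [K * |t1 - t0| <= ep]: the slope in time changes by at most [2 * ep], however large [K] is. *)
Lemma lowlim_super (R : realType) (T : R) (k d m : nat) (b : R -> 'cV[R]_k -> 'cV[R]_k)
    (sigma : R -> 'cV[R]_k -> 'M[R]_(k, d)) (Cg CL : R) (A : schemes R k m)
    (F : driver R k d m) h C5 (i : 'I_m) G CG (t0 : R) x0 p q M :
  0 < T -> coefs T b sigma Cg CL -> approximates T b sigma A F h C5 ->
  0 <= CG -> (forall z z', `|G z - G z'| <= CG * enorm (z - z')) ->
  0 <= t0 < T -> dominates T A F i t0 x0 G ->
  subjet T (lowlim T A i) t0 x0 p q M -> 0 <= op b sigma G t0 x0 p q M.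
Proof.
move=> T0 cf ap CG0 Gl /andP[t00 t0T] dom [Ms sj].
have t0in : 0 <= t0 <= T by rewrite t00 ltW.
have [_ _ _ bc sc] := cf.
suff H : forall w : R, 0 < w -> 0 <= w + op b sigma G t0 x0 p q M by apply/ler_addgt0Pl.
move=> w w0; have w2 : 0 < w / 2 by rewrite divr_gt0.
have [dl dl0 hdl] := op_cont x0 p q M bc sc CG0 Gl t0in w2.
have [d1 d10 hd1] := dominates_near T0 t0in dom w2.
pose ep := dl / 8; have ep0 : 0 < ep by rewrite divr_gt0.
have epE : ep = dl / 8 by []; clearbody ep.
have [r1 r10 hr1] := (near_strip _ _ _ _).1 (sj _ ep0).
pose M' := M + (- (4 * ep)) *: 1%:M.
have M's : M'^T = M' by rewrite linearD /= linearZ /= Ms trmx1.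
pose C := `|p| + enorm q + enorm M'.
have C0 : 0 <= C by rewrite !addr_ge0 ?enorm_ge0//.
pose D := Num.min (Num.min dl d1) (Num.min r1 (T - t0)).
have D0 : 0 < D by rewrite !lt_min dl0 d10 r10 subr_gt0.
have [D1 D2 D3 D4] : [/\ D <= dl, D <= d1, D <= r1 & D <= T - t0] by rewrite !ge_min !lexx !orbT.
clearbody D.
pose r := Num.min 1 (D / 2 / (C + 1)).
have D20 : 0 < D / 2 by rewrite divr_gt0.
have r0 : 0 < r by rewrite lt_min ltr01 divr_gt0//; lra_on C0.
have r1' : r <= 1 by rewrite ge_min lexx.
have rD : C * r <= D / 2.
  apply: le_trans (mul_small C0 D20); apply: ler_wpM2l => //; by rewrite ge_min lexx orbT.
have rD2 : r <= D / 2.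
  apply: (@le_trans _ _ (D / 2 / (C + 1))); first by rewrite ge_min lexx orbT.
  by rewrite ler_pdivrMr; [rewrite ler_peMr//; [exact: ltW|lra_on C0]|lra_on C0].
clearbody r.
(* From [K * |t1 - t0| <= ep] this value gives [|t1 - t0| <= r ^+ 2 / 2], and then [|x1 - x0| < r]
   by [key]: the minimum is interior to the box. *)
pose K := Num.max 1 (2 * ep / r ^+ 2).
have K1 : 1 <= K by rewrite le_max lexx.
have Kr : 2 * ep <= K * r ^+ 2.
  by rewrite -ler_pdivrMr ?exprn_gt0// le_max lexx orbT.
clearbody K.
have [t1 [x1 [[t1in tr xr] hmin]]] := box_min x0 p q K (lowlim_lsc_ A i T0) t0in r0 M's.
have hc := hmin _ _ (boxQ_center x0 t0in r0); rewrite quad0 subr0 in hc.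
set v := lowlim T A i in hmin hc hr1 hd1.
have hsub : v t0 x0 + quad p q M 0 t0 x0 t1 x1 - ep * (`|t1 - t0| + enorm (x1 - x0) ^+ 2) <= v t1 x1.
  have := hr1 t1 x1 t1in; rewrite /taylor2 /= /quad -/(qf _ _) mul0r subr0 !addrA; apply.
    by lra_on tr rD2 D3 D0.
  by lra_on xr rD2 D3 D0.
have qd : quad p q M' K t0 x0 t1 x1 = quad p q M 0 t0 x0 t1 x1 - 2 * ep * enorm (x1 - x0) ^+ 2 - K * (t1 - t0) ^+ 2.
  by rewrite /quad /M' qfD qfZ qf1; field.
have key : ep * enorm (x1 - x0) ^+ 2 + K * `|t1 - t0| ^+ 2 <= ep * `|t1 - t0|.
  rewrite (real_normK (num_real _)); lra_on hsub qd hc.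
have n0 := normr_ge0 (t1 - t0); have m0 := enorm_ge0 (x1 - x0).
have Kt : K * `|t1 - t0| <= ep.
  have [->|n1] := eqVneq `|t1 - t0| 0; first by rewrite mulr0 ltW.
  have np : 0 < `|t1 - t0| by rewrite lt_neqAle eq_sym n1.
  rewrite -(ler_pM2r np); have : 0 <= ep * enorm (x1 - x0) ^+ 2 by rewrite mulr_ge0 ?sqr_ge0// ltW.
  by rewrite -mulrA -expr2; lra_on key.
have K0 : 0 <= K by lra_on K1.
have r20 : 0 < r ^+ 2 by rewrite exprn_gt0.
have kt2 : `|t1 - t0| * 2 <= r ^+ 2.
  have kp : 0 < K by lra_on K1.
  rewrite -(ler_pM2l kp); lra_on Kt Kr.
have tlt : `|t1 - t0| < r.
  have : r ^+ 2 <= r by rewrite expr2 ler_piMl// ltW.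
  lra_on kt2 r0.
have xlt : enorm (x1 - x0) < r.
  rewrite -(@ltr_pXn2r _ 2)// ?nnegrE//; last exact: ltW.
  have : enorm (x1 - x0) ^+ 2 <= `|t1 - t0|.
    rewrite -(ler_pM2l ep0); have : 0 <= K * `|t1 - t0| ^+ 2 by rewrite mulr_ge0 ?sqr_ge0.
    lra_on key.
  lra_on kt2 r20.
have [r2 r20' hr2] := boxQ_sub T tlt xlt.
have vlt : v t1 x1 < v t0 x0 + d1.
  have := quad_le p q M' K0 r1' tr xr; rewrite -/C; lra_on hc rD D2 D0.
have tT : t1 < T by have := ler_norm (t1 - t0); lra_on tlt rD2 D4 D0.
have dom1 := hd1 t1 x1 t1in ltac:(lra_on tlt rD2 D2 D0) ltac:(lra_on xlt rD2 D2 D0) vlt.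
have Gl' z z' : `|(G z - w / 2) - (G z' - w / 2)| <= CG * enorm (z - z').
  by rewrite opprB addrA subrK.
have := quad_touch T0 cf ap CG0 Gl' t1in r20' M's K0
  (fun s y Q => hmin s y (hr2 s y Q)) (or_introl tT) dom1.
have C1 : enorm M' * r <= D / 2.
  apply: le_trans rD; apply: ler_wpM2r; first exact: ltW.
  by rewrite /C lerDr addr_ge0 ?enorm_ge0.
have := hdl t1 x1 (p - 2 * K * (t1 - t0)) (q + M' *m (x1 - x0)) M' t1in.
have -> : `|t1 - t0| < dl by lra_on tlt rD2 D1 D0.
have -> : enorm (x1 - x0) < dl by lra_on xlt rD2 D1 D0.
have -> : `|p - 2 * K * (t1 - t0) - p| <= dl.
  rewrite addrAC subrr sub0r normrN !normrM (@ger0_norm _ 2)// (ger0_norm K0).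
  by rewrite -mulrA epE in Kt *; lra_on Kt dl0.
have -> : enorm (q + M' *m (x1 - x0) - q) <= dl.
  rewrite addrAC subrr add0r; apply: le_trans (enorm_mulv _ _) _.
  have := ler_wpM2l (enorm_ge0 M') (ltW xlt); lra_on C1 D1 D0.
move=> /(_ isT isT isT isT) H.
have /H : forall e, `|qf M' e - qf M e| <= dl * enorm e ^+ 2.
  move=> e; have -> : qf M' e - qf M e = - (4 * ep * enorm e ^+ 2).
    by rewrite /M' qfD qfZ qf1; ring.
  rewrite normrN ger0_norm; last by apply: mulr_ge0; [apply: mulr_ge0 => //; exact: ltW|exact: sqr_ge0].
  by apply: ler_wpM2r; [exact: sqr_ge0|rewrite epE; lra_on dl0].
rewrite ler_norml => /andP[_]; rewrite /op; clear; lra.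
Qed.

(** A steep paraboloid touches the lower limit from below near [(t0, x0)], with derivatives that do
    not depend on [L]. If every [L] were dominated there, the value of the operator plus one could
    be taken for [L], and [quad_touch] would give [0 <= -1]. *)
Lemma lowlim_no_blowup (R : realType) (T : R) (k d m : nat) (b : R -> 'cV[R]_k -> 'cV[R]_k)
    (sigma : R -> 'cV[R]_k -> 'M[R]_(k, d)) (Cg CL : R) (A : schemes R k m)
    (F : driver R k d m) h C5 (i : 'I_m) CG (t0 dl : R) x0 :
  0 < T -> coefs T b sigma Cg CL -> approximates T b sigma A F h C5 -> 0 <= CG ->
  0 <= t0 < T -> 0 < dl ->
  (forall (t1 : R) x1 L, 0 <= t1 <= T -> `|t1 - t0| < dl -> enorm (x1 - x0) < dl ->
    lowlim T A i t1 x1 < lowlim T A i t0 x0 + dl ->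
    dominates T A F i t1 x1 (fun z => L - CG * enorm z)) -> False.
Proof.
move=> T0 cf ap CG0 /andP[t00 t0T] dl0 dom.
have t0in : 0 <= t0 <= T by rewrite t00 ltW.
have vl := lowlim_lsc_ A i T0.
have [r1 r10 hr1] := (strip_lscP T _).1 vl t0 x0 t0in _ ltr01.
pose r := Num.min (Num.min 1 (r1 / 2)) (Num.min (dl / 2) ((T - t0) / 2)).
have r0 : 0 < r by rewrite !lt_min ltr01 !divr_gt0// subr_gt0.
have [rA rB rC rD] : [/\ r <= 1, r <= r1 / 2, r <= dl / 2 & r <= (T - t0) / 2] by rewrite !ge_min !lexx !orbT.
clearbody r.
have r20 : 0 < r ^+ 2 by rewrite exprn_gt0.
pose K := 2 / r ^+ 2; have K0 : 0 < K by rewrite divr_gt0.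
have KE : K * r ^+ 2 = 2 by rewrite /K mulfVK// gt_eqF.
pose M : 'M[R]_k := (- (2 * K)) *: 1%:M.
have Ms : M^T = M by rewrite linearZ /= trmx1.
have [t1 [x1 [[t1in tr xr] hmin]]] := box_min x0 0 0 K vl t0in r0 Ms.
have hc := hmin _ _ (boxQ_center x0 t0in r0); rewrite quad0 subr0 in hc.
have qE : quad 0 0 M K t0 x0 t1 x1 = - (K * ((t1 - t0) ^+ 2 + enorm (x1 - x0) ^+ 2)).
  rewrite /quad mul0r add0r /M qfZ qf1.
  have -> : dotv 0 (x1 - x0) = 0 by rewrite /dotv big1// => j _; rewrite mxE mul0r.
  by field.
have lo := hr1 t1 x1 t1in (ltac:(lra_on tr rB r10)) (ltac:(lra_on xr rB r10)).
have key : (t1 - t0) ^+ 2 + enorm (x1 - x0) ^+ 2 < r ^+ 2.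
  rewrite -(ltr_pM2l K0); lra_on lo hc qE KE.
have s0 := sqr_ge0 (t1 - t0); have y0 := sqr_ge0 (enorm (x1 - x0)).
have tlt : `|t1 - t0| < r.
  rewrite -(@ltr_pXn2r _ 2)// ?nnegrE//; last exact: ltW.
  by rewrite real_normK ?num_real//; lra_on key y0.
have xlt : enorm (x1 - x0) < r.
  rewrite -(@ltr_pXn2r _ 2)// ?nnegrE ?enorm_ge0//; last exact: ltW.
  by lra_on key s0.
have [r2 r20' hr2] := boxQ_sub T tlt xlt.
have tT : t1 < T by have := ler_norm (t1 - t0); lra_on tlt rD r0.
have Ks := mulr_ge0 (ltW K0) (addr_ge0 s0 y0).
have vlt : lowlim T A i t1 x1 < lowlim T A i t0 x0 + dl by lra_on hc qE dl0 Ks.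
pose p1 := 0 - 2 * K * (t1 - t0); pose q1 : 'cV[R]_k := 0 + M *m (x1 - x0).
pose L := op b sigma (fun z => - (CG * enorm z)) t1 x1 p1 q1 M + 1.
have dom1 := dom t1 x1 L t1in (ltac:(lra_on tlt rC dl0)) (ltac:(lra_on xlt rC dl0)) vlt.
have Gl z z' : `|(L - CG * enorm z) - (L - CG * enorm z')| <= CG * enorm (z - z' : 'cV[R]_d).
  have -> : (L - CG * enorm z) - (L - CG * enorm z') = CG * (enorm z' - enorm z) by ring.
  rewrite normrM (ger0_norm CG0); apply: ler_wpM2l => //.
  have := enorm_le_add z z'; have := enorm_le_add z' z; rewrite (enormB z' z) ler_norml.
  by move=> h1 h2; apply/andP; split; lra_on h1 h2.
have := quad_touch T0 cf ap CG0 Gl t1in r20' Ms (ltW K0)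
  (fun s y Q => hmin s y (hr2 s y Q)) (or_introl tT) dom1.
rewrite -/p1 -/q1 /L /op; clear; lra.
Qed.

(** Were the lower limit below [h] at time [T], a test function very steep in time would touch it
    near [(T, x0)], at a point where it is still below [h]. There contact at time [T] itself is
    allowed, and the slope violates the inequality. *)
Lemma lowlim_terminal (R : realType) (T : R) (k d m : nat) (b : R -> 'cV[R]_k -> 'cV[R]_k)
    (sigma : R -> 'cV[R]_k -> 'M[R]_(k, d)) (Cg CL : R) (A : schemes R k m)
    (F : driver R k d m) h C5 (i : 'I_m) C1 CG (dl : R) x0 :
  0 < T -> coefs T b sigma Cg CL -> approximates T b sigma A F h C5 -> 0 <= CG ->
  0 < dl ->
  (forall (t1 : R) x1, 0 <= t1 <= T -> `|t1 - T| < dl -> enorm (x1 - x0) < dl ->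
    lowlim T A i t1 x1 < lowlim T A i T x0 + dl ->
    dominates T A F i t1 x1 (fun z => - C1 - CG * enorm z)) ->
  h i x0 <= lowlim T A i T x0.
Proof.
move=> T0 cf ap CG0 dl0 dom; rewrite leNgt; apply/negP => hlt.
have t0in : 0 <= T <= T by rewrite lexx andbT ltW.
have [[Cg0 CL0] hg _ bc sc] := cf; have [_ _ hcont _ _] := ap.
have vl := lowlim_lsc_ A i T0.
have [r1 r10 hr1] := (strip_lscP T _).1 vl T x0 t0in _ ltr01.
have hd : 0 < h i x0 - lowlim T A i T x0 by rewrite subr_gt0.
have [r3 r30 hr3] := hcont i x0 _ hd.
pose r := Num.min (Num.min 1 (r1 / 2)) (Num.min (dl / 2) (r3 / 2)).
have r0 : 0 < r by rewrite !lt_min ltr01 !divr_gt0.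
have [rA rB rC rD] : [/\ r <= 1, r <= r1 / 2, r <= dl / 2 & r <= r3 / 2] by rewrite !ge_min !lexx !orbT.
clearbody r.
have r20 : 0 < r ^+ 2 by rewrite exprn_gt0.
pose a := 4 / r ^+ 2; have a0 : 0 < a by rewrite divr_gt0.
have aE : a * r ^+ 2 = 4 by rewrite /a mulfVK// gt_eqF.
clearbody a.
pose Cs := Cg * (2 + enorm x0).
have x00 := enorm_ge0 x0.
have Cs0 : 0 <= Cs by apply: mulr_ge0 => //; lra_on x00.
have hCs t x : 0 <= t <= T -> enorm (x - x0) <= 1 -> enorm (b t x) + enorm (sigma t x) <= Cs.
  move=> ht hx; apply: le_trans (hg t x ht) _; apply: ler_wpM2l => //.
  by have := enorm_le_add x x0; lra_on hx.
pose L := `|C1| + 2^-1 * a * Cs ^+ 2 + (1 + CG) * (Cs * (a * r)).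
have L0 : 0 <= L.
  by rewrite !addr_ge0 ?mulr_ge0 ?sqr_ge0 ?invr_ge0 ?addr_ge0// ltW.
(* [2 / r] keeps the contact point inside the box, [L] bounds the rest of the operator there, and 1
   makes the contradiction strict. *)
pose E := 2 / r + L + 1.
have rV : 0 < 2 / r by rewrite divr_gt0.
have E0 : 0 < E by rewrite /E; lra_on L0 rV.
have Er : 2 <= E * r.
  rewrite -ler_pdivrMr// /E; lra_on L0.
pose M : 'M[R]_k := (- a) *: 1%:M.
have Ms : M^T = M by rewrite linearZ /= trmx1.
have [t1 [x1 [[t1in tr xr] hmin]]] := box_min x0 E 0 0 vl t0in r0 Ms.
have hc := hmin _ _ (boxQ_center x0 t0in r0); rewrite quad0 subr0 in hc.
have qE : quad E 0 M 0 T x0 t1 x1 = - (E * (T - t1)) - 2^-1 * a * enorm (x1 - x0) ^+ 2.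
  rewrite /quad mul0r subr0 /M qfZ qf1.
  have -> : dotv 0 (x1 - x0) = 0 by rewrite /dotv big1// => j _; rewrite mxE mul0r.
  by ring.
have t1T : t1 <= T by case/andP: t1in.
have lo := hr1 t1 x1 t1in (ltac:(lra_on tr rB r10)) (ltac:(lra_on xr rB r10)).
have y0 := sqr_ge0 (enorm (x1 - x0)).
have P1 : 0 <= E * (T - t1) by rewrite mulr_ge0 ?subr_ge0// ltW.
have P2 : 0 <= 2^-1 * a * enorm (x1 - x0) ^+ 2 by apply: mulr_ge0 => //; apply: mulr_ge0 => //; exact: ltW.
have xlt : enorm (x1 - x0) < r.
  rewrite -(@ltr_pXn2r _ 2)// ?nnegrE ?enorm_ge0//; last exact: ltW.
  by rewrite -(ltr_pM2l a0); lra_on lo hc qE aE P1.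
have tlt : `|t1 - T| < r.
  rewrite distrC ger0_norm ?subr_ge0// -(ltr_pM2l E0); lra_on lo hc qE Er P2.
have [r2 r20' hr2] := boxQ_sub T tlt xlt.
have vle : lowlim T A i t1 x1 <= lowlim T A i T x0 by lra_on hc qE P1 P2.
have vlt : lowlim T A i t1 x1 < lowlim T A i T x0 + dl by lra_on vle dl0.
have hh : lowlim T A i t1 x1 < h i x1.
  have := hr3 x1 ltac:(lra_on xlt rD r30); rewrite ltr_norml => /andP[g _]; lra_on g vle.
have dom1 := dom t1 x1 t1in (ltac:(lra_on tlt rC dl0)) (ltac:(lra_on xlt rC dl0)) vlt.
have Gl z z' : `|(- C1 - CG * enorm z) - (- C1 - CG * enorm z')| <= CG * enorm (z - z' : 'cV[R]_d).
  have -> : (- C1 - CG * enorm z) - (- C1 - CG * enorm z') = CG * (enorm z' - enorm z) by ring.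
  rewrite normrM (ger0_norm CG0); apply: ler_wpM2l => //.
  have := enorm_le_add z z'; have := enorm_le_add z' z; rewrite (enormB z' z) ler_norml.
  by move=> h1 h2; apply/andP; split; lra_on h1 h2.
have := quad_touch T0 cf ap CG0 Gl t1in r20' Ms (lexx 0)
  (fun s y Q => hmin s y (hr2 s y Q)) (or_intror hh) dom1.
rewrite /op generatorE mulr0 mul0r subr0 add0r.
set q1 := M *m (x1 - x0).
have q1E : enorm q1 <= a * r.
  rewrite /q1 /M -scalemxAl mul1mx enormZ normrN gtr0_norm//.
  by apply: ler_wpM2l; exact: ltW.
have hb := hCs t1 x1 t1in ltac:(lra_on xlt rA).
have b0 := enorm_ge0 (b t1 x1); have s0 := enorm_ge0 (sigma t1 x1).
have ar0 : 0 <= a * r by rewrite mulr_ge0// ltW.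
have S1 : \sum_j qf M (col j (sigma t1 x1)) = - (a * enorm (sigma t1 x1) ^+ 2).
  rewrite enorm_sqr_col mulr_sumr -sumrN; apply: eq_bigr => j _.
  by rewrite /M qfZ qf1 mulNr.
have S2 : a * enorm (sigma t1 x1) ^+ 2 <= a * Cs ^+ 2.
  apply: ler_wpM2l; first exact: ltW.
  by apply: lerXn2r; rewrite ?nnegrE//; lra_on hb b0.
have B1 : - dotv (b t1 x1) q1 <= Cs * (a * r).
  apply: le_trans (ler_norm _) _; rewrite normrN; apply: le_trans (dotv_CS _ _) _.
  by apply: ler_pM; rewrite ?enorm_ge0//; lra_on hb s0.
have G1 : CG * enorm ((sigma t1 x1)^T *m q1) <= CG * (Cs * (a * r)).
  apply: ler_wpM2l => //; apply: le_trans (enorm_trmulv _ _) _.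
  by apply: ler_pM; rewrite ?enorm_ge0//; lra_on hb b0.
have c1 := ler_norm C1.
rewrite S1 /E /L; lra_on S2 B1 G1 c1 rV.
Qed.

(** * The growth barrier *)

Section barrier.
Variables (R : realType) (T : R) (k : nat).

(** The recursion is what the induction step of [psi_taylor] produces. *)
Fixpoint psiK (N : nat) : R := if N is N'.+1 then 4 * psiK N' + 6 * N'%:R + 1 else 0.

Lemma psiK_ge0 N : 0 <= psiK N.
Proof. by elim: N => //= N IH; have := ler0n R N; lra. Qed.

Lemma dotv_sqr_le (x e : 'cV[R]_k) : dotv x e ^+ 2 <= enorm x ^+ 2 * enorm e ^+ 2.
Proof.
rewrite -exprMn -(real_normK (num_real (dotv x e))); apply: lerXn2r; rewrite ?nnegrE ?mulr_ge0 ?enorm_ge0//.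
exact: dotv_CS.
Qed.

(** Induction on [N], each step multiplying by [1 + |x + e|^2]. The cross terms fit into the
    quadratic one because [|e| <= 1], [|x . e| <= 1 + |x|^2] and [(x . e)^2 <= (1 + |x|^2) |e|^2];
    multiplying by [1 + |x|^2] keeps the induction free of divisions. *)
Lemma psi_taylor N (x e : 'cV[R]_k) : enorm e <= 1 ->
  (1 + enorm x ^+ 2) * psi N (x + e) <=
  psi N x * (1 + enorm x ^+ 2 + 2 * N%:R * dotv x e + psiK N * enorm e ^+ 2).
Proof.
move=> e1; rewrite /psi; set a := 1 + enorm x ^+ 2.
have -> : 1 + enorm (x + e) ^+ 2 = a + 2 * dotv x e + enorm e ^+ 2.
  by rewrite enorm_sqrD /a; ring.
have e0 := enorm_ge0 e; have n0 := sqr_ge0 (enorm e).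
have n1 : enorm e ^+ 2 <= 1 by rewrite expr_le1.
have x2 := sqr_ge0 (enorm x).
have a1 : 1 <= a by rewrite lerDl.
have s2 : dotv x e ^+ 2 <= a * enorm e ^+ 2.
  apply: le_trans (dotv_sqr_le _ _) _; apply: ler_wpM2r => //; rewrite /a; lra.
have s1 : `|dotv x e| <= a.
  apply: le_trans (dotv_CS _ _) _.
  have h1 : enorm x * enorm e <= enorm x * 1 by apply: ler_wpM2l => //; exact: enorm_ge0.
  have h2 := sqr_ge0 (enorm x - 1); rewrite /a; nra.
move: s1; rewrite ler_norml => /andP[s1 s1'].
have ad : 0 <= a + 2 * dotv x e + enorm e ^+ 2.
  have -> : a + 2 * dotv x e + enorm e ^+ 2 = 1 + enorm (x + e) ^+ 2 by rewrite enorm_sqrD /a; ring.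
  by rewrite addr_ge0 ?sqr_ge0.
move: (dotv x e) (enorm e ^+ 2) n0 n1 s2 s1 s1' ad => s n n0 n1 s2 s1 s1' ad.
clearbody a; clear e1 e0 x2.
elim: N => [|N IH]; first by rewrite !expr0 /= !mulr0 !mul0r !addr0 mulr1 mul1r.
rewrite exprSr mulrA; apply: le_trans (ler_wpM2r ad IH) _.
have aN : 0 <= a ^+ N by rewrite exprn_ge0//; lra_on a1.
rewrite exprSr -!mulrA; apply: ler_wpM2l => //=.
have K0 := psiK_ge0 N; have N0 := ler0n R N.
have -> : N.+1%:R = N%:R + 1 :> R by rewrite natr1.
move: (psiK N) (N%:R) K0 N0 => K M K0 M0.
have h1 : M * s ^+ 2 <= M * (a * n) by apply: ler_wpM2l.
have h2 : K * (s * n) <= K * (a * n) by apply: ler_wpM2l => //; apply: ler_wpM2r.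
have h3 : M * (s * n) <= M * (a * n) by apply: ler_wpM2l => //; apply: ler_wpM2r.
have h4 : K * (n * n) <= K * (a * n).
  by apply: ler_wpM2l => //; apply: ler_wpM2r => //; lra_on n1 a1.
rewrite expr2 in h1; lra_on h1 h2 h3 h4.
Qed.

Definition Psi (mu : R) N t (x : 'cV[R]_k) : R := expR (mu * (T - t)) * psi N x.

Lemma Psi_gt0 mu N t x : 0 < Psi mu N t x.
Proof. by rewrite mulr_gt0 ?expR_gt0 ?psi_gt0. Qed.

Lemma Psi_psi mu N t x : 0 <= mu -> t <= T -> psi N x <= Psi mu N t x.
Proof.
move=> mu0 tT; rewrite /Psi ler_peMl ?(ltW (psi_gt0 _ _))//.
by apply: le_trans (expR_ge1Dx _); rewrite lerDl mulr_ge0 ?subr_ge0.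
Qed.

Lemma expR_quad (a : R) : `|a| <= 2^-1 -> expR a <= 1 + a + 2 * a ^+ 2.
Proof.
rewrite ler_norml => /andP[a1 a2].
have h := expR_ge1Dx (- a); have p := expR_gt0 (- a).
have -> : expR a = (expR (- a))^-1 by rewrite expRN invrK.
have q : 0 < 1 - a by lra.
apply: (@le_trans _ _ (1 - a)^-1); first by rewrite lef_pV2 ?posrE.
rewrite -[X in X <= _]mul1r ler_pdivrMr//.
have := sqr_ge0 a; nra.
Qed.

Lemma psi_near N (x : 'cV[R]_k) (e : R) : 0 < e -> exists2 r : R, 0 < r &
  forall y, enorm (y - x) < r -> `|psi N y - psi N x| < e.
Proof.
move=> e0.
have h : (fun r : R => (1 + r ^+ 2) ^+ N) r @[r --> enorm x] --> (1 + enorm x ^+ 2) ^+ N.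
  apply: (@continuous_cvg _ _ _ _ _ _ (fun r : R => r ^+ N)); first exact: exprn_continuous.
  by apply: cvgD; [exact: cvg_cst|exact: exprn_continuous].
have [r /= r0 hr] := h _ (nbhsx_ballx _ _ e0).
exists r => // y hy; rewrite /psi distrC; apply: hr.
rewrite /ball /=; have := enorm_le_add x y; have := enorm_le_add y x.
rewrite (enormB x y) ltr_norml => h1 h2; apply/andP; split; lra_on h1 h2 hy.
Qed.

Lemma expR_near (mu t e : R) : 0 < e -> exists2 r : R, 0 < r &
  forall s, `|s - t| < r -> `|expR (mu * (T - s)) - expR (mu * (T - t))| < e.
Proof.
move=> e0.
have h : (fun s : R => expR (mu * (T - s))) s @[s --> t] --> expR (mu * (T - t)).
  apply: (@continuous_cvg _ _ _ _ _ _ expR); first exact: continuous_expR.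
  by apply: cvgM; [exact: cvg_cst|apply: cvgB; [exact: cvg_cst|exact: cvg_id]].
have [r /= r0 hr] := h _ (nbhsx_ballx _ _ e0).
by exists r => // s hs; rewrite distrC; apply: hr; rewrite /ball /= distrC.
Qed.

Lemma Psi_near mu N t x (e : R) : 0 < e -> exists2 r : R, 0 < r &
  forall s y, `|s - t| < r -> enorm (y - x) < r -> `|Psi mu N s y - Psi mu N t x| < e.
Proof.
move=> e0.
have P0 := psi_gt0 N x; have E0 := expR_gt0 (mu * (T - t)).
have e2 : 0 < e / 2 by rewrite divr_gt0.
have e3 : 0 < e / 2 / expR (mu * (T - t)) by rewrite divr_gt0.
have [r1 r10 h1] := psi_near N x e3.
have [r2 r20 h2] := psi_near N x (ltr01).
have e4 : 0 < e / 2 / (psi N x + 1) by rewrite divr_gt0//; lra_on P0.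
have [r3 r30 h3] := expR_near mu t e4.
exists (Num.min r1 (Num.min r2 r3)); first by rewrite !lt_min r10 r20.
move=> s y; rewrite !lt_min => /andP[_ /andP[_ a3]] /andP[b1 /andP[b2 _]].
have g1 := h1 y b1; have g2 := h2 y b2; have g3 := h3 s a3.
have -> : Psi mu N s y - Psi mu N t x =
   (expR (mu * (T - s)) - expR (mu * (T - t))) * psi N y + expR (mu * (T - t)) * (psi N y - psi N x).
  by rewrite /Psi; ring.
apply: le_lt_trans (ler_normD _ _) _; rewrite !normrM (gtr0_norm E0) (gtr0_norm (psi_gt0 _ _)).
rewrite [e](splitr e); apply: ler_ltD.
  have y1 : psi N y <= psi N x + 1 by have := ler_norm (psi N y - psi N x); lra_on g2.
  rewrite ltr_pdivlMr in g3; last by lra_on P0.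
  apply: le_trans (ltW g3); apply: ler_wpM2l => //.
by rewrite mulrC -ltr_pdivlMr.
Qed.

(** A multiple of the identity replaces the Hessian of [Psi]: a superjet only needs an upper
    expansion, and [psi_taylor] supplies one. *)
Lemma superjet_add_Psi mu N c (U : R -> 'cV[R]_k -> R) t x p q X : 0 <= c ->
  superjet T U t x p q X ->
  let a := c * Psi mu N t x / (1 + enorm x ^+ 2) in
  superjet T (fun t x => U t x + c * Psi mu N t x) t x (p - c * mu * Psi mu N t x)
    (q + (2 * N%:R * a) *: x) (X + (2 * psiK N * a) *: 1%:M).
Proof.
move=> c0 [Xs hU] a; split.
  by apply/matrixP => i j; move/matrixP: Xs => /(_ i j); rewrite !mxE (eq_sym i) => ->.
move=> eps eps0; apply/near_strip.
have eps2 : 0 < eps / 2 by rewrite divr_gt0.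
have [r1 r10 hr1] := (near_strip _ _ _ _).1 (hU _ eps2).
have x1 : 0 < 1 + enorm x ^+ 2 by rewrite ltr_wpDr ?sqr_ge0.
have P0 := Psi_gt0 mu N t x.
have a0 : 0 <= a by apply: divr_ge0; [apply: mulr_ge0 => //; exact: ltW|exact: ltW].
pose L := 2 * N%:R * enorm x + psiK N.
have K0 := psiK_ge0 N; have N0 := ler0n R N; have ex0 := enorm_ge0 x.
have L0 : 0 <= L by rewrite /L addr_ge0 ?mulr_ge0.
pose B := c * Psi mu N t x * (2 * `|mu| ^+ 2) + a * L * (`|mu| + 2 * `|mu| ^+ 2).
have m0 := normr_ge0 mu.
have m2 : 0 <= `|mu| ^+ 2 by rewrite sqr_ge0.
have cP : 0 <= c * Psi mu N t x by apply: mulr_ge0 => //; exact: ltW.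
have aL : 0 <= a * L by apply: mulr_ge0.
have B0 : 0 <= B.
  by rewrite /B; apply: addr_ge0; apply: mulr_ge0 => //; lra_on m0 m2.
pose r := Num.min (Num.min r1 1) (Num.min (2^-1 / (`|mu| + 1)) (eps / 2 / (B + 1))).
have r0 : 0 < r.
  rewrite !lt_min r10 ltr01 /=; apply/andP; split; apply: divr_gt0 => //; lra_on m0 B0.
have [ra rb rc] : [/\ r <= r1, r <= 1 & `|mu| * r <= 2^-1].
  split; rewrite ?ge_min ?lexx ?orbT//.
  apply: le_trans (mul_small m0 (ltac:(by [])  : 0 < 2^-1 :> R)); apply: ler_wpM2l => //.
  by rewrite !ge_min lexx !orbT.
have rd : B * r <= eps / 2.
  apply: le_trans (mul_small B0 eps2); apply: ler_wpM2l => //.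
  by rewrite !ge_min lexx !orbT.
clearbody r; exists r => // t' x' t'in ht hx /=.
have h1 := hr1 t' x' t'in (lt_le_trans ht ra) (lt_le_trans hx ra).
rewrite /= /taylor2 -!/(qf _ _) in h1 *.
have xE : x' = x + (x' - x) by rewrite addrC subrK.
pose e := x' - x; rewrite -/e in hx xE h1 *.
rewrite qfD qfZ qf1 dotvDl dotvZl.
have e1 : enorm e <= 1 by lra_on hx rb.
have e0 := enorm_ge0 e; have s0 := normr_ge0 (t' - t).
have pt := psi_taylor N x e1.
pose al := - mu * (t' - t).
have alr : `|al| <= `|mu| * `|t' - t| by rewrite /al normrM normrN.
have al2 : `|al| <= 2^-1.
  apply: le_trans alr _; apply: le_trans rc; apply: ler_wpM2l => //; exact: ltW.
have he := expR_quad al2.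
have PE : Psi mu N t' x' = Psi mu N t x * expR al * (psi N (x + e) / psi N x).
  rewrite /Psi {1}xE; have -> : mu * (T - t') = mu * (T - t) + al by rewrite /al; ring.
  by rewrite expRD; have := psi_gt0 N x; move=> h; field; rewrite gt_eqF.
have D1 : psi N (x + e) / psi N x <= 1 + (2 * N%:R * dotv x e + psiK N * enorm e ^+ 2) / (1 + enorm x ^+ 2).
  rewrite ler_pdivrMr ?psi_gt0// -(ler_pM2l x1); apply: le_trans pt _.
  by rewrite le_eqVlt; apply/orP; left; apply/eqP; field; rewrite gt_eqF.
set dl := 2 * N%:R * dotv x e + psiK N * enorm e ^+ 2 in D1.
have dlL : `|dl| <= L * enorm e.
  apply: le_trans (ler_normD _ _) _.
  have q1 : `|2 * N%:R * dotv x e| = 2 * N%:R * `|dotv x e| by rewrite normrM ger0_norm// mulr_ge0.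
  have q2 : `|psiK N * enorm e ^+ 2| = psiK N * enorm e ^+ 2 by rewrite ger0_norm// mulr_ge0// sqr_ge0.
  rewrite q1 q2.
  have g1 : 2 * N%:R * `|dotv x e| <= 2 * N%:R * (enorm x * enorm e).
    by apply: ler_wpM2l; [exact: mulr_ge0|exact: dotv_CS].
  have g2 : psiK N * enorm e ^+ 2 <= psiK N * enorm e.
    by apply: ler_wpM2l => //; rewrite expr2 ler_piMl.
  by rewrite /L; lra_on g1 g2.
have main : c * Psi mu N t' x' <= c * Psi mu N t x * (1 + al) + a * dl + B * r * `|t' - t|.
  rewrite PE.
  apply: (@le_trans _ _ (c * Psi mu N t x * (1 + al + 2 * al ^+ 2) * (1 + dl / (1 + enorm x ^+ 2)))).
    have -> : c * (Psi mu N t x * expR al * (psi N (x + e) / psi N x)) =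
       (c * Psi mu N t x * expR al) * (psi N (x + e) / psi N x) by ring.
    apply: ler_pM => //.
    - by apply: mulr_ge0 => //; exact: expR_ge0.
    - by apply: divr_ge0; apply: ltW; exact: psi_gt0.
    - by apply: ler_wpM2l.
  have aa : al ^+ 2 <= `|mu| ^+ 2 * (r * `|t' - t|).
    rewrite -(real_normK (num_real al)); apply: (@le_trans _ _ ((`|mu| * `|t' - t|) ^+ 2)).
      by apply: lerXn2r; rewrite ?nnegrE ?mulr_ge0.
    rewrite exprMn; apply: ler_wpM2l => //; rewrite expr2; apply: ler_wpM2r => //; exact: ltW.
  have -> : c * Psi mu N t x * (1 + al + 2 * al ^+ 2) * (1 + dl / (1 + enorm x ^+ 2)) =
     c * Psi mu N t x * (1 + al) + a * dl + c * Psi mu N t x * (2 * al ^+ 2) + a * (dl * (al + 2 * al ^+ 2)).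
    by rewrite /a; field; rewrite gt_eqF.
  have g1 : c * Psi mu N t x * (2 * al ^+ 2) <= c * Psi mu N t x * (2 * (`|mu| ^+ 2 * (r * `|t' - t|))).
    by apply: ler_wpM2l => //; lra_on aa.
  have g2 : a * (dl * (al + 2 * al ^+ 2)) <= a * (L * r * ((`|mu| + 2 * `|mu| ^+ 2) * `|t' - t|)).
    apply: ler_wpM2l => //; apply: le_trans (ler_norm _) _; rewrite normrM; apply: ler_pM => //.
      by apply: le_trans dlL _; apply: ler_wpM2l => //; exact: ltW.
    apply: le_trans (ler_normD _ _) _; rewrite (@ger0_norm _ (2 * al ^+ 2)); last by rewrite mulr_ge0// sqr_ge0.
    have : `|mu| ^+ 2 * (r * `|t' - t|) <= `|mu| ^+ 2 * (1 * `|t' - t|).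
      by apply: ler_wpM2l => //; apply: ler_wpM2r.
    by lra_on alr aa.
  by rewrite /B; lra_on g1 g2.
have rd2 : B * r * `|t' - t| <= eps / 2 * `|t' - t| by apply: ler_wpM2r.
have en2 := sqr_ge0 (enorm e).
have ee : 0 <= eps * enorm e ^+ 2 by apply: mulr_ge0 => //; exact: ltW.
rewrite /dl /al in main; lra_on main rd2 h1 ee.
Qed.

End barrier.

Definition driver_ok (R : realType) (T : R) (k d m : nat)
    (f : 'I_m -> R -> 'cV[R]_k -> 'cV[R]_m -> 'cV[R]_d -> R) (Cf : R) : Prop :=
  [/\ 0 <= Cf, forall i, driver_continuous T (f i),
    forall i (t : R) x y y' z z', 0 <= t <= T ->
      `|f i t x y z - f i t x y' z'| <= Cf * (\sum_l `|y l ord0 - y' l ord0| + enorm (z - z'))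
    & forall i, driver_monotone T i (f i)].

(** * Comparison with the lower limit *)

Section comparison.
Variables (R : realType) (T : R) (k d m : nat).

Lemma driver_mono_all (f : 'I_m -> R -> 'cV[R]_k -> 'cV[R]_m -> 'cV[R]_d -> R) Cf i (t : R) x (y y' : 'cV[R]_m) z :
  driver_ok T f Cf -> 0 <= t <= T -> y i ord0 = y' i ord0 ->
  (forall l, l != i -> y l ord0 <= y' l ord0) -> f i t x y z <= f i t x y' z.
Proof.
move=> [_ _ _ fm] ht hi hl.
(* [driver_monotone] changes one coordinate at a time, so the first [n] coordinates are replaced one
   after the other; coordinate [i] does not change. *)
pose w (n : nat) : 'cV[R]_m := \col_l (if (l < n)%N then y' l ord0 else y l ord0).
have w0 : w 0 = y by apply/colP => l; rewrite mxE ltn0.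
have wm : w m = y' by apply/colP => l; rewrite mxE ltn_ord.
suff H n : (n <= m)%N -> f i t x y z <= f i t x (w n) z by rewrite -wm; exact: H.
elim: n => [|n IH] hn; first by rewrite w0.
apply: le_trans (IH (ltnW hn)) _.
pose l0 := Ordinal hn.
have [e|ne] := eqVneq l0 i.
  have -> // : w n = w n.+1.
  apply/colP => l; rewrite !mxE ltnS (leq_eqVlt l n).
  have [ln|//] := eqVneq (l : nat) n.
  have -> : l = i by rewrite -e; apply: val_inj.
  by rewrite hi !if_same.
apply: (fm i l0 ne) => //.
  move=> j jl; rewrite !mxE ltnS (leq_eqVlt j n).
  by have [jn|//] := eqVneq (j : nat) n; case/eqP: jl; apply: val_inj.
by rewrite !mxE /= ltnn ltnSn; exact: hl.
Qed.

End comparison.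

Section ratio.
Variables (R : realType) (T : R) (k m : nat).

Lemma usc_mul (W g : R -> 'cV[R]_k -> R) :
  strip_usc T W -> (forall t x, 0 <= g t x) ->
  (forall t x (e : R), 0 < e -> exists2 r : R, 0 < r & forall s y, `|s - t| < r ->
     enorm (y - x) < r -> `|g s y - g t x| < e) ->
  strip_usc T (fun t x => W t x * g t x).
Proof.
move=> /strip_uscP Wu g0 gc; apply/strip_uscP => t x ht e e0.
have G0 := g0 t x.
pose e1 := e / 2 / (g t x + 1); have e10 : 0 < e1 by rewrite !divr_gt0//; lra_on G0.
pose e2 := Num.min 1 (e / 2 / (`|W t x| + 1)).
have n0 := normr_ge0 (W t x).
have e20 : 0 < e2 by rewrite lt_min ltr01 !divr_gt0//; lra_on n0.
have [r1 r10 h1] := Wu t x ht _ e10.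
have [r2 r20 h2] := gc t x _ e20.
exists (Num.min r1 r2); first by rewrite lt_min r10.
move=> s y hs; rewrite !lt_min => /andP[a1 a2] /andP[b1 b2].
have k1 := h1 s y hs a1 b1; have k2 := h2 s y a2 b2.
have k3 : `|g s y - g t x| < 1 by apply: lt_le_trans k2 _; rewrite ge_min lexx.
have k4 : `|W t x| * `|g s y - g t x| < e / 2.
  apply: (@le_lt_trans _ _ (`|W t x| * (e / 2 / (`|W t x| + 1)))).
    by apply: ler_wpM2l => //; apply: le_trans (ltW k2) _; rewrite ge_min lexx orbT.
  rewrite mulrA ltr_pdivrMr; last by lra_on n0.
  by have : 0 < e / 2 by [rewrite divr_gt0]; lra_on n0.
have k5 : W t x * (g s y - g t x) < e / 2.
  by apply: le_lt_trans k4; apply: le_trans (ler_norm _) _; rewrite normrM.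
have k6 : g s y <= g t x + 1 by have := ler_norm (g s y - g t x); lra_on k3.
have k7 : e1 * g s y <= e / 2.
  apply: (@le_trans _ _ (e1 * (g t x + 1))); first by apply: ler_wpM2l => //; exact: ltW.
  by rewrite /e1 divfK// gt_eqF//; lra_on G0.
have k8 : W s y * g s y <= (W t x + e1) * g s y by apply: ler_wpM2r => //; exact: ltW.
lra_on k5 k7 k8.
Qed.

Lemma usc_sub (u w : R -> 'cV[R]_k -> R) : strip_usc T u -> strip_lsc T w ->
  strip_usc T (fun t x => u t x - w t x).
Proof.
move=> /strip_uscP hu /strip_lscP hw; apply/strip_uscP => t x ht e e0.
have e2 : 0 < e / 2 by rewrite divr_gt0.
have [r1 r10 h1] := hu t x ht _ e2; have [r2 r20 h2] := hw t x ht _ e2.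
exists (Num.min r1 r2); first by rewrite lt_min r10.
move=> s y hs; rewrite !lt_min => /andP[a1 a2] /andP[b1 b2].
have := h1 s y hs a1 b1; have := h2 s y hs a2 b2; clear; lra.
Qed.

Lemma psi_mono N N' (x : 'cV[R]_k) : (N <= N')%N -> psi N x <= psi N' x.
Proof. by move=> h; rewrite /psi ler_weXn2l// lerDl sqr_ge0. Qed.

(** [Psi] has one power more than the growth of the differences, so the ratios tend to 0 at infinity
    and their maximum over the strip and over all components is attained. *)
Lemma ratio_max (mu : R) N (u v : 'I_m -> R -> 'cV[R]_k -> R) C i0 t0 x0 :
  0 < T -> 0 <= mu -> (forall i, strip_usc T (u i)) -> (forall i, strip_lsc T (v i)) ->
  (forall i (t : R) x, 0 <= t <= T -> u i t x - v i t x <= C * psi N x) ->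
  0 <= t0 <= T -> v i0 t0 x0 < u i0 t0 x0 ->
  exists i t x c, [/\ 0 < c, 0 <= t <= T, u i t x - v i t x = c * Psi T mu N.+1 t x &
    forall l (s : R) y, 0 <= s <= T -> u l s y - v l s y <= c * Psi T mu N.+1 s y].
Proof.
move=> T0 mu0 uu vl hC t0in hlt.
pose g t x := (Psi T mu N.+1 t (x : 'cV[R]_k))^-1.
have P0 t x := Psi_gt0 T mu N.+1 t (x : 'cV[R]_k).
have g0 t x : 0 < g t x by rewrite invr_gt0.
pose W i t x := (u i t x - v i t x) * g t x.
have gc t x (e : R) : 0 < e -> exists2 r : R, 0 < r & forall s y, `|s - t| < r ->
     enorm (y - x) < r -> `|g s y - g t x| < e.
  move=> e0; have p := P0 t x; set Px := Psi T mu N.+1 t x in p.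
  have e2 : 0 < Num.min (Px / 2) (e * (Px ^+ 2 / 2)).
    by rewrite lt_min divr_gt0//= mulr_gt0// divr_gt0// exprn_gt0.
  have [r r0 hr] := Psi_near T mu N.+1 t x e2.
  exists r => // s y h1 h2; have := hr s y h1 h2; rewrite lt_min -/Px => /andP[h3 h4].
  have q := P0 s y; rewrite /g -/Px; move: h3 h4 q; set Py := Psi _ _ _ _ _ => h3 h4 q.
  have -> : Py^-1 - Px^-1 = (Px - Py) / (Py * Px) by field; rewrite !gt_eqF.
  have kk : 0 < Py * Px by apply: mulr_gt0.
  have kki : 0 < (Py * Px)^-1 by rewrite invr_gt0.
  rewrite normrM distrC (gtr0_norm kki).
  rewrite ltr_pdivrMr//; apply: (lt_le_trans h4); apply: ler_wpM2l; first exact: ltW.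
  have : Px / 2 <= Py by move: h3; rewrite ltr_norml => /andP[h5 _]; lra_on h5.
  by move=> h6; have := ler_wpM2r (ltW p) h6; rewrite expr2; lra_on p.
have Wu i : strip_usc T (W i).
  apply: usc_mul => //; first exact: usc_sub.
  by move=> t x; exact: ltW.
have W0 : 0 < W i0 t0 x0 by rewrite /W mulr_gt0// subr_gt0.
pose Rad := Num.max (enorm x0) (`|C| / W i0 t0 x0 + 1).
have Rb : `|C| / W i0 t0 x0 + 1 <= Rad by rewrite le_max lexx orbT.
have R0 : enorm x0 <= Rad by rewrite le_max lexx.
pose Q t (x : 'cV[R]_k) := 0 <= t <= T /\ enorm x <= Rad.
have C00 : 0 <= `|C| / W i0 t0 x0 by rewrite divr_ge0// ltW.
have far i t x : 0 <= t <= T -> Rad < enorm x -> W i t x <= W i0 t0 x0.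
  move=> tin hx; have tT : t <= T by case/andP: tin.
  apply: (@le_trans _ _ (`|C| * psi N x * g t x)).
    apply: ler_wpM2r; first exact: ltW.
    apply: le_trans (hC i t x tin) _; apply: ler_wpM2r (ler_norm _); exact: ltW (psi_gt0 _ _).
  rewrite ler_pdivrMr//.
  have h1 : psi N.+1 x <= Psi T mu N.+1 t x by exact: Psi_psi.
  apply: le_trans (ler_wpM2l (ltW W0) h1).
  have -> : psi N.+1 x = psi N x * (1 + enorm x ^+ 2) by rewrite /psi exprSr.
  rewrite mulrCA (mulrC `|C|); apply: ler_wpM2l; first exact: ltW (psi_gt0 _ _).
  rewrite mulrC -ler_pdivrMr//.
  have := sqr_ge0 (enorm x - 1); lra_on hx Rb C00.
have Wmax i : exists t x, Q t x /\ forall s y, Q s y -> W i s y <= W i t x.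
  have [||||t [x [h1 h2]]] := @usc_max R k Q (W i) (T + Rad) t0 x0.
  - by split.
  - move=> t x [/andP[h1 h2] h3]; have := enorm_ge0 x; rewrite ger0_norm// => h4.
    by split; lra_on h1 h2 h3 h4 T0.
  - move=> t_ x_ t x hQ ht hx; split.
      have : 0 <= t /\ t <= T; last by case=> -> ->.
      split; rewrite leNgt; apply/negP => hlt'.
        have n0 : 0 < - t by rewrite oppr_gt0.
        have [n hn] := @UU_ex _ (ht _ n0); have [/andP[a1 _] _] := hQ n.
        by have := ler_norm (t_ n - t); lra_on hn a1.
      have n0 : 0 < t - T by rewrite subr_gt0.
      have [n hn] := @UU_ex _ (ht _ n0); have [/andP[_ a1] _] := hQ n.
      by have := ler_norm (t - t_ n); rewrite distrC; lra_on hn a1.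
    rewrite leNgt; apply/negP => hlt'.
    have n0 : 0 < enorm x - Rad by rewrite subr_gt0.
    have [n hn] := @UU_ex _ (hx _ n0); have [_ a1] := hQ n.
    have := enorm_le_add x (x_ n); rewrite (enormB x (x_ n)).
    by have := ler_norm (enorm (x_ n - x)); lra_on hn a1.
  - move=> t x [tin _] e e0; have [r r0 hr] := (strip_uscP T _).1 (Wu i) t x tin e e0.
    by exists r => // t' x' [t'in _]; apply: hr.
  by exists t, x.
have /choice [z hz] i : exists z : R * 'cV[R]_k, Q z.1 z.2 /\ forall s y, Q s y -> W i s y <= W i z.1 z.2.
  by have [t [x h]] := Wmax i; exists (t, x).
have [j _ hj] := arg_maxP (fun i => W i (z i).1 (z i).2) (erefl (xpredT i0)).
have Q0 : Q t0 x0 by [].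
have c0 : 0 < W j (z j).1 (z j).2.
  by apply: lt_le_trans W0 _; apply: le_trans ((hz i0).2 _ _ Q0) (hj i0 isT).
exists j, (z j).1, (z j).2, (W j (z j).1 (z j).2); split=> //.
- by case: (hz j).1.
- by rewrite /W /g divfK// gt_eqF.
move=> l s y sin; rewrite -ler_pdivrMr// -/(g s y) -/(W l s y).
have [hy|hy] := leP (enorm y) Rad; first by apply: le_trans ((hz l).2 s y _) (hj l isT).
apply: le_trans (far l s y sin hy) _.
by apply: le_trans ((hz i0).2 _ _ Q0) (hj i0 isT).
Qed.

End ratio.

(** By contradiction at the maximum of [(u_i - v_i) / Psi]. This maximum is over all components, so
    each [u_l] is at most [v_l + c * Psi] there, which monotonicity turns into a bound on the driver
    of [u_i]; the decay rate [mu] of [Psi] then outweighs all other terms. The last hypothesis hides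
    the obstacles: it supplies a maximal component for which only the equation matters, so that the
    lemma serves both the scheme and its opposite. *)
Lemma sub_le_lowlim (R : realType) (T : R) (k d m : nat) (b : R -> 'cV[R]_k -> 'cV[R]_k)
    (sigma : R -> 'cV[R]_k -> 'M[R]_(k, d)) (Cg CL : R) (A : schemes R k m)
    (F : driver R k d m) h C5 f Cf (u : 'I_m -> R -> 'cV[R]_k -> R) C N :
  0 < T -> coefs T b sigma Cg CL -> approximates T b sigma A F h C5 -> driver_ok T f Cf ->
  (forall i, strip_usc T (u i)) ->
  (forall i (t : R) x, 0 <= t <= T -> u i t x <= C * psi N x) ->
  (forall i x, u i T x <= lowlim T A i T x) ->
  (forall (t : R) x c, 0 <= t < T ->
    (forall l, u l t x - lowlim T A l t x <= c) -> (exists i, u i t x - lowlim T A i t x = c) ->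
    exists i, [/\ u i t x - lowlim T A i t x = c,
      dominates T A F i t x (f i t x (\col_l lowlim T A l t x)) &
      exists2 r : R, 0 < r & forall (t' : R) x' p q M, 0 <= t' < T -> `|t' - t| < r ->
        enorm (x' - x) < r -> `|u i t' x' - u i t x| < r -> superjet T (u i) t' x' p q M ->
        op b sigma (f i t' x' (\col_l u l t' x')) t' x' p q M <= 0]) ->
  forall i (t : R) x, 0 <= t <= T -> u i t x <= lowlim T A i t x.
Proof.
move=> T0 cf ap dr uu hC hterm good i0 t0 x0 t0in; rewrite leNgt; apply/negP => hlt.
have [[Cg0 CL0] hg hl bc sc] := cf; have [sF tF hc C50 Fgr] := ap.
have [Cf0 fc fl fm] := dr.
pose N' := (N + bP A)%N.
have vl i := lowlim_lsc_ A i T0.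
have m0 : (0 < m)%N := leq_ltn_trans (leq0n i0) (ltn_ord i0).
have hCv i (t : R) x : 0 <= t <= T -> u i t x - lowlim T A i t x <= (`|C| + bC A) * psi N' x.
  move=> tin; have := @lowlim_bnd R T k m T0 A i t x tin; rewrite ler_norml => /andP[h1 _].
  have h2 := hC i t x tin.
  have h3 : C * psi N x <= `|C| * psi N' x.
    apply: (@le_trans _ _ (`|C| * psi N x)).
      by apply: ler_wpM2r (ler_norm _); exact: ltW (psi_gt0 _ _).
    by apply: ler_wpM2l => //; apply: psi_mono; exact: leq_addr.
  have h4 : bC A * psi (bP A) x <= bC A * psi N' x.
    by apply: ler_wpM2l; [exact: bC_ge0|apply: psi_mono; exact: leq_addl].
  by rewrite mulrDl; lra_on h1 h2 h3 h4.
pose NN := N'.+1; pose M1 : R := m%:R.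
have K0 := psiK_ge0 R NN; have N0 := ler0n R NN; have M10 : 0 <= M1 := ler0n _ _.
(* First the diffusion of the barrier, then its gradient in the drift and in the variable [z] of the
   driver, then the dependence on the components, doubled because [Psi] at the jet point is only
   known to be at least half of its value at the maximum; the final 1 leaves a strict margin. *)
pose mu := 2 * (psiK R NN * Cg ^+ 2) + 4 * (NN%:R * Cg * (1 + Cf)) + 2 * (Cf * M1) + 1.
have mu0 : 0 <= mu.
  rewrite /mu; have g1 : 0 <= psiK R NN * Cg ^+ 2 by rewrite mulr_ge0// sqr_ge0.
  have g2 : 0 <= NN%:R * Cg * (1 + Cf) by rewrite mulr_ge0 ?mulr_ge0//; lra_on Cf0.
  have g3 : 0 <= Cf * M1 by rewrite mulr_ge0.
  lra_on g1 g2 g3.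
have [j [t1 [x1 [c [c0 t1in heq hle]]]]] := ratio_max T0 mu0 uu vl hCv t0in hlt.
rewrite -/NN in heq hle.
have P0 := Psi_gt0 T mu NN t1 x1; set P1 := Psi T mu NN t1 x1 in heq P0.
have cP : 0 < c * P1 by rewrite mulr_gt0.
have t1T : 0 <= t1 < T.
  case/andP: (t1in) => -> h1; rewrite lt_neqAle h1 andbT; apply/eqP => e1.
  by move: heq; rewrite e1; have := hterm j x1; lra_on cP.
have [i [hi dom [r r0 hr]]] := good t1 x1 (c * P1) t1T (fun l => hle l t1 x1 t1in) (ex_intro _ j heq).
clear j heq.
pose U t x := u i t x - c * Psi T mu NN t x.
have Uu : strip_usc T U.
  apply/strip_uscP => t x tin e e0; have e2 : 0 < e / 2 by rewrite divr_gt0.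
  have e3 : 0 < e / 2 / c by rewrite divr_gt0.
  have [r1 r10 h1] := (strip_uscP T _).1 (uu i) t x tin _ e2.
  have [r2 r20 h2] := Psi_near T mu NN t x e3.
  exists (Num.min r1 r2); first by rewrite lt_min r10.
  move=> s y sin; rewrite !lt_min => /andP[a1 a2] /andP[b1 b2].
  have g1 := h1 s y sin a1 b1; have := h2 s y a2 b2; rewrite ltr_norml => /andP[+ _].
  rewrite -(ltr_pM2l c0) mulrN mulrC divfK ?gt_eqF// => g2; rewrite /U; lra_on g1 g2.
have hmax t x : boxQ T t1 x1 1 t x -> U t x - lowlim T A i t x <= U t1 x1 - lowlim T A i t1 x1.
  move=> [tin _ _]; have := hle i t x tin; have := hi; rewrite /U -/P1; clear; lra.
pose G := f i t1 x1 (\col_l lowlim T A l t1 x1).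
have Gl z z' : `|G z - G z'| <= Cf * enorm (z - z').
  apply: le_trans (fl i t1 x1 _ _ z z' t1in) _; apply: ler_wpM2l => //.
  by rewrite big1 ?add0r// => l _; rewrite subrr normr0.
pose ep := c * P1 / 8 / (4 + 2 * (M1 * Cf)).
have mc0 : 0 <= M1 * Cf by rewrite mulr_ge0.
have dn : 0 < 4 + 2 * (M1 * Cf) by lra_on mc0.
have ep0 : 0 < ep by rewrite !divr_gt0.
have epE : ep * (4 + 2 * (M1 * Cf)) = c * P1 / 8 by rewrite /ep divfK// gt_eqF.
clearbody ep.
have [rf rf0 hrf] := (near_strip _ _ _ _).1 (fc i t1 x1 t1in ep ep0).
have epc : 0 < Num.min (ep / c) (P1 / 4) by rewrite lt_min !divr_gt0.
have [rp rp0 hrp] := Psi_near T mu NN t1 x1 epc; rewrite -/P1 in hrp.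
have /choice [fu hfu] l : exists r : R, 0 < r /\ forall t x, 0 <= t <= T -> `|t - t1| < r ->
    enorm (x - x1) < r -> u l t x < u l t1 x1 + ep.
  by have [r' a1 a2] := (strip_uscP T _).1 (uu l) t1 x1 t1in ep ep0; exists r'.
have [ru ru0 hru] := fin_lb (fun l => (hfu l).1).
pose eta := Num.min (Num.min (r / 2) (ep / 2)) (Num.min (Num.min rf rp) ru).
have eta0 : 0 < eta by rewrite !lt_min !divr_gt0// rf0 rp0.
have [ea eb [ec ed ee]] : [/\ eta <= r / 2, eta <= ep / 2 & [/\ eta <= rf, eta <= rp & eta <= ru]].
  by rewrite /eta !ge_min !lexx !orbT.
pose rr2 := Num.min (r / 2 / c) 1.
have epc2 : 0 < r / 2 / c by rewrite !divr_gt0.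
have [rq rq0 hrq] := Psi_near T mu NN t1 x1 epc2; rewrite -/P1 in hrq.
clearbody eta; pose eta' := Num.min eta rq.
have eta'0 : 0 < eta' by rewrite lt_min eta0.
have [e'a e'b] : eta' <= eta /\ eta' <= rq by rewrite /eta' !ge_min !lexx !orbT.
clearbody eta'.
have [t [x [p [q [X [[tin ht hx hU hj] hop]]]]]] :=
  superjet_at_max T0 Cg0 CL0 hg hl bc sc Uu t1T ltr01 hmax sF tF (hc i) Cf0 Gl dom C50 (fun n => Fgr n i) eta'0.
have tin' : 0 <= t <= T by case/andP: tin => -> /ltW ->.
have hsj := superjet_add_Psi mu NN (ltW c0) hj.
rewrite /= in hsj; have {}hsj : superjet T (u i) t x (p - c * mu * Psi T mu NN t x)
    (q + (2 * NN%:R * (c * Psi T mu NN t x / (1 + enorm x ^+ 2))) *: x)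
    (X + (2 * psiK R NN * (c * Psi T mu NN t x / (1 + enorm x ^+ 2))) *: 1%:M).
  move: hsj; rewrite (_ : (fun t x => U t x + c * Psi T mu NN t x) = u i)//.
  by apply/funext => s; apply/funext => y; rewrite /U subrK.
have g1 : `|c * Psi T mu NN t x - c * P1| < ep.
  rewrite -mulrBr normrM gtr0_norm// mulrC -ltr_pdivlMr//.
  have := hrp t x ltac:(lra_on ht e'a ed) ltac:(lra_on hx e'a ed).
  by rewrite lt_min => /andP[].
have g2 : `|c * Psi T mu NN t x - c * P1| < r / 2.
  rewrite -mulrBr normrM gtr0_norm// mulrC -ltr_pdivlMr//.
  by apply: hrq; [lra_on ht e'b|lra_on hx e'b].
have g3 : P1 / 2 <= Psi T mu NN t x.
  have := hrp t x ltac:(lra_on ht e'a ed) ltac:(lra_on hx e'a ed).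
  rewrite lt_min => /andP[_]; rewrite ltr_norml => /andP[g _]; lra_on g P0.
have uiE : u i t x = U t x + c * Psi T mu NN t x by rewrite /U subrK.
have uiE1 : u i t1 x1 = U t1 x1 + c * P1 by rewrite /U subrK.
have g4 : `|u i t x - u i t1 x1| < r.
  rewrite uiE uiE1; move: hU g2; rewrite !ltr_norml => /andP[u1 u2] /andP[u3 u4].
  by apply/andP; split; lra_on u1 u2 u3 u4 e'a ea.
have g5 : `|u i t x - u i t1 x1| < 2 * ep.
  rewrite uiE uiE1; move: hU g1; rewrite !ltr_norml => /andP[u1 u2] /andP[u3 u4].
  by apply/andP; split; lra_on u1 u2 u3 u4 e'a eb ep0.
have := hr t x _ _ _ tin ltac:(lra_on ht e'a ea r0) ltac:(lra_on hx e'a ea r0) g4 hsj.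
set Pt := Psi T mu NN t x in g1 g2 g3 *.
have A1 : 0 < 1 + enorm x ^+ 2 by rewrite ltr_wpDr ?sqr_ge0.
set a := c * Pt / (1 + enorm x ^+ 2).
have aA : a * (1 + enorm x ^+ 2) = c * Pt by rewrite /a divfK// gt_eqF.
have Pt0 : 0 < Pt by exact: Psi_gt0.
have a0 : 0 <= a by apply: divr_ge0; [apply: mulr_ge0; exact: ltW|exact: ltW].
clearbody a.
set z := (sigma t x)^T *m q in hop *.
pose z' := (sigma t x)^T *m (q + (2 * NN%:R * a) *: x).
have ex := enorm_ge0 x.
have hbs := hg t x tin'; have b0 := enorm_ge0 (b t x); have s0 := enorm_ge0 (sigma t x).
have x2 : (1 + enorm x) * enorm x <= 2 * (1 + enorm x ^+ 2).
  by have := sqr_ge0 (enorm x - 1); have := sqr_ge0 (enorm x); clear; lra.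
have x3 : (1 + enorm x) ^+ 2 <= 2 * (1 + enorm x ^+ 2).
  by have := sqr_ge0 (enorm x - 1); clear; lra.
have Na : 0 <= NN%:R * a by rewrite mulr_ge0.
have bx : enorm (b t x) * enorm x <= 2 * (Cg * (1 + enorm x ^+ 2)).
  apply: (@le_trans _ _ (Cg * (1 + enorm x) * enorm x)).
    by apply: ler_wpM2r => //; lra_on hbs s0.
  by rewrite -mulrA; have := ler_wpM2l Cg0 x2; clear; lra.
have sx : enorm (sigma t x) * enorm x <= 2 * (Cg * (1 + enorm x ^+ 2)).
  apply: (@le_trans _ _ (Cg * (1 + enorm x) * enorm x)).
    by apply: ler_wpM2r => //; lra_on hbs b0.
  by rewrite -mulrA; have := ler_wpM2l Cg0 x2; clear; lra.
have ss : enorm (sigma t x) ^+ 2 <= 2 * (Cg ^+ 2 * (1 + enorm x ^+ 2)).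
  apply: (@le_trans _ _ ((Cg * (1 + enorm x)) ^+ 2)).
    by apply: lerXn2r; rewrite ?nnegrE//; lra_on hbs b0 s0.
  by rewrite exprMn; have := ler_wpM2l (sqr_ge0 Cg) x3; clear; lra.
have zz : enorm (z' - z) <= 4 * (NN%:R * Cg) * (c * Pt).
  have -> : z' - z = (2 * NN%:R * a) *: ((sigma t x)^T *m x).
    by rewrite /z' /z mulmxDr addrAC subrr add0r -scalemxAr.
  rewrite enormZ ger0_norm; last by rewrite -mulrA; apply: mulr_ge0.
  have := ler_wpM2l Na (le_trans (enorm_trmulv (sigma t x) x) sx).
  by rewrite -aA; clear; lra.
have bxd : (2 * NN%:R * a) * dotv (b t x) x <= 4 * (NN%:R * Cg) * (c * Pt).
  have h1 : dotv (b t x) x <= 2 * (Cg * (1 + enorm x ^+ 2)).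
    by apply: le_trans (ler_norm _) _; apply: le_trans (dotv_CS _ _) _.
  have := ler_wpM2l Na h1; rewrite -aA; clear; lra.
have trd : psiK R NN * a * enorm (sigma t x) ^+ 2 <= 2 * (psiK R NN * Cg ^+ 2) * (c * Pt).
  have Ka : 0 <= psiK R NN * a by rewrite mulr_ge0.
  have := ler_wpM2l Ka ss; rewrite -aA; clear; lra.
have fbound : f i t x (\col_l u l t x) z' <= G z + ep + Cf * (M1 * (c * P1 + 2 * ep) + 4 * (NN%:R * Cg) * (c * Pt)).
  have h1 := hrf t x tin' ltac:(lra_on ht e'a ec) ltac:(lra_on hx e'a ec) (\col_l u l t x) z'.
  rewrite /= in h1.
  pose w : 'cV[R]_m := \col_l (if l == i then u i t x else lowlim T A l t1 x1 + c * P1 + ep).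
  have h2 : f i t1 x1 (\col_l u l t x) z' <= f i t1 x1 w z'.
    apply: (driver_mono_all x1 z' dr t1in); first by rewrite !mxE eqxx.
    move=> l li; rewrite !mxE (negbTE li).
    have := (hfu l).2 t x tin' ltac:(have := hru l; lra_on ht e'a ee) ltac:(have := hru l; lra_on hx e'a ee).
    by have := hle l t1 x1 t1in; rewrite -/P1; clear; lra.
  have h3 := fl i t1 x1 w (\col_l lowlim T A l t1 x1) z' z t1in.
  have h4 : \sum_l `|w l ord0 - (\col_l lowlim T A l t1 x1) l ord0| <= M1 * (c * P1 + 2 * ep).
    apply: (@le_trans _ _ (\sum_(l < m) (c * P1 + 2 * ep))).
      apply: ler_sum => l _; rewrite !mxE; case: eqP => [->|_].
        have -> : u i t x - lowlim T A i t1 x1 = (u i t x - u i t1 x1) + c * P1 by rewrite -hi; ring.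
        apply: le_trans (ler_normD _ _) _; rewrite (gtr0_norm cP); lra_on g5.
      have -> : lowlim T A l t1 x1 + c * P1 + ep - lowlim T A l t1 x1 = c * P1 + ep by ring.
      rewrite ger0_norm; lra_on cP ep0.
    by rewrite sumr_const card_ord -[X in X <= _]mulr_natl.
  have h5 : Cf * (\sum_l `|w l ord0 - (\col_l lowlim T A l t1 x1) l ord0| + enorm (z' - z)) <=
      Cf * (M1 * (c * P1 + 2 * ep) + 4 * (NN%:R * Cg) * (c * Pt)).
    by apply: ler_wpM2l => //; exact: lerD.
  have h6 := ler_norm (f i t x (\col_l u l t x) z' - f i t1 x1 (\col_l u l t x) z').
  have h7 := ler_norm (f i t1 x1 w z' - G z).
  rewrite -/G in h3; lra_on h1 h2 h3 h5 h6 h7.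
rewrite /op !generatorE -/z' sum_qf_shift dotvDr dotvZr.
rewrite /op generatorE -/z in hop.
have muE : c * mu * Pt = (c * Pt) * mu by rewrite mulrAC.
have g6 : c * P1 / 2 <= c * Pt by have := ler_wpM2l (ltW c0) g3; clear; lra.
have g7 : (c * P1 / 2) * (Cf * M1) <= (c * Pt) * (Cf * M1) by apply: ler_wpM2r => //; rewrite mulr_ge0.
rewrite muE /mu.
move: hop fbound bxd trd epE g6 g7 cP e'a eb ep0.
move: (\sum_l _) (f _ _ _ _ _) (G z) (dotv _ _) (dotv _ _) (enorm (sigma t x) ^+ 2).
move: (c * P1) (c * Pt) => c1 c2 v1 v2 v3 v4 v5 v6.
clear; move=> *; lra.
Qed.

(** * Loops and sign changes *)

Section loop.
Variables (R : realType) (T : R) (k m : nat).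
Variable g : 'I_m -> 'I_m -> R -> 'cV[R]_k -> R.

(** Choose for each index of [S] a successor in [S]. Some iterate returns to a point [x1], and the
    orbit of [x1] is a loop without repetition. Along it the costs are at most the increments of
    [a], whose sum telescopes to 0. *)
Lemma no_loop (t : R) x (a : 'I_m -> R) (S : 'I_m -> Prop) :
  no_free_loop T g -> 0 <= t <= T -> (exists i, S i) ->
  (forall i, S i -> exists l, [/\ l != i, S l & a i <= a l - g i l t x]) -> False.
Proof.
move=> nfl ht [i0 Si0] hS.
have /choice [s hs] i : exists l, S i -> [/\ l != i, S l & a i <= a l - g i l t x].
  have [Si|nSi] := EM (S i); last by exists i.
  by have [l hl] := hS i Si; exists l.
have Siter n i : S i -> S (iter n s i) by move=> Si; elim: n => //= n IH; case: (hs _ IH).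
have /trajectP [p hp e] := looping_order s i0.
set n := fingraph.order s i0 in hp e.
pose x1 := iter p s i0.
have Sx1 : S x1 by exact: Siter.
have cyc : iter (n - p).-1.+1 s x1 = x1.
  by rewrite prednK ?subn_gt0// /x1 -iterD subnK 1?ltnW// e.
have fin : iter (fingraph.order s x1) s x1 = x1.
  (* [T4 3 4] passes from the return of some iterate to [x1] to the return of the iterate of index
     [order s x1]. *)
  have T4 := @orbitPcycle _ s x1; apply/(T4 3 4); first by exists (n - p).-1.
set N := fingraph.order s x1 in fin.
have N2 : (2 <= N)%N.
  case eN : N fin => [|[|N']] //; first by move: (fingraph.order_gt0 s x1); rewrite -/N eN.
  by move=> /= h; have [+ _ _] := hs _ Sx1; rewrite h eqxx.
pose sq := traject s (s x1) N.
have szs : size sq = N by rewrite size_traject.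
have sqE : x1 :: sq = traject s x1 N.+1 by [].
have := nfl t x ht x1 sq; rewrite /= szs ltnS => /(_ N2).
have -> : last x1 sq = x1.
  have := last_traject s x1 N; rewrite -/sq => ->; exact: fin.
have cardE : #|x1 :: sq| = N.
  rewrite -[RHS](size_orbit s x1) -(card_uniqP (orbit_uniq s x1)).
  apply: eq_card => y; rewrite sqE trajectSr mem_rcons fin in_cons /orbit -/N.
  by have [->|//] := eqVneq y x1; rewrite /N -/(fingraph.orbit s x1) in_orbit.
move=> /(_ erefl cardE); apply/negP; rewrite -leNgt.
have nthE j : (j <= N)%N -> nth x1 (x1 :: sq) j = iter j s x1.
  by move=> hj; rewrite sqE nth_traject.
apply: (@le_trans _ _ (\sum_(j < N) (a (iter j.+1 s x1) - a (iter j s x1)))).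
  apply: ler_sum => j _; rewrite !nthE ?(ltnW (ltn_ord j))//.
  have -> : nth x1 sq j = iter j.+1 s x1 := nthE j.+1 (ltn_ord j).
  have [_ _] := hs _ (Siter j x1 Sx1); rewrite -iterS; clear; lra.
rewrite -(big_mkord xpredT (fun j => a (iter j.+1 s x1) - a (iter j s x1))).
by rewrite (telescope_sumr (fun j => a (iter j s x1)))// fin subrr.
Qed.

End loop.

Section flip.
Variables (R : realType) (T : R) (k d m : nat).

Lemma flip_bnd (A : schemes R k m) n j i y xi : (j <= nsteps A n)%N -> xi \in grid A n ->
  `|- val_ A n j i y xi| <= bC A * psi (bP A) y.
Proof. by rewrite normrN; exact: val_bnd. Qed.

Lemma flip_cont (A : schemes R k m) n j i xi : (j <= nsteps A n)%N -> xi \in grid A n ->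
  forall x (e : R), 0 < e -> exists2 r : R, 0 < r &
    forall y, enorm (y - x) < r -> `|(- val_ A n j i y xi) - (- val_ A n j i x xi)| < e.
Proof.
move=> hj hxi x e e0; have [r r0 hr] := @val_cont _ _ _ A n j i xi hj hxi x e e0.
by exists r => // y hy; rewrite -opprD normrN; exact: hr.
Qed.

Definition flip (A : schemes R k m) : schemes R k m :=
  @Schemes R k m (nsteps A) (grid A) (fun n j i y xi => - val_ A n j i y xi) (gC A) (bC A) (bP A)
    (nsteps_gt A) (grid_n0 A) (gC_ge0 A) (@grid_le _ _ _ A) (@flip_bnd A) (@flip_cont A).

Definition dflip (f : 'I_m -> R -> 'cV[R]_k -> 'cV[R]_m -> 'cV[R]_d -> R) i t x y z :=
  - f i t x (- y) (- z).

(** The lower limit is below the upper one, which is the opposite of the lower limit of the opposite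
    scheme. Both are tested on a common point near [(t, x)]. *)
Lemma lowlim_flip (A : schemes R k m) i (t : R) x : 0 < T -> 0 <= t <= T ->
  lowlim T A i t x <= - lowlim T (flip A) i t x.
Proof.
move=> T0 tin; apply/ler_addgt0Pr => e e0; have e2 : 0 < e / 2 by rewrite divr_gt0.
have [r r0 [n1 h1]] := @lowlim_near R T k m T0 A i t x (e / 2) tin e2.
have [r' r'0 [n2 h2]] := @lowlim_near R T k m T0 (flip A) i t x (e / 2) tin e2.
have rr0 : 0 < Num.min r r' by rewrite lt_min r0.
have [n [j [y [xi [[a1 a2 a3] [a4 a5 _]]]]]] :=
  @lowlim_recover R T k m T0 (flip A) i t x _ (maxn n1 n2) tin rr0.
move: a4 a5 a1; rewrite !lt_min geq_max => /andP[a4 b4] /andP[a5 b5] /andP[a1 b1].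
have := h1 n j y xi a1 a2 a3 a4 a5; have := h2 n j y xi b1 a2 a3 b4 b5.
by rewrite /=; clear; lra.
Qed.

Lemma dflip_ok f Cf : driver_ok T f Cf -> driver_ok T (dflip f) Cf.
Proof.
move=> [C0 fc fl fm]; split=> //.
- move=> i t x tin e e0; have := fc i t x tin e e0; apply: filterS => s h y z.
  by rewrite /dflip -opprD normrN.
- move=> i t x y y' z z' tin; rewrite /dflip -opprD normrN.
  apply: le_trans (fl i t x _ _ _ _ tin) _; apply: ler_wpM2l => //.
  rewrite -opprD enormN lerD2r; apply: ler_sum => l _.
  by rewrite !mxE -opprD normrN.
- move=> i l li t x y y' z tin hy hl; rewrite /dflip lerN2; apply: (fm i l li) => //.
    by move=> j jl; rewrite !mxE hy.
  by rewrite !mxE lerN2.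
Qed.

Lemma superjet_flip (u : R -> 'cV[R]_k -> R) t x p q M :
  superjet T u t x p q M -> subjet T (fun t x => - u t x) t x (- p) (- q) (- M).
Proof.
move=> [Ms hu]; split; first by rewrite linearN /= Ms.
move=> e e0; have := hu e e0; apply: filterS => s; rewrite /taylor2.
by rewrite dotvNl mulNmx dotvNr; lra.
Qed.

Lemma subjet_limiting (u : R -> 'cV[R]_k -> R) t x p q M : 0 <= t <= T ->
  subjet T u t x p q M -> limiting_jet T (@subjet R k) u t x p q M.
Proof.
move=> tin hj; exists (fun=> t), (fun=> x), (fun=> p), (fun=> q), (fun=> M).
by split; [|split; exact: cvg_cst|split; exact: cvg_cst].
Qed.

Lemma superjet_limiting (u : R -> 'cV[R]_k -> R) t x p q M : 0 <= t <= T ->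
  superjet T u t x p q M -> limiting_jet T (@superjet R k) u t x p q M.
Proof.
move=> tin hj; exists (fun=> t), (fun=> x), (fun=> p), (fun=> q), (fun=> M).
by split; [|split; exact: cvg_cst|split; exact: cvg_cst].
Qed.

Lemma op_flip b (sigma : R -> 'cV[R]_k -> 'M[R]_(k, d)) f i t x y p q M :
  op b sigma (dflip f i t x y) t x (- p) (- q) (- M) = - op b sigma (f i t x (- y)) t x p q M.
Proof.
rewrite /op /dflip mulmxN !opprK !generatorE dotvNr.
have -> : \sum_j qf (- M) (col j (sigma t x)) = - \sum_j qf M (col j (sigma t x)).
  by rewrite -sumrN; apply: eq_bigr => j _; rewrite -scaleN1r qfZ mulN1r.
by ring.
Qed.

End flip.

(** * The system operator and polynomial growth *)

Section systemop.
Variables (R : realType) (k d m : nat).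
Variables (b : R -> 'cV[R]_k -> 'cV[R]_k) (sigma : R -> 'cV[R]_k -> 'M[R]_(k, d)).
Variables (f : 'I_m -> R -> 'cV[R]_k -> 'cV[R]_m -> 'cV[R]_d -> R).
Variables (g : 'I_m -> 'I_m -> R -> 'cV[R]_k -> R).

Lemma max_others_le i (y c : 'I_m -> R) (a : R) :
  (max_others i y c <= a%:E)%E <-> forall j, j != i -> y j - c j <= a.
Proof.
rewrite /max_others; split.
  move=> h j ji; rewrite -lee_fin; apply: le_trans h.
  by rewrite (bigD1 j)//= le_max lexx.
move=> h; elim/big_ind: _ => [|x1 x2 h1 h2|j ji]; first exact: leNye.
  by rewrite ge_max h1.
by rewrite lee_fin; exact: h.
Qed.

Lemma max_others_ge i (y c : 'I_m -> R) (a : R) :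
  (a%:E <= max_others i y c)%E <-> exists2 j, j != i & a <= y j - c j.
Proof.
rewrite /max_others; split.
  apply: contraPP => hn; apply/negP; rewrite -ltNge.
  elim/big_ind: _ => [|x1 x2 h1 h2|j ji]; first exact: ltNyr.
    by rewrite gt_max h1.
  by rewrite lte_fin ltNge; apply/negP => h; apply: hn; exists j.
move=> [j ji h]; rewrite (bigD1 j)//= le_max; apply/orP; left.
by rewrite lee_fin.
Qed.

Lemma system_op_ge0 v i t x p q M : (0 <= system_op b sigma f g v i t x p q M)%E <->
  (forall j, j != i -> v j t x - g i j t x <= v i t x) /\
  0 <= op b sigma (f i t x (\col_j v j t x)) t x p q M.
Proof.
rewrite /system_op le_min lee_fin -/(op b sigma _ t x p q M) sube_ge0; last by apply/orP; right.
by split=> [/andP[/max_others_le h1 h2]|[h1 h2]]; [split|apply/andP; split=> //; apply/max_others_le].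
Qed.

Lemma system_op_le0 v i t x p q M : (system_op b sigma f g v i t x p q M <= 0)%E <->
  (exists2 j, j != i & v i t x <= v j t x - g i j t x) \/
  op b sigma (f i t x (\col_j v j t x)) t x p q M <= 0.
Proof.
rewrite /system_op ge_min lee_fin -/(op b sigma _ t x p q M) sube_le0.
by split=> [/orP[/max_others_ge h|h]|[h|h]]; [left|right|apply/orP; left; apply/max_others_ge|apply/orP; right].
Qed.

End systemop.

Section growth.
Variables (R : realType) (k : nat).

Lemma poly_psi (u : 'cV[R]_k -> R) (C ga : R) : 0 <= C -> 0 <= ga ->
  (forall x, `|u x| <= C * (1 + enorm x `^ ga)) ->
  forall N, ga <= N%:R -> forall x, `|u x| <= 2 * C * psi N x.
Proof.
move=> C0 g0 h N hN x; apply: le_trans (h x) _; rewrite (mulrC 2) -mulrA; apply: ler_wpM2l => //.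
have p1 := psi_ge1 N x; have e0 := enorm_ge0 x.
suff : enorm x `^ ga <= psi N x by lra.
have [x1|x1] := leP (enorm x) 1.
  apply: le_trans p1.
  have [->|xp] := eqVneq (enorm x) 0.
    by have [->|gn] := eqVneq ga 0; rewrite ?powRr0 ?powR0.
  have p1' : 1 = 1 `^ ga :> R by rewrite powR1.
  rewrite [leRHS]p1'; apply: ge0_ler_powR => //; rewrite nnegrE//.
apply: (@le_trans _ _ (enorm x `^ N%:R)); first by apply: ler_powR => //; exact: ltW.
rewrite powR_mulrn//; apply: lerXn2r; rewrite ?nnegrE// ?addr_ge0// ?sqr_ge0//.
have := sqr_ge0 (enorm x - 1); lra.
Qed.

Lemma psi_poly N (x : 'cV[R]_k) : psi N x <= 2 ^+ N * (1 + enorm x `^ (2 * N)%:R).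
Proof.
have e0 := enorm_ge0 x; rewrite powR_mulrn// exprM /psi; move: (enorm x ^+ 2) (sqr_ge0 (enorm x)) => r r0.
have N0 : 0 <= 2 ^+ N :> R by rewrite exprn_ge0.
have rN : 0 <= r ^+ N by rewrite exprn_ge0.
have [r1|r1] := leP r 1.
  apply: (@le_trans _ _ (2 ^+ N)); first by apply: lerXn2r; rewrite ?nnegrE ?addr_ge0//; lra.
  by rewrite ler_peMr// lerDl.
apply: (@le_trans _ _ ((2 * r) ^+ N)); first by apply: lerXn2r; rewrite ?nnegrE ?addr_ge0 ?mulr_ge0//; lra.
by rewrite exprMn; apply: ler_wpM2l => //; rewrite lerDr.
Qed.

End growth.

(** * The penalized driver *)

Definition pos (R : realType) (x : R) : R := Num.max 0 x.

Definition penalized (R : realType) (k d m : nat)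
    (f : 'I_m -> R -> 'cV[R]_k -> 'cV[R]_m -> 'cV[R]_d -> R)
    (g : 'I_m -> 'I_m -> R -> 'cV[R]_k -> R) : driver R k d m :=
  fun n i t x y z => f i t x y z +
    nn R n * \sum_(l | l != i) pos (y l ord0 - g i l t x - y i ord0).

Lemma pos_ge0 (R : realType) (x : R) : 0 <= pos x.
Proof. by rewrite /pos le_max lexx. Qed.

Lemma pos_ge (R : realType) (x : R) : x <= pos x.
Proof. by rewrite /pos le_max lexx orbT. Qed.

Lemma pos_eq0 (R : realType) (x : R) : x <= 0 -> pos x = 0.
Proof. by move=> h; rewrite /pos; apply/max_idPl. Qed.

Section system.
Variables (R : realType) (T : R) (k d m : nat).

(** Monotonicity first lowers the components other than [i] to their lower bounds [v l - rr]; all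
    components are then close to [v] and the Lipschitz condition concludes. Hence no upper bound on
    them is needed. *)
Lemma f_lower (f : 'I_m -> R -> 'cV[R]_k -> 'cV[R]_m -> 'cV[R]_d -> R) Cf (v : 'I_m -> R) i (t : R) x (e : R) : driver_ok T f Cf -> 0 <= t <= T -> 0 < e ->
  exists2 rr : R, 0 < rr & forall (s : R) xi (c : 'I_m -> R), 0 <= s <= T ->
    `|s - t| < rr -> enorm (xi - x) < rr -> `|c i - v i| < rr ->
    (forall l, l != i -> v l - rr <= c l) ->
    forall z, f i t x (\col_l v l) z - e <= f i s xi (\col_l c l) z.
Proof.
move=> dr tin e0; have [C0 fc fl fm] := dr.
have e2 : 0 < e / 2 by rewrite divr_gt0.
have [r1 r10 h1] := (near_strip _ _ _ _).1 (fc i t x tin _ e2).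
have mC : 0 <= Cf * m%:R by rewrite mulr_ge0.
exists (Num.min r1 (e / 2 / (Cf * m%:R + 1))).
  by rewrite lt_min r10 divr_gt0//; lra_on mC.
move=> s xi c sin; rewrite !lt_min => /andP[a1 _] /andP[b1 _] /andP[_ c1] hc z.
set rr := e / 2 / (Cf * m%:R + 1) in c1 hc.
have rr0 : 0 < rr by rewrite divr_gt0//; lra_on mC.
have g1 := h1 s xi sin a1 b1 (\col_l c l) z.
rewrite /= ltr_norml in g1; case/andP: g1 => g1 _.
pose w : 'cV[R]_m := \col_l (if l == i then c i else v l - rr).
have g2 : f i t x w z <= f i t x (\col_l c l) z.
  apply: (driver_mono_all x z dr tin); first by rewrite !mxE eqxx.
  move=> l li; rewrite !mxE (negbTE li); apply: le_trans (hc l li).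
  by rewrite lerD2l lerN2 ge_min lexx orbT.
have g3 := fl i t x (\col_l v l) w z z tin.
have g4 : Cf * (\sum_l `|(\col_l v l) l ord0 - w l ord0| + enorm (z - z)) <= e / 2.
  apply: le_trans (mul_small mC e2); rewrite -mulrA; apply: ler_wpM2l => //.
  rewrite subrr enorm0 addr0.
  apply: (@le_trans _ _ (\sum_(l < m) rr)); last by rewrite sumr_const card_ord -[X in X <= _]mulr_natl.
  apply: ler_sum => l _; rewrite !mxE; case: eqP => [->|_].
    by rewrite distrC ltW.
  by rewrite opprB addrC subrK gtr0_norm.
have := ler_norm (f i t x (\col_l v l) z - f i t x w z).
lra_on g1 g2 g3 g4.
Qed.

Lemma dominates_pen (f : 'I_m -> R -> 'cV[R]_k -> 'cV[R]_m -> 'cV[R]_d -> R) Cf g 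
    (A : schemes R k m) i (t : R) x : driver_ok T f Cf -> 0 <= t <= T ->
  dominates T A (penalized f g) i t x (f i t x (\col_l lowlim T A l t x)).
Proof.
move=> dr tin e e0.
have [rr rr0 h] := f_lower (fun l => lowlim T A l t x) i x dr tin e0.
exists rr => //; exists 0%N => n s xi c _ sin h1 h2 h3 h4 z.
apply: le_trans (h s xi c sin h1 h2 h3 h4 z) _.
rewrite /penalized lerDl mulr_ge0 ?(ltW (nn_gt0 _ _))// sumr_ge0// => l _; exact: pos_ge0.
Qed.

(** After the change of sign the penalty is harmful, but it vanishes near a point where the
    obstacles of [i] are inactive. Its argument becomes [c_i - c_l - g_il], which again only needs
    lower bounds on the other components. *)
Lemma dominates_flip (f : 'I_m -> R -> 'cV[R]_k -> 'cV[R]_m -> 'cV[R]_d -> R) Cf g 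
    (A : schemes R k m) i (t : R) x : driver_ok T f Cf -> 0 <= t <= T ->
  (forall a b : 'I_m, a != b -> strip_continuous T (g a b)) ->
  (forall l, l != i -> lowlim T A i t x < lowlim T A l t x + g i l t x) ->
  dominates T A (fun n => dflip (penalized f g n)) i t x
    (dflip f i t x (\col_l lowlim T A l t x)).
Proof.
move=> dr tin gc hg e e0.
have [rr rr0 h] := f_lower (fun l => lowlim T A l t x) i x (dflip_ok dr) tin e0.
have /choice [dl hdl] l : exists r : R, 0 < r /\ forall s xi, l != i -> 0 <= s <= T -> `|s - t| < r ->
    enorm (xi - x) < r -> lowlim T A i t x + 2 * r < lowlim T A l t x + g i l s xi.
  have [->|li] := eqVneq l i; first by exists 1.
  have dd : 0 < (lowlim T A l t x + g i l t x - lowlim T A i t x) / 4 by rewrite divr_gt0// subr_gt0 hg.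
  have il : i != l by rewrite eq_sym.
  have [r r0 hr] := (strip_contP T _).1 (gc i l il) t x tin _ dd.
  exists (Num.min r ((lowlim T A l t x + g i l t x - lowlim T A i t x) / 4)).
  split; first by rewrite lt_min r0.
  move=> s xi _ sin; rewrite !lt_min => /andP[a1 _] /andP[b1 _].
  have := hr s xi sin a1 b1; rewrite ltr_norml => /andP[g1 _].
  have : Num.min r ((lowlim T A l t x + g i l t x - lowlim T A i t x) / 4) <= (lowlim T A l t x + g i l t x - lowlim T A i t x) / 4.
    by rewrite ge_min lexx orbT.
  lra_on g1 dd.
have [rm rm0 hrm] := fin_lb (fun l => (hdl l).1).
exists (Num.min rr rm); first by rewrite lt_min rr0.
exists 0%N => n s xi c _ sin; rewrite !lt_min => /andP[a1 a2] /andP[b1 b2] /andP[c1 c2] hc z.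
have hc1 l : l != i -> lowlim T A l t x - rr <= c l.
  by move=> li; apply: le_trans (hc l li); rewrite lerD2l lerN2 ge_min lexx.
apply: le_trans (h s xi c sin a1 b1 c1 hc1 z) _.
rewrite /dflip /penalized big1 ?mulr0 ?addr0// => l li.
apply: pos_eq0; rewrite !mxE.
have := (hdl l).2 s xi li sin (lt_le_trans a2 (hrm l)) (lt_le_trans b2 (hrm l)).
have := hrm l; have := hc l li.
have : Num.min rr rm <= rm by rewrite ge_min lexx orbT.
move: c2; rewrite ltr_norml => /andP[c2 c3]; lra_on c2 c3.
Qed.

(** Where the obstacle [l] is violated, the penalty is at least [nn n] times a fixed gap, which
    exceeds any constant; only the dependence on [z], at most [Cf * |z|], is left. *)
Lemma dominates_blowup (f : 'I_m -> R -> 'cV[R]_k -> 'cV[R]_m -> 'cV[R]_d -> R) Cf g 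
    (A : schemes R k m) i l (t : R) x L : driver_ok T f Cf -> 0 <= t <= T ->
  (forall a b : 'I_m, a != b -> strip_continuous T (g a b)) ->
  l != i -> lowlim T A i t x < lowlim T A l t x - g i l t x ->
  dominates T A (penalized f g) i t x (fun z => L - Cf * enorm z).
Proof.
move=> dr tin gc li hlt e e0; have [C0 fc fl fm] := dr.
have [rr rr0 h] := f_lower (fun l => lowlim T A l t x) i x dr tin ltr01.
pose dd := (lowlim T A l t x - g i l t x - lowlim T A i t x) / 4.
have dd0 : 0 < dd by rewrite divr_gt0// subr_gt0.
have il : i != l by rewrite eq_sym.
have [r r0 hr] := (strip_contP T _).1 (gc i l il) t x tin _ dd0.
pose K := (`|L| + `|f i t x (\col_l lowlim T A l t x) 0| + 1) / dd.
have [n1 hn1] := nn_large K.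
exists (Num.min rr (Num.min r dd)); first by rewrite !lt_min rr0 r0.
exists n1 => n s xi c hn sin; rewrite !lt_min => /andP[a1 /andP[a2 _]] /andP[b1 /andP[b2 _]] /andP[c1 /andP[_ c2]] hc z.
have hc1 j : j != i -> lowlim T A j t x - rr <= c j.
  by move=> ji; apply: le_trans (hc j ji); rewrite lerD2l lerN2 ge_min lexx.
have h1 := h s xi c sin a1 b1 c1 hc1 z.
have h2 := fl i t x (\col_l lowlim T A l t x) (\col_l lowlim T A l t x) 0 z tin.
rewrite big1 in h2; last by move=> ? _; rewrite subrr normr0.
rewrite add0r sub0r enormN in h2.
have h3 : dd <= pos (c l - g i l s xi - c i).
  apply: le_trans (pos_ge _); have := hr s xi sin a2 b2; rewrite ltr_norml => /andP[_ g1].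
  move: c2; rewrite ltr_norml => /andP[_ c3].
  have := hc l li; have : Num.min rr (Num.min r dd) <= dd by rewrite !ge_min lexx !orbT.
  by move: g1 c3; rewrite /dd; clear; lra.
have h4 : `|L| + `|f i t x (\col_l lowlim T A l t x) 0| + 1 <= nn R n * dd.
  by rewrite -ler_pdivrMr//; exact: hn1.
have h5 : nn R n * dd <= nn R n * \sum_(j | j != i) pos ((\col_l c l) j ord0 - g i j s xi - (\col_l c l) i ord0).
  apply: ler_wpM2l; first exact: ltW (nn_gt0 _ _).
  rewrite (bigD1 l)//= !mxE; apply: le_trans h3 _; rewrite lerDl sumr_ge0// => j _; exact: pos_ge0.
rewrite /penalized.
have g1 := ler_norm L; have g2 := ler_norm (- f i t x (\col_l lowlim T A l t x) 0).
have g3 := ler_norm (f i t x (\col_l lowlim T A l t x) 0 - f i t x (\col_l lowlim T A l t x) z).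
rewrite normrN in g2; lra_on h1 h2 h4 h5 g1 g2 g3 e0.
Qed.

Lemma dr_lip (f' : 'I_m -> R -> 'cV[R]_k -> 'cV[R]_m -> 'cV[R]_d -> R) Cf i (t : R) x y :
  driver_ok T f' Cf -> 0 <= t <= T ->
  forall z z' : 'cV[R]_d, `|f' i t x y z - f' i t x y z'| <= Cf * enorm (z - z').
Proof.
move=> [C0 _ fl _] tin z z'; apply: le_trans (fl i t x y y z z' tin) _; apply: ler_wpM2l => //.
by rewrite big1 ?add0r// => l _; rewrite subrr normr0.
Qed.

End system.

Record data_ok (R : realType) (T : R) (k d m : nat) (b : R -> 'cV[R]_k -> 'cV[R]_k)
    (sigma : R -> 'cV[R]_k -> 'M[R]_(k, d))
    (f : 'I_m -> R -> 'cV[R]_k -> 'cV[R]_m -> 'cV[R]_d -> R)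
    (g : 'I_m -> 'I_m -> R -> 'cV[R]_k -> R) (h : 'I_m -> 'cV[R]_k -> R)
    (Cg CL Cf : R) : Prop := DataOk {
  data_T : 0 < T;
  data_coefs : coefs T b sigma Cg CL;
  data_driver : driver_ok T f Cf;
  data_gc : forall i j : 'I_m, i != j -> strip_continuous T (g i j);
  data_g0 : forall i j : 'I_m, i != j -> forall (t : R) x, 0 <= t <= T -> 0 <= g i j t x;
  data_loop : no_free_loop T g;
  data_h : forall i j x, j != i -> h j x - g i j T x <= h i x
}.

(** * The limit of the penalized schemes *)

Section solution.
Variables (R : realType) (T : R) (k d m : nat).
Variables (b : R -> 'cV[R]_k -> 'cV[R]_k) (sigma : R -> 'cV[R]_k -> 'M[R]_(k, d)).
Variables (f : 'I_m -> R -> 'cV[R]_k -> 'cV[R]_m -> 'cV[R]_d -> R).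
Variables (g : 'I_m -> 'I_m -> R -> 'cV[R]_k -> R) (h : 'I_m -> 'cV[R]_k -> R).
Variables (Cg CL Cf C5 : R) (A : schemes R k m).
Hypothesis D : data_ok T b sigma f g h Cg CL Cf.
Hypothesis ap : approximates T b sigma A (penalized f g) h C5.
Hypothesis apm : approximates T b sigma (flip A) (fun n => dflip (penalized f g n))
  (fun i x => - h i x) C5.

Let T0 : 0 < T := data_T D.
Let cf := data_coefs D.
Let dr := data_driver D.
Let gc := data_gc D.
Let Cf0 : 0 <= Cf. Proof. by case: dr. Qed.
Local Notation v := (lowlim T A).
Local Notation vm := (lowlim T (flip A)).

Lemma v_obstacle i l (t : R) x : l != i -> 0 <= t < T -> v l t x - g i l t x <= v i t x.
Proof.
move=> li tin; rewrite leNgt; apply/negP => hlt.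
have tin' : 0 <= t <= T by case/andP: tin => -> /ltW ->.
pose dd := (v l t x - g i l t x - v i t x) / 4.
have dd0 : 0 < dd by rewrite divr_gt0// subr_gt0.
have il : i != l by rewrite eq_sym.
have [r1 r10 h1] := (strip_contP T _).1 (gc il) t x tin' _ dd0.
have [r2 r20 h2] := (strip_lscP T _).1 (lowlim_lsc_ A l T0) t x tin' _ dd0.
have dl0 : 0 < Num.min dd (Num.min r1 r2) by rewrite !lt_min dd0 r10.
apply: (@lowlim_no_blowup R T k d m b sigma Cg CL A _ h C5 i Cf t _ x T0 cf ap Cf0 tin dl0).
move=> t1 x1 L t1in; rewrite !lt_min => /andP[_ /andP[a1 a2]] /andP[_ /andP[b1 b2]] hv.
apply: (dominates_blowup L dr t1in gc li).
have := h1 t1 x1 t1in a1 b1; rewrite ltr_norml => /andP[_ g1].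
have g2 := h2 t1 x1 t1in a2 b2.
have : Num.min dd (Num.min r1 r2) <= dd by rewrite ge_min lexx.
by move: hv g1 g2 dd0; rewrite /dd; lra.
Qed.

Lemma v_terminal i x : h i x <= v i T x.
Proof.
have Tin : 0 <= T <= T by rewrite lexx ltW.
have [dl dl0 hdl] := dominates_near T0 Tin (dominates_pen g A i x dr Tin) ltr01.
pose y := \col_l lowlim T A l T x.
apply: (@lowlim_terminal R T k d m b sigma Cg CL A _ h C5 i (`|f i T x y 0| + 1) Cf dl x T0 cf ap Cf0 dl0).
move=> t1 x1 t1in ht hx hv e e0.
have [rr rr0 [n1 hn1]] := hdl t1 x1 t1in ht hx hv e e0.
exists rr => //; exists n1 => n s xi c g1 g2 g3 g4 g5 g6 z.
apply: le_trans (hn1 n s xi c g1 g2 g3 g4 g5 g6 z); rewrite -/y.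
have := dr_lip i x y dr Tin 0 z; rewrite sub0r enormN => k1.
have k2 := ler_norm (- f i T x y 0); rewrite normrN in k2.
have := ler_norm (f i T x y 0 - f i T x y z); lra.
Qed.

(** Suppose [vm_i < - h_i]. If some obstacle [l] is active for [i], the compatibility of the
    terminal data gives [vm_l < - h_l] too, and following such indices would close a free loop. So
    for some index all obstacles are inactive, and there [lowlim_terminal] applies. *)
Lemma vm_terminal i x : - h i x <= vm i T x.
Proof.
rewrite leNgt; apply/negP => hlt.
have Tin : 0 <= T <= T by rewrite lexx ltW.
apply: (no_loop (x := x) (a := fun i => - vm i T x) (S := fun i => vm i T x < - h i x) (data_loop D) Tin).
  by exists i.
move=> {}i {}hlt; apply: contrapT => hn.
have hgood l : l != i -> vm i T x < vm l T x + g i l T x.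
  move=> li; rewrite ltNge; apply/negP => hle; apply: hn; exists l; split=> //; last by lra.
  by have := data_h D x li; lra.
have dom := dominates_flip dr Tin gc hgood.
have [dl dl0 hdl] := dominates_near T0 Tin dom ltr01.
pose y := \col_l vm l T x.
suff : - h i x <= vm i T x by lra.
apply: (@lowlim_terminal R T k d m b sigma Cg CL (flip A) _ (fun i x => - h i x) C5 i (`|dflip f i T x y 0| + 1) Cf dl x T0 cf apm Cf0 dl0).
move=> t1 x1 t1in ht hx hv e e0.
have [rr rr0 [n1 hn1]] := hdl t1 x1 t1in ht hx hv e e0.
exists rr => //; exists n1 => n s xi c g1 g2 g3 g4 g5 g6 z.
apply: le_trans (hn1 n s xi c g1 g2 g3 g4 g5 g6 z); rewrite -/y.
have := dr_lip i x y (dflip_ok dr) Tin 0 z; rewrite sub0r enormN => k1.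
have k2 := ler_norm (- dflip f i T x y 0); rewrite normrN in k2.
have := ler_norm (dflip f i T x y 0 - dflip f i T x y z); lra.
Qed.

(* Were every obstacle active at the maximum, following the maximizing indices
   would close a loop of zero total cost. *)
Lemma good_index (u : 'I_m -> R -> 'cV[R]_k -> R) (t : R) x c : 0 <= t < T ->
  (forall l, u l t x - v l t x <= c) -> (exists i, u i t x - v i t x = c) ->
  exists i, u i t x - v i t x = c /\ forall l, l != i -> u l t x - g i l t x < u i t x.
Proof.
move=> tin hle hex; apply: contrapT => hn.
have tin' : 0 <= t <= T by case/andP: tin => -> /ltW ->.
apply: (no_loop (x := x) (a := fun i => u i t x) (S := fun i => u i t x - v i t x = c) (data_loop D) tin' hex).
move=> i hi; apply: contrapT => hn2; apply: hn; exists i; split=> // l li.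
rewrite ltNge; apply/negP => h1; apply: hn2; exists l; split=> //.
have := v_obstacle x li tin; have := hle l; move: hi h1 => h1 h2 h3 h4.
by apply/eqP; rewrite eq_le h3 /=; lra.
Qed.

Lemma good_open (u : 'I_m -> R -> 'cV[R]_k -> R) i (t : R) x : 0 <= t <= T ->
  (forall i, strip_usc T (u i)) ->
  (forall l, l != i -> u l t x - g i l t x < u i t x) ->
  exists2 r : R, 0 < r & forall (t' : R) x', 0 <= t' <= T -> `|t' - t| < r -> enorm (x' - x) < r ->
    `|u i t' x' - u i t x| < r -> forall l, l != i -> u l t' x' - g i l t' x' < u i t' x'.
Proof.
move=> tin uu hg.
have /choice [dl hdl] l : exists r : R, 0 < r /\ (l != i -> forall s xi, 0 <= s <= T -> `|s - t| < r ->
    enorm (xi - x) < r -> `|u i s xi - u i t x| < r -> u l s xi - g i l s xi < u i s xi).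
  have [->|li] := eqVneq l i; first by exists 1.
  pose dd := (u i t x - (u l t x - g i l t x)) / 4.
  have dd0 : 0 < dd by rewrite divr_gt0// subr_gt0 hg.
  have il : i != l by rewrite eq_sym.
  have [r1 r10 h1] := (strip_contP T _).1 (gc il) t x tin _ dd0.
  have [r2 r20 h2] := (strip_uscP T _).1 (uu l) t x tin _ dd0.
  exists (Num.min dd (Num.min r1 r2)); split; first by rewrite !lt_min dd0 r10.
  move=> _ s xi sin; rewrite !lt_min => /andP[_ /andP[a1 a2]] /andP[_ /andP[b1 b2]] /andP[c1 _].
  have := h1 s xi sin a1 b1; have := h2 s xi sin a2 b2.
  move: c1; rewrite !ltr_norml => /andP[c1 c2] h3 /andP[g1 g2].
  by move: c1 c2 h3 g1 g2; rewrite /dd; lra.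
have [rm rm0 hrm] := fin_lb (fun l => (hdl l).1).
exists rm => // s xi sin a1 b1 c1 l li; apply: (hdl l).2 => //;
  by [exact: lt_le_trans a1 (hrm l)|exact: lt_le_trans b1 (hrm l)|exact: lt_le_trans c1 (hrm l)].
Qed.

Lemma vm_usc i : strip_usc T (fun t x => - vm i t x).
Proof.
rewrite /strip_usc (_ : (fun t x => - - vm i t x) = vm i); first exact: lowlim_lsc_.
by apply/funext => t; apply/funext => x; rewrite opprK.
Qed.

Lemma vm_sub i (t : R) x p q M : 0 <= t < T ->
  superjet T (fun t x => - vm i t x) t x p q M ->
  (forall l, l != i -> - vm l t x - g i l t x < - vm i t x) ->
  op b sigma (f i t x (\col_l - vm l t x)) t x p q M <= 0.
Proof.
move=> tin hj hg; have tin' : 0 <= t <= T by case/andP: tin => -> /ltW ->.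
have hgood l : l != i -> vm i t x < vm l t x + g i l t x by move=> /hg; lra.
have dom := dominates_flip dr tin' gc hgood.
have sj : subjet T (vm i) t x (- p) (- q) (- M).
  have := superjet_flip hj; rewrite (_ : (fun t x => - - vm i t x) = vm i)//.
  by apply/funext => s; apply/funext => y; rewrite opprK.
have := lowlim_super T0 cf apm Cf0 (dr_lip i x _ (dflip_ok dr) tin') tin dom sj.
have -> : (\col_l - vm l t x) = - (\col_l vm l t x) :> 'cV[R]_m by apply/colP => l; rewrite !mxE.
by rewrite op_flip oppr_ge0.
Qed.

Lemma v_super i (t : R) x p q M : 0 <= t < T -> subjet T (v i) t x p q M ->
  0 <= op b sigma (f i t x (\col_l v l t x)) t x p q M.
Proof.
move=> tin hj; have tin' : 0 <= t <= T by case/andP: tin => -> /ltW ->.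
exact: (lowlim_super T0 cf ap Cf0 (dr_lip i x _ dr tin') tin (dominates_pen g A i x dr tin') hj).
Qed.

(** The inequality is required of [u] only where the obstacles of [i] are strictly inactive: this is
    all that is known of the upper limit [- vm], and [good_index] shows that it is enough. *)
Lemma below_v (u : 'I_m -> R -> 'cV[R]_k -> R) C N : (forall i, strip_usc T (u i)) ->
  (forall i (t : R) x, 0 <= t <= T -> u i t x <= C * psi N x) ->
  (forall i x, u i T x <= h i x) ->
  (forall i (t : R) x p q M, 0 <= t < T -> superjet T (u i) t x p q M ->
     (forall l, l != i -> u l t x - g i l t x < u i t x) ->
     op b sigma (f i t x (\col_l u l t x)) t x p q M <= 0) ->
  forall i (t : R) x, 0 <= t <= T -> u i t x <= v i t x.
Proof.
move=> uu hC hT hsub; apply: (sub_le_lowlim T0 cf ap dr uu hC).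
  by move=> i x; apply: le_trans (hT i x) (v_terminal i x).
move=> t x c tin hle hex; have tin' : 0 <= t <= T by case/andP: tin => -> /ltW ->.
have [i [hi hg]] := good_index tin hle hex.
have [r r0 hr] := good_open tin' uu hg.
exists i; split; [exact: hi|exact: (dominates_pen g A i x dr tin')|].
exists r => // t' x' p q M t'in a1 b1 c1 hj; apply: hsub => //.
by apply: hr => //; case/andP: t'in => -> /ltW ->.
Qed.

Lemma vm_le_v i (t : R) x : 0 <= t <= T -> - vm i t x <= v i t x.
Proof.
move: i t x; apply: (@below_v (fun i t x => - vm i t x) (bC (flip A)) (bP (flip A))).
- exact: vm_usc.
- move=> i t x tin; have := @lowlim_bnd R T k m T0 (flip A) i t x tin.
  by rewrite ler_norml => /andP[h1 _]; rewrite lerNl.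
- by move=> i x; rewrite lerNl; exact: vm_terminal.
- by move=> i t x p q M tin hj hg; exact: vm_sub.
Qed.

Lemma vmE i (t : R) x : 0 <= t <= T -> v i t x = - vm i t x.
Proof. by move=> tin; apply/eqP; rewrite eq_le lowlim_flip// vm_le_v. Qed.

Lemma v_cont i : strip_continuous T (v i).
Proof.
apply/strip_contP => t x tin e e0.
have [r1 r10 h1] := (strip_lscP T _).1 (lowlim_lsc_ A i T0) t x tin e e0.
have [r2 r20 h2] := (strip_lscP T _).1 (lowlim_lsc_ (flip A) i T0) t x tin e e0.
exists (Num.min r1 r2); first by rewrite lt_min r10.
move=> s y sin; rewrite !lt_min => /andP[a1 a2] /andP[b1 b2].
have := h1 s y sin a1 b1; have := h2 s y sin a2 b2.
have := vmE i x tin; have := vmE i y sin; rewrite ltr_norml => e1 e2 h3 h4.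
by apply/andP; split; lra.
Qed.

End solution.

(** * Passing to limiting jets *)

Section limits.
Variables (R : realType) (T : R) (k d m : nat).

Lemma real_cvg_ev (u : nat -> R) l (e : R) : u n @[n --> \oo] --> l -> 0 < e ->
  exists n0, forall n, (n0 <= n)%N -> `|u n - l| < e.
Proof.
move=> h e0; have [n0 _ hn0] := h _ (nbhsx_ballx l _ e0).
by exists n0 => n hn; have := hn0 n hn; rewrite /ball /= distrC.
Qed.

Lemma mx_cvg_ev p q (u : nat -> 'M[R]_(p, q)) (l : 'M[R]_(p, q)) (e : R) : u n @[n --> \oo] --> l -> 0 < e ->
  exists n0, forall n, (n0 <= n)%N -> enorm (u n - l) < e.
Proof.
move=> h e0.
have mn0 : 0 < (p * q)%:R + 1 :> R by rewrite ltr_wpDl.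
have e'0 : 0 < e / ((p * q)%:R + 1) by rewrite divr_gt0.
have [n0 _ hn0] := h _ (nbhsx_ballx l _ e'0).
exists n0 => n hn; apply: (@le_lt_trans _ _ ((p * q)%:R * (e / ((p * q)%:R + 1)))).
  apply: enorm_le_coord => i j; have := (hn0 n hn).2 i j; rewrite /ball /= distrC !mxE.
  exact: ltW.
by rewrite mulrA ltr_pdivrMr// mulrC ltr_pM2l//; lra.
Qed.

Lemma qf_near (M M' : 'M[R]_k) e : `|qf M' e - qf M e| <= enorm (M' - M) * enorm e ^+ 2.
Proof.
by have := qf_le (M' - M) e; rewrite qfD -[- M]scaleN1r qfZ mulN1r.
Qed.

Lemma op_lim b sigma f Cf (v : 'I_m -> R -> 'cV[R]_k -> R) i (t : R) x p q M t_ x_ p_ q_ M_ (w : R) :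
  strip_continuous T b -> strip_continuous T sigma -> @driver_ok R T k d m f Cf ->
  (forall l, strip_continuous T (v l)) -> 0 <= t <= T ->
  (forall n, 0 <= t_ n <= T) ->
  t_ n @[n --> \oo] --> t -> x_ n @[n --> \oo] --> x -> p_ n @[n --> \oo] --> p ->
  q_ n @[n --> \oo] --> q -> M_ n @[n --> \oo] --> M -> 0 < w ->
  exists n0, forall n, (n0 <= n)%N ->
    `|op b sigma (f i (t_ n) (x_ n) (\col_l v l (t_ n) (x_ n))) (t_ n) (x_ n) (p_ n) (q_ n) (M_ n)
      - op b sigma (f i t x (\col_l v l t x)) t x p q M| <= w.
Proof.
move=> bc sc dr vc tin tnin ct cx cp cq cM w0; have [C0 fc fl fm] := dr.
have w2 : 0 < w / 2 by rewrite divr_gt0.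
have w4 : 0 < w / 4 by rewrite divr_gt0.
have [dl dl0 hdl] := op_cont x p q M bc sc C0 (dr_lip i x (\col_l v l t x) dr tin) tin w2.
have [rf rf0 hrf] := (near_strip _ _ _ _).1 (fc i t x tin _ w4).
have mC : 0 <= Cf * m%:R by rewrite mulr_ge0.
have ev0 : 0 < w / 4 / (Cf * m%:R + 1) by rewrite divr_gt0// ltr_wpDl.
have /choice [fv hfv] l : exists r : R, 0 < r /\ forall t' x', 0 <= t' <= T -> `|t' - t| < r ->
    enorm (x' - x) < r -> `|v l t' x' - v l t x| < w / 4 / (Cf * m%:R + 1).
  by have [r a1 a2] := (strip_contP T _).1 (vc l) t x tin _ ev0; exists r.
have [rv rv0 hrv] := fin_lb (fun l => (hfv l).1).
pose e := Num.min dl (Num.min rf rv).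
have e0 : 0 < e by rewrite !lt_min dl0 rf0.
have [ea eb ec] : [/\ e <= dl, e <= rf & e <= rv] by rewrite !ge_min !lexx !orbT.
clearbody e.
have [n1 h1] := real_cvg_ev ct e0; have [n2 h2] := mx_cvg_ev cx e0.
have [n3 h3] := real_cvg_ev cp e0; have [n4 h4] := mx_cvg_ev cq e0.
have [n5 h5] := mx_cvg_ev cM e0.
exists (maxn n1 (maxn n2 (maxn n3 (maxn n4 n5)))) => n.
rewrite !geq_max => /andP[/h1 {}h1 /andP[/h2 {}h2 /andP[/h3 {}h3 /andP[/h4 {}h4 /h5 {}h5]]]].
have := hdl (t_ n) (x_ n) (p_ n) (q_ n) (M_ n) (tnin n) (lt_le_trans h1 ea) (lt_le_trans h2 ea)
  (ltW (lt_le_trans h3 ea)) (ltW (lt_le_trans h4 ea)).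
have hM g : `|qf (M_ n) g - qf M g| <= dl * enorm g ^+ 2.
  apply: le_trans (qf_near _ _ _) _; apply: ler_wpM2r; first exact: sqr_ge0.
  by apply: ltW; apply: lt_le_trans h5 ea.
move=> /(_ hM).
set z := (sigma (t_ n) (x_ n))^T *m q_ n.
have k1 : `|f i (t_ n) (x_ n) (\col_l v l (t_ n) (x_ n)) z - f i t x (\col_l v l (t_ n) (x_ n)) z| < w / 4.
  exact: (hrf _ _ (tnin n) (lt_le_trans h1 eb) (lt_le_trans h2 eb)).
have k2 : `|f i t x (\col_l v l (t_ n) (x_ n)) z - f i t x (\col_l v l t x) z| <= w / 4.
  apply: le_trans (fl i t x _ _ z z tin) _.
  apply: le_trans (mul_small mC w4); rewrite -mulrA; apply: ler_wpM2l => //.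
  rewrite subrr enorm0 addr0.
  apply: (@le_trans _ _ (\sum_(l < m) w / 4 / (Cf * m%:R + 1))).
    apply: ler_sum => l _; rewrite !mxE; apply: ltW; apply: (hfv l).2 => //.
      by apply: lt_le_trans h1 _; apply: le_trans ec (hrv l).
    by apply: lt_le_trans h2 _; apply: le_trans ec (hrv l).
  by rewrite sumr_const card_ord -[X in X <= _]mulr_natl.
rewrite /op -/z; move: k1 k2; rewrite !ler_norml !ltr_norml.
move=> /andP[a1 a2] /andP[a3 a4] /andP[a5 a6]; apply/andP; split; lra_on a1 a2 a3 a4 a5 a6.
Qed.

(* Subjets exist densely: minimize w plus a steep quadratic. *)
Lemma subjet_dense (w : R -> 'cV[R]_k -> R) (t : R) x (e : R) : strip_lsc T w -> 0 <= t < T -> 0 < e ->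
  exists t1 x1 p q M, [/\ 0 <= t1 < T, `|t1 - t| < e, enorm (x1 - x) < e & subjet T w t1 x1 p q M].
Proof.
move=> wl /andP[t0 tT] e0; have tin : 0 <= t <= T by rewrite t0 ltW.
have [r1 r10 hr1] := (strip_lscP T _).1 wl t x tin _ ltr01.
pose r := Num.min (r1 / 2) (Num.min (e / 2) ((T - t) / 2)).
have r0 : 0 < r by rewrite !lt_min !divr_gt0// subr_gt0.
have [rB rC rD] : [/\ r <= r1 / 2, r <= e / 2 & r <= (T - t) / 2] by rewrite !ge_min !lexx !orbT.
clearbody r.
have r20 : 0 < r ^+ 2 by rewrite exprn_gt0.
pose K := 2 / r ^+ 2; have K0 : 0 < K by rewrite divr_gt0.
have KE : K * r ^+ 2 = 2 by rewrite /K mulfVK// gt_eqF.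
clearbody K.
pose M : 'M[R]_k := (- (2 * K)) *: 1%:M.
have Ms : M^T = M by rewrite linearZ /= trmx1.
have [t1 [x1 [[t1in tr xr] hmin]]] := box_min x 0 0 K wl tin r0 Ms.
have hc := hmin _ _ (boxQ_center x tin r0); rewrite quad0 subr0 in hc.
have qE : quad 0 0 M K t x t1 x1 = - (K * ((t1 - t) ^+ 2 + enorm (x1 - x) ^+ 2)).
  rewrite /quad mul0r add0r /M qfZ qf1.
  have -> : dotv 0 (x1 - x) = 0 by rewrite /dotv big1// => j _; rewrite mxE mul0r.
  by field.
have lo := hr1 t1 x1 t1in (ltac:(lra_on tr rB r10)) (ltac:(lra_on xr rB r10)).
have key : (t1 - t) ^+ 2 + enorm (x1 - x) ^+ 2 < r ^+ 2.
  rewrite -(ltr_pM2l K0); lra_on lo hc qE KE.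
have s0 := sqr_ge0 (t1 - t); have y0 := sqr_ge0 (enorm (x1 - x)).
have tlt : `|t1 - t| < r.
  rewrite -(@ltr_pXn2r _ 2)// ?nnegrE//; last exact: ltW.
  by rewrite real_normK ?num_real//; lra_on key y0.
have xlt : enorm (x1 - x) < r.
  rewrite -(@ltr_pXn2r _ 2)// ?nnegrE ?enorm_ge0//; last exact: ltW.
  by lra_on key s0.
have [r2 r20' hr2] := boxQ_sub T tlt xlt.
have tT1 : t1 < T by have := ler_norm (t1 - t); lra_on tlt rD r0.
exists t1, x1, (0 - 2 * K * (t1 - t)), (0 + M *m (x1 - x)), M; split.
- by rewrite tT1 andbT; case/andP: t1in.
- lra_on tlt rC e0.
- lra_on xlt rC e0.
- split=> // ep ep0; apply/near_strip.
  exists (Num.min r2 (ep / K)); first by rewrite lt_min r20' divr_gt0.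
  move=> s y sin; rewrite !lt_min => /andP[a1 a2] /andP[b1 _] /=.
  have := hmin s y (hr2 s y (And3 sin (ltW a1) (ltW b1))).
  rewrite (quad_expand 0 0 K t x t1 x1 s y Ms) /taylor2 -/(qf _ _).
  have : K * (s - t1) ^+ 2 <= ep * `|s - t1|.
    rewrite -(real_normK (num_real (s - t1))) expr2 mulrA; apply: ler_wpM2r => //.
    by rewrite mulrC -ler_pdivlMr// ltW.
  have : 0 <= ep * enorm (y - x1) ^+ 2 by rewrite mulr_ge0 ?sqr_ge0// ltW.
  clear; lra.
Qed.

End limits.

(** * Existence and uniqueness for given schemes *)

Section wellposed.
Variables (R : realType) (T : R) (k d m : nat).
Variables (b : R -> 'cV[R]_k -> 'cV[R]_k) (sigma : R -> 'cV[R]_k -> 'M[R]_(k, d)).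
Variables (f : 'I_m -> R -> 'cV[R]_k -> 'cV[R]_m -> 'cV[R]_d -> R).
Variables (g : 'I_m -> 'I_m -> R -> 'cV[R]_k -> R) (h : 'I_m -> 'cV[R]_k -> R).
Variables (Cg CL Cf C5 : R) (A : schemes R k m).
Hypothesis D : data_ok T b sigma f g h Cg CL Cf.
Hypothesis ap : approximates T b sigma A (penalized f g) h C5.
Hypothesis apm : approximates T b sigma (flip A) (fun n => dflip (penalized f g n))
  (fun i x => - h i x) C5.

Let T0 : 0 < T := data_T D.
Let cf := data_coefs D.
Let dr := data_driver D.
Let gc := data_gc D.
Let Cf0 : 0 <= Cf. Proof. by case: dr. Qed.
Local Notation v := (lowlim T A).
Local Notation vm := (lowlim T (flip A)).

Lemma half_in (t : R) : 0 <= t < T -> 0 <= t <= T.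
Proof. by case/andP => -> /ltW ->. Qed.

Lemma near_T (t_ : nat -> R) t : 0 <= t < T -> t_ n @[n --> \oo] --> t -> (forall n, 0 <= t_ n <= T) ->
  exists n0, forall n, (n0 <= n)%N -> 0 <= t_ n < T.
Proof.
move=> /andP[t0 tT] ct tnin; have dT : 0 < T - t by rewrite subr_gt0.
have [n0 h0] := real_cvg_ev ct dT; exists n0 => n /h0.
case/andP: (tnin n) => -> _ /=; have := ler_norm (t_ n - t); lra.
Qed.

Lemma v_terminalE i x : v i T x = h i x.
Proof.
have Tin : 0 <= T <= T by rewrite lexx ltW.
apply/eqP; rewrite eq_le (v_terminal D ap) andbT (vmE D ap apm)// lerNl.
exact: (vm_terminal D apm).
Qed.

(** The inequalities are known on jets, and the continuity of [v] carries them over to limiting jets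
    by [op_lim]. For the subsolution part, either an obstacle is active, or all of them are inactive
    in a neighbourhood and [vm_sub] applies along the approximating jets. *)
Lemma v_viscosity : viscosity_solution T b sigma f g h v.
Proof.
have vc := v_cont D ap apm; have [_ _ _ bc sc] := cf.
have Tin : 0 <= T <= T by rewrite lexx ltW.
split=> //; split.
- by move=> i; exact: lowlim_lsc_.
- move=> i t x p q M tin [t_ [x_ [p_ [q_ [M_ [hj [ct cx _] [cp cq cM]]]]]]].
  have tnin n : 0 <= t_ n <= T by case: (hj n).
  apply/system_op_ge0; split; first by move=> l li; exact: (v_obstacle D ap).
  apply/ler_addgt0Pl => w w0.
  have [n1 h1] := op_lim i bc sc dr vc (half_in tin) tnin ct cx cp cq cM w0.
  have [n2 h2] := near_T tin ct tnin.
  have := h1 _ (leq_maxl n1 n2).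
  have := v_super D ap (h2 _ (leq_maxr n1 n2)) (hj (maxn n1 n2)).2.
  by move=> a1; rewrite ler_norml => /andP[_ a2]; lra.
- by move=> i x; rewrite v_terminalE.
- move=> i; apply/strip_uscP => t x tin e e0.
  have [r r0 hr] := (strip_contP T _).1 (vc i) t x tin e e0.
  exists r => // s y sin a1 b1; have := hr s y sin a1 b1; rewrite ltr_norml => /andP[_]; lra.
- move=> i t x p q M tin [t_ [x_ [p_ [q_ [M_ [hj [ct cx _] [cp cq cM]]]]]]].
  have tnin n : 0 <= t_ n <= T by case: (hj n).
  apply/system_op_le0.
  have [hex|hn] := EM (exists2 j, j != i & v i t x <= v j t x - g i j t x); [by left|right].
  have hg l : l != i -> v l t x - g i l t x < v i t x.
    by move=> li; rewrite ltNge; apply/negP => hle; apply: hn; exists l.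
  have vu l : strip_usc T (v l).
    apply/strip_uscP => s y sin e e0.
    have [r r0 hr] := (strip_contP T _).1 (vc l) s y sin e e0.
    exists r => // s' y' sin' a1 b1; have := hr s' y' sin' a1 b1; rewrite ltr_norml => /andP[_]; lra.
  have [r r0 hr] := good_open D (half_in tin) vu hg.
  have [r' r'0 hr'] := (strip_contP T _).1 (vc i) t x (half_in tin) r r0.
  suff : forall w : R, 0 < w -> op b sigma (f i t x (\col_j v j t x)) t x p q M <= w.
    by move=> H; apply/ler_addgt0Pl => w w0; rewrite addr0; exact: H.
  move=> w w0.
  have rr0 : 0 < Num.min r r' by rewrite lt_min r0.
  have [n1 h1] := op_lim i bc sc dr vc (half_in tin) tnin ct cx cp cq cM w0.
  have [n2 h2] := near_T tin ct tnin.
  have [n3 h3] := real_cvg_ev ct rr0; have [n4 h4] := mx_cvg_ev cx rr0.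
  pose n := maxn n1 (maxn n2 (maxn n3 n4)).
  have l1 : (n1 <= n)%N by rewrite leq_maxl.
  have l2 : (n2 <= n)%N by rewrite /n !leq_max leqnn orbT.
  have l3 : (n3 <= n)%N by rewrite /n !leq_max leqnn !orbT.
  have l4 : (n4 <= n)%N by rewrite /n !leq_max leqnn !orbT.
  have := h3 n l3; rewrite lt_min => /andP[a1 a2]; have := h4 n l4; rewrite lt_min => /andP[b1 b2].
  have hgn := hr _ _ (tnin n) a1 b1 (hr' _ _ (tnin n) a2 b2).
  have E s y : 0 <= s <= T -> forall l, v l s y = - vm l s y.
    by move=> sin l; exact: (vmE D ap apm).
  have sj : superjet T (fun t x => - vm i t x) (t_ n) (x_ n) (p_ n) (q_ n) (M_ n).
    have [Ms hs] := (hj n).2; split=> // e e0; have := hs e e0.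
    move=> /near_strip [r3 r30 hr3]; apply/near_strip; exists r3 => // s y sin c1 c2.
    have := hr3 s y sin c1 c2; rewrite /taylor2 /=.
    by rewrite !E.
  have := vm_sub D apm (h2 n l2) sj.
  have -> : (\col_l - vm l (t_ n) (x_ n)) = \col_l v l (t_ n) (x_ n) :> 'cV[R]_m.
    by apply/colP => l; rewrite !mxE E.
  have hg' l : l != i -> - vm l (t_ n) (x_ n) - g i l (t_ n) (x_ n) < - vm i (t_ n) (x_ n).
    by move=> li; rewrite -!E//; exact: hgn.
  move=> /(_ hg') z1; have := h1 n l1; rewrite ler_norml => /andP[z2 _]; lra.
- by move=> i x; rewrite v_terminalE.
Qed.

(** The definition speaks only of points that carry a limiting subjet. Such points are dense, and
    both sides are continuous. *)
Lemma super_obstacle (w : 'I_m -> R -> 'cV[R]_k -> R) i l (t : R) x :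
  (forall i, strip_continuous T (w i)) -> viscosity_supersolution T b sigma f g h w ->
  l != i -> 0 <= t < T -> w l t x - g i l t x <= w i t x.
Proof.
move=> wc [wl ws _] li tin; rewrite leNgt; apply/negP => hlt.
have tin' := half_in tin; have il : i != l by rewrite eq_sym.
pose e := (w l t x - g i l t x - w i t x) / 4.
have e0 : 0 < e by rewrite divr_gt0// subr_gt0.
have [r1 r10 h1] := (strip_contP T _).1 (gc il) t x tin' _ e0.
have [r2 r20 h2] := (strip_contP T _).1 (wc l) t x tin' _ e0.
have [r3 r30 h3] := (strip_contP T _).1 (wc i) t x tin' _ e0.
have rr : 0 < Num.min r1 (Num.min r2 r3) by rewrite !lt_min r10 r20.
have [t1 [x1 [p [q [M [t1in a b' hj]]]]]] := subjet_dense x (wl i) tin rr.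
have t1in' := half_in t1in.
move: a b'; rewrite !lt_min => /andP[a1 /andP[a2 a3]] /andP[b1 /andP[b2 b3]].
have /system_op_ge0 [ho _] := ws i t1 x1 p q M t1in (subjet_limiting t1in' hj).
have := ho l li; have := h1 _ _ t1in' a1 b1; have := h2 _ _ t1in' a2 b2; have := h3 _ _ t1in' a3 b3.
rewrite !ltr_norml /e => /andP[c1 c2] /andP[c3 c4] /andP[c5 c6] c7.
by move: hlt; rewrite /e in c1 c2 c3 c4 c5 c6; lra.
Qed.

(** As a subsolution, [w] lies below [v]. For the converse [- w] is compared with the opposite
    scheme: here the obstacle inequality comes from [w], and the loop condition yields a maximal
    index at which the obstacles of the limit are inactive, as [dominates_flip] requires. *)
Lemma v_unique (w : 'I_m -> R -> 'cV[R]_k -> R) C N :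
  viscosity_solution T b sigma f g h w ->
  (forall i (t : R) x, 0 <= t <= T -> `|w i t x| <= C * psi N x) ->
  forall i (t : R) x, 0 <= t <= T -> w i t x = v i t x.
Proof.
move=> [wc wsuper wsub] hC; have Tin : 0 <= T <= T by rewrite lexx ltW.
have [wl wsp wT] := wsuper; have [wu wsb wT'] := wsub.
have le1 : forall i (t : R) x, 0 <= t <= T -> w i t x <= v i t x.
  apply: (below_v D ap wu (C := C) (N := N)).
  - by move=> i t x tin; have := hC i t x tin; rewrite ler_norml => /andP[].
  - by move=> i x; exact: wT'.
  - move=> i t x p q M tin hj hg.
    have /system_op_le0 := wsb i t x p q M tin (superjet_limiting (half_in tin) hj).
    by case=> // -[l li]; rewrite leNgt hg.
have le2 : forall i (t : R) x, 0 <= t <= T -> - w i t x <= vm i t x.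
  apply: (sub_le_lowlim T0 cf apm (dflip_ok dr) (u := fun i t x => - w i t x) (C := C) (N := N)).
  - move=> i; rewrite /strip_usc (_ : (fun t x => - - w i t x) = w i); first exact: wl.
    by apply/funext => t; apply/funext => x; rewrite opprK.
  - by move=> i t x tin; have := hC i t x tin; rewrite ler_norml => /andP[h1 _]; rewrite lerNl.
  - move=> i x; apply: (@le_trans _ _ (- h i x)); first by rewrite lerN2.
    exact: (vm_terminal D apm).
  - move=> t x c tin hle hex; have tin' := half_in tin.
    have : exists i, - w i t x - vm i t x = c /\ forall l, l != i -> vm i t x < vm l t x + g i l t x.
      apply: contrapT => hn.
      apply: (no_loop (x := x) (a := fun i => - vm i t x) (S := fun i => - w i t x - vm i t x = c) (data_loop D) tin' hex).
      move=> i hi; apply: contrapT => hn2; apply: hn; exists i; split=> // l li.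
      rewrite ltNge; apply/negP => h1; apply: hn2; exists l; split=> //; last by lra.
      have h2 := super_obstacle x wc wsuper li tin; have h3 := hle l.
      by apply/eqP; rewrite eq_le h3 /=; lra.
    move=> [i [hi hg]]; exists i; split=> //; first exact: (dominates_flip dr tin' gc hg).
    exists 1 => // t' x' p q M t'in _ _ _ hj.
    have sj : subjet T (w i) t' x' (- p) (- q) (- M).
      have := superjet_flip hj; rewrite (_ : (fun t x => - - w i t x) = w i)//.
      by apply/funext => s; apply/funext => y; rewrite opprK.
    have /system_op_ge0 [_ hop] := wsp i t' x' _ _ _ t'in (subjet_limiting (half_in t'in) sj).
    have := op_flip b sigma f i t' x' (\col_l - w l t' x') (- p) (- q) (- M).
    rewrite !opprK => ->; rewrite oppr_le0.
    have -> : - (\col_l - w l t' x') = \col_l w l t' x' :> 'cV[R]_m.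
      by apply/colP => l; rewrite !mxE opprK.
    exact: hop.
move=> i t x tin; apply/eqP; rewrite eq_le le1//= (vmE D ap apm)// lerNl.
exact: le2.
Qed.

Lemma v_growth i : strip_poly_growth T (v i).
Proof.
have m0 : (0 < m)%N := leq_ltn_trans (leq0n i) (ltn_ord i).
exists (bC A * 2 ^+ bP A), (2 * bP A)%:R; split.
- by rewrite mulr_ge0 ?bC_ge0// exprn_ge0.
- exact: ler0n.
- move=> t x tin; apply: le_trans (@lowlim_bnd R T k m T0 A i t x tin) _.
  by rewrite -mulrA; apply: ler_wpM2l; [exact: bC_ge0|exact: psi_poly].
Qed.

End wellposed.

(** * Functions with a cubic Taylor remainder; partitions of unity *)

Section taylor.
Variables (R : realType) (k : nat).
Implicit Types (f g : 'cV[R]_k -> R) (x e v : 'cV[R]_k).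

(* Bounded functions with a second-order expansion whose remainder is cubic,
   uniformly in the base point. *)
Definition tay (C : R) f : Prop := (forall x, `|f x| <= C) /\
  forall x, exists q Y, Y^T = Y /\ forall e, enorm e <= 1 ->
    `|f (x + e) - f x - dotv q e - 2^-1 * qf Y e| <= C * enorm e ^+ 3.

Lemma tay_ge0 C f : tay C f -> 0 <= C.
Proof. by case=> h _; exact: le_trans (normr_ge0 _) (h 0). Qed.

Lemma tay_le C C' f : C <= C' -> tay C f -> tay C' f.
Proof.
move=> h [h1 h2]; split=> [x|x]; first exact: le_trans (h1 x) h.
have [q [Y [Ys hY]]] := h2 x; exists q, Y; split=> // e he.
by apply: le_trans (hY e he) _; apply: ler_wpM2r => //; rewrite exprn_ge0// enorm_ge0.
Qed.

Lemma tay_cst (c : R) : tay `|c| (fun=> c).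
Proof.
split=> // x; exists 0, 0; split=> [|e _]; first exact: trmx0.
rewrite subrr /qf mul0mx.
have dot0 (u : 'cV[R]_k) : dotv 0 u = 0 by rewrite /dotv big1// => i _; rewrite mxE mul0r.
by rewrite (dotvC e) !dot0 mulr0 !subr0 normr0 mulr_ge0// exprn_ge0// enorm_ge0.
Qed.

Lemma tay_shift C f v : tay C f -> tay C (fun x => f (x + v)).
Proof.
move=> [h1 h2]; split=> x; first exact: h1.
have [q [Y [Ys hY]]] := h2 (x + v); exists q, Y; split=> // e he.
by rewrite (addrAC x e v); exact: hY.
Qed.

Lemma tay_ext C f g : f =1 g -> tay C f -> tay C g.
Proof. by move=> /funext ->. Qed.

Lemma tay_lin C D f g (a c : R) : tay C f -> tay D g ->
  tay (`|a| * C + `|c| * D) (fun x => a * f x + c * g x).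
Proof.
move=> [f1 f2] [g1 g2]; split=> x.
  by apply: le_trans (ler_normD _ _) _; rewrite !normrM; apply: lerD; apply: ler_wpM2l.
have [q [Y [Ys hY]]] := f2 x; have [q' [Y' [Ys' hY']]] := g2 x.
exists (a *: q + c *: q'), (a *: Y + c *: Y'); split.
  by rewrite linearD /= !linearZ /= Ys Ys'.
move=> e he; rewrite dotvDl !dotvZl qfD !qfZ.
have -> : a * f (x + e) + c * g (x + e) - (a * f x + c * g x) - (a * dotv q e + c * dotv q' e) -
  2^-1 * (a * qf Y e + c * qf Y' e) =
  a * (f (x + e) - f x - dotv q e - 2^-1 * qf Y e) +
  c * (g (x + e) - g x - dotv q' e - 2^-1 * qf Y' e) by ring.
apply: le_trans (ler_normD _ _) _; rewrite !normrM mulrDl -!mulrA; apply: lerD; apply: ler_wpM2l => //.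
  exact: hY.
exact: hY'.
Qed.

Lemma tay_sum (I : Type) (r : seq I) C (f : I -> 'cV[R]_k -> R) (a : I -> R) :
  (forall i, tay C (f i)) -> tay (\sum_(i <- r) `|a i| * C) (fun x => \sum_(i <- r) a i * f i x).
Proof.
move=> hf; elim: r => [|i r IH].
  rewrite big_nil; apply: (tay_ext (f := fun=> 0)); first by move=> x; rewrite big_nil.
  by rewrite -[X in tay X](normr0 R); exact: tay_cst.
rewrite big_cons; apply: (tay_ext (f := fun x => a i * f i x + 1 * \sum_(i <- r) a i * f i x)).
  by move=> x; rewrite big_cons mul1r.
have := tay_lin (a i) 1 (hf i) IH; by rewrite normr1 mul1r.
Qed.

Lemma qfNr (Y : 'M[R]_k) e : qf Y (- e) = qf Y e.
Proof. by rewrite -scaleN1r qfZr sqrrN expr1n mul1r. Qed.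

(** For a unit vector, the symmetric difference gives [2 * C] (one [C] from the values, one from the
    remainder) and the second difference gives [6 * C] (four and two). Homogeneity extends both
    bounds to all vectors. *)
Lemma tay_bnd C f x q Y : (forall x, `|f x| <= C) ->
  (forall e, enorm e <= 1 ->
    `|f (x + e) - f x - dotv q e - 2^-1 * qf Y e| <= C * enorm e ^+ 3) ->
  forall e, `|dotv q e| <= 2 * C * enorm e /\ `|qf Y e| <= 6 * C * enorm e ^+ 2.
Proof.
move=> hb hY.
have unit e : enorm e = 1 -> `|dotv q e| <= 2 * C /\ `|qf Y e| <= 6 * C.
  move=> e1; have h1 := hY e; have h2 := hY (- e).
  rewrite dotvNr qfNr enormN e1 expr1n mulr1 in h2; rewrite e1 expr1n mulr1 in h1.
  have := hb (x + e); have := hb (x - e); have := hb x.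
  have {h1} := h1 (lexx _); have {h2} := h2 (lexx _); rewrite !ler_norml.
  move=> /andP[a1 a2] /andP[a3 a4] /andP[a5 a6] /andP[a7 a8] /andP[a9 a10].
  by split; apply/andP; split; lra_on a1 a2 a3 a4 a5 a6 a7 a8 a9 a10.
move=> e; have [e0|en] := eqVneq (enorm e) 0.
  have -> : e = 0 by apply/enorm_eq0.
  rewrite enorm0 expr0n /= !mulr0; have := dotv_CS q 0; rewrite enorm0 mulr0 => ->.
  by have := qf_le Y 0; rewrite enorm0 expr0n /= mulr0.
have ep : 0 < enorm e by rewrite lt_neqAle eq_sym en enorm_ge0.
have [] := unit ((enorm e)^-1 *: e).
  by rewrite enormZ gtr0_norm ?invr_gt0// mulVf.
have v0 : 0 < (enorm e)^-1 by rewrite invr_gt0.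
have e2 : 0 < enorm e ^+ 2 by rewrite exprn_gt0.
rewrite dotvZr qfZr (normrM (enorm e)^-1) (normrM (_ ^+ 2)) (gtr0_norm v0) (ger0_norm (sqr_ge0 _)) exprVn => h1 h2.
by split; rewrite -ler_pdivrMr// mulrC.
Qed.

Lemma qf_outer (u v e : 'cV[R]_k) : qf (u *m v^T + v *m u^T) e = 2 * (dotv u e * dotv v e).
Proof.
have H (a c : 'cV[R]_k) : qf (a *m c^T) e = dotv a e * dotv c e.
  rewrite /qf -mulmxA.
  have -> : c^T *m e = (dotv c e)%:M.
    apply/matrixP => i j; rewrite !mxE !ord1 eqxx mulr1n; apply: eq_bigr => l _.
    by rewrite mxE.
  by rewrite mul_mx_scalar dotvZr (dotvC e) mulrC.
by rewrite qfD !H; ring.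
Qed.

(** The product of the two expansions leaves ten error terms, bounded with the help of [tay_bnd];
    their constants add up to 34, and 64 is a round majorant. *)
Lemma tay_mul C D f g : tay C f -> tay D g -> tay (64 * C * D) (fun x => f x * g x).
Proof.
move=> tf tg; have C0 := tay_ge0 tf; have D0 := tay_ge0 tg.
have CD0 : 0 <= C * D by rewrite mulr_ge0.
case: tf => f1 f2; case: tg => g1 g2; split=> x.
  rewrite normrM; apply: le_trans (ler_pM _ _ (f1 x) (g1 x)) _ => //; lra_on CD0.
have [q [Y [Ys hY]]] := f2 x; have [q' [Y' [Ys' hY']]] := g2 x.
exists (f x *: q' + g x *: q), (f x *: Y' + g x *: Y + (q *m q'^T + q' *m q^T)); split.
  by rewrite !linearD /= !linearZ /= Ys Ys' !trmx_mul !trmxK [q' *m _ + _]addrC.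
move=> e he; rewrite dotvDl !dotvZl !qfD !qfZ.
have := qf_outer q q' e; rewrite qfD => ->.
have [b1 b2] := tay_bnd f1 hY e; have [b3 b4] := tay_bnd g1 hY' e.
have {hY} hr := hY e he; have {hY'} hr' := hY' e he.
have e0 := enorm_ge0 e; have F := f1 x; have G := g1 x.
set rf := f (x + e) - f x - dotv q e - 2^-1 * qf Y e in hr.
set rg := g (x + e) - g x - dotv q' e - 2^-1 * qf Y' e in hr'.
have -> : f (x + e) * g (x + e) - f x * g x - (f x * dotv q' e + g x * dotv q e) -
    2^-1 * (f x * qf Y' e + g x * qf Y e + 2 * (dotv q e * dotv q' e)) =
   f x * rg + g x * rf + 2^-1 * (dotv q e * qf Y' e) + 2^-1 * (qf Y e * dotv q' e)
   + (2^-1 * qf Y e) * (2^-1 * qf Y' e) + dotv q e * rg + rf * dotv q' e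
   + 2^-1 * (qf Y e * rg) + 2^-1 * (rf * qf Y' e) + rf * rg.
  by rewrite /rf /rg; field.
move: (enorm e) e0 he b1 b2 b3 b4 hr hr' => n n0 n1 b1 b2 b3 b4 hr hr'.
have n3 : 0 <= n ^+ 3 by rewrite exprn_ge0.
have n32 : n ^+ 3 <= n ^+ 2 by apply: ler_wiXn2l.
have n21 : n ^+ 2 <= n by rewrite expr2 ler_piMl.
have n31 : n ^+ 3 <= n by apply: le_trans n21.
have e3 : n * n ^+ 2 = n ^+ 3 by rewrite -exprS.
have e3' : n ^+ 2 * n = n ^+ 3 by rewrite -exprSr.
have n4 : n ^+ 2 * n ^+ 2 <= n ^+ 3 by rewrite -[X in _ <= X]e3; apply: ler_wpM2r => //; exact: exprn_ge0.
have n5 : n * n ^+ 3 <= n ^+ 3 by rewrite ler_piMl.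
have n6 : n ^+ 2 * n ^+ 3 <= n ^+ 3 by rewrite ler_piMl// exprn_ile1.
have n7 : n ^+ 3 * n ^+ 3 <= n ^+ 3 by rewrite ler_piMl// exprn_ile1.
have P (a c A E : R) (N : R) : `|a| <= A -> `|c| <= E -> A * E <= N -> `|a * c| <= N.
  by move=> h1 h2 h3; rewrite normrM; apply: le_trans h3; apply: ler_pM.
have m1 : `|f x * rg| <= C * D * n ^+ 3 by apply: (P _ _ _ _ _ F hr'); rewrite mulrA.
have m2 : `|g x * rf| <= C * D * n ^+ 3 by apply: (P _ _ _ _ _ G hr); rewrite mulrA (mulrC D).
have m3 : `|dotv q e * qf Y' e| <= 12 * (C * D * n ^+ 3).
  by apply: (P _ _ _ _ _ b1 b4); rewrite -e3; lra.
have m4 : `|qf Y e * dotv q' e| <= 12 * (C * D * n ^+ 3).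
  by apply: (P _ _ _ _ _ b2 b3); rewrite -e3; lra.
have w4 := ler_wpM2l CD0 n4; have w5 := ler_wpM2l CD0 n5; have w6 := ler_wpM2l CD0 n6.
have w7 := ler_wpM2l CD0 n7.
have m5 : `|qf Y e * qf Y' e| <= 36 * (C * D * n ^+ 3).
  by apply: (P _ _ _ _ _ b2 b4); lra_on w4.
have m6 : `|dotv q e * rg| <= 2 * (C * D * n ^+ 3).
  by apply: (P _ _ _ _ _ b1 hr'); lra_on w5.
have m7 : `|rf * dotv q' e| <= 2 * (C * D * n ^+ 3).
  by apply: (P _ _ _ _ _ hr b3); lra_on w5.
have m8 : `|qf Y e * rg| <= 6 * (C * D * n ^+ 3).
  by apply: (P _ _ _ _ _ b2 hr'); lra_on w6.
have m9 : `|rf * qf Y' e| <= 6 * (C * D * n ^+ 3).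
  by apply: (P _ _ _ _ _ hr b4); lra_on w6.
have m10 : `|rf * rg| <= C * D * n ^+ 3.
  by apply: (P _ _ _ _ _ hr hr'); lra_on w7.
have pos : 0 <= C * D * n ^+ 3 by rewrite mulr_ge0.
have -> : 64 * C * D * n ^+ 3 = 64 * (C * D * n ^+ 3) by ring.
move: m1 m2 m3 m4 m5 m6 m7 m8 m9 m10 pos; rewrite !ler_norml; clear.
move: (C * D * n ^+ 3) (f x * rg) (g x * rf) (dotv q e * qf Y' e) (qf Y e * dotv q' e) => X v1 v2 v3 v4.
have -> : 2^-1 * qf Y e * (2^-1 * qf Y' e) = 4^-1 * (qf Y e * qf Y' e) by field.
move: (qf Y e * qf Y' e) (dotv q e * rg) (rf * dotv q' e) (qf Y e * rg) (rf * qf Y' e) (rf * rg) => v5 v6 v7 v8 v9 v10.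
do 10 move=> /andP[? ?]; move=> ?; apply/andP; split; lra.
Qed.

Lemma tay_prod (n : nat) C (f : 'I_n -> 'cV[R]_k -> R) : (forall i, tay C (f i)) ->
  exists D, tay D (fun x => \prod_i f i x).
Proof.
elim: n f => [|n IH] f hf.
  exists `|1|; apply: (tay_ext (f := fun=> 1)); first by move=> x; rewrite big_ord0.
  exact: tay_cst.
have [D hD] := IH (fun i => f (widen_ord (leqnSn n) i)) (fun i => hf _).
exists (64 * D * C).
apply: (tay_ext (f := fun x => (\prod_(i < n) f (widen_ord (leqnSn n) i) x) * f ord_max x)).
  by move=> x; rewrite big_ord_recr.
exact: tay_mul.
Qed.

Lemma tay_coord C (phi : R -> R) (c : 'I_k) : (forall s, `|phi s| <= C) ->
  (forall s, exists a a2, forall u, `|phi (s + u) - phi s - a * u - 2^-1 * (a2 * u ^+ 2)| <= C * `|u| ^+ 3) ->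
  tay C (fun x => phi (x c ord0)).
Proof.
move=> hb ht; split=> x; first exact: hb.
have C0 : 0 <= C := le_trans (normr_ge0 _) (hb 0).
have [a [a2 h]] := ht (x c ord0).
exists (a *: delta_mx c ord0), (a2 *: delta_mx c c); split; first by rewrite linearZ /= trmx_delta.
move=> e _.
have -> : dotv (a *: delta_mx c ord0) e = a * e c ord0.
  rewrite dotvZl; congr (_ * _); rewrite /dotv (bigD1 c)//= mxE !eqxx mul1r big1 ?addr0// => i ic.
  by rewrite mxE (negbTE ic) mul0r.
have -> : qf (a2 *: delta_mx c c) e = a2 * e c ord0 ^+ 2.
  rewrite qfZ; congr (_ * _); rewrite /qf /dotv (bigD1 c)//= [X in _ + X]big1 ?addr0; last first.
    by move=> i ic; rewrite mxE big1 ?mulr0// => j _; rewrite mxE (negbTE ic) mul0r.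
  rewrite mxE (bigD1 c)//= mxE !eqxx mul1r [X in _ + X]big1 ?addr0 ?expr2// => j jc.
  by rewrite mxE (negbTE jc) andbF mul0r.
rewrite mxE; apply: le_trans (h _) _; apply: ler_wpM2l => //.
by apply: lerXn2r; rewrite ?nnegrE ?enorm_ge0// enorm_coord.
Qed.

Lemma tay_cont C f x (e : R) : tay C f -> 0 < e -> exists2 r : R, 0 < r &
  forall y, enorm (y - x) < r -> `|f y - f x| < e.
Proof.
move=> tf e0; have C0 := tay_ge0 tf; case: tf => f1 f2.
have [q [Y [Ys hY]]] := f2 x; have hb := tay_bnd f1 hY.
have c1 : 0 < 6 * C + 1 by lra_on C0.
exists (Num.min 1 (e / (6 * C + 1))); first by rewrite lt_min ltr01 divr_gt0.
move=> y; rewrite lt_min => /andP[h1 h2].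
have yE : y = x + (y - x) by rewrite addrC subrK.
move: (y - x) yE h1 h2 => u -> h1 h2.
have [b1 b2] := hb u; have := hY u (ltW h1).
have u0 := enorm_ge0 u.
have u2 : enorm u ^+ 2 <= enorm u by rewrite expr2 ler_piMl// ltW.
have u3 : enorm u ^+ 3 <= enorm u.
  by apply: le_trans u2; apply: ler_wiXn2l => //; exact: ltW.
have k2 := ler_wpM2l C0 u2; have k3 := ler_wpM2l C0 u3.
rewrite ltr_pdivlMr// in h2.
move: b1 b2; rewrite !ler_norml ltr_norml => /andP[a1 a2] /andP[a3 a4] /andP[a5 a6].
by apply/andP; split; lra_on a1 a2 a3 a4 a5 a6 k2 k3 h2 u0.
Qed.

End taylor.

Section ramp.
Variable R : realType.
Implicit Types s u : R.

Definition cub s : R := Num.max 0 s ^+ 3.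

Lemma max0_pos s : 0 <= s -> Num.max 0 s = s. Proof. by move=> h; apply/max_idPr. Qed.
Lemma max0_neg s : s <= 0 -> Num.max 0 s = 0. Proof. by move=> h; apply/max_idPl. Qed.

Lemma cub_pos s : 0 <= s -> cub s = s ^+ 3. Proof. by move=> h; rewrite /cub max0_pos. Qed.
Lemma cub_neg s : s <= 0 -> cub s = 0.
Proof. by move=> h; rewrite /cub max0_neg// expr0n. Qed.

Lemma cub_taylor s u :
  `|cub (s + u) - cub s - 3 * Num.max 0 s ^+ 2 * u - 2^-1 * (6 * Num.max 0 s * u ^+ 2)| <= `|u| ^+ 3.
Proof.
have [s0|s0] := leP 0 s; have [t0|t0] := leP 0 (s + u).
- rewrite !cub_pos//.
  have -> : (s + u) ^+ 3 - s ^+ 3 - 3 * s ^+ 2 * u - 2^-1 * (6 * s * u ^+ 2) = u ^+ 3 by field.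
  by rewrite normrX.
- rewrite (cub_neg (ltW t0)) cub_pos//.
  have u0 : u <= 0 by lra.
  rewrite (ler0_norm u0).
  have h1 : 0 <= - (s + u) by lra.
  have h2 : - (s + u) <= - u by lra.
  have h3 : (- (s + u)) ^+ 3 <= (- u) ^+ 3 by apply: lerXn2r; rewrite ?nnegrE//; lra.
  have h4 : 0 <= (- (s + u)) ^+ 3 by rewrite exprn_ge0.
  have -> : 0 - s ^+ 3 - 3 * s ^+ 2 * u - 2^-1 * (6 * s * u ^+ 2) = (- (s + u)) ^+ 3 - (- u) ^+ 3 by field.
  by rewrite ler0_norm; lra.
- rewrite (cub_neg (ltW s0)) cub_pos// expr0n /= !(mulr0, mul0r) !subr0.
  rewrite ger0_norm ?exprn_ge0//; apply: lerXn2r; rewrite ?nnegrE//.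
  by have := ler_norm u; lra.
- rewrite (cub_neg (ltW s0)) (cub_neg (ltW t0)) expr0n /= !(mulr0, mul0r) !subr0.
  by rewrite normr0 exprn_ge0.
Qed.

(* The integral of the quadratic B-spline: a C^2 step from 0 to 1 on [0, 3]. *)
Definition chi s : R := (cub s - 3 * cub (s - 1) + 3 * cub (s - 2) - cub (s - 3)) / 6.

Lemma chi_le0 s : s <= 0 -> chi s = 0.
Proof. by move=> h; rewrite /chi !cub_neg; lra. Qed.

Lemma chi_ge3 s : 3 <= s -> chi s = 1.
Proof. by move=> h; rewrite /chi !cub_pos; try lra; field. Qed.

Lemma chi01 s : 0 <= s <= 1 -> chi s = s ^+ 3 / 6.
Proof. by move=> /andP[h1 h2]; rewrite /chi cub_pos// !cub_neg; lra. Qed.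

Lemma chi12 s : 1 <= s <= 2 -> chi s = (s ^+ 3 - 3 * (s - 1) ^+ 3) / 6.
Proof.
move=> /andP[h1 h2]; rewrite /chi (@cub_pos s) ?(@cub_pos (s - 1)) ?(@cub_neg (s - 2)) ?(@cub_neg (s - 3)); lra.
Qed.

Lemma chi23 s : 2 <= s <= 3 -> chi s = 1 - (3 - s) ^+ 3 / 6.
Proof.
move=> /andP[h1 h2]; rewrite /chi (@cub_pos s) ?(@cub_pos (s - 1)) ?(@cub_pos (s - 2)) ?(@cub_neg (s - 3)); lra.
Qed.

Lemma chi_mono s s' : s <= s' -> chi s <= chi s'.
Proof.
have c01 a c : 0 <= a -> a <= c -> c <= 1 -> chi a <= chi c.
  move=> h1 h2 h3; rewrite !chi01; try by apply/andP; split; lra.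
  by have : a ^+ 3 <= c ^+ 3 by [apply: lerXn2r; rewrite ?nnegrE//; lra]; lra.
have c12 a c : 1 <= a -> a <= c -> c <= 2 -> chi a <= chi c.
  move=> h1 h2 h3; rewrite !chi12; try by apply/andP; split; lra.
  rewrite -subr_ge0.
  pose p := a - 1; pose q := c - 1.
  have -> : (c ^+ 3 - 3 * (c - 1) ^+ 3) / 6 - (a ^+ 3 - 3 * (a - 1) ^+ 3) / 6 =
    (q - p) * (3 + 3 * p + 3 * q - 2 * (p ^+ 2 + p * q + q ^+ 2)) / 6 by rewrite /p /q; field.
  have p0 : 0 <= p by rewrite /p; lra.
  have q1 : q <= 1 by rewrite /q; lra.
  have pq : p <= q by rewrite /p /q; lra.
  clearbody p q; apply: divr_ge0 => //; apply: mulr_ge0; nra.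
have c23 a c : 2 <= a -> a <= c -> c <= 3 -> chi a <= chi c.
  move=> h1 h2 h3; rewrite !chi23; try by apply/andP; split; lra.
  by have : (3 - c) ^+ 3 <= (3 - a) ^+ 3 by [apply: lerXn2r; rewrite ?nnegrE//; lra]; lra.
have c03 a c : 0 <= a -> a <= c -> c <= 3 -> chi a <= chi c.
  move=> h1 h2 h3.
  have [a1|a1] := leP a 1; have [q1|q1] := leP c 1.
  - exact: c01.
  - apply: (@le_trans _ _ (chi 1)); first by apply: c01; lra.
    have [q2|q2] := leP c 2; first by apply: c12; lra.
    by apply: (@le_trans _ _ (chi 2)); [apply: c12; lra|apply: c23; lra].
  - lra.
  - have [a2|a2] := leP a 2; have [q2|q2] := leP c 2.
    + by apply: c12; lra.
    + by apply: (@le_trans _ _ (chi 2)); [apply: c12; lra|apply: c23; lra].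
    + lra.
    + by apply: c23; lra.
move=> h; have [a0|a0] := leP s 0.
  rewrite (chi_le0 a0); have [b0|b0] := leP s' 0; first by rewrite chi_le0.
  rewrite -(chi_le0 (lexx 0)); have [b3|b3] := leP s' 3; first by apply: c03; lra.
  by rewrite (chi_ge3 (ltW b3)) -(chi_ge3 (lexx 3)); apply: c03.
have [b3|b3] := leP s' 3; first by apply: c03; lra.
rewrite (chi_ge3 (ltW b3)) -(chi_ge3 (lexx 3)).
have [a3|a3] := leP s 3; first by apply: c03; lra.
by rewrite (chi_ge3 (ltW a3)) (chi_ge3 (lexx 3)).
Qed.

Lemma chi_ge0 s : 0 <= chi s.
Proof.
have [h|h] := leP s 0; first by rewrite chi_le0.
by rewrite -(chi_le0 (lexx 0)); apply: chi_mono; exact: ltW.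
Qed.

Lemma chi_le1 s : chi s <= 1.
Proof.
have [h|h] := leP s 3; last by rewrite chi_ge3// ltW.
by rewrite -(chi_ge3 (lexx 3)); apply: chi_mono.
Qed.

Lemma chi_taylor s : exists a a2, forall u,
  `|chi (s + u) - chi s - a * u - 2^-1 * (a2 * u ^+ 2)| <= 2 * `|u| ^+ 3.
Proof.
pose A z : R := 3 * Num.max 0 z ^+ 2; pose B z : R := 6 * Num.max 0 z.
exists ((A s - 3 * A (s - 1) + 3 * A (s - 2) - A (s - 3)) / 6),
  ((B s - 3 * B (s - 1) + 3 * B (s - 2) - B (s - 3)) / 6) => u.
have h0 := cub_taylor s u; have h1 := cub_taylor (s - 1) u.
have h2 := cub_taylor (s - 2) u; have h3 := cub_taylor (s - 3) u.
have u3 : 0 <= `|u| ^+ 3 by rewrite exprn_ge0.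
have E a : s + u - a = s - a + u by ring.
rewrite /chi !E.
move: h0 h1 h2 h3; rewrite -/(A s) -/(A (s - 1)) -/(A (s - 2)) -/(A (s - 3)) -/(B s) -/(B (s - 1)) -/(B (s - 2)) -/(B (s - 3)).
move: (cub (s + u)) (cub (s - 1 + u)) (cub (s - 2 + u)) (cub (s - 3 + u)) (cub s) (cub (s - 1)) (cub (s - 2)) (cub (s - 3)).
move: (A s) (A (s - 1)) (A (s - 2)) (A (s - 3)) (B s) (B (s - 1)) (B (s - 2)) (B (s - 3)) (`|u| ^+ 3) u3.
move=> ? ? ? ? ? ? ? ? X X0 ? ? ? ? ? ? ? ?.
by rewrite !ler_norml => /andP[? ?] /andP[? ?] /andP[? ?] /andP[? ?]; apply/andP; split; lra.
Qed.

End ramp.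

Section steps.
Variables (R : realType) (Rad : R) (L : nat).
Hypothesis Rad_gt0 : 0 < Rad.
Hypothesis L_gt0 : (0 < L)%N.

Definition mesh : R := 2 * Rad / (3 * L%:R).
Definition node (j : nat) : R := - Rad + 3 * mesh * j%:R.
(** Constantly 1 for [j = 0] and constantly 0 beyond [L], so that the differences [hat] sum to 1 on
    the whole line and not only on [[-Rad, Rad]]. In between, the ramp rises exactly from [node j]
    to [node j.+1], which are [3 * mesh] apart. *)
Definition ramp (j : nat) (s : R) : R :=
  if j == 0%N then 1 else if (L < j)%N then 0 else chi ((s - node j) / mesh).
Definition hat (j : nat) (s : R) : R := ramp j s - ramp j.+1 s.

Lemma mesh_gt0 : 0 < mesh.
Proof. by rewrite divr_gt0// mulr_gt0// ltr0n. Qed.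

Lemma nodeL : node L = Rad.
Proof. by rewrite /node /mesh; field; rewrite pnatr_eq0 -lt0n. Qed.

Lemma node_le i j : (i <= j)%N -> node i <= node j.
Proof.
move=> h; rewrite /node lerD2l; apply: ler_wpM2l; last by rewrite ler_nat.
by rewrite mulr_ge0// ltW// mesh_gt0.
Qed.

Lemma node_bnd j : (j <= L)%N -> `|node j| <= Rad.
Proof.
move=> h; rewrite ler_norml -{2}nodeL node_le// andbT.
by rewrite /node lerDl; apply: mulr_ge0 => //; rewrite mulr_ge0// ltW// mesh_gt0.
Qed.

Lemma ramp_ge0 j s : 0 <= ramp j s.
Proof. by rewrite /ramp; case: ifP => // _; case: ifP => // _; exact: chi_ge0. Qed.

Lemma ramp_le1 j s : ramp j s <= 1.
Proof. by rewrite /ramp; case: ifP => // _; case: ifP => // _; exact: chi_le1. Qed.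

Lemma hat_ge0 j s : 0 <= hat j s.
Proof.
rewrite /hat subr_ge0 {2}/ramp; case: eqP => [_|_]; first exact: ramp_le1.
case: ltnP => h; first by rewrite /ramp /= ltnS (ltnW h).
rewrite /ramp /=; case: ltnP => h'; first exact: chi_ge0.
apply: chi_mono; rewrite ler_pM2r ?invr_gt0 ?mesh_gt0// lerD2l lerN2; exact: node_le.
Qed.

Lemma hat_sum s : \sum_(j < L.+1) hat j s = 1.
Proof.
rewrite -(big_mkord xpredT (fun j => hat j s)).
rewrite (eq_bigr (fun j => - ramp j.+1 s - (- ramp j s))); last by move=> j _; rewrite opprK addrC.
by rewrite (telescope_sumr (fun j => - ramp j s))// /ramp /= ltnSn oppr0 add0r opprK.
Qed.

(** [s'] is the projection of [s] onto [[-Rad, Rad]]. An inner hat lives on two mesh intervals, of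
    total length [6 * mesh]; the first and the last one extend to infinity. *)
Lemma hat_loc j s : (j <= L)%N -> hat j s != 0 ->
  exists s', [/\ `|s'| <= `|s|, `|node j - s'| <= 6 * mesh & `|s| <= Rad -> s' = s].
Proof.
move=> hj; have m0 := mesh_gt0; have Rad0 := Rad_gt0; have nb := node_bnd hj; rewrite /hat /ramp /= => h.
have lo : j != 0%N -> node j <= s.
  move=> j0; rewrite leNgt; apply/negP => hs; move: h; rewrite (negbTE j0) ltnNge hj /=.
  have -> : chi ((s - node j) / mesh) = 0.
    by apply: chi_le0; rewrite ler_pdivrMr// mul0r; lra.
  case: ifP => _; first by rewrite subrr eqxx.
  rewrite chi_le0 ?subrr ?eqxx// ler_pdivrMr// mul0r.
  by have := node_le (leqnSn j); lra.
have nS : node j.+1 = node j + 3 * mesh by rewrite /node -natr1; ring.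
have hi : (j < L)%N -> s <= node j + 6 * mesh.
  move=> jL; rewrite leNgt; apply/negP => hs; move: h; rewrite [(L < j)%N]ltnNge hj /= ltnNge jL /=.
  have -> : chi ((s - node j.+1) / mesh) = 1.
    by apply: chi_ge3; rewrite ler_pdivlMr// nS; lra.
  case: ifP => _; first by rewrite subrr eqxx.
  by rewrite chi_ge3 ?subrr ?eqxx// ler_pdivlMr//; lra.
have n0 : node 0 = - Rad by rewrite /node mulr0 addr0.
move: nb; rewrite ler_norml => /andP[nb1 nb2].
have lo' : - Rad <= s -> node j <= s.
  by move=> hs; have [->|j0] := eqVneq j 0%N; [rewrite n0|exact: lo].
have hi' : s <= Rad -> s <= node j + 6 * mesh.
  by move: hj; rewrite leq_eqVlt => /orP[/eqP ->|/hi//]; rewrite nodeL => hs; lra.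
have [s1|s1] := leP s (- Rad).
  exists (- Rad); split.
  - by rewrite normrN (gtr0_norm Rad_gt0) ler0_norm; lra.
  - have [j0|j0] := eqVneq j 0%N; last by have := lo j0; rewrite ler_norml => ?; apply/andP; split; lra.
    by rewrite j0 n0 subrr normr0 mulr_ge0// ltW.
  - by rewrite ler_norml => /andP[? ?]; lra.
have [s2|s2] := leP s Rad.
  exists s; split=> //; rewrite ler_norml; have := lo' (ltW s1); have := hi' s2.
  by move=> ? ?; apply/andP; split; lra.
exists Rad; split.
- by rewrite !gtr0_norm//; lra.
- rewrite ler_norml; apply/andP; split; last by lra.
  by move: hj; rewrite leq_eqVlt => /orP[/eqP ->|/hi ?]; rewrite ?nodeL; lra.
- by rewrite ler_norml => /andP[? ?]; lra.
Qed.

Lemma ramp_taylor j s : exists a a2, forall u,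
  `|ramp j (s + u) - ramp j s - a * u - 2^-1 * (a2 * u ^+ 2)| <= 2 / mesh ^+ 3 * `|u| ^+ 3.
Proof.
have m0 := mesh_gt0; have C0 : 0 <= 2 / mesh ^+ 3 by rewrite divr_ge0// exprn_ge0// ltW.
rewrite /ramp; case: ifP => _.
  by exists 0, 0 => u; rewrite subrr !mul0r mulr0 !subr0 normr0 mulr_ge0// exprn_ge0.
case: ifP => _.
  by exists 0, 0 => u; rewrite !mul0r mulr0 !subr0 normr0 mulr_ge0// exprn_ge0.
have [a [a2 h]] := chi_taylor ((s - node j) / mesh).
exists (a / mesh), (a2 / mesh ^+ 2) => u; have := h (u / mesh).
have mi : 0 < mesh^-1 by rewrite invr_gt0.
have -> : (s - node j) / mesh + u / mesh = (s + u - node j) / mesh by rewrite -mulrDl; congr (_ / _); ring.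
have -> : a / mesh * u = a * (u / mesh) by ring.
have -> : a2 / mesh ^+ 2 * u ^+ 2 = a2 * (u / mesh) ^+ 2 by rewrite [(u / mesh) ^+ 2]expr_div_n; move: ((mesh ^+ 2)^-1) (u ^+ 2) => X Z; ring.
have -> // : 2 / mesh ^+ 3 * `|u| ^+ 3 = 2 * `|u / mesh| ^+ 3.
move: mi; move: (mesh) => q; rewrite invr_gt0 => q0; have qi : `|q^-1| = q^-1 by rewrite gtr0_norm// invr_gt0.
by rewrite normrM qi; move: `|u| => X; field; rewrite gt_eqF.
Qed.

Lemma hat_tay k (c : 'I_k) j : tay (4 / mesh ^+ 3 + 1) (fun x : 'cV[R]_k => hat j (x c ord0)).
Proof.
have m0 := mesh_gt0; have C0 : 0 <= 4 / mesh ^+ 3 by rewrite divr_ge0// exprn_ge0// ltW.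
apply: (tay_coord (phi := hat j)) => s.
  rewrite ger0_norm ?hat_ge0// /hat; have := ramp_ge0 j.+1 s; have := ramp_le1 j s; lra.
have [a [a2 h]] := ramp_taylor j s; have [a' [a2' h']] := ramp_taylor j.+1 s.
exists (a - a'), (a2 - a2') => u; have := h u; have := h' u; rewrite /hat.
have u3 : 0 <= `|u| ^+ 3 by rewrite exprn_ge0.
have -> : 4 / mesh ^+ 3 = 2 * (2 / mesh ^+ 3) by rewrite mulrA; congr (_ / _); ring.
move: (2 / mesh ^+ 3) (`|u| ^+ 3) u3 => M X X0.
rewrite !ler_norml => /andP[? ?] /andP[? ?]; apply/andP; split; lra.
Qed.

End steps.

(** Products of one-dimensional hats. The partition covers the whole space with finitely many nodes:
    a point outside the cube is attached to nodes near its projection [x'], whose norm is not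
    larger, so growth weights are not increased. *)
Lemma partition_ex (R : realType) (k : nat) (Rad r : R) : 0 < Rad -> 0 < r ->
  exists (I : finType) (pt : I -> 'cV[R]_k) (B : I -> 'cV[R]_k -> R) (CB : R),
  [/\ forall p x, 0 <= B p x, forall x, \sum_p B p x = 1, forall p, tay CB (B p),
    forall p, enorm (pt p) <= k%:R * Rad &
    forall p x, B p x != 0 -> exists x', [/\ enorm x' <= enorm x, enorm (pt p - x') <= r &
      enorm x <= Rad -> x' = x]].
Proof.
move=> Rad0 r0.
(* The 4 is [6 * 2 / 3], from the width of a hat and the definition of [mesh]; the factor [k] comes
   from bounding the Euclidean norm by the coordinates. *)
have [L0 hL] := nn_large (4 * Rad * (k%:R + 1) / r).
pose L := L0.+1; have L1 : (0 < L)%N by [].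
have hm : k%:R * (6 * mesh Rad L) <= r.
  have := hL L0 (leqnn _); rewrite nnE ler_pdivrMr// => h.
  have Lp : 0 < L%:R :> R by rewrite ltr0n.
  rewrite /mesh.
  have -> : k%:R * (6 * (2 * Rad / (3 * L%:R))) = 4 * Rad * k%:R / L%:R :> R by field; rewrite gt_eqF.
  have {}h : 4 * Rad * (k%:R + 1) <= L%:R * r := h.
  rewrite ler_pdivrMr//; move: (L%:R : R) h => X h; lra.
pose pt (p : {ffun 'I_k -> 'I_L.+1}) : 'cV[R]_k := \col_c node Rad L (p c).
pose B (p : {ffun 'I_k -> 'I_L.+1}) (x : 'cV[R]_k) := \prod_c hat Rad L (p c) (x c ord0).
have /choice [CB hCB] (p : {ffun 'I_k -> 'I_L.+1}) : exists D, tay D (B p).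
  exact: tay_prod (fun c => hat_tay Rad0 L1 c (p c)).
exists {ffun 'I_k -> 'I_L.+1}, pt, B, (\sum_p `|CB p|); split.
- by move=> p x; apply: prodr_ge0 => c _; exact: hat_ge0.
- move=> x; rewrite -(bigA_distr_bigA (fun c (j : 'I_L.+1) => hat Rad L j (x c ord0))).
  by rewrite big1// => c _; exact: hat_sum.
- move=> p; apply: tay_le (hCB p); rewrite (bigD1 p)//=.
  by apply: le_trans (ler_norm _) _; rewrite lerDl sumr_ge0.
- move=> p; rewrite -[k in X in _ <= X]muln1; apply: enorm_le_coord => c j.
  by rewrite mxE; apply: node_bnd => //; rewrite -ltnS.
- move=> p x hB.
  have hc c : hat Rad L (p c) (x c ord0) != 0 by move/prodf_neq0: hB => /(_ c isT).
  have hp c : (p c <= L)%N by rewrite -ltnS.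
  have /choice [s' hs'] c := hat_loc Rad0 L1 (hp c) (hc c).
  exists (\col_c s' c); split.
  + rewrite /enorm ler_wsqrtr// ler_sum// => c _; apply: ler_sum => j _.
    rewrite mxE ord1 -(real_normK (num_real (s' c))) -(real_normK (num_real (x c ord0))).
    by apply: lerXn2r; rewrite ?nnegrE//; case: (hs' c).
  + apply: le_trans hm; rewrite -[k in X in _ <= X]muln1; apply: enorm_le_coord => c j.
    by rewrite !mxE; case: (hs' c).
  + move=> hx; apply/matrixP => c j; rewrite mxE ord1; case: (hs' c) => _ _; apply.
    by apply: le_trans hx; exact: enorm_coord.
Qed.

(** * The scheme *)

Section barrier_increments.
Variables (R : realType) (k : nat).
Implicit Types x xi v : 'cV[R]_k.

Lemma psiS p x : psi p.+1 x = psi p x * (1 + enorm x ^+ 2).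
Proof. by rewrite /psi exprSr. Qed.

Lemma psi_cross p x xi : psi p x * (1 + enorm xi ^+ 2) <= psi p.+1 x + psi p.+1 xi.
Proof.
rewrite !psiS; have a1 := psi_gt0 p x; have a2 := psi_gt0 p xi.
have X0 : 0 < 1 + enorm x ^+ 2 by rewrite ltr_pwDl// sqr_ge0.
have Y0 : 0 < 1 + enorm xi ^+ 2 by rewrite ltr_pwDl// sqr_ge0.
have [h|/ltW h] := leP (1 + enorm xi ^+ 2) (1 + enorm x ^+ 2).
  by apply: le_trans (ler_wpM2l (ltW a1) h) _; rewrite lerDl ltW// mulr_gt0.
have : psi p x <= psi p xi.
  by apply: lerXn2r => //; rewrite nnegrE ltW.
by move=> /(ler_wpM2r (ltW Y0)) h2; apply: le_trans h2 _; rewrite lerDr ltW// mulr_gt0.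
Qed.

Definition incr_cst p (Cg : R) : R := p.+1%:R + 2 * (p.+1%:R + psiK R p.+1) * Cg ^+ 2.

Lemma incr_cst_ge0 p Cg : 0 <= incr_cst p Cg.
Proof.
apply: addr_ge0 => //; apply: mulr_ge0; last exact: sqr_ge0.
by apply: mulr_ge0 => //; apply: addr_ge0 => //; exact: psiK_ge0.
Qed.

Lemma growth_sqr (Cg : R) xi v : 0 <= Cg -> enorm v <= Cg * (1 + enorm xi) ->
  enorm v ^+ 2 <= 2 * Cg ^+ 2 * (1 + enorm xi ^+ 2).
Proof.
move=> C0 h; have v0 := enorm_ge0 v; have x0 := enorm_ge0 xi.
have h1 : enorm v ^+ 2 <= (Cg * (1 + enorm xi)) ^+ 2.
  by apply: lerXn2r; rewrite ?nnegrE// mulr_ge0// addr_ge0.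
apply: le_trans h1 _; rewrite exprMn [2 * _]mulrC -[X in _ <= X]mulrA; apply: ler_wpM2l; first exact: sqr_ge0.
have := sqr_ge0 (1 - enorm xi); rewrite !expr2; nra.
Qed.

Lemma psi_taylor_ub p x v : enorm v <= 1 -> psi p.+1 (x + v) <=
  psi p x * (1 + enorm x ^+ 2 + 2 * p.+1%:R * dotv x v + psiK R p.+1 * enorm v ^+ 2).
Proof.
move=> h; have A0 : 0 < 1 + enorm x ^+ 2 by rewrite ltr_pwDl// sqr_ge0.
have h1 := psi_taylor p.+1 x h; rewrite -(ler_pM2l A0); apply: le_trans h1 _.
by rewrite (psiS p x) -mulrA mulrCA.
Qed.

Lemma psi_first p x xi v (s Cg : R) : 0 <= Cg -> 0 <= s <= 1 -> s * enorm v <= 1 ->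
  enorm v <= Cg * (1 + enorm xi) ->
  psi p.+1 (x + s *: v) - psi p.+1 x <= s * (incr_cst p Cg * (psi p.+1 x + psi p.+1 xi)).
Proof.
move=> C0 /andP[s0 s1] sv hv; have gs := growth_sqr C0 hv.
have A0 : 0 < 1 + enorm x ^+ 2 by rewrite ltr_pwDl// sqr_ge0.
have ev : enorm (s *: v) = s * enorm v by rewrite enormZ ger0_norm.
have := @psi_taylor_ub p x (s *: v); rewrite ev => /(_ sv) h1.
have q0 := psi_gt0 p x; have K0 := psiK_ge0 R p.+1; have N0 := ler0n R p.+1.
have cr := psi_cross p x xi.
have xv : 2 * dotv x v <= enorm x ^+ 2 + enorm v ^+ 2.
  have := dotv_CS x v; rewrite ler_norml => /andP[_ h2].
  have := sqr_ge0 (enorm x - enorm v); rewrite !expr2; nra.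
have qx : psi p x * enorm x ^+ 2 <= psi p.+1 x by rewrite psiS; apply: ler_wpM2l; [exact: ltW|rewrite lerDr].
have qv : psi p x * enorm v ^+ 2 <= 2 * Cg ^+ 2 * (psi p.+1 x + psi p.+1 xi).
  apply: le_trans (ler_wpM2l (ltW q0) gs) _; rewrite mulrCA; apply: ler_wpM2l => //.
  by rewrite mulr_ge0// sqr_ge0.
have pxi := psi_gt0 p.+1 xi.
rewrite dotvZr [(s * _) ^+ 2]exprMn in h1.
have v2 : 0 <= enorm v ^+ 2 by rewrite sqr_ge0.
have ss : s ^+ 2 * enorm v ^+ 2 <= s * enorm v ^+ 2.
  by apply: ler_wpM2r => //; rewrite expr2 ler_piMr.
have e1 : psi p x * (1 + enorm x ^+ 2 + 2 * p.+1%:R * (s * dotv x v) + psiK R p.+1 * (s ^+ 2 * enorm v ^+ 2))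
   <= psi p x * (1 + enorm x ^+ 2 + s * (p.+1%:R * (enorm x ^+ 2 + enorm v ^+ 2) + psiK R p.+1 * enorm v ^+ 2)).
  apply: ler_wpM2l; first exact: ltW.
  have := ler_wpM2l K0 ss; have := ler_wpM2l s0 (ler_wpM2l N0 xv); lra.
have e2 : psi p x * (p.+1%:R * (enorm x ^+ 2 + enorm v ^+ 2) + psiK R p.+1 * enorm v ^+ 2) <=
   incr_cst p Cg * (psi p.+1 x + psi p.+1 xi).
  have := ler_wpM2l N0 qx; have := ler_wpM2l (addr_ge0 N0 K0) qv.
  have := ler_wpM2l N0 (ltW pxi); rewrite /incr_cst; lra.
have := ler_wpM2l s0 e2; have := le_trans h1 e1; have := psiS p x; lra.
Qed.

Lemma psi_second p x xi v (s Cg : R) : 0 <= Cg -> 0 <= s <= 1 -> s * enorm v <= 1 ->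
  enorm v <= Cg * (1 + enorm xi) ->
  psi p.+1 (x + s *: v) + psi p.+1 (x - s *: v) - 2 * psi p.+1 x
    <= 2 * s ^+ 2 * (incr_cst p Cg * (psi p.+1 x + psi p.+1 xi)).
Proof.
move=> C0 /andP[s0 s1] sv hv; have gs := growth_sqr C0 hv.
have A0 : 0 < 1 + enorm x ^+ 2 by rewrite ltr_pwDl// sqr_ge0.
have ev : enorm (s *: v) = s * enorm v by rewrite enormZ ger0_norm.
have ev' : enorm (- (s *: v)) = s * enorm v by rewrite enormN.
have := @psi_taylor_ub p x (s *: v); rewrite ev => /(_ sv) h1.
have := @psi_taylor_ub p x (- (s *: v)); rewrite ev' => /(_ sv) h2.
have q0 := psi_gt0 p x; have K0 := psiK_ge0 R p.+1; have N0 := ler0n R p.+1.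
have cr := psi_cross p x xi.
have qv : psi p x * enorm v ^+ 2 <= 2 * Cg ^+ 2 * (psi p.+1 x + psi p.+1 xi).
  apply: le_trans (ler_wpM2l (ltW q0) gs) _; rewrite mulrCA; apply: ler_wpM2l => //.
  by rewrite mulr_ge0// sqr_ge0.
have pxi := psi_gt0 p.+1 xi; have px := psi_gt0 p.+1 x.
rewrite dotvNr !dotvZr [(s * _) ^+ 2]exprMn in h1 h2.
have := ler_wpM2l (mulr_ge0 (sqr_ge0 s) K0) qv.
have C2 : 0 <= Cg ^+ 2 by rewrite sqr_ge0.
have g1 : 0 <= s ^+ 2 * p.+1%:R * ((1 + 2 * Cg ^+ 2) * (psi p.+1 x + psi p.+1 xi)).
  by rewrite !mulr_ge0// ?sqr_ge0// ?addr_ge0// ?mulr_ge0// ltW.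
have := psiS p x; rewrite /incr_cst; lra.
Qed.

End barrier_increments.

Section scheme.
Variables (R : realType) (k d m : nat).
Variables (b : R -> 'cV[R]_k -> 'cV[R]_k) (sigma : R -> 'cV[R]_k -> 'M[R]_(k, d)).
Variables (I : finType) (pt : I -> 'cV[R]_k) (B : I -> 'cV[R]_k -> R).
(* lambda: coupling of the frozen point; K: damping; Cz: Lipschitz constant in
   z; th: step of the discrete gradient; et: square root of the diffusion step *)
Variables (lambda K Cz th et ta T : R).

Local Notation cV := 'cV[R]_k.
Definition gen_driver := 'I_m -> R -> cV -> 'cV[R]_m -> 'cV[R]_d -> R.
Local Notation sg t xi l := (col l (sigma t xi)).

(** The variable [z] is replaced by centered differences along the columns of [sigma], and the last
    sum is a Lax-Friedrichs viscosity making the whole nondecreasing in [P] and [M]. The term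
    [K * y i] compensates the damping in [step], up to the interpolation by the partition. *)
Definition HH (F : gen_driver) i (t : R) (xi : cV) (D : R) (y : 'I_m -> R) (P M : 'I_d -> R) : R :=
  K * y i + lambda * (D - y i) + F i t xi (\col_l y l) (\col_l ((P l - M l) / (2 * th)))
  + Cz / (2 * th) * \sum_l (P l + M l - 2 * y i).

Definition HV (F : gen_driver) i t xi (w : 'I_m -> cV -> cV -> R) p : R :=
  HH F i t xi (w i (pt p) (pt p)) (fun l => w l (pt p) xi)
    (fun l => w i (pt p + th *: sg t xi l) xi) (fun l => w i (pt p - th *: sg t xi l) xi).

(** Second differences along the columns of [sigma] and a one-sided difference along [b]: shifted
    values carry nonnegative weights, and the shifts depend on [xi] alone. *)
Definition Ah t xi (w : cV -> R) x : R :=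
  (2 * et ^+ 2)^-1 * \sum_l (w (x + et *: sg t xi l) + w (x - et *: sg t xi l) - 2 * w x)
  + (et ^+ 2)^-1 * (w (x + et ^+ 2 *: b t xi) - w x).

(** The nonlinear part is evaluated at the nodes only and spread by the partition, so that [x]
    occurs solely in translates of [w] and in the functions [B p]. *)
Definition step F t (w : 'I_m -> cV -> cV -> R) i x xi : R :=
  w i x xi + ta * (Ah t xi (fun y => w i y xi) x - K * w i x xi
    + \sum_p B p x * HV F i t xi w p).

Fixpoint VV (F : gen_driver) (h : 'I_m -> cV -> R) (j : nat) : 'I_m -> cV -> cV -> R :=
  if j is j'.+1 then step F (T - j%:R * ta) (VV F h j')
  else fun i x _ => \sum_p B p x * h i (pt p).

Lemma HH_flip (F : gen_driver) i t xi D y P M :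
  HH (dflip F) i t xi (- D) (fun l => - y l) (fun l => - P l) (fun l => - M l) = - HH F i t xi D y P M.
Proof.
rewrite /HH /dflip.
have -> : - (\col_l - y l) = \col_l y l :> 'cV[R]_m by apply/colP => l; rewrite !mxE opprK.
have -> : - (\col_l ((- P l - - M l) / (2 * th))) = \col_l ((P l - M l) / (2 * th)) :> 'cV[R]_d.
  by apply/colP => l; rewrite !mxE -opprD mulNr opprK.
have -> : \sum_l (- P l + - M l - 2 * - y i) = - \sum_l (P l + M l - 2 * y i).
  by rewrite -sumrN; apply: eq_bigr => l _; ring.
by ring.
Qed.

Lemma Ah_flip t xi (w : cV -> R) x : Ah t xi (fun y => - w y) x = - Ah t xi w x.
Proof.
rewrite /Ah.
have -> : \sum_l (- w (x + et *: sg t xi l) + - w (x - et *: sg t xi l) - 2 * - w x) =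
   - \sum_l (w (x + et *: sg t xi l) + w (x - et *: sg t xi l) - 2 * w x).
  by rewrite -sumrN; apply: eq_bigr => l _; ring.
by ring.
Qed.

Lemma VV_flip F h j i x xi :
  VV (dflip F) (fun i x => - h i x) j i x xi = - VV F h j i x xi.
Proof.
elim: j i x xi => [|j IH] i x xi /=.
  by rewrite -sumrN; apply: eq_bigr => p _; rewrite mulrN.
have -> : VV (dflip F) (fun i x => - h i x) j = fun i x xi => - VV F h j i x xi.
  by apply/funext => i'; apply/funext => x'; apply/funext => xi'; exact: IH.
rewrite /step Ah_flip.
have -> : \sum_p B p x * HV (dflip F) i (T - j.+1%:R * ta) xi (fun i x xi => - VV F h j i x xi) p =
  - \sum_p B p x * HV F i (T - j.+1%:R * ta) xi (VV F h j) p.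
  by rewrite -sumrN; apply: eq_bigr => p _; rewrite /HV HH_flip mulrN.
by ring.
Qed.

Definition lip_driver (F : gen_driver) (CF : R) : Prop :=
  [/\ forall i t xi y y' z z', 0 <= t <= T ->
        F i t xi y z - F i t xi y' z' <=
        CF * (\sum_l `|y l ord0 - y' l ord0|) + Cz * \sum_l `|z l ord0 - z' l ord0|
    & forall i (t : R) xi (y y' : 'cV[R]_m) z, 0 <= t <= T -> y i ord0 = y' i ord0 ->
        (forall l, l != i -> y l ord0 <= y' l ord0) -> F i t xi y z <= F i t xi y' z].

(** The components other than [i] rise by monotonicity. Raising [y i] may lose [CF] in the driver,
    [lambda] in the coupling and [Cz * d / th] in the viscosity; [K] pays for the three. The
    variation of [z] is absorbed by the viscosity. *)
Lemma HH_mono F CF i (t : R) xi D y P M D' y' P' M' : 0 <= CF -> 0 <= Cz -> 0 < th -> 0 <= lambda ->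
  lip_driver F CF -> lambda + CF + Cz * d%:R / th <= K -> 0 <= t <= T ->
  D <= D' -> (forall l, y l <= y' l) -> (forall l, P l <= P' l) -> (forall l, M l <= M' l) ->
  HH F i t xi D y P M <= HH F i t xi D' y' P' M'.
Proof.
move=> CF0 Cz0 th0 la0 [Fl Fm] hK tin hD hy hP hM.
pose y1 : 'cV[R]_m := \col_l (if l == i then y i else y' l).
pose z : 'cV[R]_d := \col_l ((P l - M l) / (2 * th)).
pose z' : 'cV[R]_d := \col_l ((P' l - M' l) / (2 * th)).
have h1 : F i t xi (\col_l y l) z <= F i t xi y1 z.
  apply: (Fm i t xi _ _ _ tin); first by rewrite !mxE eqxx.
  by move=> l li; rewrite !mxE (negbTE li).
have h2 := Fl i t xi y1 (\col_l y' l) z z' tin.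
have h3 : \sum_l `|y1 l ord0 - (\col_l y' l) l ord0| = y' i - y i.
  rewrite (bigD1 i)//= !mxE eqxx big1 ?addr0; last by move=> l li; rewrite !mxE (negbTE li) subrr normr0.
  by rewrite distrC ger0_norm// subr_ge0.
have t2 : 0 < 2 * th by rewrite mulr_gt0.
have h4 : \sum_l `|z l ord0 - z' l ord0| <= (2 * th)^-1 * \sum_l (P' l - P l + (M' l - M l)).
  rewrite mulr_sumr; apply: ler_sum => l _; rewrite !mxE -mulrBl normrM [X in _ * X]gtr0_norm ?invr_gt0//.
  rewrite mulrC; apply: ler_wpM2l; first by rewrite invr_ge0 ltW.
  have := hP l; have := hM l; rewrite ler_norml => a1 a2; apply/andP; split; lra.
have h5 : \sum_l (P' l + M' l - 2 * y' i) - \sum_l (P l + M l - 2 * y i) =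
    \sum_l (P' l - P l + (M' l - M l)) - 2 * d%:R * (y' i - y i).
  rewrite -sumrB.
  have -> : 2 * d%:R * (y' i - y i) = \sum_(l < d) 2 * (y' i - y i).
    by rewrite sumr_const card_ord -[RHS]mulr_natl; ring.
  by rewrite -sumrB; apply: eq_bigr => l _; ring.
have h6 := ler_wpM2l Cz0 h4.
have h7 : Cz / (2 * th) * (2 * d%:R * (y' i - y i)) = Cz * d%:R / th * (y' i - y i).
  by field; rewrite gt_eqF.
have h8 : (lambda + CF + Cz * d%:R / th) * (y' i - y i) <= K * (y' i - y i).
  by apply: ler_wpM2r => //; rewrite subr_ge0.
have h9 : lambda * D <= lambda * D' by apply: ler_wpM2l.
rewrite h3 in h2.
have h10 : Cz / (2 * th) * (\sum_l (P' l + M' l - 2 * y' i) - \sum_l (P l + M l - 2 * y i)) =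
  Cz * ((2 * th)^-1 * \sum_l (P' l - P l + (M' l - M l))) - Cz * d%:R / th * (y' i - y i).
  by rewrite h5 mulrBr h7; congr (_ - _); rewrite [RHS]mulrA.
rewrite /HH -/z -/z'.
move: h1 h2 h6 h8 h9 h10; move: (F i t xi _ _) (F i t xi _ _) (F i t xi _ _) => f1 f2 f3.
move: (\sum_l (P' l + M' l - 2 * y' i)) (\sum_l (P l + M l - 2 * y i)) (Cz * ((2 * th)^-1 * _)) (Cz * \sum_l _) (Cz * d%:R / th) (Cz / (2 * th)) => s1 s2 s3 s4 s5 s6.
move: (y' i) (y i) => a1 a2; lra.
Qed.

Lemma Ah_split t xi w x : 0 < et -> w x + ta * (Ah t xi w x - K * w x) =
  (1 - ta * (K + (d%:R + 1) / et ^+ 2)) * w x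
  + ta / (2 * et ^+ 2) * (\sum_l (w (x + et *: sg t xi l) + w (x - et *: sg t xi l)))
  + ta / et ^+ 2 * w (x + et ^+ 2 *: b t xi).
Proof.
move=> e0; rewrite /Ah.
have -> : \sum_l (w (x + et *: sg t xi l) + w (x - et *: sg t xi l) - 2 * w x) =
  \sum_l (w (x + et *: sg t xi l) + w (x - et *: sg t xi l)) - 2 * d%:R * w x.
  rewrite -[2 * d%:R * _]mulrA; have -> : 2 * (d%:R * w x) = \sum_(l < d) 2 * w x.
    by rewrite sumr_const card_ord -[RHS]mulr_natl; ring.
  by rewrite -sumrB.
by field; rewrite gt_eqF// expf_neq0// gt_eqF.
Qed.

Lemma step_mono F CF t w w' i x xi : 0 <= CF -> 0 <= Cz -> 0 < th -> 0 <= lambda -> 0 < et -> 0 <= ta ->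
  lip_driver F CF -> lambda + CF + Cz * d%:R / th <= K -> 0 <= t <= T ->
  ta * (K + (d%:R + 1) / et ^+ 2) <= 1 -> (forall p y, 0 <= B p y) ->
  (forall i y, w i y xi <= w' i y xi) -> (forall i p, w i (pt p) (pt p) <= w' i (pt p) (pt p)) ->
  step F t w i x xi <= step F t w' i x xi.
Proof.
move=> CF0 Cz0 th0 la0 et0 ta0 hF hK tin cfl B0 hw hd.
have E v : step F t v i x xi = (v i x xi + ta * (Ah t xi (fun y => v i y xi) x - K * v i x xi))
   + ta * \sum_p B p x * HV F i t xi v p by rewrite /step; ring.
rewrite !E !Ah_split//.
have e2 : 0 < et ^+ 2 by rewrite exprn_gt0.
apply: lerD; last first.
  apply: ler_wpM2l => //; apply: ler_sum => p _; apply: ler_wpM2l => //.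
  by apply: (HH_mono (CF := CF)).
apply: lerD; first apply: lerD.
- by apply: ler_wpM2l => //; rewrite subr_ge0.
- apply: ler_wpM2l; first by rewrite divr_ge0// mulr_ge0// ltW.
  by apply: ler_sum => l _; apply: lerD.
- by apply: ler_wpM2l; [rewrite divr_ge0// ltW|].
Qed.

(** * A growth barrier for the scheme *)

Section estimates.
Variables (F : gen_driver) (h : 'I_m -> cV -> R).
Variables (CF C2 Cg c0 Ch rho S : R) (p0 : nat).
Hypotheses (CF0 : 0 <= CF) (Cz0 : 0 <= Cz) (la0 : 0 < lambda).
Hypotheses (th0 : 0 < th) (th1 : th <= 1) (et0 : 0 < et) (et1 : et <= 1) (ta0 : 0 <= ta).
Hypothesis lipF : lip_driver F CF.
Hypotheses (C20 : 0 <= C2) (bndF : forall i (t : R) xi c, 0 <= t <= T ->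
  `|F i t xi (const_mx c) 0| <= C2 * (psi p0.+1 xi + `|c|)).
Hypotheses (K1 : 1 <= K) (hK : lambda + CF + Cz * d%:R / th <= K).
Hypothesis cfl : ta * (K + (d%:R + 1) / et ^+ 2) <= 1.
Hypotheses (B_ge0 : forall p x, 0 <= B p x) (B_sum : forall x, \sum_p B p x = 1).
Hypotheses (rho0 : 0 <= rho) (Krho : K * rho <= 1).
Hypothesis Bpsi : forall p x, B p x != 0 -> psi p0.+1 (pt p) <= (1 + rho) * psi p0.+1 x.
Hypotheses (Cg0 : 0 <= Cg) (coefg : forall (t : R) x, 0 <= t <= T ->
  enorm (b t x) + enorm (sigma t x) <= Cg * (1 + enorm x)).
Hypothesis Sbnd : forall (t : R) p, 0 <= t <= T ->
  enorm (b t (pt p)) <= S /\ enorm (sigma t (pt p)) <= S.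
Hypotheses (S0 : 0 <= S) (etS : et * S <= 1) (thS : th * S <= 1).
Local Notation ps := (psi p0.+1).

Definition crate : R := (d%:R + 1) * incr_cst p0 Cg.
Definition c1rate : R := crate + C2 + Cz * crate.
Definition murate : R := crate + 1 + 2 * c1rate + 2 * C2 + 2 * (Cz * crate).
Local Notation kap := (c1rate / lambda).
Local Notation bar c x xi := (c * (ps x + kap * ps xi)).

Lemma crate_ge0 : 0 <= crate.
Proof. by rewrite mulr_ge0 ?incr_cst_ge0// addr_ge0. Qed.

Lemma c1rate_ge0 : 0 <= c1rate.
Proof. by have := crate_ge0 => h0; rewrite !addr_ge0// mulr_ge0. Qed.

Lemma sg_bnd (t : R) xi l : 0 <= t <= T -> enorm (sg t xi l) <= Cg * (1 + enorm xi).
Proof.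
move=> /(coefg xi); have := enorm_col (sigma t xi) l; have := enorm_ge0 (b t xi); lra.
Qed.

Lemma sgS (t : R) p l : 0 <= t <= T -> enorm (sg t (pt p) l) <= S.
Proof. by move=> /(Sbnd p) [_]; apply: le_trans; exact: enorm_col. Qed.

Lemma Ah_psi (t : R) x p : 0 <= t <= T -> Ah t (pt p) ps x <= crate * (ps x + ps (pt p)).
Proof.
move=> tin; have e2 : 0 < et ^+ 2 by rewrite exprn_gt0.
have hs l : ps (x + et *: sg t (pt p) l) + ps (x - et *: sg t (pt p) l) - 2 * ps x <=
    2 * et ^+ 2 * (incr_cst p0 Cg * (ps x + ps (pt p))).
  apply: psi_second => //; first by rewrite ltW.
    by apply: le_trans etS; apply: ler_wpM2l; [exact: ltW|exact: sgS].
  exact: sg_bnd.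
have hb : ps (x + et ^+ 2 *: b t (pt p)) - ps x <= et ^+ 2 * (incr_cst p0 Cg * (ps x + ps (pt p))).
  have e21 : et ^+ 2 <= et by rewrite expr2; apply: ler_piMr => //; exact: ltW.
  have bS := (Sbnd p tin).1.
  apply: psi_first => //.
  - by rewrite (ltW e2); apply: le_trans e21 et1.
  - apply: le_trans etS; apply: ler_pM => //; [exact: ltW|exact: enorm_ge0].
  - by have := coefg (pt p) tin; have := enorm_ge0 (sigma t (pt p)); lra.
have hs2 : \sum_l (ps (x + et *: sg t (pt p) l) + ps (x - et *: sg t (pt p) l) - 2 * ps x) <=
   2 * et ^+ 2 * (d%:R * (incr_cst p0 Cg * (ps x + ps (pt p)))).
  have -> : 2 * et ^+ 2 * (d%:R * (incr_cst p0 Cg * (ps x + ps (pt p)))) =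
     \sum_(l < d) 2 * et ^+ 2 * (incr_cst p0 Cg * (ps x + ps (pt p))).
    by rewrite sumr_const card_ord -[RHS]mulr_natl mulrCA.
  by apply: ler_sum => l _; exact: hs.
rewrite /Ah /crate; move: hs2 hb; move: (\sum_l _) (ps _ - ps x) (incr_cst p0 Cg) (ps x + _) => s1 s2 c X h1 h2.
have h3 : (2 * et ^+ 2)^-1 * s1 <= d%:R * (c * X).
  by rewrite mulrC ler_pdivrMr ?mulr_gt0// mulrC.
have h4 : (et ^+ 2)^-1 * s2 <= c * X by rewrite mulrC ler_pdivrMr// mulrC.
lra.
Qed.

Lemma HV_bar i (t : R) c p q : 0 <= t <= T -> 0 <= c ->
  HV F i t (pt q) (fun _ x xi => bar c x xi) p <=
  K * bar c (pt p) (pt q) + c * c1rate * (ps (pt p) - ps (pt q))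
  + C2 * (ps (pt q) + bar c (pt p) (pt q)) + Cz * (c * (crate * (ps (pt p) + ps (pt q)))).
Proof.
move=> tin c_ge0; rewrite /HV /HH.
set w0 := bar c (pt p) (pt q).
have px := psi_gt0 p0.+1 (pt p); have pxi := psi_gt0 p0.+1 (pt q); have c10 := c1rate_ge0.
have k0 : 0 <= kap by rewrite divr_ge0// ltW.
have y0 : 0 <= kap * ps (pt q) by apply: mulr_ge0 => //; exact: ltW.
have w00 : 0 <= w0 := mulr_ge0 c_ge0 (addr_ge0 (ltW px) y0).
have -> : \col_(_ < m) w0 = const_mx w0 :> 'cV[R]_m by apply/colP => l; rewrite !mxE.
set z := \col_l _.
have hF : F i t (pt q) (const_mx w0) z <= C2 * (ps (pt q) + w0) + Cz * \sum_l `|z l ord0|.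
  have := lipF.1 i t (pt q) (const_mx w0) (const_mx w0) z 0 tin.
  rewrite big1 ?mulr0 ?add0r; last by move=> l _; rewrite subrr normr0.
  have -> : \sum_l `|z l ord0 - (0 : 'cV[R]_d) l ord0| = \sum_l `|z l ord0|.
    by apply: eq_bigr => l _; rewrite !mxE subr0.
  have := bndF i (pt q) w0 tin; rewrite (ger0_norm w00) => h1.
  by have := ler_norm (F i t (pt q) (const_mx w0) 0); lra.
pose D := incr_cst p0 Cg * (ps (pt p) + ps (pt q)).
have hP l : ps (pt p + th *: sg t (pt q) l) - ps (pt p) <= th * D.
  apply: psi_first => //; first by rewrite ltW.
    by apply: le_trans thS; apply: ler_wpM2l; [exact: ltW|exact: sgS].
  exact: sg_bnd.
have hM l : ps (pt p - th *: sg t (pt q) l) - ps (pt p) <= th * D.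
  rewrite -scalerN; apply: psi_first => //; first by rewrite ltW.
    by rewrite enormN; apply: le_trans thS; apply: ler_wpM2l; [exact: ltW|exact: sgS].
  by rewrite enormN; exact: sg_bnd.
have hl l : Cz * `|z l ord0| + Cz / (2 * th) * (bar c (pt p + th *: sg t (pt q) l) (pt q) +
    bar c (pt p - th *: sg t (pt q) l) (pt q) - 2 * w0) <= Cz * (c * D).
  rewrite !mxE /w0; move: (hP l) (hM l); clear hF hP hM; clearbody D.
  move: (ps (pt p + _)) (ps (pt p - _)) (ps (pt p)) (kap * _) => P M W Y h1 h2.
  have -> : c * (P + Y) - c * (M + Y) = c * (P - M) by ring.
  have -> : c * (P + Y) + c * (M + Y) - 2 * (c * (W + Y)) = c * (P + M - 2 * W) by ring.
  have t2 : 0 < (2 * th)^-1 by rewrite invr_gt0 mulr_gt0.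
  rewrite !normrM (ger0_norm c_ge0) (gtr0_norm t2) -!mulrA -mulrDr; apply: ler_wpM2l => //.
  rewrite [(2 * th)^-1 * (c * _)]mulrCA -mulrDr; apply: ler_wpM2l => //.
  have -> : `|P - M| * (2 * th)^-1 + (2 * th)^-1 * (P + M - 2 * W) = (2 * th)^-1 * (`|P - M| + (P + M - 2 * W)) by ring.
  rewrite mulrC ler_pdivrMr ?mulr_gt0//.
  have [g|g] := ger0P (P - M); lra.
have hsum : Cz * \sum_l `|z l ord0| + Cz / (2 * th) * \sum_l (bar c (pt p + th *: sg t (pt q) l) (pt q) +
    bar c (pt p - th *: sg t (pt q) l) (pt q) - 2 * w0) <= Cz * (c * (crate * (ps (pt p) + ps (pt q)))).
  rewrite !mulr_sumr -big_split /=.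
  apply: le_trans (_ : \sum_(l < d) Cz * (c * D) <= _); first by apply: ler_sum => l _; exact: hl.
  rewrite sumr_const card_ord -[X in X <= _]mulr_natl /crate /D.
  have g1 : 0 <= incr_cst p0 Cg * (ps (pt p) + ps (pt q)) by rewrite mulr_ge0 ?incr_cst_ge0// addr_ge0// ltW.
  have := mulr_ge0 Cz0 (mulr_ge0 c_ge0 g1); lra.
have hd : lambda * (bar c (pt p) (pt p) - w0) = c * c1rate * (ps (pt p) - ps (pt q)).
  by rewrite /w0; field; rewrite gt_eqF.
rewrite hd; lra.
Qed.

(** As [lambda * kap = c1rate], the coupling produces [- c * c1rate * ps (pt q)], which cancels all
    growth caused by coefficients frozen at [pt q], however far from [x]. What remains is
    proportional to the barrier itself, with rate [murate]; the summand 1 in that rate pays for the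
    interpolation error of the damping. *)
Lemma step_bar i (t : R) c x q : 0 <= t <= T -> 1 <= c ->
  step F t (fun _ x xi => bar c x xi) i x (pt q) <= bar ((1 + murate * ta) * c) x (pt q).
Proof.
move=> tin c_ge1; have c_ge0 : 0 <= c := le_trans ler01 c_ge1.
have px := psi_gt0 p0.+1 x; have pxi := psi_gt0 p0.+1 (pt q); have c10 := c1rate_ge0.
have cr0 := crate_ge0; have k0 : 0 <= kap by rewrite divr_ge0// ltW.
have K0 : 0 <= K := le_trans ler01 K1.
have rho1 : rho <= 1 by apply: le_trans Krho; apply: ler_peMl.
pose U := K * bar c x (pt q) + c * ps x + c * c1rate * (2 * ps x - ps (pt q))
  + C2 * (ps (pt q) + c * (2 * ps x + kap * ps (pt q))) + Cz * (c * (crate * (2 * ps x + ps (pt q)))).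
have hsum : \sum_p B p x * HV F i t (pt q) (fun _ x xi => bar c x xi) p <= U.
  rewrite -[U]mul1r -(B_sum x) mulr_suml; apply: ler_sum => p _.
  have [->|np] := eqVneq (B p x) 0; first by rewrite !mul0r.
  apply: ler_wpM2l => //; apply: le_trans (HV_bar i p q tin c_ge0) _.
  have hp := Bpsi np.
  have hp2 : ps (pt p) <= 2 * ps x.
    have := ler_wpM2r (ltW px) rho1; lra.
  have e1 : K * bar c (pt p) (pt q) <= K * bar c x (pt q) + c * ps x.
    have g1 : K * ps (pt p) <= K * ps x + ps x.
      have g2 := ler_wpM2l K0 hp; have g3 := ler_wpM2r (ltW px) Krho; lra.
    have := ler_wpM2l c_ge0 g1; lra.
  have e2 := ler_wpM2l (mulr_ge0 c_ge0 c10) hp2.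
  have e3 := ler_wpM2l (mulr_ge0 C20 c_ge0) hp2.
  have e4 := ler_wpM2l (mulr_ge0 Cz0 (mulr_ge0 c_ge0 cr0)) hp2.
  rewrite /U; lra.
have hA : Ah t (pt q) (fun y => bar c y (pt q)) x <= c * (crate * (ps x + ps (pt q))).
  have -> : Ah t (pt q) (fun y => bar c y (pt q)) x = c * Ah t (pt q) ps x.
    rewrite /Ah; have -> : \sum_l (bar c (x + et *: sg t (pt q) l) (pt q) + bar c (x - et *: sg t (pt q) l) (pt q)
        - 2 * bar c x (pt q)) =
      c * \sum_l (ps (x + et *: sg t (pt q) l) + ps (x - et *: sg t (pt q) l) - 2 * ps x).
      by rewrite mulr_sumr; apply: eq_bigr => l _; ring.
    by ring.
  by apply: ler_wpM2l => //; exact: Ah_psi.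
have e : c * (crate * (ps x + ps (pt q))) - K * bar c x (pt q) + U <= murate * bar c x (pt q).
  have g1 : C2 * ps (pt q) <= c * (C2 * ps (pt q)) by apply: ler_peMl => //; rewrite mulr_ge0// ltW.
  have g2 : C2 * (c * (kap * ps (pt q))) <= murate * (c * (kap * ps (pt q))).
    apply: ler_wpM2r; first by apply: mulr_ge0 => //; apply: mulr_ge0 => //; exact: ltW.
    rewrite /murate; have := mulr_ge0 Cz0 cr0; have := C20; lra.
  move: g2; rewrite /U /murate; move: (kap * _) => Y g2.
  move: g1 g2; rewrite /murate /c1rate; lra.
have -> : bar ((1 + murate * ta) * c) x (pt q) = bar c x (pt q) + ta * (murate * bar c x (pt q)) by ring.
rewrite /step lerD2l; apply: ler_wpM2l => //; lra.
Qed.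

Hypotheses (c01 : 1 <= c0) (Chc0 : 2 * Ch <= c0) (hbnd : forall i x, `|h i x| <= Ch * ps x).

Lemma VV_time j : j%:R * ta <= T -> 0 <= T - j%:R * ta <= T.
Proof. by move=> hj; rewrite subr_ge0 hj lerBlDr lerDl mulr_ge0. Qed.

(* The penalty vanishes on equal components, so the barrier is the same for
   all n. *)
Lemma VV_bar j : j%:R * ta <= T -> forall i x q,
  VV F h j i x (pt q) <= bar ((1 + murate * ta) ^+ j * c0) x (pt q).
Proof.
have c10 := c1rate_ge0; have k0 : 0 <= kap by rewrite divr_ge0// ltW.
have cr0 := crate_ge0.
have mu0 : 0 <= murate by rewrite /murate; have := mulr_ge0 Cz0 cr0; have := C20; lra.
have K0 : 0 <= K := le_trans ler01 K1.
have rho1 : rho <= 1 by apply: le_trans Krho; apply: ler_peMl.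
elim: j => [|j IH] hj i x q.
  have px := psi_gt0 p0.+1 x; have pxi := psi_gt0 p0.+1 (pt q).
  rewrite expr0 mul1r /=; apply: le_trans (_ : c0 * ps x <= _); last first.
    apply: ler_wpM2l; first exact: le_trans ler01 c01.
    by rewrite lerDl mulr_ge0// ltW.
  rewrite -[X in _ <= X]mul1r -(B_sum x) mulr_suml; apply: ler_sum => p _.
  have [->|np] := eqVneq (B p x) 0; first by rewrite !mul0r.
  apply: ler_wpM2l => //; apply: le_trans (ler_norm _) _; apply: le_trans (hbnd _ _) _.
  have Ch0 : 0 <= Ch.
    by have := le_trans (normr_ge0 _) (hbnd i 0); rewrite pmulr_lge0 ?psi_gt0.
  have hp := Bpsi np; have g1 := ler_wpM2r (ltW px) rho1.
  have g2 : ps (pt p) <= 2 * ps x by lra.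
  have := ler_wpM2l Ch0 g2; have := ler_wpM2r (ltW px) Chc0; lra.
have hj' : j%:R * ta <= T.
  by apply: le_trans hj; apply: ler_wpM2r => //; rewrite ler_nat.
have c1 : 1 <= (1 + murate * ta) ^+ j * c0.
  apply: mulr_ege1 => //; apply: exprn_ege1; rewrite lerDl mulr_ge0//.
have -> : (1 + murate * ta) ^+ j.+1 * c0 = (1 + murate * ta) * ((1 + murate * ta) ^+ j * c0).
  by rewrite exprS mulrA.
apply: le_trans _ (step_bar i x q (VV_time hj) c1).
apply: (step_mono (F := F) (CF := CF)) => //; [exact: ltW|exact: VV_time| |] => i' y; exact: IH.
Qed.

End estimates.

(** * Regularity and consistency of the scheme *)

Section regularity.
Variables (F : gen_driver) (h : 'I_m -> cV -> R).
Variables (CF C2 S bb Rb Sp CB : R) (p0 : nat).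
Hypotheses (CF0 : 0 <= CF) (Cz0 : 0 <= Cz) (la0 : 0 < lambda).
Hypotheses (th0 : 0 < th) (th1 : th <= 1) (et0 : 0 < et) (et1 : et <= 1) (ta0 : 0 < ta).
Hypothesis lipF : lip_driver F CF.
Hypotheses (C20 : 0 <= C2) (bndF : forall i (t : R) xi c, 0 <= t <= T ->
  `|F i t xi (const_mx c) 0| <= C2 * (psi p0.+1 xi + `|c|)).
Hypotheses (K1 : 1 <= K) (hK : lambda + CF + Cz * d%:R / th <= K).
Hypothesis cfl : ta * (K + (d%:R + 1) / et ^+ 2) <= 1.
Hypotheses (B_ge0 : forall p x, 0 <= B p x) (B_sum : forall x, \sum_p B p x = 1).
Hypothesis B_tay : forall p, tay CB (B p).
Hypothesis Sbnd : forall (t : R) p, 0 <= t <= T ->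
  enorm (b t (pt p)) <= S /\ enorm (sigma t (pt p)) <= S.
Hypotheses (S1 : 1 <= S) (etS : et * S <= 1) (thS : th * S <= 1).
Hypotheses (bb0 : 0 <= bb) (Vbb : forall j, j%:R * ta <= T -> forall i x q, enorm x <= Rb ->
  `|VV F h j i x (pt q)| <= bb).
Hypotheses (hbb : forall i p, `|h i (pt p)| <= bb) (pRb : forall p, enorm (pt p) + 1 <= Rb).
Hypothesis pSp : forall p, psi p0.+1 (pt p) <= Sp.

Definition MH : R := (K + 2 * lambda + CF * m%:R + 3 * (Cz * d%:R / th)) * bb + C2 * Sp.
(* Stable because the damping K compensates the source, whose Taylor constant is
   at most #|I| CB MH: the constant does not depend on et and ta, which are
   chosen after it. *)
Definition Cs : R := #|I|%:R * CB * MH.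
Definition M2 : R := (2 * d%:R + 2) / et ^+ 2 * Cs + K * Cs + MH.

Tactic Notation "lra_in" hyp_list(hs) :=
  revert hs; clear -CF0 Cz0 la0 th0 th1 et0 et1 ta0 lipF C20 bndF K1 hK cfl B_ge0 B_sum B_tay Sbnd S1 etS thS bb0 Vbb hbb pRb pSp; lra.

Lemma HH_bnd i (t : R) q D y P M : 0 <= t <= T -> `|D| <= bb -> (forall l, `|y l| <= bb) ->
  (forall l, `|P l| <= bb) -> (forall l, `|M l| <= bb) -> `|HH F i t (pt q) D y P M| <= MH.
Proof.
move=> tin hD hy hP hM; rewrite /HH.
set Y := \col_l y l; set z := \col_l _.
have t2 : 0 < (2 * th)^-1 by rewrite invr_gt0 mulr_gt0.
have hz : \sum_l `|z l ord0| <= d%:R * bb / th.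
  have -> : d%:R * bb / th = \sum_(l < d) bb / th by rewrite sumr_const card_ord -[RHS]mulr_natl mulrA.
  apply: ler_sum => l _; rewrite !mxE normrM (gtr0_norm t2) ler_pdivrMr ?mulr_gt0//.
  have -> : bb / th * (2 * th) = 2 * bb by field; rewrite gt_eqF.
  by have := ler_normB (P l) (M l); have := hP l; have := hM l; lra.
have hY : \sum_l `|Y l ord0| <= m%:R * bb.
  have -> : m%:R * bb = \sum_(l < m) bb by rewrite sumr_const card_ord -[RHS]mulr_natl.
  by apply: ler_sum => l _; rewrite !mxE.
have c0 : const_mx 0 = 0 :> 'cV[R]_m by apply/colP => l; rewrite !mxE.
have f0 : `|F i t (pt q) 0 0| <= C2 * Sp.
  rewrite -c0; apply: le_trans (bndF i (pt q) 0 tin) _.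
  by rewrite normr0 addr0; apply: ler_wpM2l.
have Y0 : \sum_l `|Y l ord0 - (0 : 'cV[R]_m) l ord0| = \sum_l `|Y l ord0|.
  by apply: eq_bigr => l _; rewrite !mxE subr0.
have Z0 : \sum_l `|z l ord0 - (0 : 'cV[R]_d) l ord0| = \sum_l `|z l ord0|.
  by apply: eq_bigr => l _; rewrite !mxE subr0.
have Y0' : \sum_l `|(0 : 'cV[R]_m) l ord0 - Y l ord0| = \sum_l `|Y l ord0|.
  by apply: eq_bigr => l _; rewrite !mxE sub0r normrN.
have Z0' : \sum_l `|(0 : 'cV[R]_d) l ord0 - z l ord0| = \sum_l `|z l ord0|.
  by apply: eq_bigr => l _; rewrite !mxE sub0r normrN.
have u1 := lipF.1 i t (pt q) Y 0 z 0 tin; have u2 := lipF.1 i t (pt q) 0 Y 0 z tin.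
rewrite Y0 Z0 in u1; rewrite Y0' Z0' in u2.
have hv : `|\sum_l (P l + M l - 2 * y i)| <= d%:R * (4 * bb).
  apply: le_trans (ler_norm_sum _ _ _) _.
  have -> : d%:R * (4 * bb) = \sum_(l < d) 4 * bb by rewrite sumr_const card_ord -[RHS]mulr_natl.
  apply: ler_sum => l _; have := hP l; have := hM l; have := hy i.
  rewrite !ler_norml => /andP[a1 a2] /andP[a3 a4] /andP[a5 a6].
  by apply/andP; split; lra_in a1 a2 a3 a4 a5 a6.
have w1 := ler_wpM2l Cz0 hz; have w2 := ler_wpM2l CF0 hY.
have cz : 0 <= Cz / (2 * th) by rewrite mulr_ge0// ltW.
have w3 := ler_wpM2l cz hv.
have e3 : Cz / (2 * th) * (d%:R * (4 * bb)) = 2 * (Cz * d%:R / th) * bb by field; rewrite gt_eqF.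
have w4 : `|Cz / (2 * th) * \sum_l (P l + M l - 2 * y i)| <= 2 * (Cz * d%:R / th) * bb.
  by rewrite normrM (ger0_norm cz) -e3.
have w5 : `|K * y i| <= K * bb by rewrite normrM ger0_norm ?(le_trans ler01 K1)// ler_wpM2l// (le_trans ler01 K1).
have w6 : `|lambda * (D - y i)| <= 2 * lambda * bb.
  rewrite normrM gtr0_norm// [2 * _]mulrC -mulrA; apply: ler_wpM2l; first exact: ltW.
  by have := ler_normB D (y i); have := hy i; lra_in hD.
move: w4 w5 w6 f0; rewrite !ler_norml => /andP[a1 a2] /andP[a3 a4] /andP[a5 a6] /andP[a7 a8].
have e1 : Cz * (d%:R * bb / th) = Cz * d%:R / th * bb by ring.
rewrite e1 in w1; rewrite /MH; apply/andP; split; lra_in u1 u2 w1 w2 a1 a2 a3 a4 a5 a6 a7 a8.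
Qed.

Lemma MH_ge0 : (0 < #|I|)%N -> 0 <= MH.
Proof.
move=> /card_gt0P[p _]; have sp : 0 <= Sp by apply: le_trans (pSp p); exact: ltW (psi_gt0 _ _).
have a1 : 0 <= Cz * d%:R / th by apply: divr_ge0; [exact: mulr_ge0|exact: ltW].
have a2 : 0 <= CF * m%:R by apply: mulr_ge0.
have a3 : 0 <= K + 2 * lambda + CF * m%:R + 3 * (Cz * d%:R / th).
  by have := le_trans ler01 K1; have := la0; lra.
by rewrite /MH; apply: addr_ge0; apply: mulr_ge0.
Qed.

Lemma bb_MH : (0 < #|I|)%N -> bb <= MH.
Proof.
move=> /card_gt0P[p _]; have sp : 0 <= Sp by apply: le_trans (pSp p); exact: ltW (psi_gt0 _ _).
have a1 : 0 <= Cz * d%:R / th by apply: divr_ge0; [exact: mulr_ge0|exact: ltW].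
have a2 : 0 <= CF * m%:R by apply: mulr_ge0.
have a3 : 1 <= K + 2 * lambda + CF * m%:R + 3 * (Cz * d%:R / th).
  by have := K1; have := la0; lra.
have := ler_wpM2r bb0 a3; rewrite mul1r /MH; have := mulr_ge0 C20 sp; lra.
Qed.

Lemma sumB_bnd (u : I -> R) C x : (forall p, `|u p| <= C) -> `|\sum_p B p x * u p| <= C.
Proof.
move=> hu; apply: le_trans (ler_norm_sum _ _ _) _.
rewrite -[X in _ <= X]mul1r -(B_sum x) mulr_suml; apply: ler_sum => p _.
by rewrite normrM ger0_norm//; apply: ler_wpM2l.
Qed.

Lemma sumB_ge (u : I -> R) C x : (forall p, B p x != 0 -> C <= u p) -> C <= \sum_p B p x * u p.
Proof.
move=> hu; rewrite -[C]mul1r -(B_sum x) mulr_suml; apply: ler_sum => p _.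
have [->|np] := eqVneq (B p x) 0; first by rewrite !mul0r.
by apply: ler_wpM2l => //; exact: hu.
Qed.

Lemma HV_bnd j i (t : R) q p : j%:R * ta <= T -> 0 <= t <= T -> `|HV F i t (pt q) (VV F h j) p| <= MH.
Proof.
move=> hj tin; have hp : enorm (pt p) <= Rb by have := pRb p; lra.
have hs l : enorm (th *: sg t (pt q) l) <= 1.
  rewrite enormZ gtr0_norm//; apply: le_trans thS; apply: ler_wpM2l; first exact: ltW.
  by apply: le_trans (Sbnd q tin).2; exact: enorm_col.
apply: HH_bnd => // [|l|l|l]; apply: Vbb => //.
  by apply: le_trans (enormD _ _) _; have := hs l; have := pRb p; lra.
by apply: le_trans (enormD _ _) _; rewrite enormN; have := hs l; have := pRb p; lra.
Qed.

Lemma cardI_gt0 : (0 < #|I|)%N.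
Proof.
case: (posnP #|I|) => // /card0_eq h0; have := B_sum 0.
by rewrite big_pred0 => [/esym/eqP|p]; [rewrite oner_eq0|exact: h0].
Qed.

Lemma VV_tay j : j%:R * ta <= T -> forall i q, tay Cs (fun x => VV F h j i x (pt q)).
Proof.
have MH0 := MH_ge0 cardI_gt0; have bM := bb_MH cardI_gt0.
have CB0 : 0 <= CB by have [p _] := card_gt0P cardI_gt0; exact: tay_ge0 (B_tay p).
have sumb (u : I -> R) C : (forall p, `|u p| <= C) -> C <= MH ->
    \sum_p `|u p| * CB <= Cs.
  move=> hu hC; rewrite -mulr_suml /Cs mulrAC; apply: ler_wpM2r => //.
  apply: le_trans (_ : \sum_(p : I) MH <= _).
    by apply: ler_sum => p _; apply: le_trans (hu p) hC.
  by rewrite sumr_const -[X in X <= _]mulr_natl cardT.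
have Cs0 : 0 <= Cs by rewrite /Cs !mulr_ge0.
elim: j => [|j IH] hj i q.
  apply: (tay_ext (f := fun x => \sum_p h i (pt p) * B p x)).
    by move=> x /=; apply: eq_bigr => p _; rewrite mulrC.
  apply: tay_le (tay_sum (index_enum I) (fun p => h i (pt p)) B_tay).
  by apply: (sumb _ bb) => // p; exact: hbb.
have hj' : j%:R * ta <= T.
  by apply: le_trans hj; apply: ler_wpM2r; [exact: ltW|rewrite ler_nat].
have tin : 0 <= T - j.+1%:R * ta <= T by apply: VV_time => //; exact: ltW.
have tw := IH hj' i q; set t := T - _ in tin *; set w := fun x => _ in tw.
have e2 : 0 < et ^+ 2 by rewrite exprn_gt0.
pose a0 := 1 - ta * (K + (d%:R + 1) / et ^+ 2).
pose a1 := ta / (2 * et ^+ 2); pose a2 := ta / et ^+ 2.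
pose u p := HV F i t (pt q) (VV F h j) p.
(* The factors 1 fit the shape of [tay_lin]. The weights on the translates of [w] sum to
   [1 - ta * K], and the source adds at most [ta * Cs], so [1 <= K] keeps the constant [Cs]. *)
apply: (tay_ext (f := fun x => 1 * (1 * (a0 * w x + a1 *
    \sum_l 1 * (1 * w (x + et *: sg t (pt q) l) + 1 * w (x - et *: sg t (pt q) l))) +
    a2 * w (x + et ^+ 2 *: b t (pt q))) + ta * \sum_p u p * B p x)).
  move=> x /=; rewrite /step -/t.
  have E v : w x + ta * (v - K * w x + \sum_p B p x * u p) = (w x + ta * (v - K * w x)) +
     ta * \sum_p u p * B p x.
    have -> : \sum_p B p x * u p = \sum_p u p * B p x by apply: eq_bigr => p _; rewrite mulrC.
    by ring.
  rewrite -/(w x) E Ah_split// -/w; congr (_ + _); rewrite mul1r; congr (_ + _); rewrite mul1r.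
  by congr (_ + _ * _); apply: eq_bigr => l _; rewrite !mul1r.
have hs l : tay (`|1| * Cs + `|1| * Cs) (fun x => 1 * w (x + et *: sg t (pt q) l) + 1 * w (x - et *: sg t (pt q) l)).
  by apply: tay_lin; [exact: (tay_shift _ tw)|exact: (tay_shift _ tw)].
have tall := tay_lin 1 ta (tay_lin 1 a2 (tay_lin a0 a1 tw (tay_sum (index_enum 'I_d) (fun=> 1) hs))
   (tay_shift (et ^+ 2 *: b t (pt q)) tw)) (tay_sum (index_enum I) u B_tay).
apply: tay_le tall.
have h0 : 0 <= a0 by rewrite subr_ge0.
have h1 : 0 <= a1 by rewrite divr_ge0 ?mulr_ge0// ltW.
have h2 : 0 <= a2 by rewrite divr_ge0// ltW.
rewrite !normr1 !mul1r (ger0_norm h0) (ger0_norm h1) (ger0_norm h2) (gtr0_norm ta0).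
rewrite sumr_const card_ord -[_ *+ d]mulr_natl.
have hu : \sum_p `|u p| * CB <= Cs by apply: (sumb u MH) => // p; exact: HV_bnd.
have hKC : Cs <= K * Cs by apply: ler_peMl.
have := ler_wpM2l (ltW ta0) hKC; have := ler_wpM2l (ltW ta0) hu.
have E : a1 * (d%:R * (Cs + Cs)) + a2 * Cs = ta * (d%:R + 1) / et ^+ 2 * Cs.
  by rewrite /a1 /a2; field; rewrite gt_eqF.
have E0 : a0 * Cs = Cs - ta * K * Cs - ta * (d%:R + 1) / et ^+ 2 * Cs by rewrite /a0; ring.
move: E E0; move: (a0 * Cs) (a1 * _) (a2 * Cs) (\sum_p _) => x1 x2 x3 x4; lra.
Qed.

Lemma Ah_bnd t xi (w : cV -> R) x C : (forall y, `|w y| <= C) ->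
  `|Ah t xi w x| <= (2 * d%:R + 2) / et ^+ 2 * C.
Proof.
move=> hw; have e2 : 0 < et ^+ 2 by rewrite exprn_gt0.
have hs : `|\sum_l (w (x + et *: sg t xi l) + w (x - et *: sg t xi l) - 2 * w x)| <= d%:R * (4 * C).
  apply: le_trans (ler_norm_sum _ _ _) _.
  have -> : d%:R * (4 * C) = \sum_(l < d) 4 * C by rewrite sumr_const card_ord -[RHS]mulr_natl.
  apply: ler_sum => l _; have := hw (x + et *: sg t xi l); have := hw (x - et *: sg t xi l); have := hw x.
  by rewrite !ler_norml => /andP[? ?] /andP[? ?] /andP[? ?]; apply/andP; split; lra.
have hb : `|w (x + et ^+ 2 *: b t xi) - w x| <= 2 * C.
  by apply: le_trans (ler_normB _ _) _; have := hw x; have := hw (x + et ^+ 2 *: b t xi); lra.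
rewrite /Ah; apply: le_trans (ler_normD _ _) _; rewrite !normrM.
have i1 : 0 < (2 * et ^+ 2)^-1 by rewrite invr_gt0 mulr_gt0.
have i2 : 0 < (et ^+ 2)^-1 by rewrite invr_gt0.
rewrite (gtr0_norm i1) (gtr0_norm i2).
have := ler_wpM2l (ltW i1) hs; have := ler_wpM2l (ltW i2) hb.
have -> : (2 * et ^+ 2)^-1 * (d%:R * (4 * C)) = 2 * d%:R / et ^+ 2 * C by field; rewrite gt_eqF.
lra.
Qed.

Lemma VV_diff j i x q : j.+1%:R * ta <= T ->
  `|VV F h j.+1 i x (pt q) - VV F h j i x (pt q)| <= ta * M2.
Proof.
move=> hj; have hj' : j%:R * ta <= T.
  by apply: le_trans hj; apply: ler_wpM2r; [exact: ltW|rewrite ler_nat].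
have tin : 0 <= T - j.+1%:R * ta <= T by apply: VV_time => //; exact: ltW.
have [wb _] := VV_tay hj' i q.
have hA := Ah_bnd (T - j.+1%:R * ta) (pt q) x wb.
rewrite /= /step addrC addKr normrM gtr0_norm//; apply: ler_wpM2l; first exact: ltW.
have hs : `|\sum_p B p x * HV F i (T - j.+1%:R * ta) (pt q) (VV F h j) p| <= MH.
  by apply: sumB_bnd => p; exact: HV_bnd.
have hk : `|K * VV F h j i x (pt q)| <= K * Cs.
  by rewrite normrM ger0_norm ?(le_trans ler01 K1)//; apply: ler_wpM2l; rewrite ?(le_trans ler01 K1).
rewrite /M2; apply: le_trans (ler_normD _ _) _; apply: lerD => //.
by apply: le_trans (ler_normB _ _) _; apply: lerD.
Qed.

Lemma grad_eq (v : cV) (L rr : R) : 0 < rr -> 0 <= L ->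
  (forall e, enorm e <= rr -> dotv v e <= L * enorm e ^+ 2) -> v = 0.
Proof.
move=> r0 L0 hv; apply: enorm_eq0; apply/eqP; apply: contraT => n0.
have v0 : 0 < enorm v by rewrite lt_neqAle eq_sym n0 enorm_ge0.
pose s := Num.min (rr / enorm v) (2 * (L + 1))^-1.
have s0 : 0 < s by rewrite lt_min divr_gt0//= invr_gt0 mulr_gt0// ltr_wpDl.
have sr : s * enorm v <= rr by rewrite -ler_pdivlMr// ge_min lexx.
have sL : s * (2 * (L + 1)) <= 1.
  by rewrite -ler_pdivlMr ?mulr_gt0 ?ltr_wpDl// mul1r ge_min lexx orbT.
have := hv (s *: v); rewrite enormZ (gtr0_norm s0) => /(_ sr).
rewrite dotvZr dotvv => h1.
have h2 : s * enorm v ^+ 2 <= L * s * (s * enorm v ^+ 2) by move: h1; rewrite !expr2; lra.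
have h3 : 0 < s * enorm v ^+ 2 by rewrite mulr_gt0// exprn_gt0.
have h4 : 1 <= L * s by rewrite -(ler_pM2r h3) mul1r.
exfalso; move: h4 sL s0; lra.
Qed.

Variables (nu r : R).
Hypotheses (nu1 : 1 <= nu) (r0 : 0 <= r) (rnu : r <= (2 * nu)^-1) (thSnu : th * S <= (2 * nu)^-1).
(** The summands: distance to the nodes and one time step inside the driver, numerical viscosity,
    one time step in the damping, one time step in [Ah], Taylor remainder of [Ah]. *)
Hypothesis err_le : (K + CF * m%:R) * (4 * nu * r + ta * M2) + 2 * (Cz * d%:R * nu * (th * S ^+ 2))
  + K * (ta * M2) + (2 * d%:R + 2) / et ^+ 2 * (ta * M2) + (d%:R + 4) * (Cs * (et * S ^+ 3)) <= nu^-1.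

Tactic Notation "lra_at" hyp_list(hs) :=
  revert hs; clear -CF0 Cz0 la0 th0 th1 et0 et1 ta0 lipF C20 bndF K1 hK cfl B_ge0 B_sum B_tay Sbnd S1 etS thS bb0 Vbb hbb pRb pSp nu1 r0 rnu thSnu err_le; lra.

(** The [d] counts the remainders of the second differences. The 4 belongs to the drift step: half
    of [6 * C] for the quadratic term, which is an error there, and one for the cubic remainder. *)
Lemma Ah_taylor (t : R) p w x q Y C : 0 <= t <= T -> 0 <= C -> (forall e, enorm e <= 1 ->
    `|w (x + e) - w x - dotv q e - 2^-1 * qf Y e| <= C * enorm e ^+ 3) ->
  (forall e, `|qf Y e| <= 6 * C * enorm e ^+ 2) ->
  2^-1 * (\sum_l qf Y (sg t (pt p) l)) + dotv (b t (pt p)) q - (d%:R + 4) * (C * (et * S ^+ 3))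
    <= Ah t (pt p) w x.
Proof.
move=> tin C0 hY hq; have e2 : 0 < et ^+ 2 by rewrite exprn_gt0.
have S0 : 0 <= S := le_trans ler01 S1.
have hs l : et ^+ 2 * (qf Y (sg t (pt p) l) - 2 * (C * (et * S ^+ 3))) <=
    w (x + et *: sg t (pt p) l) + w (x - et *: sg t (pt p) l) - 2 * w x.
  have sS : enorm (sg t (pt p) l) <= S by apply: le_trans (Sbnd p tin).2; exact: enorm_col.
  have e1 : enorm (et *: sg t (pt p) l) <= et * S.
    by rewrite enormZ gtr0_norm//; apply: ler_wpM2l => //; exact: ltW.
  have c3 : C * enorm (et *: sg t (pt p) l) ^+ 3 <= C * (et * S) ^+ 3.
    by apply: ler_wpM2l => //; apply: lerXn2r; rewrite ?nnegrE ?enorm_ge0// mulr_ge0// ltW.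
  have h1 := hY _ (le_trans e1 etS).
  have := hY (- (et *: sg t (pt p) l)); rewrite enormN => /(_ (le_trans e1 etS)) h2.
  rewrite dotvNr qfNr in h2; rewrite qfZr in h1 h2.
  move: h1 h2; rewrite !ler_norml => /andP[h1 _] /andP[h2 _].
  have -> : et ^+ 2 * (qf Y (sg t (pt p) l) - 2 * (C * (et * S ^+ 3))) =
     et ^+ 2 * qf Y (sg t (pt p) l) - 2 * (C * (et * S) ^+ 3) by ring.
  lra.
have hb : et ^+ 2 * (dotv (b t (pt p)) q - 4 * (C * (et * S ^+ 3))) <= w (x + et ^+ 2 *: b t (pt p)) - w x.
  have bS := (Sbnd p tin).1; have b0 := enorm_ge0 (b t (pt p)).
  have e21 : et ^+ 2 <= et by rewrite expr2; apply: ler_piMr => //; exact: ltW.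
  have e1 : enorm (et ^+ 2 *: b t (pt p)) <= et * S.
    by rewrite enormZ gtr0_norm//; apply: ler_pM => //; exact: ltW.
  have h1 := hY _ (le_trans e1 etS); have h2 := hq (et ^+ 2 *: b t (pt p)).
  have eb : enorm (et ^+ 2 *: b t (pt p)) ^+ 2 <= et ^+ 2 * (et * S ^+ 3).
    rewrite enormZ (gtr0_norm e2).
    have -> : (et ^+ 2 * enorm (b t (pt p))) ^+ 2 = et ^+ 2 * (et ^+ 2 * enorm (b t (pt p)) ^+ 2) by ring.
    apply: ler_wpM2l; first exact: ltW.
    apply: ler_pM => //; [exact: ltW|exact: sqr_ge0|].
    apply: le_trans (_ : S ^+ 2 <= _); first by apply: lerXn2r; rewrite ?nnegrE.
    by rewrite [S ^+ 3]exprS; apply: ler_peMl => //; exact: sqr_ge0.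
  have e3 : enorm (et ^+ 2 *: b t (pt p)) ^+ 3 <= enorm (et ^+ 2 *: b t (pt p)) ^+ 2.
    rewrite exprS; apply: ler_piMl; first exact: sqr_ge0.
    exact: le_trans e1 etS.
  have g1 := ler_wpM2l C0 eb; have g2 := ler_wpM2l C0 e3.
  rewrite dotvZr (dotvC q) in h1.
  move: h1 h2; rewrite !ler_norml => /andP[h1 _] /andP[h2 _]; lra.
rewrite /Ah.
have i1 : 0 < (2 * et ^+ 2)^-1 by rewrite invr_gt0 mulr_gt0.
have i2 : 0 < (et ^+ 2)^-1 by rewrite invr_gt0.
have hss : et ^+ 2 * (\sum_l qf Y (sg t (pt p) l) - d%:R * (2 * (C * (et * S ^+ 3)))) <=
   \sum_l (w (x + et *: sg t (pt p) l) + w (x - et *: sg t (pt p) l) - 2 * w x).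
  have -> : d%:R * (2 * (C * (et * S ^+ 3))) = \sum_(l < d) 2 * (C * (et * S ^+ 3)).
    by rewrite sumr_const card_ord -[RHS]mulr_natl.
  by rewrite -sumrB mulr_sumr; apply: ler_sum => l _; exact: hs.
have g1 := ler_wpM2l (ltW i1) hss; have g2 := ler_wpM2l (ltW i2) hb.
have E1 X : (2 * et ^+ 2)^-1 * (et ^+ 2 * X) = 2^-1 * X by field; rewrite gt_eqF.
have E2 X : (et ^+ 2)^-1 * (et ^+ 2 * X) = X by field; rewrite gt_eqF.
rewrite E1 in g1; rewrite E2 in g2; lra.
Qed.

(** The hypotheses concern the new value [W], while the explicit step is built from the old one; by
    [VV_diff] they differ by at most [ta * M2]. Since [HH] is nondecreasing in all its value
    arguments, lower bounds for the old values may be inserted into it, and those follow from the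
    touching conditions on [W]. *)
Lemma VV_main j i y0 q0 (q : cV) Bq (c : 'I_m -> R) a : j.+1%:R * ta <= T ->
  (forall p, B p y0 != 0 -> enorm (pt p - y0) <= r) ->
  enorm q <= nu -> 0 <= Bq <= nu -> 0 <= a ->
  let W := VV F h j.+1 in let xi0 := pt q0 in let t := T - j.+1%:R * ta in
  (forall y, enorm (y - y0) <= nu^-1 ->
     W i y0 xi0 + dotv q (y - y0) - Bq * enorm (y - y0) ^+ 2 <= W i y xi0) ->
  (forall p, enorm (pt p - y0) <= nu^-1 -> W i y0 xi0 + a - Bq * enorm (pt p - y0) <= W i (pt p) (pt p)) ->
  (forall l, l != i -> forall y, enorm (y - y0) <= nu^-1 -> c l <= W l y xi0) ->
  c i = W i y0 xi0 ->
  exists Y C, [/\ Y^T = Y,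
    forall e, enorm e <= 1 -> W i (y0 + e) xi0 <= W i y0 xi0 + dotv q e + 2^-1 * qf Y e + C * enorm e ^+ 3 &
    lambda * a + F i t xi0 (\col_l c l) ((sigma t xi0)^T *m q) - nu^-1 <=
    (W i y0 xi0 - VV F h j i y0 xi0) / ta - 2^-1 * (\sum_l qf Y (col l (sigma t xi0)))
     - dotv (b t xi0) q].
Proof.
move=> hj near qnu /andP[Bq0 Bqnu] a0 W xi0 t hW hD hc ci.
have hj' : j%:R * ta <= T.
  by apply: le_trans hj; apply: ler_wpM2r; [exact: ltW|rewrite ler_nat].
have tin : 0 <= t <= T by apply: VV_time => //; exact: ltW.
have nu0 : 0 < nu := lt_le_trans ltr01 nu1.
have nui : 0 < nu^-1 by rewrite invr_gt0.
have nu2 : (2 * nu)^-1 + (2 * nu)^-1 = nu^-1 by field; rewrite gt_eqF.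
have nu20 : 0 < (2 * nu)^-1 by rewrite invr_gt0 mulr_gt0.
have S0 : 0 <= S := le_trans ler01 S1.
have [Wb WT] := VV_tay hj i q0.
have [q1 [Y [Ys hY]]] := WT y0; rewrite -/W -/xi0 in Wb hY.
have Cs0 : 0 <= Cs := le_trans (normr_ge0 _) (Wb 0).
have hbd := tay_bnd Wb hY.
have qq : q1 = q.
  apply/eqP; rewrite eq_sym -subr_eq0; apply/eqP.
  have rr0 : 0 < Num.min 1 nu^-1 by rewrite lt_min ltr01.
  apply: (grad_eq (L := nu + 4 * Cs) rr0); first by apply: addr_ge0; [exact: ltW|exact: mulr_ge0].
  move=> e; rewrite le_min => /andP[e1 e2].
  have := hW (y0 + e); rewrite addrC addKr => /(_ e2) h1.
  have := hY e e1; have := (hbd e).2; rewrite !ler_norml => /andP[_ h2] /andP[_ h3].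
  have e3 : Cs * enorm e ^+ 3 <= Cs * enorm e ^+ 2.
    by apply: ler_wpM2l => //; rewrite exprS; apply: ler_piMl => //; exact: sqr_ge0.
  have h4 := ler_wpM2r (sqr_ge0 (enorm e)) Bqnu.
  rewrite addrC in h1.
  by rewrite dotvDl dotvNl; lra_at h1 h2 h3 h4 e3.
rewrite qq in hY hbd; exists Y, Cs; split=> //.
  by move=> e e1; have := hY e e1; rewrite ler_norml => /andP[_ h1]; lra.
have dif l y p := VV_diff l y p hj.
pose e1 := ta * M2.
have M20 : 0 <= M2 by rewrite -(pmulr_rge0 _ ta0); exact: le_trans (normr_ge0 _) (dif i y0 q0).
have e10 : 0 <= e1 by apply: mulr_ge0 => //; exact: ltW.
have lowv l y p : W l y (pt p) - e1 <= VV F h j l y (pt p).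
  by have := dif l y p; rewrite ler_norml => /andP[_]; rewrite -/W -/e1; lra.
(* [e1] is one time step; [4 * nu * r] covers replacing [y0] by a node at distance [r], in the
   linear and in the quadratic part of the touching condition. *)
pose eps := 4 * nu * r + e1.
pose W0 := W i y0 xi0.
have hr : r <= nu^-1 by have := rnu; lra.
have n2 : r + th * S <= nu^-1 by have := rnu; have := thSnu; lra.
have r1 : r <= 1.
  by apply: le_trans hr _; rewrite invf_le1.
pose z := (sigma t xi0)^T *m q.
have zE l : z l ord0 = dotv q (sg t xi0 l).
  by rewrite /z mxE /dotv; apply: eq_bigr => u _; rewrite !mxE mulrC.
pose G := 2 * nu * (th ^+ 2 * S ^+ 2).
have gradlow v p' : enorm (p' - y0) <= r -> enorm v <= th * S ->
    W0 + dotv q v - eps + e1 - G <= W i (p' + v) xi0.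
  move=> hp hv; have e : p' + v - y0 = (p' - y0) + v by rewrite addrAC.
  have n1 : enorm (p' + v - y0) <= r + th * S by rewrite e; apply: le_trans (enormD _ _) _; exact: lerD.
  have h1 := hW (p' + v) (le_trans n1 n2); rewrite -/W0 in h1.
  have h2 : enorm (p' + v - y0) ^+ 2 <= 2 * r + 2 * (th ^+ 2 * S ^+ 2).
    have h3 : enorm (p' + v - y0) ^+ 2 <= (r + th * S) ^+ 2.
      by apply: lerXn2r => //; rewrite nnegrE ?enorm_ge0// addr_ge0// mulr_ge0// ltW.
    apply: le_trans h3 _; have := sqr_ge0 (r - th * S); have : r ^+ 2 <= r by rewrite expr2 ler_piMl.
    by rewrite -exprMn !expr2; lra_at r1.
  have h4 : - (nu * r) <= dotv q (p' - y0).
    have := dotv_CS q (p' - y0); rewrite ler_norml => /andP[h5 _].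
    have : enorm q * enorm (p' - y0) <= nu * r by apply: ler_pM => //; exact: enorm_ge0.
    lra_at h5.
  have h6 : Bq * enorm (p' + v - y0) ^+ 2 <= nu * (2 * r + 2 * (th ^+ 2 * S ^+ 2)).
    by apply: ler_pM => //; exact: sqr_ge0.
  rewrite e dotvDr in h1; rewrite -e in h1.
  have nr := mulr_ge0 (ltW nu0) r0.
  rewrite /eps /G; lra_at h1 h2 h4 h6 nr.
have hHV p : B p y0 != 0 -> K * W0 + lambda * a + F i t xi0 (\col_l c l) z
    - ((K + CF * m%:R) * eps + 2 * (Cz * d%:R * nu * (th * S ^+ 2))) <= HV F i t xi0 (VV F h j) p.
  move=> np; have hp := near p np.
  have svS l : enorm (th *: sg t xi0 l) <= th * S.
    rewrite enormZ gtr0_norm//; apply: ler_wpM2l; first exact: ltW.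
    by apply: le_trans (Sbnd q0 tin).2; exact: enorm_col.
  have hp' : enorm (pt p - y0) <= nu^-1 by apply: le_trans hp hr.
  pose y' l := c l - eps; pose P' l := W0 + th * z l ord0 - eps - G.
  pose M' l := W0 - th * z l ord0 - eps - G.
  have nr := mulr_ge0 (ltW nu0) r0.
  have key : HH F i t xi0 (W0 + a - eps) y' P' M' <= HV F i t xi0 (VV F h j) p.
    apply: (HH_mono (CF := CF)) => //; first exact: ltW.
    - apply: le_trans (lowv i (pt p) p); have := hD p hp'; rewrite -/W0.
      have : Bq * enorm (pt p - y0) <= nu * r by apply: ler_pM => //; exact: enorm_ge0.
      by rewrite /eps; lra_at nr.
    - move=> l; apply: le_trans (lowv l (pt p) q0); rewrite /y'.
      have [->|li] := eqVneq l i; last by have := hc l li (pt p) hp'; rewrite /eps -/xi0; lra_at nr.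
      rewrite ci; have := hW (pt p) hp'.
      have := dotv_CS q (pt p - y0); rewrite ler_norml => /andP[h5 _].
      have h6 : enorm q * enorm (pt p - y0) <= nu * r by apply: ler_pM => //; exact: enorm_ge0.
      have h7 : Bq * enorm (pt p - y0) ^+ 2 <= nu * r.
        apply: ler_pM => //; first exact: sqr_ge0.
        apply: le_trans (hp); rewrite expr2; apply: ler_piMl; first exact: enorm_ge0.
        exact: le_trans hp r1.
      by rewrite /eps -/xi0; lra_at h5 h6 h7 nr.
    - move=> l; apply: le_trans (lowv i _ q0); have := gradlow (th *: sg t xi0 l) (pt p) hp (svS l).
      by rewrite dotvZr -zE /P' -/xi0; lra_at nr.
    - move=> l; apply: le_trans (lowv i _ q0); have := gradlow (- (th *: sg t xi0 l)) (pt p) hp.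
      by rewrite enormN => /(_ (svS l)); rewrite dotvNr dotvZr -zE /M' -/xi0; lra_at nr.
  apply: le_trans key; rewrite /HH.
  have -> : \col_l ((P' l - M' l) / (2 * th)) = z.
    by apply/colP => l; rewrite mxE /P' /M'; field; rewrite gt_eqF.
  have -> : \sum_l (P' l + M' l - 2 * y' i) = - (d%:R * (2 * G)).
    have -> : d%:R * (2 * G) = \sum_(l < d) 2 * G by rewrite sumr_const card_ord -[RHS]mulr_natl.
    by rewrite -sumrN; apply: eq_bigr => l _; rewrite /P' /M' /y' ci -/W0; ring.
  have -> : y' i = W0 - eps by rewrite /y' ci.
  have -> : Cz / (2 * th) * (- (d%:R * (2 * G))) = - (2 * (Cz * d%:R * nu * (th * S ^+ 2))).
    by rewrite /G; field; rewrite gt_eqF.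
  have eps0 : 0 <= eps by apply: addr_ge0 => //; rewrite -mulrA; apply: mulr_ge0.
  have := lipF.1 i t xi0 (\col_l c l) (\col_l y' l) z z tin.
  rewrite [X in _ + Cz * X]big1 ?mulr0 ?addr0; last by move=> l _; rewrite subrr normr0.
  have -> : \sum_l `|(\col_l c l) l ord0 - (\col_l y' l) l ord0| = m%:R * eps.
    have -> : m%:R * eps = \sum_(l < m) eps by rewrite sumr_const card_ord -[RHS]mulr_natl.
    by apply: eq_bigr => l _; rewrite !mxE /y' opprB addrC subrK ger0_norm.
  lra_at eps0.
have hsum : K * W0 + lambda * a + F i t xi0 (\col_l c l) z
    - ((K + CF * m%:R) * eps + 2 * (Cz * d%:R * nu * (th * S ^+ 2))) <=
    \sum_p B p y0 * HV F i t xi0 (VV F h j) p.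
  exact: sumB_ge hHV.
have hA := @Ah_taylor t q0 (fun y => W i y xi0) y0 q Y Cs tin Cs0 hY (fun e => (hbd e).2).
have hA2 : Ah t xi0 (fun y => W i y xi0) y0 <= Ah t xi0 (fun y => VV F h j i y xi0) y0
    + (2 * d%:R + 2) / et ^+ 2 * e1.
  have := @Ah_bnd t xi0 (fun y => W i y xi0 - VV F h j i y xi0) y0 e1 (fun y => dif i y q0).
  have -> : Ah t xi0 (fun y => W i y xi0 - VV F h j i y xi0) y0 =
     Ah t xi0 (fun y => W i y xi0) y0 - Ah t xi0 (fun y => VV F h j i y xi0) y0.
    rewrite /Ah; have -> : \sum_l (W i (y0 + et *: sg t xi0 l) xi0 - VV F h j i (y0 + et *: sg t xi0 l) xi0 +
       (W i (y0 - et *: sg t xi0 l) xi0 - VV F h j i (y0 - et *: sg t xi0 l) xi0) - 2 * (W i y0 xi0 - VV F h j i y0 xi0)) =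
       \sum_l (W i (y0 + et *: sg t xi0 l) xi0 + W i (y0 - et *: sg t xi0 l) xi0 - 2 * W i y0 xi0) -
       \sum_l (VV F h j i (y0 + et *: sg t xi0 l) xi0 + VV F h j i (y0 - et *: sg t xi0 l) xi0 - 2 * VV F h j i y0 xi0).
      by rewrite -sumrB; apply: eq_bigr => l _; ring.
    by ring.
  by rewrite ler_norml => /andP[_]; lra_at e10.
have hk : K * VV F h j i y0 xi0 <= K * W0 + K * e1.
  rewrite -mulrDr; apply: ler_wpM2l; first exact: le_trans ler01 K1.
  by have := dif i y0 q0; rewrite ler_norml => /andP[h1 _]; rewrite -/xi0 -/W -/e1 -/W0 in h1 *; lra_at h1.
have -> : (W i y0 xi0 - VV F h j i y0 xi0) / ta = Ah t xi0 (fun y => VV F h j i y xi0) y0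
    - K * VV F h j i y0 xi0 + \sum_p B p y0 * HV F i t xi0 (VV F h j) p.
  by rewrite /W /= /step -/t addrC addKr mulrC mulKf// gt_eqF.
have := err_le; rewrite -/e1 -/eps -/z; lra_at hsum hA hA2 hk.
Qed.

End regularity.

End scheme.

(** * Elementary inequalities and the requirements at one level *)

Section elementary.
Variable R : realType.

Lemma pow1_le (s : R) P : 0 <= s <= 1 -> (1 + s) ^+ P <= 1 + s * 3 ^+ P.
Proof.
move=> /andP[s0 s1]; elim: P => [|P IH]; first by rewrite !expr0; lra.
have p3 : 1 <= 3 ^+ P :> R by apply: exprn_ege1; lra.
have h1 : (1 + s) * (1 + s) ^+ P <= (1 + s) * (1 + s * 3 ^+ P) by apply: ler_wpM2l => //; lra.
rewrite !exprS; apply: le_trans h1 _; move: (3 ^+ P) p3 => X X1.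
have h2 : s * (s * X) <= s * X by apply: ler_piMl => //; apply: mulr_ge0 => //; lra.
have h3 : s <= s * X by apply: ler_peMr.
lra.
Qed.

Lemma psi_near_le k P (x y : 'cV[R]_k) (r : R) : 0 <= r -> 2 * r <= 1 -> enorm y <= enorm x + r ->
  psi P y <= (1 + 2 * r * 3 ^+ P) * psi P x.
Proof.
move=> r0 r1 h; have x0 := enorm_ge0 x; have y0 := enorm_ge0 y.
have h1 : 1 + enorm y ^+ 2 <= (1 + 2 * r) * (1 + enorm x ^+ 2).
  have h2 : enorm y ^+ 2 <= (enorm x + r) ^+ 2 by apply: lerXn2r; rewrite ?nnegrE ?addr_ge0.
  have h3 : 0 <= r * (1 - enorm x) ^+ 2 by rewrite mulr_ge0// sqr_ge0.
  have h4 : 0 <= r * enorm x ^+ 2 by rewrite mulr_ge0// sqr_ge0.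
  have h5 : r * r <= r by apply: ler_piMl => //; lra.
  move: h2 h3 h4 h5; rewrite !expr2; move: (enorm x) (enorm y) => X Y; lra.
have a0 : 0 <= 1 + enorm y ^+ 2 by rewrite addr_ge0// sqr_ge0.
have b0 : 0 <= (1 + 2 * r) * (1 + enorm x ^+ 2) := le_trans a0 h1.
have := lerXn2r P a0 b0 h1; rewrite exprMn => h6; apply: le_trans h6 _.
apply: ler_wpM2r; first exact: ltW (psi_gt0 _ _).
by apply: pow1_le; rewrite mulr_ge0.
Qed.

Lemma exp_pow_le (mu T ta : R) j : 0 <= mu -> 0 <= ta -> j%:R * ta <= T -> (1 + mu * ta) ^+ j <= expR (mu * T).
Proof.
move=> m0 t0 h; have h0 : 0 <= 1 + mu * ta by rewrite addr_ge0// mulr_ge0.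
have h1 : (1 + mu * ta) ^+ j <= expR (mu * ta) ^+ j.
  by apply: lerXn2r; rewrite ?nnegrE ?expR_ge0//; exact: expR_ge1Dx.
apply: le_trans h1 _; rewrite -expRM_natl ler_expR -mulr_natl; nra.
Qed.

Lemma average_le (I : finType) (w u : I -> R) : (forall p, 0 <= w p) -> \sum_p w p = 1 ->
  exists2 p, w p != 0 & u p <= \sum_p w p * u p.
Proof.
move=> w0 w1; apply: contrapT => hn.
have hlt p : w p != 0 -> \sum_p w p * u p < u p.
  by move=> np; rewrite ltNge; apply/negP => hp; apply: hn; exists p.
set s := \sum_p _ in hlt.
have [p hp] : exists p, w p != 0.
  apply: contrapT => h; have := oner_neq0 R; rewrite -w1 big1 ?eqxx// => p _.
  by apply: contrapT => /eqP np; apply: h; exists p.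
have : \sum_p w p * s < \sum_p w p * u p.
  rewrite (bigD1 p)//= [X in _ < X](bigD1 p)//=; apply: ltr_leD.
    have wp : 0 < w p by rewrite lt_neqAle eq_sym hp w0.
    by rewrite ltr_pM2l//; exact: hlt.
  apply: ler_sum => p' _; have [->|np] := eqVneq (w p') 0; first by rewrite !mul0r.
  by apply: ler_wpM2l => //; apply: ltW; exact: hlt.
by rewrite -mulr_suml w1 mul1r ltxx.
Qed.

End elementary.

(** [lower_scheme] at a single level: parameters are chosen for each [n] separately and the schemes
    are then assembled by the axiom of choice. *)
Definition step_ok (R : realType) (k d m : nat) (nu lambda ta T : R)
    (b : R -> 'cV[R]_k -> 'cV[R]_k) (sigma : R -> 'cV[R]_k -> 'M[R]_(k, d))
    (F : gen_driver R k d m) (N : nat) (grid : seq 'cV[R]_k)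
    (V : nat -> 'I_m -> 'cV[R]_k -> 'cV[R]_k -> R) : Prop :=
  forall j i y0 xi0, (j < N)%N -> xi0 \in grid -> enorm y0 <= nu ->
  forall q (Bq : R) (c : 'I_m -> R) (a : R), enorm q <= nu -> 0 <= Bq <= nu -> 0 <= a ->
  (forall y, enorm (y - y0) <= nu^-1 ->
     V j.+1 i y0 xi0 + dotv q (y - y0) - Bq * enorm (y - y0) ^+ 2 <= V j.+1 i y xi0) ->
  (forall y, y \in grid -> enorm (y - y0) <= nu^-1 ->
     V j.+1 i y0 xi0 + a - Bq * enorm (y - y0) <= V j.+1 i y y) ->
  (forall l, l != i -> forall y, enorm (y - y0) <= nu^-1 -> c l <= V j.+1 l y xi0) ->
  c i = V j.+1 i y0 xi0 ->
  exists Y C, [/\ Y^T = Y,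
    forall e, enorm e <= 1 -> V j.+1 i (y0 + e) xi0 <=
      V j.+1 i y0 xi0 + dotv q e + 2^-1 * qf Y e + C * enorm e ^+ 3 &
    lambda * a + F i (T - j.+1%:R * ta) xi0 (\col_l c l) ((sigma (T - j.+1%:R * ta) xi0)^T *m q) - nu^-1 <=
    (V j.+1 i y0 xi0 - V j i y0 xi0) / ta
    - 2^-1 * (\sum_l qf Y (col l (sigma (T - j.+1%:R * ta) xi0))) - dotv (b (T - j.+1%:R * ta) xi0) q].

Definition term_ok (R : realType) (k m : nat) (nu : R) (grid : seq 'cV[R]_k)
    (h : 'I_m -> 'cV[R]_k -> R) (V : nat -> 'I_m -> 'cV[R]_k -> 'cV[R]_k -> R) : Prop :=
  forall i x xi, enorm x <= nu -> xi \in grid ->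
  exists2 x', enorm (x' - x) <= nu^-1 & h i x' <= V 0%N i x xi.

(** * Choice of the discretization parameters *)

Section fixed_level.
Variables (R : realType) (k d m : nat).
Variables (b : R -> 'cV[R]_k -> 'cV[R]_k) (sigma : R -> 'cV[R]_k -> 'M[R]_(k, d)).
Variables (I : finType) (pt : I -> 'cV[R]_k) (B : I -> 'cV[R]_k -> R).
Variables (lambda K Cz th et ta T CF C2 Cg c0 Ch S CB bC Rb nu r : R) (p0 N : nat).
Local Notation ps := (psi p0.+1).
Local Notation Sp := ((1 + Rb ^+ 2) ^+ p0.+1).
Local Notation bb := (bC * Sp).
Hypotheses (CF0 : 0 <= CF) (Cz0 : 0 <= Cz) (la0 : 0 < lambda).
Hypotheses (th0 : 0 < th) (th1 : th <= 1) (et0 : 0 < et) (et1 : et <= 1) (ta0 : 0 < ta).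
Hypotheses (C20 : 0 <= C2) (K1 : 1 <= K) (hK : lambda + CF + Cz * d%:R / th <= K).
Hypothesis cfl : ta * (K + (d%:R + 1) / et ^+ 2) <= 1.
Hypotheses (B_ge0 : forall p x, 0 <= B p x) (B_sum : forall x, \sum_p B p x = 1).
Hypothesis B_tay : forall p, tay CB (B p).
Hypothesis B_near : forall p x, B p x != 0 -> exists x', [/\ enorm x' <= enorm x,
   enorm (pt p - x') <= r & enorm x <= nu -> x' = x].
Hypotheses (r0 : 0 <= r) (rnu : r <= (2 * nu)^-1) (Kr : K * (2 * r * 3 ^+ p0.+1) <= 1).
Hypotheses (Cg0 : 0 <= Cg) (coefg : forall (t : R) x, 0 <= t <= T ->
  enorm (b t x) + enorm (sigma t x) <= Cg * (1 + enorm x)).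
Hypothesis Sbnd : forall (t : R) p, 0 <= t <= T ->
  enorm (b t (pt p)) <= S /\ enorm (sigma t (pt p)) <= S.
Hypotheses (S1 : 1 <= S) (etS : et * S <= 1) (thS : th * S <= 1) (thSnu : th * S <= (2 * nu)^-1).
Hypotheses (nu1 : 1 <= nu) (pRb : forall p, enorm (pt p) + 1 <= Rb).
Hypotheses (c01 : 1 <= c0) (Ch0 : 0 <= Ch) (Chc0 : 2 * Ch <= c0).
Hypothesis taN : N%:R * ta = T.
Hypothesis bCE : forall (x : 'cV[R]_k) q, expR (murate d Cz C2 Cg p0 * T) * c0 *
  (ps x + c1rate d Cz C2 Cg p0 / lambda * ps (pt q)) <= bC * ps x.
Local Notation M2v := (M2 d m I lambda K Cz th et CF C2 bb Sp CB).
Local Notation Csv := (Cs d m I lambda K Cz th CF C2 bb Sp CB).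
Hypothesis err_le : (K + CF * m%:R) * (4 * nu * r + ta * M2v) + 2 * (Cz * d%:R * nu * (th * S ^+ 2))
  + K * (ta * M2v) + (2 * d%:R + 2) / et ^+ 2 * (ta * M2v) + (d%:R + 4) * (Csv * (et * S ^+ 3)) <= nu^-1.

Definition good (F : gen_driver R k d m) (h : 'I_m -> 'cV[R]_k -> R) : Prop :=
  [/\ lip_driver Cz T F CF,
    forall i (t : R) xi c, 0 <= t <= T -> `|F i t xi (const_mx c) 0| <= C2 * (ps xi + `|c|)
    & forall i x, `|h i x| <= Ch * ps x].

Local Notation V F h := (VV b sigma pt B lambda K Cz th et ta T F h).

Lemma jta j : (j <= N)%N -> j%:R * ta <= T.
Proof. by move=> hj; rewrite -taN; apply: ler_wpM2r; [exact: ltW|rewrite ler_nat]. Qed.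

Lemma Bpsi p x : B p x != 0 -> ps (pt p) <= (1 + 2 * r * 3 ^+ p0.+1) * ps x.
Proof.
move=> /B_near[x' [h1 h2 _]]; apply: psi_near_le => //.
  have h3 : (2 * nu)^-1 <= 2^-1 by rewrite lef_pV2 ?posrE ?mulr_gt0//; have := nu1; lra.
  by have := rnu; lra.
by have := enorm_le_add (pt p) x'; lra.
Qed.

Lemma V_up F h j i x q : good F h -> j%:R * ta <= T -> V F h j i x (pt q) <= bC * ps x.
Proof.
move=> [lipF bndF hbnd] hj; apply: le_trans _ (bCE x q).
have rho0 : 0 <= 2 * r * 3 ^+ p0.+1 by rewrite mulr_ge0 ?mulr_ge0 ?exprn_ge0.
have := VV_bar CF0 Cz0 la0 th0 th1 et0 et1 (ltW ta0) lipF C20 bndF K1 hK cfl B_ge0 B_sum rho0 Kr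
  Bpsi Cg0 coefg Sbnd etS thS c01 Chc0 hbnd hj i x q.
move=> h1; apply: le_trans h1 _; have cr := crate_ge0 d Cg p0.
have c1 := @c1rate_ge0 R d Cz C2 Cg p0 Cz0 C20.
apply: ler_wpM2r.
  apply: addr_ge0; first exact: ltW (psi_gt0 _ _).
  by apply: mulr_ge0; [apply: divr_ge0 => //; exact: ltW|exact: ltW (psi_gt0 _ _)].
apply: ler_wpM2r; first exact: le_trans ler01 c01.
apply: exp_pow_le => //; last exact: ltW.
rewrite /murate; have := mulr_ge0 Cz0 cr; have := C20; lra.
Qed.

Lemma good_flip F h : good F h -> good (dflip F) (fun i x => - h i x).
Proof.
move=> [[l1 l2] bndF hbnd]; split.
- split=> [i t xi y y' z z' tin|i t xi y y' z tin hi hl].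
    rewrite /dflip opprK addrC.
    have := l1 i t xi (- y') (- y) (- z') (- z) tin.
    rewrite (eq_bigr (fun l => `|y l ord0 - y' l ord0|)); last by move=> l _; rewrite !mxE opprK addrC.
    by rewrite (eq_bigr (fun l => `|z l ord0 - z' l ord0|)) // => l _; rewrite !mxE opprK addrC.
  rewrite /dflip lerN2; apply: l2 => //; first by rewrite !mxE hi.
  by move=> l li; rewrite !mxE lerN2; exact: hl.
- move=> i t xi c tin; rewrite /dflip normrN oppr0.
  have -> : - const_mx c = const_mx (- c) :> 'cV[R]_m by apply/colP => l; rewrite !mxE.
  by rewrite -(normrN c); exact: bndF.
- by move=> i x; rewrite normrN.
Qed.

Lemma V_abs F h j i x q : good F h -> j%:R * ta <= T -> `|V F h j i x (pt q)| <= bC * ps x.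
Proof.
move=> gd hj; rewrite ler_norml; apply/andP; split; last exact: V_up.
(* The lower bound is the upper bound for the opposite scheme. *)
have := V_up i x q (good_flip gd) hj; rewrite VV_flip; lra.
Qed.

Lemma bC0 : 0 <= bC.
Proof.
have [q _] := card_gt0P (cardI_gt0 B_sum).
have := bCE 0 q; rewrite -(pmulr_lge0 bC (psi_gt0 p0.+1 (0 : 'cV[R]_k))); apply: le_trans.
have c1 := @c1rate_ge0 R d Cz C2 Cg p0 Cz0 C20.
apply: mulr_ge0; first by apply: mulr_ge0; [exact: expR_ge0|exact: le_trans ler01 c01].
apply: addr_ge0; first exact: ltW (psi_gt0 _ _).
by apply: mulr_ge0; [apply: divr_ge0 => //; exact: ltW|exact: ltW (psi_gt0 _ _)].
Qed.

Lemma ps_Sp (x : 'cV[R]_k) : enorm x <= Rb -> ps x <= Sp.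
Proof.
move=> h; have x0 := enorm_ge0 x; apply: lerXn2r; rewrite ?nnegrE ?addr_ge0 ?sqr_ge0//.
by rewrite lerD2l; apply: lerXn2r; rewrite ?nnegrE//; exact: le_trans h.
Qed.

Lemma V_bb F h : good F h -> forall j, j%:R * ta <= T -> forall i x q, enorm x <= Rb ->
  `|V F h j i x (pt q)| <= bb.
Proof.
move=> gd j hj i x q hx; apply: le_trans (V_abs i x q gd hj) _.
by apply: ler_wpM2l; [exact: bC0|exact: ps_Sp].
Qed.

Lemma pSp p : ps (pt p) <= Sp.
Proof. by apply: ps_Sp; have := pRb p; lra. Qed.

Lemma bb0 : 0 <= bb.
Proof. by apply: mulr_ge0; [exact: bC0|rewrite exprn_ge0// addr_ge0// sqr_ge0]. Qed.

Lemma h_bb F h : good F h -> forall i p, `|h i (pt p)| <= bb.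
Proof.
move=> [_ _ hb] i p; apply: le_trans (hb _ _) _; apply: ler_pM => //; last exact: pSp.
  exact: ltW (psi_gt0 _ _).
have := bCE (pt p) p; have ps0 := psi_gt0 p0.+1 (pt p).
have c1 := @c1rate_ge0 R d Cz C2 Cg p0 Cz0 C20.
have mu0 : 0 <= murate d Cz C2 Cg p0 * T.
  apply: mulr_ge0; last by rewrite -taN mulr_ge0// ltW.
  have cr := crate_ge0 d Cg p0; rewrite /murate; have := mulr_ge0 Cz0 cr; have := C20; lra.
have e1 : 1 <= expR (murate d Cz C2 Cg p0 * T).
  by have := expR_ge1Dx (murate d Cz C2 Cg p0 * T); lra.
move=> h1; rewrite -(ler_pM2r ps0); apply: le_trans _ h1.
have h2 : Ch <= expR (murate d Cz C2 Cg p0 * T) * c0.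
  have := ler_wpM2r (le_trans ler01 c01) e1; have := Chc0; have := Ch0; lra.
apply: ler_pM => //; first exact: ltW.
rewrite lerDl; apply: mulr_ge0; last exact: ltW.
by apply: divr_ge0 => //; exact: ltW.
Qed.

Lemma V_tay F h j i q : good F h -> j%:R * ta <= T -> tay Csv (fun x => V F h j i x (pt q)).
Proof.
move=> gd hj; have [lipF bndF _] := gd.
exact: (VV_tay CF0 Cz0 la0 th0 et0 ta0 lipF C20 bndF K1 cfl B_sum B_tay Sbnd thS bb0 (V_bb gd)
  (h_bb gd) pRb pSp hj i q).
Qed.

Lemma V_step F h : good F h -> step_ok nu lambda ta T b sigma F N [seq pt p | p <- enum I] (V F h).
Proof.
move=> gd; have [lipF bndF _] := gd.
move=> j i y0 xi0 jN /mapP[q0 _ ->] hy0 q Bq c a qnu Bqnu a0 h1 h2 h3 h4.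
apply: (VV_main CF0 Cz0 la0 th0 et0 et1 ta0 lipF C20 bndF K1 hK cfl B_ge0 B_sum B_tay Sbnd S1 etS thS
  bb0 (V_bb gd) (h_bb gd) pRb pSp nu1 r0 rnu thSnu err_le (jta jN) _ qnu Bqnu a0 h1 _ h3 h4).
  by move=> p /B_near[x' [_ e1 e2]]; rewrite -(e2 hy0).
by move=> p hp; apply: h2 => //; apply: map_f; rewrite mem_enum.
Qed.

Lemma V_term F (h : 'I_m -> 'cV[R]_k -> R) : term_ok nu [seq pt p | p <- enum I] h (V F h).
Proof.
move=> i x xi hx _; have [p np hp] := average_le (fun p => h i (pt p)) (B_ge0^~ x) (B_sum x).
exists (pt p) => //; have [x' [_ e1 e2]] := B_near np; rewrite -(e2 hx); apply: le_trans e1 _.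
have nu0 : 0 < nu := lt_le_trans ltr01 nu1.
apply: le_trans rnu _; rewrite lef_pV2 ?posrE ?mulr_gt0//; lra.
Qed.

End fixed_level.

Lemma inv_small (R : realType) (a x : R) : 0 < x -> a * x <= 1 -> a <= x^-1.
Proof. by move=> x0 h; rewrite -[x^-1]mul1r ler_pdivlMr. Qed.

Lemma inv_le1 (R : realType) (x y : R) : 0 < x -> y <= x -> x^-1 * y <= 1.
Proof. by move=> x0 h; rewrite mulrC ler_pdivrMr// mul1r. Qed.

Definition level_bnd (R : realType) (k d : nat) (T Cz C2 Cg Ch : R) (p0 : nat) : R :=
  expR (murate d Cz C2 Cg p0 * T) * (1 + 2 * Ch) * (1 + c1rate d Cz C2 Cg p0 * (1 + k%:R ^+ 2) ^+ p0.+1).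

Lemma level_bndP (R : realType) (k d : nat) (T Cz C2 Cg Ch nu : R) (p0 : nat) (x y : 'cV[R]_k) :
  0 <= Cz -> 0 <= C2 -> 0 <= Ch -> 1 <= nu -> enorm y <= k%:R * nu ->
  expR (murate d Cz C2 Cg p0 * T) * (1 + 2 * Ch) *
    (psi p0.+1 x + c1rate d Cz C2 Cg p0 / nu ^+ (2 * p0.+1 + 8) * psi p0.+1 y)
  <= level_bnd k d T Cz C2 Cg Ch p0 * psi p0.+1 x.
Proof.
move=> Cz0 C20 Ch0 nu1 hy; rewrite /level_bnd -[X in _ <= X]mulrA; apply: ler_wpM2l.
  by apply: mulr_ge0; [exact: expR_ge0|rewrite addr_ge0// mulr_ge0].
have c1 := @c1rate_ge0 R d Cz C2 Cg p0 Cz0 C20; have nu0 : 0 < nu := lt_le_trans ltr01 nu1.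
have l0 : 0 < nu ^+ (2 * p0.+1 + 8) by rewrite exprn_gt0.
have h1 : psi p0.+1 y <= (1 + k%:R ^+ 2) ^+ p0.+1 * nu ^+ (2 * p0.+1 + 8).
  have h2 : psi p0.+1 y <= ((1 + k%:R ^+ 2) * nu ^+ 2) ^+ p0.+1.
    apply: lerXn2r; rewrite ?nnegrE ?addr_ge0 ?sqr_ge0//.
      by rewrite mulr_ge0 ?addr_ge0 ?sqr_ge0.
    have h3 : enorm y ^+ 2 <= (k%:R * nu) ^+ 2.
      by apply: lerXn2r; rewrite ?nnegrE ?enorm_ge0// mulr_ge0// ltW.
    have h4 : 1 <= nu ^+ 2 by apply: exprn_ege1.
    by rewrite mulrDl mul1r -exprMn; exact: lerD.
  apply: le_trans h2 _; rewrite exprMn -exprM; apply: ler_wpM2l.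
    by rewrite exprn_ge0// addr_ge0// sqr_ge0.
  by apply: ler_weXn2l => //; exact: leq_addr.
have h5 : c1rate d Cz C2 Cg p0 / nu ^+ (2 * p0.+1 + 8) * psi p0.+1 y <=
   c1rate d Cz C2 Cg p0 * (1 + k%:R ^+ 2) ^+ p0.+1.
  rewrite -mulrA; apply: ler_wpM2l => //.
  by rewrite mulrC ler_pdivrMr.
have px := psi_ge1 p0.+1 x.
have h6 : 0 <= c1rate d Cz C2 Cg p0 * (1 + k%:R ^+ 2) ^+ p0.+1.
  by rewrite mulr_ge0// exprn_ge0// addr_ge0// sqr_ge0.
rewrite [X in _ <= X]mulrDl mul1r lerD2l; apply: le_trans h5 _; exact: ler_peMr.
Qed.

(** The order of the choices matters: [th], then [K] (which contains [1 / th]), then [r], then the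
    partition and its Taylor constant [CB], then [et], and last the number of steps. It is
    consistent because the Taylor constant [Csv] of the scheme involves neither [et] nor [ta]. Each
    source of error receives the share [(5 * nu)^-1]. *)
Lemma level_ex (R : realType) (k d m : nat) (T Cg Cz C2 Ch CF : R) (p0 n : nat)
    (b : R -> 'cV[R]_k -> 'cV[R]_k) (sigma : R -> 'cV[R]_k -> 'M[R]_(k, d))
    (F : gen_driver R k d m) (h : 'I_m -> 'cV[R]_k -> R) :
  0 < T -> 0 <= Cg -> (forall (t : R) x, 0 <= t <= T ->
    enorm (b t x) + enorm (sigma t x) <= Cg * (1 + enorm x)) ->
  0 <= Cz -> 0 <= C2 -> 0 <= Ch -> 0 <= CF -> good Cz T CF C2 Ch p0 F h ->
  exists N grid V, let nu := nn R n in let lambda := nu ^+ (2 * p0.+1 + 8) in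
  [/\ (n < N)%N, exists xi, xi \in grid, forall xi, xi \in grid -> enorm xi <= k%:R * nu,
      forall j i y xi, (j <= N)%N -> xi \in grid ->
        `|V j i y xi| <= level_bnd k d T Cz C2 Cg Ch p0 * psi p0.+1 y &
      forall j i xi, (j <= N)%N -> xi \in grid -> forall x (e : R), 0 < e ->
        exists2 r : R, 0 < r & forall y, enorm (y - x) < r -> `|V j i y xi - V j i x xi| < e] /\
  [/\ step_ok nu lambda (T / N%:R) T b sigma F N grid V,
      step_ok nu lambda (T / N%:R) T b sigma (dflip F) N grid (fun j i x xi => - V j i x xi),
      term_ok nu grid h V & term_ok nu grid (fun i x => - h i x) (fun j i x xi => - V j i x xi)].
Proof.
move=> T0 Cg0 coefg Cz0 C20 Ch0 CF0 gd.
pose nu : R := nn R n; pose lambda := nu ^+ (2 * p0.+1 + 8).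
have nu1 : 1 <= nu := nn_ge1 R n; have nu0 : 0 < nu := nn_gt0 R n.
have la0 : 0 < lambda by rewrite exprn_gt0.
pose S := 1 + Cg * (1 + k%:R * nu).
have kn0 : 0 <= k%:R * nu by rewrite mulr_ge0// ltW.
have S1 : 1 <= S by rewrite lerDl mulr_ge0// addr_ge0.
have czd : 0 <= Cz * d%:R by rewrite mulr_ge0.
have nn2 : nu <= nu ^+ 2 by rewrite expr2 ler_peMr// ltW.
have SS2 : S <= S ^+ 2 by rewrite expr2 ler_peMr// (le_trans ler01 S1).
have SS3 : S ^+ 2 <= S ^+ 3 by rewrite [X in _ <= X]exprS ler_peMl// sqr_ge0.
(* The 2 secures [th * S <= (2 * nu)^-1]; the 10 brings the numerical viscosity down to its share of
   the error. *)
pose E := 2 + 10 * (Cz * d%:R).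
have E2 : 2 <= E by rewrite lerDl mulr_ge0.
pose thi := nu ^+ 2 * S ^+ 2 * E.
have n2 : 1 <= nu ^+ 2 := le_trans nu1 nn2; have s2 : 1 <= S ^+ 2 := le_trans S1 SS2.
have ns1 : 1 <= nu ^+ 2 * S ^+ 2 by apply: mulr_ege1.
have thi0 : 0 < thi by rewrite /thi; nra.
pose th := thi^-1; have th0 : 0 < th by rewrite invr_gt0.
have th1 : th <= 1 by rewrite invf_le1// /thi; nra.
have thSnu : th * S <= (2 * nu)^-1.
  apply: inv_small; rewrite ?mulr_gt0// -mulrA; apply: inv_le1 => //.
  have : S * nu <= S ^+ 2 * nu ^+ 2 by apply: ler_pM => //; [exact: le_trans ler01 S1|exact: ltW].
  by rewrite /thi; nra.
have thS : th * S <= 1.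
  apply: le_trans thSnu _; rewrite invf_le1 ?mulr_gt0//; lra.
have err1 : 2 * (Cz * d%:R * nu * (th * S ^+ 2)) <= (5 * nu)^-1.
  apply: inv_small; rewrite ?mulr_gt0//.
  have -> : 2 * (Cz * d%:R * nu * (th * S ^+ 2)) * (5 * nu) = th * (10 * (Cz * d%:R) * (nu ^+ 2 * S ^+ 2)) by ring.
  by apply: inv_le1 => //; rewrite /thi /E; nra.
pose K := 1 + lambda + CF + Cz * d%:R / th.
have cth : 0 <= Cz * d%:R / th by rewrite divr_ge0// ltW.
have K1 : 1 <= K by rewrite /K; lra_on la0 CF0 cth.
have hK : lambda + CF + Cz * d%:R / th <= K by rewrite /K; lra_on la0.
have CFm : 0 <= CF * m%:R by rewrite mulr_ge0.
pose D1 := K + CF * m%:R + 1; pose X3 : R := 3 ^+ p0.+1.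
have X31 : 1 <= X3 by apply: exprn_ege1; rewrite ler1n.
have D12 : 2 <= D1 by rewrite /D1; lra_on K1 CFm.
(* [20 * nu ^+ 2] is the factor [4 * nu] of the error term times the [5 * nu] of its share; [X3] is
   there for the interpolation condition [Kr]. *)
pose ri := 20 * nu ^+ 2 * (D1 * X3).
have DX : D1 <= D1 * X3 by apply: ler_peMr => //; lra_on D12.
have ri0 : 0 < ri by rewrite /ri !mulr_gt0 ?exprn_gt0//; lra_on D12 X31.
pose r := ri^-1; have r0 : 0 < r by rewrite invr_gt0.
have rnu : r <= (2 * nu)^-1.
  apply: inv_small; rewrite ?mulr_gt0//; apply: inv_le1 => //.
  by rewrite /ri; nra_on nn2 D12 DX n2.
have Kr : K * (2 * r * X3) <= 1.
  have -> : K * (2 * r * X3) = r * (2 * (K * X3)) by ring.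
  apply: inv_le1 => //.
  have : K * X3 <= D1 * X3 by apply: ler_wpM2r; rewrite /D1; [lra_on X31|lra_on CFm].
  by rewrite /ri; nra_on D12 DX n2.
have err2 : (K + CF * m%:R) * (4 * nu * r) <= (5 * nu)^-1.
  apply: inv_small; rewrite ?mulr_gt0//.
  have -> : (K + CF * m%:R) * (4 * nu * r) * (5 * nu) = r * (20 * nu ^+ 2 * (K + CF * m%:R)) by ring.
  apply: inv_le1 => //; apply: ler_wpM2l; first by rewrite mulr_ge0// sqr_ge0.
  by apply: le_trans DX; rewrite /D1; lra_on CFm.
have [I [pt [B [CB [B_ge0 B_sum B_tay pt_le B_near]]]]] := partition_ex k nu0 r0.
pose Rb := k%:R * nu + 1.
have pRb p : enorm (pt p) + 1 <= Rb by rewrite lerD2r.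
pose bC := level_bnd k d T Cz C2 Cg Ch p0; pose Sp := (1 + Rb ^+ 2) ^+ p0.+1.
pose Csv := Cs d m I lambda K Cz th CF C2 (bC * Sp) Sp CB.
pose eti := 5 * nu * (d%:R + 4) * (`|Csv| + 1) * S ^+ 3.
have d0 := ler0n R d; have C1 : 1 <= `|Csv| + 1 by rewrite lerDr.
have S31 : 1 <= S ^+ 3 by apply: exprn_ege1.
have e5 : 1 <= 5 * nu * (d%:R + 4) by apply: mulr_ege1; lra_on d0 nu1.
have e51 : 1 <= 5 * nu * (d%:R + 4) * (`|Csv| + 1) by apply: mulr_ege1.
have eti1 : S ^+ 3 <= eti by apply: ler_peMl => //; exact: le_trans ler01 S31.
have eti0 : 0 < eti by apply: lt_le_trans eti1; exact: lt_le_trans ltr01 S31.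
pose et := eti^-1; have et0 : 0 < et by rewrite invr_gt0.
have et1 : et <= 1 by rewrite invf_le1//; exact: le_trans S31 eti1.
have etS : et * S <= 1 by apply: inv_le1 => //; exact: le_trans (le_trans SS2 SS3) eti1.
have err3 : (d%:R + 4) * (Csv * (et * S ^+ 3)) <= (5 * nu)^-1.
  apply: inv_small; rewrite ?mulr_gt0//.
  have -> : (d%:R + 4) * (Csv * (et * S ^+ 3)) * (5 * nu) = et * (5 * nu * (d%:R + 4) * Csv * S ^+ 3) by ring.
  apply: inv_le1 => //; apply: ler_wpM2r; first exact: le_trans ler01 S31.
  by apply: ler_wpM2l; [exact: le_trans ler01 e5|have := ler_norm Csv; clear; lra].
pose M2v := M2 d m I lambda K Cz th et CF C2 (bC * Sp) Sp CB.
pose Y := M2v * (K + CF * m%:R + K + (2 * d%:R + 2) / et ^+ 2).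
(* [X1] is the stability condition; the maximum with 0 handles the errors made over one time
   step. *)
pose X1 := K + (d%:R + 1) / et ^+ 2; pose X := X1 + Num.max 0 (5 * nu * Y).
pose N := (n + Num.truncn (T * X)).+1.
have nN : (n < N)%N by rewrite /N ltnS leq_addr.
have N0 : 0 < N%:R :> R by rewrite ltr0n.
have TX : T * X <= N%:R.
  by apply: le_trans (ltW (truncnS_gt _)) _; rewrite ler_nat ltnS leq_addl.
pose ta := T / N%:R; have ta0 : 0 < ta by rewrite divr_gt0.
have taX : ta * X <= 1 by rewrite /ta mulrAC ler_pdivrMr// mul1r.
have X10 : 0 <= X1.
  by apply: addr_ge0; [exact: le_trans ler01 K1|apply: divr_ge0; [exact: addr_ge0|exact: sqr_ge0]].
have mx : 0 <= Num.max 0 (5 * nu * Y) by rewrite le_max lexx.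
have mxY : 5 * nu * Y <= Num.max 0 (5 * nu * Y) by rewrite le_max lexx orbT.
have cfl : ta * X1 <= 1.
  by apply: le_trans taX; apply: ler_wpM2l; [exact: ltW|rewrite lerDl].
have err4 : ta * Y <= (5 * nu)^-1.
  apply: inv_small; rewrite ?mulr_gt0//; apply: le_trans taX.
  rewrite -mulrA; apply: ler_wpM2l; first exact: ltW.
  by rewrite mulrC; apply: le_trans mxY _; rewrite lerDr.
have taN : N%:R * ta = T by rewrite /ta mulrCA divff ?mulr1// gt_eqF.
have Sbnd (t : R) p : 0 <= t <= T -> enorm (b t (pt p)) <= S /\ enorm (sigma t (pt p)) <= S.
  move=> tin; have h1 := coefg t (pt p) tin.
  have h2 : Cg * (1 + enorm (pt p)) <= Cg * (1 + k%:R * nu) by apply: ler_wpM2l => //; rewrite lerD2l.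
  by have := enorm_ge0 (b t (pt p)); have := enorm_ge0 (sigma t (pt p)); rewrite /S; move: h1 h2; clear; lra.
have bCE (x : 'cV[R]_k) q := @level_bndP R k d T Cz C2 Cg Ch nu p0 x (pt q) Cz0 C20 Ch0 nu1 (pt_le q).
have c01 : 1 <= 1 + 2 * Ch by rewrite lerDl mulr_ge0.
have Chc0 : 2 * Ch <= 1 + 2 * Ch by rewrite lerDr.
have err_le : (K + CF * m%:R) * (4 * nu * r + ta * M2v) + 2 * (Cz * d%:R * nu * (th * S ^+ 2))
  + K * (ta * M2v) + (2 * d%:R + 2) / et ^+ 2 * (ta * M2v) + (d%:R + 4) * (Csv * (et * S ^+ 3)) <= nu^-1.
  have e4 : (K + CF * m%:R) * (ta * M2v) + K * (ta * M2v) + (2 * d%:R + 2) / et ^+ 2 * (ta * M2v) = ta * Y.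
    by rewrite /Y; ring.
  have e6 : 5 * (5 * nu)^-1 = nu^-1 by field; rewrite gt_eqF.
  have i0 : 0 < (5 * nu)^-1 by rewrite invr_gt0 mulr_gt0.
  have -> : (K + CF * m%:R) * (4 * nu * r + ta * M2v) + 2 * (Cz * d%:R * nu * (th * S ^+ 2))
    + K * (ta * M2v) + (2 * d%:R + 2) / et ^+ 2 * (ta * M2v) + (d%:R + 4) * (Csv * (et * S ^+ 3)) =
    (K + CF * m%:R) * (4 * nu * r) + 2 * (Cz * d%:R * nu * (th * S ^+ 2)) + ta * Y
    + (d%:R + 4) * (Csv * (et * S ^+ 3)) by rewrite -e4; ring.
  by have := lerD (lerD (lerD err2 err1) err4) err3; rewrite -e6; move: i0; clear; lra.
pose grid := [seq pt p | p <- enum I].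
pose V := VV b sigma pt B lambda K Cz th et ta T F h.
have Vf : (fun j i x xi => - V j i x xi) =
    VV b sigma pt B lambda K Cz th et ta T (dflip F) (fun i x => - h i x).
  by apply/funext => j; apply/funext => i; apply/funext => x; apply/funext => xi; rewrite VV_flip.
exists N, grid, V; split; split=> //.
- have [q _] := card_gt0P (cardI_gt0 B_sum); exists (pt q).
  by apply: map_f; rewrite mem_enum.
- by move=> xi /mapP[q _ ->].
- move=> j i y xi jN /mapP[q _ ->].
  by apply: (V_abs CF0 Cz0 la0 th0 th1 et0 et1 ta0 C20 K1 hK cfl B_ge0 B_sum B_near (ltW r0) rnu Kr Cg0
    coefg Sbnd etS thS nu1 c01 Chc0 bCE) => //; exact: (jta ta0 taN).
- move=> j i xi jN /mapP[q _ ->] x e e0.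
  by apply: tay_cont e0; apply: (V_tay CF0 Cz0 la0 th0 th1 et0 et1 ta0 C20 K1 hK cfl B_ge0 B_sum B_tay
    B_near (ltW r0) rnu Kr Cg0 coefg Sbnd etS thS nu1 pRb c01 Ch0 Chc0 taN bCE) => //; exact: (jta ta0 taN).
- by apply: (V_step CF0 Cz0 la0 th0 th1 et0 et1 ta0 C20 K1 hK cfl B_ge0 B_sum B_tay
    B_near (ltW r0) rnu Kr Cg0 coefg Sbnd S1 etS thS thSnu nu1 pRb c01 Ch0 Chc0 taN bCE err_le gd).
- by rewrite Vf; apply: (V_step CF0 Cz0 la0 th0 th1 et0 et1 ta0 C20 K1 hK cfl B_ge0 B_sum B_tay
    B_near (ltW r0) rnu Kr Cg0 coefg Sbnd S1 etS thS thSnu nu1 pRb c01 Ch0 Chc0 taN bCE err_le (good_flip gd)).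
- exact: (@V_term R k d m b sigma I pt B lambda K Cz th et ta T nu r B_ge0 B_sum B_near rnu nu1 F h).
- by rewrite Vf; exact: (@V_term R k d m b sigma I pt B lambda K Cz th et ta T nu r B_ge0 B_sum B_near rnu nu1 (dflip F) (fun i x => - h i x)).
Qed.

(** * Schemes for the penalized driver *)

Section existence.
Variables (R : realType) (T : R) (k d m : nat).
Variables (b : R -> 'cV[R]_k -> 'cV[R]_k) (sigma : R -> 'cV[R]_k -> 'M[R]_(k, d)).
Variables (f : 'I_m -> R -> 'cV[R]_k -> 'cV[R]_m -> 'cV[R]_d -> R).
Variables (g : 'I_m -> 'I_m -> R -> 'cV[R]_k -> R) (h : 'I_m -> 'cV[R]_k -> R).
Variables (Cg CL Cf C0 Ch : R) (p0 : nat).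
Hypothesis D : data_ok T b sigma f g h Cg CL Cf.
Hypotheses (C00 : 0 <= C0) (f0_le : forall i (t : R) x, 0 <= t <= T -> `|f i t x 0 0| <= C0 * psi p0.+1 x).
Hypotheses (Ch0 : 0 <= Ch) (h_le : forall i x, `|h i x| <= Ch * psi p0.+1 x).
Hypothesis h_cont : forall i x (e : R), 0 < e -> exists2 e1 : R, 0 < e1 &
  forall y, enorm (y - x) < e1 -> `|h i y - h i x| < e.

Lemma pos_le (x y : R) : x <= y -> 0 <= y -> pos x <= y.
Proof. by move=> h1 h2; rewrite /pos ge_max h2. Qed.

Lemma enorm_le_sum1 n (z : 'cV[R]_n) : enorm z <= \sum_l `|z l ord0|.
Proof.
by apply: le_trans (enorm_le_sum z) _; apply: ler_sum => l _; rewrite big_ord1.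
Qed.

Lemma penalized_lip n : lip_driver Cf T (penalized f g n) (Cf + nn R n * (1 + m%:R)).
Proof.
have [Cf0 _ fl _] := data_driver D; have nu0 := nn_gt0 R n.
split=> [i t xi y y' z z' tin|i t xi y y' z tin hi hl].
  rewrite /penalized opprD addrACA -mulrBr -sumrB.
  have h1 : f i t xi y z - f i t xi y' z' <=
      Cf * (\sum_l `|y l ord0 - y' l ord0| + \sum_l `|z l ord0 - z' l ord0|).
    apply: le_trans (ler_norm _) _; apply: le_trans (fl _ _ _ _ _ _ _ tin) _.
    apply: ler_wpM2l => //; rewrite lerD2l; apply: le_trans (enorm_le_sum1 _) _.
    by apply: ler_sum => l _; rewrite !mxE.
  have h2 : \sum_(l | l != i) (pos (y l ord0 - g i l t xi - y i ord0) - pos (y' l ord0 - g i l t xi - y' i ord0))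
     <= (1 + m%:R) * \sum_l `|y l ord0 - y' l ord0|.
    apply: le_trans (_ : \sum_l (`|y l ord0 - y' l ord0| + `|y i ord0 - y' i ord0|) <= _); last first.
      rewrite big_split /= mulrDl mul1r lerD2l sumr_const card_ord -[X in X <= _]mulr_natl.
      apply: ler_wpM2l => //; rewrite [X in _ <= X](bigD1 i)//= lerDl.
      by apply: sumr_ge0.
    rewrite [X in _ <= X](bigID (fun l => l != i))/= -[X in X <= _]addr0; apply: lerD; last first.
      by apply: sumr_ge0 => l _; exact: addr_ge0.
    apply: ler_sum => l _; rewrite lerBlDr; apply: pos_le; last by rewrite addr_ge0 ?addr_ge0 ?pos_ge0.
    have := pos_ge (y' l ord0 - g i l t xi - y' i ord0).
    have := ler_norm (y l ord0 - y' l ord0); have := ler_norm (- (y i ord0 - y' i ord0)); rewrite normrN.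
    by lra.
  have := ler_wpM2l (ltW nu0) h2; move: h1; lra.
rewrite /penalized; apply: lerD; first exact: driver_mono_all (data_driver D) tin hi hl.
apply: ler_wpM2l; first exact: ltW.
apply: ler_sum => l li; apply: pos_le; last exact: pos_ge0.
by apply: le_trans (pos_ge _); rewrite hi lerD2r lerD2r; exact: hl.
Qed.

(** Only the Lipschitz constant in the components depends on [n]. The bound on equal components does
    not, since nonnegative costs make the penalty vanish there. *)
Lemma penalized_good n : good Cf T (Cf + nn R n * (1 + m%:R)) (C0 + Cf * m%:R) Ch p0 (penalized f g n) h.
Proof.
have [Cf0 _ fl _] := data_driver D.
split; [exact: penalized_lip| |exact: h_le].
move=> i t xi c tin; rewrite /penalized big1 ?mulr0 ?addr0; last first.
  move=> l li; apply: pos_eq0; rewrite !mxE.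
  have il : i != l by rewrite eq_sym.
  by have := data_g0 D il xi tin; lra.
have h1 := fl i t xi (const_mx c) 0 0 0 tin; have h2 := f0_le i xi tin.
rewrite subrr enorm0 addr0 in h1.
have h3 : \sum_l `|(const_mx c : 'cV[R]_m) l ord0 - (0 : 'cV[R]_m) l ord0| = m%:R * `|c|.
  rewrite (eq_bigr (fun=> `|c|)); last by move=> l _; rewrite !mxE subr0.
  by rewrite sumr_const card_ord -[LHS]mulr_natl.
rewrite h3 in h1; have := ler_normD (f i t xi (const_mx c) 0 - f i t xi 0 0) (f i t xi 0 0); rewrite subrK.
have g1 : 0 <= C0 * `|c| by rewrite mulr_ge0.
have g2 : 0 <= Cf * m%:R * psi p0.+1 xi by rewrite !mulr_ge0// ltW// psi_gt0.
lra.
Qed.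

Let C5 := C0 + Cf + 1 + m%:R.

Lemma penalized_lb n i (t : R) xi (c : 'I_m -> R) z : 0 <= t <= T ->
  - (C5 * nn R n * (1 + \sum_l `|c l| + psi p0.+1 xi + enorm z)) <= penalized f g n i t xi (\col_l c l) z.
Proof.
move=> tin; have [Cf0 _ fl _] := data_driver D; have nu1 := nn_ge1 R n.
have h1 := fl i t xi (\col_l c l) 0 z 0 tin; have h2 := f0_le i xi tin.
have h3 : \sum_l `|(\col_l c l) l ord0 - (0 : 'cV[R]_m) l ord0| = \sum_l `|c l|.
  by apply: eq_bigr => l _; rewrite !mxE subr0.
rewrite h3 subr0 in h1.
have p1 : 0 <= \sum_(l | l != i) pos ((\col_l c l) l ord0 - g i l t xi - (\col_l c l) i ord0).
  by apply: sumr_ge0 => l _; exact: pos_ge0.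
rewrite /penalized; have p2 := mulr_ge0 (le_trans ler01 nu1) p1.
have s0 : 0 <= \sum_l `|c l| by apply: sumr_ge0.
have ps0 := psi_gt0 p0.+1 xi; have z0 := enorm_ge0 z; have m0 := ler0n R m.
set s := \sum_l `|c l| in h1 s0 *; set X := 1 + s + psi p0.+1 xi + enorm z.
have X0 : 0 <= X by rewrite /X; lra.
have h4 : (C0 + Cf) * X <= C5 * nn R n * X.
  apply: ler_wpM2r => //; apply: le_trans (_ : C5 <= _); first by rewrite /C5; lra.
  by apply: ler_peMr => //; rewrite /C5; have := C00; lra.
have h5 : C0 * psi p0.+1 xi <= C0 * X by apply: ler_wpM2l => //; rewrite /X; lra.
have h6 : Cf * (s + enorm z) <= Cf * X by apply: ler_wpM2l => //; rewrite /X; lra.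
move: h1 h2; rewrite !ler_norml => /andP[h1 _] /andP[h2 _]; lra.
Qed.

Lemma penalized_ub n i (t : R) xi (c : 'I_m -> R) z : 0 <= t <= T ->
  - (C5 * nn R n * (1 + \sum_l `|c l| + psi p0.+1 xi + enorm z)) <= dflip (penalized f g n) i t xi (\col_l c l) z.
Proof.
move=> tin; have [Cf0 _ fl _] := data_driver D; have nu1 := nn_ge1 R n.
have h1 := fl i t xi (- \col_l c l) 0 (- z) 0 tin; have h2 := f0_le i xi tin.
have h3 : \sum_l `|(- \col_l c l) l ord0 - (0 : 'cV[R]_m) l ord0| = \sum_l `|c l|.
  by apply: eq_bigr => l _; rewrite !mxE subr0 normrN.
rewrite h3 subr0 enormN in h1.
have s0 : 0 <= \sum_l `|c l| by apply: sumr_ge0.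
have p1 : \sum_(l | l != i) pos ((- \col_l c l) l ord0 - g i l t xi - (- \col_l c l) i ord0) <=
    (1 + m%:R) * \sum_l `|c l|.
  apply: le_trans (_ : \sum_l (`|c l| + `|c i|) <= _); last first.
    rewrite big_split /= mulrDl mul1r lerD2l sumr_const card_ord -[X in X <= _]mulr_natl.
    by apply: ler_wpM2l => //; rewrite [X in _ <= X](bigD1 i)//= lerDl; apply: sumr_ge0.
  rewrite [X in _ <= X](bigID (fun l => l != i))/= -[X in X <= _]addr0; apply: lerD; last first.
    by apply: sumr_ge0 => l _; exact: addr_ge0.
  apply: ler_sum => l li; apply: pos_le; last exact: addr_ge0.
  rewrite !mxE; have il : i != l by rewrite eq_sym.
  have := data_g0 D il xi tin; have := ler_norm (- c l); have := ler_norm (c i); rewrite normrN.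
  by lra.
rewrite /dflip /penalized opprD; have p2 := ler_wpM2l (le_trans ler01 nu1) p1.
have ps0 := psi_gt0 p0.+1 xi; have z0 := enorm_ge0 z; have m0 := ler0n R m.
set s := \sum_l `|c l| in h1 s0 p1 p2 *; set X := 1 + s + psi p0.+1 xi + enorm z.
have X0 : 0 <= X by rewrite /X; lra.
have h4 : (C0 + Cf) * X <= (C0 + Cf) * nn R n * X.
  by apply: ler_wpM2r => //; apply: ler_peMr => //; have := C00; lra.
have h5 : C0 * psi p0.+1 xi <= C0 * X by apply: ler_wpM2l => //; rewrite /X; lra.
have h6 : Cf * (s + enorm z) <= Cf * X by apply: ler_wpM2l => //; rewrite /X; lra.
have h7 : nn R n * ((1 + m%:R) * s) <= nn R n * ((1 + m%:R) * X).
  apply: ler_wpM2l; first exact: le_trans ler01 nu1.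
  apply: ler_wpM2l; first exact: addr_ge0.
  by rewrite /X; lra.
move: h1 h2; rewrite !ler_norml => /andP[_ h1] /andP[_ h2]; rewrite /C5; lra.
Qed.

(** A single family has to serve both signs, since the two half-relaxed limits are later identified;
    [level_ex] therefore delivers the inequalities for [V] and for [- V] together. *)
Lemma approximates_ex : exists A : schemes R k m,
  approximates T b sigma A (penalized f g) h C5 /\
  approximates T b sigma (flip A) (fun n => dflip (penalized f g n)) (fun i x => - h i x) C5.
Proof.
have [[Cg0 CL0] coefg _ _ _] := data_coefs D; have T0 := data_T D.
have [Cf0 _ _ _] := data_driver D; have m0 := ler0n R m.
have C20 : 0 <= C0 + Cf * m%:R by rewrite addr_ge0// mulr_ge0.
have CF0 n : 0 <= Cf + nn R n * (1 + m%:R).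
  by rewrite addr_ge0// mulr_ge0 ?addr_ge0// ltW// nn_gt0.
have C50 : 0 <= C5 by rewrite /C5; have := C00; lra.
have lev n := level_ex n T0 Cg0 coefg Cf0 C20 Ch0 (CF0 n) (penalized_good n).
have [N /choice[grid /choice[V hw]]] := choice lev.
pose A := @Schemes R k m N grid V k%:R
  (level_bnd k d T Cf (C0 + Cf * m%:R) Cg Ch p0) p0.+1
  (fun n => let: conj (And5 h1 _ _ _ _) _ := hw n in h1)
  (fun n => let: conj (And5 _ h1 _ _ _) _ := hw n in h1) (ler0n R k)
  (fun n => let: conj (And5 _ _ h1 _ _) _ := hw n in h1)
  (fun n => let: conj (And5 _ _ _ h1 _) _ := hw n in h1)
  (fun n => let: conj (And5 _ _ _ _ h1) _ := hw n in h1).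
exists A; split; split=> //.
- by move=> n; have [_ [h1 _ _ _]] := hw n; exact: h1.
- by move=> n; have [_ [_ _ h1 _]] := hw n; exact: h1.
- by move=> n i t xi c z tin; exact: penalized_lb.
- by move=> n; have [_ [_ h1 _ _]] := hw n; exact: h1.
- by move=> n; have [_ [_ _ _ h1]] := hw n; exact: h1.
- move=> i x e e0; have [e1 e10 he1] := h_cont i x e0; exists e1 => // y hy.
  by rewrite -opprD normrN; exact: he1.
- by move=> n i t xi c z tin; exact: penalized_ub.
Qed.

End existence.

Lemma growth_common (R : realType) (T : R) (k m : nat) (u : 'I_m -> R -> 'cV[R]_k -> R) :
  (forall i, strip_poly_growth T (u i)) ->
  exists2 C : R, 0 <= C & exists N0, forall N, (N0 <= N)%N ->
    forall i (t : R) x, 0 <= t <= T -> `|u i t x| <= C * psi N x.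
Proof.
move=> /choice[C /choice[ga hu]].
have C0 i : 0 <= C i by case: (hu i).
exists (\sum_i 2 * C i); first by apply: sumr_ge0 => i _; rewrite mulr_ge0.
exists (\sum_i (Num.truncn (ga i)).+1)%N => N hN i t x tin.
have [_ g0 hi] := hu i.
have gN : ga i <= N%:R.
  apply: le_trans (ltW (truncnS_gt _)) _; rewrite ler_nat; apply: leq_trans hN.
  by rewrite (bigD1 i)//= leq_addr.
apply: le_trans (poly_psi (C0 i) g0 (fun y => hi t y tin) gN x) _.
apply: ler_wpM2r; first exact: ltW (psi_gt0 _ _).
by rewrite (bigD1 i)//= lerDl; apply: sumr_ge0 => l _; rewrite mulr_ge0.
Qed.

Theorem corollary2 (R : realType) (T : R) (k d m : nat)
  (b : R -> 'cV[R]_k -> 'cV[R]_k)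
  (sigma : R -> 'cV[R]_k -> 'M[R]_(k, d))
  (f : 'I_m -> R -> 'cV[R]_k -> 'cV[R]_m -> 'cV[R]_d -> R)
  (g : 'I_m -> 'I_m -> R -> 'cV[R]_k -> R)
  (h : 'I_m -> 'cV[R]_k -> R)
  (T_gt0 : 0 < T) (k_gt0 : (0 < k)%N) (d_gt0 : (0 < d)%N) (m_gt0 : (0 < m)%N)
  (b_cont : strip_continuous T b)
  (sigma_cont : strip_continuous T sigma)
  (b_sigma_lip : exists2 C : R, 0 <= C &
    (forall (t : R) (x : 'cV[R]_k), 0 <= t <= T ->
       enorm (b t x) + enorm (sigma t x) <= C * (1 + enorm x)) /\
    (forall (t : R) (x x' : 'cV[R]_k), 0 <= t <= T ->
       enorm (b t x - b t x') + enorm (sigma t x - sigma t x')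
         <= C * enorm (x - x')))
  (f_cont : forall i, driver_continuous T (f i))
  (f_lip : forall i, driver_lipschitz T (f i))
  (f_meas : forall i, strip_borel T (fun t x => f i t x 0 0))
  (f_growth : forall i, strip_poly_growth T (fun t x => f i t x 0 0))
  (f_mono : forall i, driver_monotone T i (f i))
  (g_cont : forall i j : 'I_m, i != j -> strip_continuous T (g i j))
  (g_ge0 : forall i j : 'I_m, i != j ->
     forall (t : R) (x : 'cV[R]_k), 0 <= t <= T -> 0 <= g i j t x)
  (g_growth : forall i j : 'I_m, i != j -> strip_poly_growth T (g i j))
  (g_loop : no_free_loop T g)
  (h_cont : forall i : 'I_m, continuous (h i))
  (h_growth : forall i, poly_growth (h i))
  (h_compat : forall (i : 'I_m) (x : 'cV[R]_k),
     (max_others i (fun j => h j x) (fun j => g i j T x) <= (h i x)%:E)%E) :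
  exists v : 'I_m -> R -> 'cV[R]_k -> R,
    (viscosity_solution T b sigma f g h v /\
     forall i, strip_poly_growth T (v i)) /\
    forall w : 'I_m -> R -> 'cV[R]_k -> R,
      viscosity_solution T b sigma f g h w ->
      (forall i, strip_poly_growth T (w i)) ->
      forall (i : 'I_m) (t : R) (x : 'cV[R]_k), 0 <= t <= T ->
        w i t x = v i t x.
Proof.
have [C C0 [blip slip]] := b_sigma_lip.
have cf : coefs T b sigma C C by split.
have f_lip' i : exists c, 0 <= c /\ forall t x y y' z z', 0 <= t <= T ->
    `|f i t x y z - f i t x y' z'| <= c * (\sum_(l < m) `|y l ord0 - y' l ord0| + enorm (z - z')).
  by have [c c0 hc] := f_lip i; exists c.
have [Cl hCl] := choice f_lip'.
pose Cf := \sum_i Cl i.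
have Cf0 : 0 <= Cf by apply: sumr_ge0 => i _; case: (hCl i).
have dr : driver_ok T f Cf.
  split=> // i t x y y' z z' tin; apply: le_trans ((hCl i).2 t x y y' z z' tin) _.
  apply: ler_wpM2r; first by rewrite addr_ge0 ?enorm_ge0 ?sumr_ge0.
  by rewrite /Cf (bigD1 i)//= lerDl; apply: sumr_ge0 => l _; case: (hCl l).
have hh i j x : j != i -> h j x - g i j T x <= h i x.
  by move=> ji; have /max_others_le := h_compat i x; exact.
have D : data_ok T b sigma f g h C C Cf by split.
have [Cw Cw0 [N1 hN1]] := growth_common f_growth.
have hg' i : strip_poly_growth T (fun=> h i).
  by have [c [ga [c0 g0 hc]]] := h_growth i; exists c, ga; split=> // t x _; exact: hc.
have [Ch Ch0 [N2 hN2]] := growth_common hg'.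
pose p0 := maxn N1 N2.
have f0 i (t : R) x : 0 <= t <= T -> `|f i t x 0 0| <= Cw * psi p0.+1 x.
  by apply: hN1; rewrite leqW// leq_maxl.
have h0 i x : `|h i x| <= Ch * psi p0.+1 x.
  by apply: (hN2 p0.+1 _ i T x); rewrite ?leqW ?leq_maxr// lexx ltW.
have [A [ap apm]] := approximates_ex D Cw0 f0 Ch0 h0 (fun i => cont_enorm (h_cont i)).
exists (lowlim T A); split; first by split; [exact: v_viscosity D ap apm|exact: (v_growth A D)].
move=> w wsol wg; have [Cv _ [N hN]] := growth_common wg.
exact: (v_unique D ap apm wsol (hN N (leqnn N))).
Qed.
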